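(* Let $(M,g)$ be non-trapping with strictly convex boundary. Let $\phi\in C^\infty(SM)$ be such that for every $y\in\partial M$ there exists some $w\in S_y(\partial M)$ with $\phi(y,w)\ne0$. Suppose $f\in\mathcal{A}^E_{\mathrm{phg}}(M)$ for some index set $E$ with $\inf(E)>-1$. (i) If $I^\phi f\in\mathcal{A}^{1+2s'}(\partial_+SM)$ for some $s'>\inf E$, then $f\in\mathcal{A}^{E_{\ge s'}}_{\mathrm{phg}}(M)$, where $E_{\ge s'}=\{(z,k)\in E:\mathrm{Re}(z)\ge s'\}$. (ii) If $I^\phi f\in\dot C^\infty(\partial_+SM)$, then $f\in\dot C^\infty(M)$.
   Context: Setting. $(M,g)$ is a compact smooth Riemannian manifold with boundary, of dimension $d\ge2$, with unit inward normal $\nu$; strictly convex boundary means that the second fundamental form $\mathrm{II}_x(v,w)=-g_x(\nabla_v\nu,w)$ of $\partial M$ is positive definite. $SM$ is the unit tangent bundle, $\pi:SM\to M$ the projection, $\partial_\pm SM=\{(x,v)\in SM:x\in\partial M,\ \pm g_x(v,\nu_x)\ge0\}$, and $\partial_0SM=\partial_+SM\cap\partial_-SM=S(\partial M)$ is the boundary of the manifold with boundary $\partial_+SM$. $\varphi_t$ is the geodesic flow, $\tau(x,v)$ the exit time (length of the maximal geodesic in $M$ issued from $(x,v)$); non-trapping means $\sup_{SM}\tau<\infty$. For a function $f$ on $M$, $I^\phi f(x,v)=\int_0^{\tau(x,v)}\phi(\varphi_t(x,v))\,f(\pi(\varphi_t(x,v)))\,dt$, $(x,v)\in\partial_+SM$.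 Function spaces on a manifold with boundary $N$ with boundary defining function $x$ and collar coordinates $(x,y)$: for $s\in\mathbb{R}$, $\mathcal{A}^s(N)$ is the set of $u\in C^\infty(N^o)$ with $V_1\cdots V_ju\in x^sL^\infty(N)$ for all $j\in\mathbb{N}_0$ and all smooth vector fields $V_i$ tangent to $\partial N$. $\dot C^\infty(N)=\bigcap_s\mathcal{A}^s(N)$ is the space of smooth functions vanishing to infinite order at $\partial N$. An index set is $E\subset\mathbb{C}\times\mathbb{N}_0$ such that $\{(z,k)\in E:\mathrm{Re}\,z\le s\}$ is finite for every real $s$, and $(z,k)\in E$ implies $(z,\ell)\in E$ for $0\le\ell<k$; $\inf E=\inf\{\mathrm{Re}\,z:(z,k)\in E\}$. $\mathcal{A}^E_{\mathrm{phg}}(N)$ is the set of $u\in\bigcup_s\mathcal{A}^s(N)$ with $u\sim\sum_{(z,k)\in E}u_{z,k}(y)x^z(\log x)^k$ as $x\to0$, $u_{z,k}\in C^\infty(\partial N)$, where $\sim$ means that the difference with finite partial sums decays, with all derivatives by vector fields tangent to $\partial N$, like the next term of the series. *)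

(* Defs.v *)
From HB Require Import structures.
From mathcomp Require Import all_boot all_order all_algebra.
From mathcomp Require Import all_classical all_reals all_analysis.
From mathcomp Require Import complex.
Set Implicit Arguments.
Unset Strict Implicit.
Unset Printing Implicit Defensive.
Import Order.TTheory GRing.Theory Num.Theory numFieldNormedType.Exports.
Local Open Scope classical_set_scope.
Local Open Scope ring_scope.

Fixpoint Ck (R : realType) (N k : nat) (O : set 'rV[R]_N) (g : 'rV[R]_N -> R)
    {struct k} : Prop :=
  (forall p, O p -> {for p, continuous g}) /\
  match k with
  | 0 => True
  | k'.+1 => forall v : 'rV[R]_N,
      (forall p, O p -> derivable g p v) /\ Ck k' O (fun p => 'D_v g p)
  end.

(* Meaningful for O open. *)
Definition Cinf (R : realType) (N : nat) (O : set 'rV[R]_N)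
    (g : 'rV[R]_N -> R) : Prop := forall k, Ck k O g.

(* A family of local coordinates on the points of Z; the value of crd i
   outside cdom i is irrelevant. *)
Record coords (R : realType) (Z : Type) (N : nat) := Coords {
  cidx : Type;
  cdom : cidx -> set Z;
  crd : cidx -> Z -> 'rV[R]_N }.

Section Smooth.
Context {R : realType} {Z : Type} {N : nat}.
Variable C : coords R Z N.

(* g is a smooth local extension, near z and in the coordinates i, of the
   function h given on P. *)
Definition local_ext (P : set Z) (i : cidx C) (z : Z) (h : Z -> R)
    (g : 'rV[R]_N -> R) : Prop :=
  exists O : set 'rV[R]_N, [/\ open O, O (crd i z), Cinf O g &
    forall z', P z' -> cdom i z' -> O (crd i z') -> h z' = g (crd i z')].

(* Smooth functions on a submanifold P, possibly with boundary. *)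
Definition smooth (P : set Z) (h : Z -> R) : Prop :=
  forall i z, P z -> cdom i z -> exists g, local_ext P i z h g.

Definition smoothC (P : set Z) (h : Z -> R[i]) : Prop :=
  smooth P (fun z => complex.Re (h z)) /\ smooth P (fun z => complex.Im (h z)).

(* Derivative at z of h (given on P) in the direction with components v in the
   coordinates i.  It does not depend on the extension when v is tangent to P;
   at boundary points of P every vector of the full tangent space is allowed. *)
Definition ddir (P : set Z) (i : cidx C) (z : Z) (h : Z -> R) (v : 'rV[R]_N)
    : R :=
  xget 0 [set r | exists2 g, local_ext P i z h g & r = 'D_v g (crd i z)].

End Smooth.

Definition smooth_map (R : realType) (Z1 Z2 : Type) (N1 N2 : nat)
    (C1 : coords R Z1 N1) (P1 : set Z1) (C2 : coords R Z2 N2) (P2 : set Z2)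
    (F : Z1 -> Z2) : Prop :=
  (forall z, P1 z -> P2 (F z)) /\
  (forall h, smooth C2 P2 h -> smooth C1 P1 (fun z => h (F z))).

Definition diffeo (R : realType) (Z1 Z2 : Type) (N1 N2 : nat)
    (C1 : coords R Z1 N1) (P1 : set Z1) (C2 : coords R Z2 N2) (P2 : set Z2)
    (F : Z1 -> Z2) : Prop :=
  smooth_map C1 P1 C2 P2 F /\
  exists G, [/\ smooth_map C2 P2 C1 P1 G,
    forall z, P1 z -> G (F z) = z & forall z, P2 z -> F (G z) = z].

Definition times_line (R : realType) (Z : Type) (N : nat) (C : coords R Z N)
    : coords R (Z * R) (N + 1) :=
  @Coords R (Z * R)%type (N + 1) (cidx C)
    (fun i => [set z | cdom i z.1])
    (fun i z => row_mx (crd i z.1) (const_mx z.2)).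

(* Function spaces on a compact manifold with boundary N, given as a subset of
   Z, with boundary dN. *)
Section FunctionSpaces.
Context {R : realType} {Z : Type} {m : nat}.
Variables (C : coords R Z m) (N dN : set Z).
Let No := N `\` dN.

(* Smooth vector fields on N, as derivations: a vector field on N is a
   derivation of C^oo(No) that extends smoothly up to the boundary, that is,
   that maps C^oo(N) to itself. *)
Definition vector_field (V : (Z -> R) -> (Z -> R)) : Prop :=
  [/\ forall u, smooth C No u -> smooth C No (V u),
      forall (c : R) u v, smooth C No u -> smooth C No v ->
        forall p, No p -> V (fun z => c * u z + v z) p = c * V u p + V v p,
      forall u v, smooth C No u -> smooth C No v ->
        forall p, No p -> V (fun z => u z * v z) p = V u p * v p + u p * V v p &
      forall u, smooth C N u ->
        exists2 w, smooth C N w & forall p, No p -> V u p = w p].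

(* Tangency to dN: V preserves the ideal of functions vanishing on dN. *)
Definition tangent_vector_field (V : (Z -> R) -> (Z -> R)) : Prop :=
  vector_field V /\
  forall u, smooth C N u -> (forall p, dN p -> u p = 0) ->
    exists w, [/\ smooth C N w, forall p, No p -> V u p = w p &
      forall p, dN p -> w p = 0].

Definition boundary_defining (rho : Z -> R) : Prop :=
  [/\ smooth C N rho,
      forall p, No p -> 0 < rho p,
      forall p, dN p -> rho p = 0 &
      (* the differential of rho does not vanish on dN *)
      forall p, dN p -> exists W w, [/\ vector_field W, smooth C N w,
        forall q, No q -> W rho q = w q & w p != 0]].

(* z |-> (rho z, y z) are collar coordinates on {rho < eps}. *)
Definition collar (rho : Z -> R) (eps : R) (y : Z -> Z) : Prop :=
  [/\ boundary_defining rho, 0 < eps,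
      forall p, dN p -> y p = p &
      diffeo C [set p | N p /\ rho p < eps]
        (times_line C) [set z | dN z.1 /\ 0 <= z.2 < eps]
        (fun p => (y p, rho p))].

Definition conormalR (rho : Z -> R) (s : R) (u : Z -> R) : Prop :=
  smooth C No u /\
  forall Vs : seq ((Z -> R) -> (Z -> R)),
    (forall k, (k < size Vs)%N -> tangent_vector_field (nth id Vs k)) ->
    exists K : R, forall p, No p ->
      `|foldr (fun V w => V w) u Vs p| <= K * (rho p `^ s).

(* A^s(N) *)
Definition conormal (rho : Z -> R) (s : R) (u : Z -> R[i]) : Prop :=
  conormalR rho s (fun z => complex.Re (u z)) /\
  conormalR rho s (fun z => complex.Im (u z)).

Definition rapidly_vanishing (rho : Z -> R) (u : Z -> R[i]) : Prop :=
  forall s : R, conormal rho s u.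

Definition index_set (E : set (R[i] * nat)) : Prop :=
  (forall s : R, finite_set [set zk | E zk /\ complex.Re zk.1 <= s]) /\
  (forall z k l, E (z, k) -> (l < k)%N -> E (z, l)).

Definition inf_index (E : set (R[i] * nat)) : \bar R :=
  ereal_inf [set (complex.Re zk.1)%:E | zk in E].

Definition index_ge (E : set (R[i] * nat)) (s : R) : set (R[i] * nat) :=
  [set zk | E zk /\ s <= complex.Re zk.1].

(* x^z (log x)^k for x > 0 *)
Definition powlog (x : R) (zk : R[i] * nat) : R[i] :=
  let a := complex.Re zk.1 in let b := complex.Im zk.1 in
  let m := (x `^ a) * (ln x) ^+ zk.2 in
  Complex (m * cos (b * ln x)) (m * sin (b * ln x)).

(* A^E_phg(N).  The remainder after the terms with Re z <= s is in A^s near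
   dN.  As this is required for all s, applying it further along the expansion
   shows that every remainder is of the order of its first omitted term. *)
Definition phg (rho : Z -> R) (eps : R) (y : Z -> Z) (E : set (R[i] * nat))
    (u : Z -> R[i]) : Prop :=
  (exists s, conormal rho s u) /\
  exists a : R[i] * nat -> Z -> R[i],
    (forall zk, E zk -> smoothC C dN (a zk)) /\
    forall s : R, exists (delta : R) (r : Z -> R[i]),
      [/\ 0 < delta <= eps, conormal rho s r &
        forall p, No p -> rho p < delta ->
          u p = \sum_(zk \in [set zk | E zk /\ complex.Re zk.1 <= s])
                   (a zk (y p) * powlog (rho p) zk) + r p].

End FunctionSpaces.

(* Smooth manifolds with boundary of dimension n.+1, modelled on the half-space
   where the coordinate of index 0 is nonnegative.  Second countability is
   omitted: these manifolds are only used under a compactness hypothesis. *)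
Definition half_space (R : realType) (n : nat) : set 'rV[R]_n.+1 :=
  [set p | 0 <= p 0 ord0].

Record bmanifold (R : realType) (n : nat) := BManifold {
  space :> topologicalType;
  atlas : coords R space n.+1;
  chart_at : space -> cidx atlas;
  space_hausdorff : hausdorff_space space;
  chart_at_dom : forall x, cdom (chart_at x) x;
  chart_dom_open : forall i : cidx atlas, open (cdom i);
  chart_inj : forall (i : cidx atlas) x y, cdom i x -> cdom i y ->
    crd i x = crd i y -> x = y;
  chart_continuous : forall (i : cidx atlas) x, cdom i x ->
    {for x, continuous (crd i)};
  chart_open : forall (i : cidx atlas) (A : set space), open A ->
    A `<=` cdom i ->
    exists2 O : set 'rV[R]_n.+1, open O & crd i @` A = O `&` @half_space R n;
  chart_smooth : forall (j : cidx atlas) (k : 'I_n.+1),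
    smooth atlas (cdom j) (fun x => crd j x 0 k) }.

Section Geometry.
Context {R : realType} {n : nat}.
Variable M : bmanifold R n.
Local Notation vec := 'rV[R]_n.+1.
Local Notation idx := (cidx (atlas M)).

Definition boundary : set M := [set x | crd (chart_at x) x 0 ord0 = 0].

(* A tangent vector at x is the family of its components in all the charts
   around x (components in the other charts are 0 by convention). *)
Definition tvec : Type := idx -> vec.

Definition tangent (x : M) (a : tvec) : Prop :=
  (forall i, ~ cdom i x -> a i = 0) /\
  (forall i j, cdom i x -> cdom j x -> forall k,
     a j 0 k = ddir (cdom j) i x (fun y => crd j y 0 k) (a i)).

Definition tatlas : coords R (M * tvec) (n.+1 + n.+1) :=
  @Coords R (M * tvec)%type (n.+1 + n.+1) idx
    (fun i => [set z | cdom i z.1])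
    (fun i z => row_mx (crd i z.1) (z.2 i)).

Definition tangent_boundary (x : M) (a : tvec) : Prop :=
  tangent x a /\ a (chart_at x) 0 ord0 = 0.

(* gram i x is the matrix of the metric at x in the chart i. *)
Record metric := Metric {
  gram : idx -> M -> 'M[R]_n.+1;
  gram_smooth : forall i k l, smooth (atlas M) (cdom i) (fun x => gram i x k l);
  gram_sym : forall i x, cdom i x -> (gram i x)^T = gram i x;
  gram_pos : forall i x (v : vec), cdom i x -> v != 0 ->
    0 < (v *m gram i x *m v^T) 0 0;
  gram_compat : forall i j x a b, cdom i x -> cdom j x ->
    tangent x a -> tangent x b ->
    a i *m gram i x *m (b i)^T = a j *m gram j x *m (b j)^T }.

Variable g : metric.

Definition inner (x : M) (a b : tvec) : R :=
  let i := chart_at x in (a i *m gram g i x *m (b i)^T) 0 0.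

(* Gamma^k_{l m} at x in the chart i *)
Definition christoffel (i : idx) (x : M) (k l m : 'I_n.+1) : R :=
  2^-1 * \sum_(r < n.+1) invmx (gram g i x) k r *
    (ddir (cdom i) i x (fun y => gram g i y r m) (delta_mx 0 l)
     + ddir (cdom i) i x (fun y => gram g i y r l) (delta_mx 0 m)
     - ddir (cdom i) i x (fun y => gram g i y l m) (delta_mx 0 r)).

Definition unit_inward_normal (x : M) (a : tvec) : Prop :=
  [/\ tangent x a, inner x a a = 1,
      forall w, tangent_boundary x w -> inner x a w = 0 &
      0 < a (chart_at x) 0 ord0].

Definition nu (x : M) : tvec :=
  xget ((fun=> 0) : idx -> vec) [set a : idx -> vec | unit_inward_normal x a].

(* Components of nabla_v nu in the chart chart_at x, for v tangent to the
   boundary at x. *)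
Definition nabla_nu (x : M) (v : tvec) : vec :=
  let i := chart_at x in
  \row_k (ddir boundary i x (fun y => nu y i 0 k) (v i)
          + \sum_(l < n.+1) \sum_(m < n.+1)
              christoffel i x k l m * v i 0 l * nu x i 0 m).

Definition second_fundamental_form (x : M) (v w : tvec) : R :=
  let i := chart_at x in - (nabla_nu x v *m gram g i x *m (w i)^T) 0 0.

Definition strictly_convex_boundary : Prop :=
  forall x v, boundary x -> tangent_boundary x v -> v (chart_at x) != 0 ->
    0 < second_fundamental_form x v v.

Definition SM : set (M * tvec) :=
  [set z | tangent z.1 z.2 /\ inner z.1 z.2 z.2 = 1].

Definition dplusSM : set (M * tvec) :=
  [set z | [/\ SM z, boundary z.1 & 0 <= inner z.1 z.2 (nu z.1)]].

Definition dminusSM : set (M * tvec) :=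
  [set z | [/\ SM z, boundary z.1 & inner z.1 z.2 (nu z.1) <= 0]].

Definition dzeroSM : set (M * tvec) := dplusSM `&` dminusSM.

(* One-sided at the end points when A is an interval. *)
Definition deriv_within (A : set R) (c : R -> vec) (t : R) (l : vec) : Prop :=
  (fun s : R => (s - t)^-1 *: (c s - c t)) @ within A t^' --> l.

(* zeta t = (gamma t, gamma' t) for a geodesic gamma : [0, L] -> M. *)
Definition geodesic (L : R) (zeta : R -> M * tvec) : Prop :=
  [/\ {within `[0, L], continuous (fun t => (zeta t).1)},
      forall t, 0 <= t <= L -> tangent (zeta t).1 (zeta t).2 &
      forall t (i : idx), 0 <= t <= L -> cdom i (zeta t).1 ->
        deriv_within `[0, L] (fun s => crd i (zeta s).1) t ((zeta t).2 i) /\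
        deriv_within `[0, L] (fun s => (zeta s).2 i) t
          (\row_k - \sum_(l < n.+1) \sum_(m < n.+1)
             christoffel i (zeta t).1 k l m
             * (zeta t).2 i 0 l * (zeta t).2 i 0 m)].

Definition exit_time (z : M * tvec) : \bar R :=
  ereal_sup [set L%:E | L in
    [set L : R | 0 <= L /\ exists zeta, geodesic L zeta /\ zeta 0 = z]].

Definition non_trapping : Prop := (ereal_sup (exit_time @` SM) < +oo)%E.

(* phi_t(z), meaningful for 0 <= t <= exit_time z *)
Definition flow (t : R) (z : M * tvec) : M * tvec :=
  xget (z : M * (idx -> vec))
    [set w : M * (idx -> vec) |
      exists zeta, [/\ geodesic t zeta, zeta 0 = z & zeta t = w]].

Definition xray (phi : M * tvec -> R[i]) (f : M -> R[i]) (z : M * tvec)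
    : R[i] :=
  let F := fun t => phi (flow t z) * f (flow t z).1 in
  let J := [set t : R | 0 <= t <= fine (exit_time z)] in
  Complex (\int[@lebesgue_measure R]_(t in J) complex.Re (F t))
          (\int[@lebesgue_measure R]_(t in J) complex.Im (F t)).

End Geometry.

Arguments boundary {R n} M _.
Arguments tatlas {R n} M.

(* Main.v *)
Require Import Defs.
From HB Require Import structures.
From mathcomp Require Import all_boot all_order all_algebra.
From mathcomp Require Import all_classical all_reals all_analysis.
From mathcomp Require Import complex.
From mathcomp Require Import measurable_realfun.
From mathcomp Require Import ring lra.
Set Implicit Arguments.
Unset Strict Implicit.
Unset Printing Implicit Defensive.
Import Order.TTheory GRing.Theory Num.Theory numFieldNormedType.Exports.
Local Open Scope classical_set_scope.
Local Open Scope ring_scope.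

(** The leading coefficients of the expansion of f are read off from the
    transform of f along short geodesics that graze the boundary.

    Let p be a boundary point and w a unit vector tangent to the boundary with
    phi (p, w) <> 0.  In a chart around p, with X the coordinate that vanishes
    on the boundary, consider the unit vectors at p whose X-component is a small
    v > 0 and which tend to w as v tends to 0.  Strict convexity says that
    X'' = - 2 A at (p, w) for some A > 0: the geodesic issued from such a vector
    stays near (p, w), leaves M at a time tau ~ v / A, and X ~ A t (tau - t)
    along it ([II_Gam], [parabola], [glancing_exists]).  As x is X times a
    positive smooth function near p, and mu is the X-component of the vector
    times a positive smooth function near (p, w) ([base_bdf_factor],
    [inflow_bdf_factor]), one gets mu ~ m0 v and x ~ B v^2 s (1 - s) with
    s = t / tau ([glancing_package]).

    Put L = ln (B v^2), which tends to - oo.  If r is the least real part of the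
    exponents whose coefficients do not vanish identically on the boundary, and
    K the largest power of the logarithm at that level, then uniformly along the
    geodesic f is e^{r L} L^K times
      sum_b a_b(p) e^{i b L} (s (1 - s))^{r + i b},
    where b runs over the imaginary parts of the exponents at level (r, K), up
    to an error small against (s (1 - s))^{r - th} for some th > 0 with
    r - th > - 1 ([scaled_term]).  Integrating,
      I f = tau e^{r L} L^K
        (phi (p, w) sum_b a_b(p) J(r + i b) e^{i b L} + o(1)),
    where J(z) is the integral of (s (1 - s))^z over ]0, 1[ ([cint_asym]).
    Since I f = O (mu^{1 + 2 s'}) = O (v e^{s' L}) and tau >= c v, the sum tends
    to 0 if r < s'.  An exponential sum with distinct frequencies that tends to
    0 has zero coefficients ([exp_sum_zero]), and J has no zero in Re z > - 1
    ([beta_neq0]): from (z + 1) J(z) = (4 z + 6) J(z + 1) a zero would propagate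
    to z + N for all N, where the integral concentrates at s = 1 / 2.  Hence
    a_b(p) = 0 for all b, and at every p, which contradicts the choice of (r, K)
    ([low_coefs_eq0]).

    So all the coefficients with real part below s' vanish on the boundary; this
    is (i), as only these terms distinguish the expansions over E and over the
    truncated index set.  For (ii) every coefficient vanishes, so near the
    boundary f equals a remainder of any given order s.  Derivations are local,
    and away from the boundary all weights x^s are comparable, so the bounds for
    the remainder give those for f ([conormalR_local]). *)

(** * Smooth functions on open sets of R^N *)

Lemma ler_mx_norm_coef (R : realType) m n (A : 'M[R]_(m, n)) i j : `|A i j| <= `|A|.
Proof.
rewrite [leRHS]/Num.Def.normr/= mx_normrE.
exact: (le_bigmax _ (fun k : 'I_m * 'I_n => `|A k.1 k.2|) (i, j)).
Qed.

Lemma mx_norm_le (R : realType) m n (A : 'M[R]_(m, n)) (c : R) : 0 <= c ->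
  (forall i j, `|A i j| <= c) -> `|A| <= c.
Proof.
by move=> c0 Ac; rewrite [leLHS]/Num.Def.normr/= mx_normrE; apply: bigmax_le.
Qed.

Lemma cvg_coef (R : realType) (T : Type) (F : set_system T) {FF : Filter F} m n
    (k : T -> 'M[R]_(m, n)) (l : 'M[R]_(m, n)) i j :
  k x @[x --> F] --> l -> k x i j @[x --> F] --> l i j.
Proof.
move=> /cvgrPdist_le H; apply/cvgrPdist_le => e /H; apply: filterS => x; apply: le_trans.
have -> : l i j - k x i j = (l - k x) i j by rewrite !mxE.
exact: ler_mx_norm_coef.
Qed.

Lemma continuous_fsum (R : realType) (T : topologicalType) (I : Type) (r : seq I)
    (F : I -> T -> R) x :
  (forall i, {for x, continuous (F i)}) ->
  {for x, continuous (fun y => \sum_(i <- r) F i y)}.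
Proof.
move=> cF; elim: r => [|i r IH].
  have -> : (fun y => \sum_(i <- [::]) F i y) = cst 0.
    by apply/funext => y; rewrite big_nil.
  exact: cst_continuous.
have -> : (fun y => \sum_(j <- i :: r) F j y) =
    (F i \+ (fun y => \sum_(j <- r) F j y)).
  by apply/funext => y; rewrite big_cons.
by apply: continuousD => //; exact: cF.
Qed.

Lemma dist_half (R : realFieldType) (x y z e : R) :
  `|x - y| < e / 2 -> `|z - y| < e / 2 -> `|x - z| <= e.
Proof. by rewrite !ltr_norml ler_norml => /andP[? ?] /andP[? ?]; lra. Qed.

Section Balls.
Context {R : realType} {V : normedModType R}.

Lemma open_normP (O : set V) p : open O -> O p ->
  exists2 d : R, 0 < d & forall q, `|p - q| < d -> O q.
Proof.
move=> oO Op; have := open_nbhs_nbhs (conj oO Op).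
by move=> /nbhs_normP[d /= d0 dO]; exists d => // q pq; exact: dO.
Qed.

Lemma cont_normP (W : normedModType R) (g : V -> W) p : {for p, continuous g} <->
  (forall e : R, 0 < e -> exists2 d : R, 0 < d &
     forall q, `|p - q| < d -> `|g p - g q| < e).
Proof.
split=> [cg e e0|H].
  have /cvgrPdist_lt/(_ _ e0) := cg.
  by move=> /nbhs_normP[d /= d0 dO]; exists d => // q pq; exact: dO.
apply/cvgrPdist_lt => e /H[d d0 dO].
by apply/nbhs_normP; exists d => //= q; exact: dO.
Qed.

End Balls.

Section DirMVT.
Context {R : realType} {V : normedModType R}.

Lemma is_derive_line (W : normedModType R) (g : V -> W) (p h : V) (t : R) :
  derivable g (p + t *: h) h ->
  is_derive t 1 (fun s : R => g (p + s *: h)) ('D_h g (p + t *: h)).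
Proof.
have E : (fun s : R => s^-1 *: (((fun s : R => g (p + s *: h)) \o shift t) (s *: 1)
            - g (p + t *: h))) =
         (fun s => s^-1 *: ((g \o shift (p + t *: h)) (s *: h) - g (p + t *: h))).
  apply/funext => s /=; congr (_ *: (g _ - _)).
  by rewrite [s *: 1]mulr1 scalerDl addrCA.
move=> dg; split; first by rewrite /derivable E.
by rewrite /derive E.
Qed.

Lemma MVT_dir (g : V -> R) (p h : V) :
  (forall t : R, 0 <= t <= 1 -> derivable g (p + t *: h) h) ->
  exists2 t : R, 0 <= t <= 1 & g (p + h) - g p = 'D_h g (p + t *: h).
Proof.
move=> dg.
have dG (t : R) : 0 <= t <= 1 ->
    is_derive t 1 (fun s : R => g (p + s *: h)) ('D_h g (p + t *: h)).
  by move=> t01; apply: is_derive_line; exact: dg.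
have := @MVT_segment R (fun s : R => g (p + s *: h))
  (fun t => 'D_h g (p + t *: h)) 0 1 ler01.
case.
- by move=> t; rewrite in_itv/= => /andP[t0 t1]; apply: dG; rewrite !ltW.
- apply: derivable_within_continuous => t; rewrite in_itv/= => t01.
  by have [] := dG t t01.
move=> t; rewrite in_itv/= => t01.
rewrite scale1r scale0r addr0 subr0 mulr1 => E.
by exists t.
Qed.

End DirMVT.

Section MatrixDerive.
Context {R : realType} {V : normedModType R} {m n : nat}.
Implicit Types (M : V -> 'M[R]_(m, n)) (D : 'M[R]_(m, n)).

Lemma is_derive_coef M t v D i j : is_derive t v M D ->
  is_derive t v (fun x => M x i j) (D i j).
Proof.
move=> [dM <-]; split; first by have /derivable_mxP := dM; exact.
by rewrite derive_mx// mxE.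
Qed.

Lemma is_derive_mxP M t v D :
  (forall i j, is_derive t v (fun x => M x i j) (D i j)) -> is_derive t v M D.
Proof.
move=> H; have dM : derivable M t v by apply/derivable_mxP => i j; have [] := H i j.
split=> //; rewrite derive_mx//; apply/matrixP => i j; rewrite mxE.
by have [_ ->] := H i j.
Qed.

End MatrixDerive.

Section CkTheory.
Context {R : realType} {N : nat}.
Local Notation vec := 'rV[R]_N.
Implicit Types (O : set vec) (g h : vec -> R) (p v : vec).

Lemma Ck_cont k O g : Ck k O g -> forall p, O p -> {for p, continuous g}.
Proof. by case: k => [|k] []. Qed.

Lemma Ck_derivable k O g : Ck k.+1 O g -> forall p v, O p -> derivable g p v.
Proof. by move=> [_ dg] p v Op; have [+ _] := dg v; exact. Qed.

Lemma Ck_D k O g v : Ck k.+1 O g -> Ck k O ('D_v g).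
Proof. by move=> [_ /(_ v)[]]. Qed.

Lemma CkS k O g : Ck k.+1 O g -> Ck k O g.
Proof.
elim: k g => [|k IH] g Cg; first by case: Cg.
split; first exact: Ck_cont Cg.
move=> v; split; first by move=> p Op; apply: Ck_derivable Cg _ _ Op.
by apply: IH; exact: Ck_D.
Qed.

Lemma Ck_restrict k O O' g : O' `<=` O -> Ck k O g -> Ck k O' g.
Proof.
move=> OO'; elim: k g => [|k IH] g Cg.
  by split=> // p /OO'; exact: Ck_cont Cg p.
split; first by move=> p /OO'; exact: Ck_cont Cg p.
move=> v; split; first by move=> p /OO' Op; apply: Ck_derivable Cg _ _ Op.
by apply: IH; exact: Ck_D.
Qed.

Lemma eq_derivable_open (W : normedModType R) (O : set vec) (g h : vec -> W) p v :
  open O -> O p -> {in O, g =1 h} -> derivable g p v -> derivable h p v.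
Proof.
have [->|v0] := eqVneq v 0; first by move=> *; exact: derivable0.
move=> oO Op gh; apply: near_eq_derivable => //.
have := open_nbhs_nbhs (conj oO Op).
by apply: filterS => q Oq; apply: gh; rewrite inE.
Qed.

Lemma eq_derive_open (W : normedModType R) (O : set vec) (g h : vec -> W) p v :
  open O -> O p -> {in O, g =1 h} -> 'D_v g p = 'D_v h p.
Proof.
have [->|v0] := eqVneq v 0; first by move=> *; rewrite !derive0.
move=> oO Op gh; apply: near_eq_derive => //.
have := open_nbhs_nbhs (conj oO Op).
by apply: filterS => q Oq; apply: gh; rewrite inE.
Qed.

Lemma eq_cont_open (W : topologicalType) (O : set vec) (g h : vec -> W) p :
  open O -> O p -> {in O, g =1 h} -> {for p, continuous g} ->
  {for p, continuous h}.
Proof.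
move=> oO Op gh; rewrite /prop_for /continuous_at => cg.
have <- : g p = h p by apply: gh; rewrite inE.
have H : {near p, g =1 h}.
  have := open_nbhs_nbhs (conj oO Op).
  by apply: filterS => q Oq; rewrite gh ?inE.
apply: cvg_trans cg; exact: (@near_eq_cvg _ _ (nbhs p) _ g h H).
Qed.

Lemma Ck_eq k O g h : open O -> {in O, g =1 h} -> Ck k O g -> Ck k O h.
Proof.
move=> oO; elim: k g h => [|k IH] g h gh Cg.
  by split=> // p Op; have /(eq_cont_open oO Op gh) := Ck_cont Cg Op.
split; first by move=> p Op; have /(eq_cont_open oO Op gh) := Ck_cont Cg Op.
move=> v; split.
  by move=> p Op; have /(eq_derivable_open oO Op gh) := @Ck_derivable _ _ _ Cg p v Op.
apply: IH (Ck_D v Cg).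
by move=> p; rewrite inE => Op; exact: (eq_derive_open _ oO Op gh).
Qed.

Lemma Cinf_eq O g h : open O -> {in O, g =1 h} -> Cinf O g -> Cinf O h.
Proof. by move=> oO gh Cg k; exact: Ck_eq (Cg k). Qed.

Lemma Cinf_restrict O O' g : O' `<=` O -> Cinf O g -> Cinf O' g.
Proof. by move=> s Cg k; exact: Ck_restrict (Cg k). Qed.

Lemma Cinf_cont O g : Cinf O g -> forall p, O p -> {for p, continuous g}.
Proof. by move=> /(_ 0%N); exact: Ck_cont. Qed.

Lemma Cinf_derivable O g : Cinf O g -> forall p v, O p -> derivable g p v.
Proof. by move=> /(_ 1%N); exact: Ck_derivable. Qed.

Lemma Cinf_D O g v : Cinf O g -> Cinf O ('D_v g).
Proof. by move=> Cg k; apply: Ck_D; exact: Cg. Qed.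

Lemma Ck_cst k O (c : R) : Ck k O (fun=> c).
Proof.
elim: k c => [|k IH] c; first by split=> // p _; exact: cst_continuous.
split; first by move=> p _; exact: cst_continuous.
move=> v; split; first by move=> p _; exact: derivable_cst.
have -> : (fun p : vec => 'D_v (fun=> c) p) = (fun=> 0).
  by apply/funext => p; rewrite derive_cst.
exact: IH.
Qed.

Lemma Ck_add k O g h : open O -> Ck k O g -> Ck k O h -> Ck k O (fun p => g p + h p).
Proof.
move=> oO; elim: k g h => [|k IH] g h Cg Ch.
  by split=> // p Op; apply: continuousD; [exact: Ck_cont Cg p Op|exact: Ck_cont Ch p Op].
split.
  by move=> p Op; apply: continuousD; [exact: Ck_cont Cg p Op|exact: Ck_cont Ch p Op].
move=> v; split=> [p Op|].
  by apply: derivableD; [apply: Ck_derivable Cg _ _ Op|apply: Ck_derivable Ch _ _ Op].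
apply: (@Ck_eq _ _ (fun p => 'D_v g p + 'D_v h p)) => //.
  move=> p; rewrite inE => Op; rewrite deriveD//.
    by apply: Ck_derivable Cg _ _ Op.
  by apply: Ck_derivable Ch _ _ Op.
by apply: IH; exact: Ck_D.
Qed.

Lemma Ck_mul k O g h : open O -> Ck k O g -> Ck k O h -> Ck k O (fun p => g p * h p).
Proof.
move=> oO; elim: k g h => [|k IH] g h Cg Ch.
  by split=> // p Op; apply: continuousM; [exact: Ck_cont Cg p Op|exact: Ck_cont Ch p Op].
split.
  by move=> p Op; apply: continuousM; [exact: Ck_cont Cg p Op|exact: Ck_cont Ch p Op].
move=> v; split=> [p Op|].
  by apply: derivableM; [apply: Ck_derivable Cg _ _ Op|apply: Ck_derivable Ch _ _ Op].
apply: (@Ck_eq _ _ (fun p => g p * 'D_v h p + h p * 'D_v g p)) => //.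
  move=> p; rewrite inE => Op; rewrite deriveM//.
    by apply: Ck_derivable Cg _ _ Op.
  by apply: Ck_derivable Ch _ _ Op.
by apply: Ck_add => //; apply: IH; [exact: CkS|exact: Ck_D|exact: CkS|exact: Ck_D].
Qed.

Lemma Cinf_cst O (c : R) : Cinf O (fun=> c).
Proof. by move=> k; exact: Ck_cst. Qed.

Lemma Cinf_add O g h : open O -> Cinf O g -> Cinf O h -> Cinf O (fun p => g p + h p).
Proof. by move=> oO Cg Ch k; exact: Ck_add. Qed.

Lemma Cinf_mul O g h : open O -> Cinf O g -> Cinf O h -> Cinf O (fun p => g p * h p).
Proof. by move=> oO Cg Ch k; exact: Ck_mul. Qed.

Lemma Cinf_scale O (c : R) g : open O -> Cinf O g -> Cinf O (fun p => c * g p).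
Proof. by move=> oO Cg; apply: Cinf_mul => //; exact: Cinf_cst. Qed.

Lemma Cinf_opp O g : open O -> Cinf O g -> Cinf O (fun p => - g p).
Proof.
move=> oO Cg; apply: (@Cinf_eq _ (fun p => -1 * g p)) => //.
  by move=> p _; rewrite mulN1r.
exact: Cinf_scale.
Qed.

Lemma Cinf_diff O g h : open O -> Cinf O g -> Cinf O h -> Cinf O (fun p => g p - h p).
Proof. by move=> oO Cg Ch; apply: Cinf_add => //; exact: Cinf_opp. Qed.

Lemma Cinf_sum O (I : Type) (r : seq I) (P : pred I) (F : I -> vec -> R) :
  open O -> (forall i, P i -> Cinf O (F i)) ->
  Cinf O (fun p => \sum_(i <- r | P i) F i p).
Proof.
move=> oO CF; elim: r => [|i r IH].
  by apply: (@Cinf_eq _ (fun=> 0)) => //; [move=> p _; rewrite big_nil|exact: Cinf_cst].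
apply: (@Cinf_eq _ (fun p => (if P i then F i p else 0) + \sum_(j <- r | P j) F j p)) => //.
  by move=> p _; rewrite big_cons; case: ifP => // _; rewrite add0r.
apply: Cinf_add => //; case Pi : (P i); [exact: CF|exact: Cinf_cst].
Qed.

Lemma Cinf_prod O (I : Type) (r : seq I) (P : pred I) (F : I -> vec -> R) :
  open O -> (forall i, P i -> Cinf O (F i)) ->
  Cinf O (fun p => \prod_(i <- r | P i) F i p).
Proof.
move=> oO CF; elim: r => [|i r IH].
  by apply: (@Cinf_eq _ (fun=> 1)) => //; [move=> p _; rewrite big_nil|exact: Cinf_cst].
apply: (@Cinf_eq _ (fun p => (if P i then F i p else 1) * \prod_(j <- r | P j) F j p)) => //.
  by move=> p _; rewrite big_cons; case: ifP => // _; rewrite mul1r.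
apply: Cinf_mul => //; case Pi : (P i); [exact: CF|exact: Cinf_cst].
Qed.

Lemma is_derive_coord (j : 'I_N) p v : is_derive p v (fun q : vec => q 0 j) (v 0 j).
Proof.
have D : derivable (id : vec -> vec) p v by exact: derivable_id.
split; first by move/derivable_mxP : D => /(_ 0 j).
by have := derive_mx D; rewrite derive_id => /matrixP/(_ 0 j); rewrite mxE => ->.
Qed.

Lemma coord_continuous (j : 'I_N) : continuous (fun q : vec => q 0 j).
Proof. by move=> p; exact: coord_continuous. Qed.

Lemma Cinf_coord O (j : 'I_N) : open O -> Cinf O (fun q : vec => q 0 j).
Proof.
move=> oO [|k]; split => //; first by move=> p _; exact: coord_continuous.
- by move=> p _; exact: coord_continuous.
- move=> v; split; first by move=> p _; have [] := is_derive_coord j p v.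
  apply: (@Ck_eq _ _ (fun=> v 0 j)) => //; last exact: Ck_cst.
  by move=> p _; have [_ ->] := is_derive_coord j p v.
Qed.

End CkTheory.

(** * Differentiability of C^1 functions *)

Section C1Theory.
Context {R : realType} {N : nat}.
Local Notation vec := 'rV[R]_N.
Implicit Types (O : set vec) (g h : vec -> R) (p v : vec).

Lemma deriveZv g p v (c : R) : derivable g p v ->
  derivable g p (c *: v) /\ 'D_(c *: v) g p = c * 'D_v g p.
Proof.
move=> dg; have [->|c0] := eqVneq c 0.
  rewrite scale0r derive0; split; first exact: derivable0.
  by rewrite mul0r.
have D0 : derivable g (p + 0 *: v) v by rewrite scale0r addr0.
have D1 := is_derive_line D0.
have E : (fun h : R => h^-1 *: ((g \o shift p) (h *: (c *: v)) - g p)) =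
    (fun h : R => h^-1 *: (((fun s => g (p + (c * s) *: v)) \o shift (0 : R)) (h *: 1)
     - (fun s => g (p + (c * s) *: v)) 0)).
  apply/funext => h /=; rewrite mulr0 scale0r !addr0 [h *: 1]mulr1.
  by rewrite scalerA mulrC [p + _]addrC.
have K : is_derive (0 : R) (1 : R) (fun s => g (p + (c * s) *: v)) (c * 'D_v g p).
  have D1' : is_derive (c * 0 : R) 1 (fun s : R => g (p + s *: v)) ('D_v g p).
    by rewrite mulr0; move: D1; rewrite scale0r addr0.
  have Dc : is_derive (0 : R) (1 : R) (fun s : R => c * s) c.
    by apply: is_derive_eq; rewrite [_ *: _]mulr1.
  have := @is_derive1_comp R (fun s => g (p + s *: v)) (fun s => c * s) 0 _ _ D1' Dc.
  by rewrite mulrC.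
split; first by have [+ _] := K; rewrite /derivable E.
by have [_ +] := K; rewrite /derive E.
Qed.

(** For C^1 functions the increment along u + v is split into an increment
    along u and one along v, and the mean value theorem is applied to each. *)
Lemma deriveDv O g p u v : open O -> Ck 1 O g -> O p ->
  'D_(u + v) g p = 'D_u g p + 'D_v g p.
Proof.
move=> oO Cg Op.
have dg q w : O q -> derivable g q w by move=> Oq; apply: Ck_derivable Cg _ _ Oq.
have cD : {for p, continuous ('D_v g)} by apply: Ck_cont (Ck_D v Cg) p Op.
apply: cvg_lim => //.
apply/cvgrPdist_le => e e0.
have e2 : 0 < e / 2 by rewrite divr_gt0.
have /cvgrPdist_le/(_ _ e2) Du := dg p u Op.
have cD2 := cD; move/cvgrPdist_le/(_ _ e2) : cD2 => /nbhs_ballP[d /= d0 dD].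
have [d1 d10 d1O] : exists2 d1 : R, 0 < d1 & forall s t : R, 0 <= s <= 1 -> `|t| < d1 ->
    O (p + t *: u + s *: (t *: v)) /\ ball p d (p + t *: u + s *: (t *: v)).
  have := open_nbhs_nbhs (conj oO Op).
  move=> /nbhs_ballP[e' /= e'0 eO].
  exists (Num.min d e' / (1 + `|u| + `|v|)).
    by rewrite divr_gt0// ?lt_min ?d0 ?e'0 ?addr_gt0// -addrA ltr_pwDl// addr_ge0.
  move=> s t /andP[s0 s1] td.
  have : `|p - (p + t *: u + s *: (t *: v))| < Num.min d e'.
    have -> : p - (p + t *: u + s *: (t *: v)) = - (t *: u + s *: (t *: v)).
      by rewrite -addrA opprD addrA subrr sub0r.
    rewrite normrN; apply: (le_lt_trans (ler_normD _ _)).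
    rewrite !normrZ (ger0_norm s0).
    apply: (@le_lt_trans _ _ (`|t| * (1 + `|u| + `|v|))).
      rewrite -addrA mulrDr mulr1 mulrDr.
      have : s * (`|t| * `|v|) <= `|t| * `|v| by rewrite ler_piMl// mulr_ge0.
      have := normr_ge0 t; lra.
    by rewrite -ltr_pdivlMr// -addrA ltr_pwDl// addr_ge0.
  by rewrite lt_min => /andP[h1 h2]; split; [apply: eO; rewrite -ball_normE|rewrite -ball_normE].
near=> t.
have t0 : t != 0 by near: t; exact: nbhs_dnbhs_neq.
have td : `|t| < d1 by near: t; apply: dnbhs0_lt.
have [s s01 E] : exists2 s : R, 0 <= s <= 1 & g (p + t *: u + t *: v) - g (p + t *: u) =
   'D_(t *: v) g (p + t *: u + s *: (t *: v)).
  apply: MVT_dir => s s01; apply: dg; exact: (d1O _ _ s01 td).1.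
rewrite (deriveZv _ (dg _ _ (d1O _ _ s01 td).1)).2 in E.
have -> : 'D_u g p + 'D_v g p - t^-1 *: ((g \o shift p) (t *: (u + v)) - g p) =
   ('D_u g p - t^-1 *: ((g \o shift p) (t *: u) - g p)) +
   ('D_v g p - 'D_v g (p + t *: u + s *: (t *: v))).
  have -> : 'D_v g (p + t *: u + s *: (t *: v)) =
     t^-1 * (g (p + t *: u + t *: v) - g (p + t *: u)) by rewrite E mulKf.
  rewrite /= [t *: (u + v)]scalerDr -[p + t *: u + t *: v]addrA [p + (_ + _)]addrC [p + t *: u]addrC.
  have W (a b : R) : a *: b = a * b by [].
  rewrite !W; ring.
apply: (le_trans (ler_normD _ _)); rewrite [e]splitr lerD//.
  by near: t; exact: Du.
exact/dD/(d1O _ _ s01 td).2.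
Unshelve. all: by end_near. Qed.

Lemma derive_sum_coord O g p v : open O -> Ck 1 O g -> O p ->
  'D_v g p = \sum_j v 0 j * 'D_(delta_mx 0 j) g p.
Proof.
move=> oO Cg Op.
have dg w : derivable g p w by apply: Ck_derivable Cg _ _ Op.
rewrite [in LHS](row_sum_delta v).
have : forall (r : seq 'I_N),
  'D_(\sum_(j <- r) v 0 j *: delta_mx 0 j) g p =
   \sum_(j <- r) v 0 j * 'D_(delta_mx 0 j) g p.
  elim=> [|j r IH]; first by rewrite !big_nil derive0.
  by rewrite !big_cons (deriveDv _ _ oO Cg Op) IH (deriveZv _ (dg _)).2.
exact.
Qed.

Definition Dlin (g : vec -> R) p : vec -> R :=
  fun v => \sum_j v 0 j * 'D_(delta_mx 0 j) g p.

Lemma Dlin_linear g p : linear (Dlin g p).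
Proof.
move=> a u v; rewrite /Dlin scaler_sumr -big_split/=; apply: eq_bigr => j _.
by rewrite !mxE mulrDl -mulrA.
Qed.

HB.instance Definition _ g p :=
  GRing.isLinear.Build R vec R _ (Dlin g p) (Dlin_linear g p).

(** The mean value theorem along the segment from p to p + h expresses the
    error of the linear approximation by the variation of the partial
    derivatives. *)
Lemma C1_diff O g p : open O -> Ck 1 O g -> O p ->
  differentiable g p /\ 'd g p = Dlin g p :> (vec -> R).
Proof.
move=> oO Cg Op.
have cc j : {for p, continuous ('D_(delta_mx 0 j) g)}.
  by apply: Ck_cont (Ck_D _ Cg) p Op.
have dg q w : O q -> derivable g q w by move=> Oq; apply: Ck_derivable Cg _ _ Oq.
have cL : continuous (Dlin g p).
  move=> x; rewrite /Dlin; apply: continuous_fsum => j.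
  by apply: continuousM; [exact: coord_continuous|exact: cst_continuous].
have E : g \o shift p = cst (g p) + Dlin g p +o_ (0 : vec) id.
  apply/eqaddoP => e e0.
  pose e' := e / (N.+1)%:R.
  have e'0 : 0 < e' by rewrite divr_gt0.
  have : \forall q \near p, forall j : 'I_N,
     `|'D_(delta_mx 0 j) g p - 'D_(delta_mx 0 j) g q| <= e'.
    have /(@filter_forall _ _ _ (nbhs p) (nbhs_filter p)) : forall j : 'I_N,
        \forall q \near p, `|'D_(delta_mx 0 j) g p - 'D_(delta_mx 0 j) g q| <= e'.
      by move=> j; have /cvgrPdist_le/(_ _ e'0) := cc j.
    exact.
  move=> H; have {H} : \forall q \near p, O q /\ forall j : 'I_N,
     `|'D_(delta_mx 0 j) g p - 'D_(delta_mx 0 j) g q| <= e'.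
    by apply: filterI => //; exact: (open_nbhs_nbhs (conj oO Op)).
  move=> /nbhs_ballP[d /= d0 dO].
  suff H : forall h : vec, `|h| < d ->
      `|(g \o shift p - (cst (g p) + Dlin g p)) h| <= e * `|h|.
    have K0 : \forall h \near (0 : vec), `|h| < d.
      by apply/nbhs_normP; exists d => // h /=; rewrite sub0r normrN.
    exact: (@filterS _ (nbhs (0 : vec)) (nbhs_filter (0 : vec)) _ _ H K0).
  move=> h hd.
  have B (s : R) : 0 <= s <= 1 -> ball p d (p + s *: h).
    move=> /andP[s0 s1]; rewrite -ball_normE/= opprD addrA subrr sub0r normrN.
    by rewrite normrZ ger0_norm// (le_lt_trans _ hd)// ler_piMl.
  have [s s01 Eh] : exists2 s : R, 0 <= s <= 1 & g (p + h) - g p = 'D_h g (p + s *: h).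
    by apply: MVT_dir => s s01; apply: dg; have [] := dO _ (B _ s01).
  have [Os Ds] := dO _ (B _ s01).
  rewrite !fctE /= [h + p]addrC opprD addrA Eh (derive_sum_coord h oO Cg Os).
  rewrite /Dlin -sumrB.
  apply: (le_trans (ler_norm_sum _ _ _)).
  apply: (@le_trans _ _ (\sum_(j < N) `|h| * e')).
    apply: ler_sum => j _; rewrite -mulrBr normrM ler_pM//.
      exact: ler_mx_norm_coef.
    by rewrite distrC Ds.
  rewrite sumr_const card_ord -mulrnAr mulrC ler_wpM2r//.
  rewrite /e' -mulrnAl ler_pdivrMr//.
  by rewrite -[leLHS]mulr_natr ler_wpM2l ?(ltW e0)// ler_nat.
have D := diff_unique cL E.
split=> //.
apply/diff_locallyP; split; first by rewrite D.
by rewrite D.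
Qed.

End C1Theory.

(** * Chain rule, real powers, symmetry of second derivatives *)

Section Chain.
Context {R : realType} {V : normedModType R}.

(** The increment G (q + k) - G q is 'd G q k up to an error o(|k|), and the
    scaling a keeps that error negligible because a k converges. *)
Lemma diff_quot (T : Type) (F : set_system T) {FF : Filter F} (G : V -> R) (q : V)
    (k : T -> V) (a : T -> R) (D : V) :
  differentiable G q -> a x *: k x @[x --> F] --> D -> k x @[x --> F] --> (0 : V) ->
  a x * (G (q + k x) - G q) @[x --> F] --> 'd G q D.
Proof.
move=> dG aD k0.
have [cL /eqaddoP E] := (diff_locallyP _ _).1 dG.
have LD : 'd G q (a x *: k x) @[x --> F] --> 'd G q D.
  by apply: continuous_cvg => //; exact: cL.
apply/cvgrPdist_le => e e0.
pose e' := e / 2 / (`|D| + 1).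
have D1 : 0 < `|D| + 1 by rewrite ltr_pwDr.
have e'0 : 0 < e' by rewrite !divr_gt0.
have /nbhs_normP[d /= d0 dE] := E _ e'0.
have {}dE (h : V) : `|h| < d -> `|G (q + h) - G q - 'd G q h| <= e' * `|h|.
  move=> hd; have := dE h; rewrite /ball_ /= sub0r normrN => /(_ hd).
  by rewrite !fctE/= opprD addrA [h + q]addrC.
have e2 : 0 < e / 2 by rewrite divr_gt0.
have /cvgrPdist_le/(_ _ e2) L1 := LD.
have /cvgrPdist_lt/(_ _ d0) L2 := k0.
have /cvgrPdist_lt/(_ _ ltr01) L3 := aD.
near=> x.
have kd : `|k x| < d.
  by rewrite -normrN -sub0r; near: x; exact: L2.
have -> : 'd G q D - a x * (G (q + k x) - G q) =
    ('d G q D - 'd G q (a x *: k x)) - a x * (G (q + k x) - G q - 'd G q (k x)).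
  have -> : 'd G q (a x *: k x) = a x * 'd G q (k x) by rewrite linearZ.
  ring.
apply: (le_trans (ler_normB _ _)); rewrite [leRHS]splitr lerD//.
  by near: x; exact: L1.
rewrite normrM; apply: (@le_trans _ _ (e' * `|a x *: k x|)).
  by rewrite normrZ mulrCA ler_wpM2l// dE.
rewrite -[leRHS](divfK (lt0r_neq0 D1)) ler_wpM2l ?(ltW e'0)//.
have : `|D - a x *: k x| < 1 by near: x; exact: L3.
move=> DL; rewrite -[a x *: k x](subrK D).
by rewrite (le_trans (ler_normD _ _))// addrC lerD2l ltW// distrC.
Unshelve. all: by end_near. Qed.

Lemma is_derive_comp (U : normedModType R) (c : U -> V) (G : V -> R) (p v : U) :
  derivable c p v -> differentiable G (c p) ->
  is_derive p v (fun x => G (c x)) ('d G (c p) ('D_v c p)).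
Proof.
move=> dc dG.
have cD : h^-1 *: (c (h *: v + p) - c p) @[h --> 0^'] --> 'D_v c p by exact: dc.
have k0 : c (h *: v + p) - c p @[h --> 0^'] --> (0 : V).
  have I0 : (h : R) @[h --> 0^'] --> (0 : R) by exact: nbhs_dnbhs.
  have H : {near 0^', (fun h : R => h *: (h^-1 *: (c (h *: v + p) - c p))) =1
      (fun h : R => c (h *: v + p) - c p)}.
    near=> h; rewrite scalerA divff ?scale1r//.
    by near: h; exact: nbhs_dnbhs_neq.
  have C := cvgZ I0 cD; rewrite scale0r in C.
  by apply: cvg_trans (C _); exact: near_eq_cvg H.
have E : (fun h : R => h^-1 * (G (c p + (c (h *: v + p) - c p)) - G (c p))) =
    (fun h : R => h^-1 *: (((fun x => G (c x)) \o shift p) (h *: v) - G (c p))).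
  by apply/funext => h; rewrite [c p + _]addrC subrK.
have H : (fun h : R => h^-1 *: (((fun x => G (c x)) \o shift p) (h *: v) - G (c p))) @ 0^'
    --> 'd G (c p) ('D_v c p).
  by rewrite -E; exact: diff_quot dG cD k0.
split; first by apply/cvg_ex; exists ('d G (c p) ('D_v c p)); exact: H.
exact: cvg_lim H.
Unshelve. all: by end_near. Qed.

End Chain.

Lemma mx_cvg {R : realType} (T : Type) (F : set_system T) {FF : Filter F} m n
    (k : T -> 'M[R]_(m, n)) (l : 'M[R]_(m, n)) :
  (forall i j, k x i j @[x --> F] --> l i j) -> k x @[x --> F] --> l.
Proof.
move=> H; apply/cvgrPdist_le => e e0.
have /filter_forall : forall ij : 'I_m * 'I_n,
    \forall x \near F, `|l ij.1 ij.2 - k x ij.1 ij.2| <= e.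
  by move=> [i j]; have /cvgrPdist_le/(_ _ e0) := H i j.
apply: filterS => x Hx; apply: mx_norm_le; first exact: ltW.
by move=> i j; rewrite !mxE; exact: (Hx (i, j)).
Qed.

Section ChainCinf.
Context {R : realType}.

Lemma is_derive_compC1 (U : normedModType R) M (c : U -> 'rV[R]_M) (O : set 'rV[R]_M) G p v :
  derivable c p v -> open O -> Ck 1 O G -> O (c p) ->
  is_derive p v (fun x => G (c x)) (\sum_j 'D_v c p 0 j * 'D_(delta_mx 0 j) G (c p)).
Proof.
move=> dc oO CG Oc; have [dG EG] := C1_diff oO CG Oc.
by have := is_derive_comp dc dG; rewrite EG.
Qed.

Lemma is_derive_comp1 (U : normedModType R) (c : U -> R) (e : R -> R) (e' : R) p v :
  derivable c p v -> is_derive (c p) 1 e e' ->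
  is_derive p v (fun x => e (c x)) ('D_v c p * e').
Proof.
move=> dc de.
have [de1 E] := de.
have dG : differentiable e (c p) by exact: (derivable1_diffP _ _).1.
have := is_derive_comp dc dG.
have -> : 'd e (c p) ('D_v c p) = 'D_v c p * e'; last by [].
by rewrite (deriv1E de1) derive1E E.
Qed.

(** By induction on the order: the derivative of a composition is a sum of
    products of functions to which the induction hypothesis applies. *)
Lemma Cinf_comp N M (O : set 'rV[R]_N) (O' : set 'rV[R]_M) (Phi : 'rV[R]_N -> 'rV[R]_M) G :
  open O -> open O' -> (forall p, O p -> O' (Phi p)) ->
  (forall j, Cinf O (fun p => Phi p 0 j)) -> Cinf O' G ->
  Cinf O (fun p => G (Phi p)).
Proof.
move=> oO oO' OO' CP CG k.
have dPhi p v : O p -> derivable Phi p v.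
  by move=> Op; apply/derivable_mxP => i j; rewrite ord1; exact: Cinf_derivable (CP j) p v Op.
have cPhi p : O p -> {for p, continuous Phi}.
  move=> Op; apply: (@mx_cvg _ _ (nbhs p) (nbhs_filter p)) => i j; rewrite ord1; exact: Cinf_cont (CP j) p Op.
elim: k G CG => [|k IH] G CG.
  split=> // p Op; apply: continuous_comp; first exact: cPhi.
  exact: Cinf_cont CG _ (OO' _ Op).
split.
  move=> p Op; apply: continuous_comp; first exact: cPhi.
  exact: Cinf_cont CG _ (OO' _ Op).
move=> v.
have D p : O p -> is_derive p v (fun p => G (Phi p))
   (\sum_j 'D_v Phi p 0 j * 'D_(delta_mx 0 j) G (Phi p)).
  move=> Op; apply: is_derive_compC1 (CG 1%N) (OO' _ Op) => //.
  exact: dPhi.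
split; first by move=> p /D[].
apply: (@Ck_eq _ _ _ _ (fun p => \sum_j 'D_v (fun p => Phi p 0 j) p * 'D_(delta_mx 0 j) G (Phi p))) => //.
  move=> p; rewrite inE => Op; have [_ ->] := D p Op.
  by apply: eq_bigr => j _; rewrite derive_mx ?mxE//; exact: dPhi.
have : forall r : seq 'I_M, Ck k O (fun p => \sum_(j <- r)
    'D_v (fun p => Phi p 0 j) p * 'D_(delta_mx 0 j) G (Phi p)).
  elim=> [|j r IHr].
    by apply: (@Ck_eq _ _ _ _ (fun=> 0)) => //; [move=> p _; rewrite big_nil|exact: Ck_cst].
  apply: (@Ck_eq _ _ _ _ (fun p => 'D_v (fun p => Phi p 0 j) p * 'D_(delta_mx 0 j) G (Phi p)
     + \sum_(j <- r) 'D_v (fun p => Phi p 0 j) p * 'D_(delta_mx 0 j) G (Phi p))) => //.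
    by move=> p _; rewrite big_cons.
  apply: Ck_add => //; apply: Ck_mul => //; first exact: Cinf_D (CP j) k.
  by apply: (IH ('D_(delta_mx 0 j) G)); exact: Cinf_D.
exact.
Qed.

Lemma open_coord N (U : set R) (j : 'I_N) : open U -> open [set X : 'rV[R]_N | U (X 0 j)].
Proof.
by move=> oU; apply: (@open_comp _ _ (fun X : 'rV[R]_N => X 0 j)) => // x _; exact: coord_continuous.
Qed.

Lemma Cinf_comp1 N (O : set 'rV[R]_N) (U : set R) (e : R -> R) g :
  open O -> open U -> (forall p, O p -> U (g p)) -> Cinf O g ->
  Cinf [set X : 'rV[R]_1 | U (X 0 0)] (fun X => e (X 0 0)) ->
  Cinf O (fun p => e (g p)).
Proof.
move=> oO oU OU Cg Ce.
have oX := @open_coord 1 U 0 oU.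
pose Phi p : 'rV[R]_1 := const_mx (g p).
apply: (@Cinf_eq _ _ _ (fun p => e (Phi p 0 0))) => //; first by move=> p _; rewrite mxE.
apply: (@Cinf_comp N 1 O _ Phi _ oO oX _ _ Ce).
  by move=> p Op /=; rewrite mxE; exact: OU.
by move=> j; apply: (@Cinf_eq _ _ _ g) => //; move=> p _; rewrite mxE.
Qed.

(** A family of functions of one variable that is closed under derivation, up
    to linear combinations, consists of smooth functions. It applies to real
    powers and to the derivatives of exp(-1/x). *)
Lemma Cinf1_family (I : Type) (U : set R) (e : I -> R -> R) :
  open U ->
  (forall i, exists s : seq (R * I), forall x, U x ->
     is_derive x 1 (e i) (\sum_(c <- s) c.1 * e c.2 x)) ->
  forall i, Cinf [set X : 'rV[R]_1 | U (X 0 0)] (fun X => e i (X 0 0)).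
Proof.
move=> oU H i k; have oUX := @open_coord 1 U 0 oU.
have cc i' (X : 'rV[R]_1) : U (X 0 0) -> {for X, continuous (fun Y : 'rV[R]_1 => e i' (Y 0 0))}.
  move=> UX; have [s /(_ _ UX)[de _]] := H i'.
  apply: (@continuous_comp _ _ _ (fun X : 'rV[R]_1 => X 0 0) (e i')).
    exact: coord_continuous.
  by apply: differentiable_continuous; apply/derivable1_diffP.
elim: k i => [|k IH] i; first by split=> // X; exact: cc.
split; first by move=> X; exact: cc.
move=> v; have [s Hs] := H i.
have D (X : 'rV[R]_1) : U (X 0 0) -> is_derive X v (fun Y : 'rV[R]_1 => e i (Y 0 0))
    (v 0 0 * \sum_(c <- s) c.1 * e c.2 (X 0 0)).
  move=> UX; have [dX EX] := is_derive_coord 0 X v.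
  by have := is_derive_comp1 dX (Hs _ UX); rewrite EX.
split; first by move=> X /D[].
apply: (@Ck_eq _ _ _ _ (fun X => v 0 0 * \sum_(c <- s) c.1 * e c.2 (X 0 0))) => //.
  by move=> X; rewrite inE => /D[_ ->].
apply: Ck_mul => //; first exact: Ck_cst.
elim: s {Hs D} => [|c s IHs].
  by apply: (@Ck_eq _ _ _ _ (fun=> 0)) => //; [move=> p _; rewrite big_nil|exact: Ck_cst].
apply: (@Ck_eq _ _ _ _ (fun X => c.1 * e c.2 (X 0 0) + \sum_(c <- s) c.1 * e c.2 (X 0 0))) => //.
  by move=> p _; rewrite big_cons.
apply: Ck_add => //; apply: Ck_mul => //; exact: Ck_cst.
Qed.

Lemma Cinf_powR N (O : set 'rV[R]_N) g (a : R) : open O ->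
  (forall p, O p -> 0 < g p) -> Cinf O g -> Cinf O (fun p => g p `^ a).
Proof.
move=> oO g0 Cg; apply: (@Cinf_comp1 _ _ [set x : R | 0 < x] (fun x => x `^ a)) => //.
move: a; apply: (@Cinf1_family _ _ (fun a x => x `^ a)); first exact: open_gt.
move=> a; exists [:: (a, a - 1)] => x /= x0; rewrite big_seq1/=.
have xi : x \in `]0, +oo[ by rewrite in_itv/= x0.
split; first exact: derivable_powR.
by rewrite -derive1E powR_derive1.
Qed.

Lemma Cinf_inv N (O : set 'rV[R]_N) g : open O ->
  (forall p, O p -> g p != 0) -> Cinf O g -> Cinf O (fun p => (g p)^-1).
Proof.
move=> oO g0 Cg.
have g2 p : O p -> 0 < g p * g p by move=> /g0; rewrite -expr2 exprn_even_gt0.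
apply: (@Cinf_eq _ _ _ (fun p => g p * (g p * g p) `^ (-1))) => //.
  move=> p; rewrite inE => Op; rewrite powR_inv1 ?ltW ?g2//.
  by rewrite invfM mulrA divff ?mul1r ?g0.
by apply: Cinf_mul => //; apply: Cinf_powR => //; exact: Cinf_mul.
Qed.

Lemma Cinf_sqrt N (O : set 'rV[R]_N) g : open O ->
  (forall p, O p -> 0 < g p) -> Cinf O g -> Cinf O (fun p => Num.sqrt (g p)).
Proof.
move=> oO g0 Cg; apply: (@Cinf_eq _ _ _ (fun p => g p `^ 2^-1)) => //.
  by move=> p; rewrite inE => Op; rewrite powR12_sqrt// ltW// g0.
exact: Cinf_powR.
Qed.

End ChainCinf.

Section Schwarz.
Context {R : realType} {N : nat}.
Local Notation vec := 'rV[R]_N.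
Implicit Types (O : set vec) (g h : vec -> R) (p v : vec).

Lemma derivable_shift g p u w : derivable g (p + w) u ->
  derivable (fun q => g (q + w)) p u.
Proof.
pose G (q : vec) : R := g (q + w).
have E : (fun t : R => t^-1 *: ((G \o shift p) (t *: u) - G p)) =
    (fun t : R => t^-1 *: ((g \o shift (p + w)) (t *: u) - g (p + w))).
  by apply/funext => t /=; rewrite /G addrA.
by rewrite /derivable -/G E.
Qed.

Lemma derive_shiftE g p u w : 'D_u (fun q => g (q + w)) p = 'D_u g (p + w).
Proof.
pose G (q : vec) : R := g (q + w).
have E : (fun t : R => t^-1 *: ((G \o shift p) (t *: u) - G p)) =
    (fun t : R => t^-1 *: ((g \o shift (p + w)) (t *: u) - g (p + w))).
  by apply/funext => t /=; rewrite /G addrA.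
by rewrite /derive -/G E.
Qed.

(** Applying the mean value theorem first in the direction u and then in the
    direction v; the left-hand side is symmetric in u and v, whence the
    symmetry of second derivatives. *)
Lemma second_difference O g p u v (t : R) : Ck 2 O g -> t != 0 ->
  (forall a b : R, 0 <= a <= 1 -> 0 <= b <= 1 -> O (p + a *: (t *: u) + b *: (t *: v))) ->
  exists a b : R, [/\ 0 <= a <= 1, 0 <= b <= 1 &
    g (p + t *: u + t *: v) - g (p + t *: u) - (g (p + t *: v) - g p) =
    t * t * 'D_v ('D_u g) (p + a *: (t *: u) + b *: (t *: v))].
Proof.
move=> Cg t0 OO.
have dg q w : O q -> derivable g q w by move=> Oq; apply: (Ck_derivable Cg).
have i0 : 0 <= (0 : R) <= 1 by rewrite lexx ler01.
have i1 : 0 <= (1 : R) <= 1 by rewrite lexx ler01.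
have d1 (a : R) w : 0 <= a <= 1 -> derivable (fun q => g (q + t *: v)) (p + a *: (t *: u)) w.
  by move=> a01; apply: derivable_shift; apply: dg; have := OO _ _ a01 i1; rewrite scale1r.
have d2 (a : R) w : 0 <= a <= 1 -> derivable g (p + a *: (t *: u)) w.
  by move=> a01; apply: dg; have := OO _ _ a01 i0; rewrite scale0r addr0.
have [a a01 Ea] : exists2 a : R, 0 <= a <= 1 &
   (fun q => g (q + t *: v) - g q) (p + t *: u) - (fun q => g (q + t *: v) - g q) p =
   'D_(t *: u) (fun q => g (q + t *: v) - g q) (p + a *: (t *: u)).
  by apply: MVT_dir => a a01; apply: derivableB; [exact: d1|exact: d2].
have [b b01 Eb] : exists2 b : R, 0 <= b <= 1 &
   'D_u g (p + a *: (t *: u) + t *: v) - 'D_u g (p + a *: (t *: u)) =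
   'D_(t *: v) ('D_u g) (p + a *: (t *: u) + b *: (t *: v)).
  apply: (@MVT_dir R _ ('D_u g)) => b b01.
  by apply: (Ck_derivable (Ck_D u Cg)); exact: OO.
exists a, b; split => //.
rewrite /= in Ea; rewrite Ea deriveB//; [|exact: d1|exact: d2].
rewrite derive_shiftE.
have D1 : derivable g (p + a *: (t *: u) + t *: v) u.
  by apply: dg; have := OO _ _ a01 i1; rewrite scale1r.
rewrite (deriveZv t D1).2 (deriveZv t (d2 _ u a01)).2 -mulrBr Eb.
have D3 : derivable ('D_u g) (p + a *: (t *: u) + b *: (t *: v)) v.
  by apply: (Ck_derivable (Ck_D u Cg)); exact: OO.
by rewrite (deriveZv t D3).2 mulrA.
Qed.

Lemma Schwarz O g p u v : open O -> Ck 2 O g -> O p ->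
  'D_u ('D_v g) p = 'D_v ('D_u g) p.
Proof.
move=> oO Cg Op.
have c1 : {for p, continuous ('D_u ('D_v g))} by apply: Ck_cont (Ck_D u (Ck_D v Cg)) p Op.
have c2 : {for p, continuous ('D_v ('D_u g))} by apply: Ck_cont (Ck_D v (Ck_D u Cg)) p Op.
apply/eqP; rewrite -subr_eq0 -normr_le0; apply/ler_addgt0Pl => e e0; rewrite addr0.
have e2 : 0 < e / 2 by rewrite divr_gt0.
have [d1 d10 H1] := (cont_normP _ _).1 c1 _ e2.
have [d2 d20 H2] := (cont_normP _ _).1 c2 _ e2.
have [d3 d30 H3] := open_normP oO Op.
pose d := Num.min d1 (Num.min d2 d3).
have d0 : 0 < d by rewrite !lt_min d10 d20 d30.
pose K := 1 + `|u| + `|v|.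
have K0 : 0 < K by rewrite /K -addrA ltr_pwDl// addr_ge0.
have [t tE] : exists t : R, t = d / 2 / K by exists (d / 2 / K).
have t0 : 0 < t by rewrite tE !divr_gt0.
have near_pt (a b : R) (w z : vec) : 0 <= a <= 1 -> 0 <= b <= 1 ->
    `|w| + `|z| <= `|u| + `|v| ->
    `|p - (p + a *: (t *: w) + b *: (t *: z))| < d.
  have K0' := ltW K0; have d0' := ltW d0; have t0' := ltW t0.
  move=> /andP[a0 a1] /andP[b0 b1] wz.
  rewrite -addrA opprD addrA subrr sub0r normrN.
  apply: (le_lt_trans (ler_normD _ _)); rewrite !normrZ (ger0_norm a0) (ger0_norm b0) (ger0_norm t0').
  apply: (@le_lt_trans _ _ (t * (`|u| + `|v|))).
    apply: (@le_trans _ _ (t * (`|w| + `|z|))); last by rewrite ler_wpM2l// ltW.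
    by rewrite mulrDr lerD// ler_piMl// mulr_ge0// ltW.
  apply: (@lt_le_trans _ _ (t * K)); first by rewrite ltr_pM2l// /K -addrA ltrDr.
  by rewrite tE divfK ?lt0r_neq0// ler_pdivrMr// ler_peMr// ler1n.
have uv : `|u| + `|v| <= `|u| + `|v| by [].
have vu : `|v| + `|u| <= `|u| + `|v| by rewrite addrC.
have [|a [b [a01 b01 E1]]] := second_difference (u := u) (v := v) (p := p) Cg (lt0r_neq0 t0).
  move=> a b a01 b01; apply: H3.
  by apply: (lt_le_trans (near_pt a b u v a01 b01 uv)); rewrite /d !ge_min lexx !orbT.
have [|a' [b' [a'01 b'01 E2]]] := second_difference (u := v) (v := u) (p := p) Cg (lt0r_neq0 t0).
  move=> a' b' a'01 b'01; apply: H3.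
  by apply: (lt_le_trans (near_pt a' b' v u a'01 b'01 vu)); rewrite /d !ge_min lexx !orbT.
have E : 'D_v ('D_u g) (p + a *: (t *: u) + b *: (t *: v)) =
         'D_u ('D_v g) (p + a' *: (t *: v) + b' *: (t *: u)).
  have tt0 : t * t != 0 by rewrite mulf_neq0// lt0r_neq0.
  apply: (mulfI tt0); apply: (etrans (esym E1)); apply: (etrans _ E2).
  rewrite -[p + t *: u + t *: v]addrA [t *: u + _]addrC addrA; ring.
have L1 := H1 _ (lt_le_trans (near_pt a' b' v u a'01 b'01 vu) _).
have L2 := H2 _ (lt_le_trans (near_pt a b u v a01 b01 uv) _).
apply: (dist_half (L1 _) _); first by rewrite /d ge_min lexx.
by rewrite -E; apply: L2; rewrite /d !ge_min lexx orbT.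
Qed.

(** The derivatives at a boundary point of a half-space are limits of
    derivatives at interior points, hence determined by the values on the
    half-space. This makes the derivatives of functions on M independent of
    the local extension, also on the boundary and in non-tangent
    directions. *)
Lemma derive_half_zero O (j : 'I_N) g p v : open O -> Cinf O g -> O p -> 0 <= p 0 j ->
  (forall q, O q -> 0 <= q 0 j -> g q = 0) -> 'D_v g p = 0.
Proof.
move=> oO Cg Op pj g0.
have int q : O q -> 0 < q 0 j -> 'D_v g q = 0.
  move=> Oq qj.
  have oI : open (O `&` [set q | 0 < q 0 j]).
    by apply: openI => //; apply: (@open_coord _ _ [set x : R | 0 < x]); exact: open_gt.
  rewrite (@eq_derive_open _ _ _ _ g (fun=> 0) q v oI)//; first by rewrite derive_cst.
  by move=> r; rewrite inE => -[Or /ltW rj]; rewrite g0.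
have c : {for p, continuous ('D_v g)} by apply: Cinf_cont (Cinf_D v Cg) p Op.
apply/eqP; rewrite -normr_le0; apply/ler_addgt0Pl => e e0; rewrite addr0.
have [d1 d10 H1] := (cont_normP _ _).1 c _ e0.
have [d2 d20 H2] := open_normP oO Op.
pose d := Num.min d1 d2; have d0 : 0 < d by rewrite lt_min d10 d20.
pose D : vec := delta_mx 0 j.
pose t := d / (`|D| + 1).
have D1 : 0 < `|D| + 1 by rewrite ltr_pwDr.
have t0 : 0 < t by rewrite divr_gt0.
pose q := p + t *: D.
have pq : `|p - q| < d.
  rewrite /q opprD addrA subrr sub0r normrN normrZ gtr0_norm// /t mulrAC ltr_pdivrMr//.
  by rewrite ltr_pM2l// ltrDl.
have qj : 0 < q 0 j by rewrite !mxE !eqxx mulr1 ltr_wpDl.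
have Dq : 'D_v g q = 0 by apply: int => //; apply: H2; rewrite (lt_le_trans pq)// ge_min lexx orbT.
have := H1 q; rewrite Dq subr0 => H; apply/ltW/H.
by rewrite (lt_le_trans pq)// ge_min lexx.
Qed.

End Schwarz.

(** * Division by a coordinate *)

Section IntervalIntegral.
Context {R : realType}.
Local Notation mu := (@lebesgue_measure R).
Implicit Types (a b : R) (f g : R -> R).

Lemma cont_within (A : set R) f : (forall x, A x -> {for x, continuous f}) ->
  {within A, continuous f}.
Proof.
move=> cf; apply: continuous_in_subspaceT => x; rewrite inE; exact: cf.
Qed.

Lemma within_contD (A : set R) f g : {within A, continuous f} ->
  {within A, continuous g} -> {within A, continuous (fun x => f x + g x)}.
Proof. by move=> cf cg x; apply: cvgD; [exact: cf|exact: cg]. Qed.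

Lemma within_contB (A : set R) f g : {within A, continuous f} ->
  {within A, continuous g} -> {within A, continuous (fun x => f x - g x)}.
Proof. by move=> cf cg x; apply: cvgB; [exact: cf|exact: cg]. Qed.

Lemma within_contZ (A : set R) (c : R) f : {within A, continuous f} ->
  {within A, continuous (fun x => c * f x)}.
Proof. by move=> cf x; apply: cvgM; [exact: cvg_cst|exact: cf]. Qed.

Lemma cont_integrable a b f : {within `[a, b], continuous f} ->
  mu.-integrable `[a, b] (EFin \o f).
Proof. by move=> cf; apply: continuous_compact_integrable => //; exact: segment_compact. Qed.

Lemma Rintegral_cst_itv a b (c : R) : a <= b ->
  (\int[mu]_(x in `[a, b]) c)%R = c * (b - a).
Proof.
move=> ab; rewrite Rintegral_cst//= lebesgue_measure_itv/= lte_fin.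
by case: ltgtP ab => // -> _; rewrite subrr.
Qed.

Lemma Rintegral_dist a b f g (c : R) : a <= b ->
  {within `[a, b], continuous f} -> {within `[a, b], continuous g} ->
  (forall x, a <= x <= b -> `|f x - g x| <= c) ->
  `|(\int[mu]_(x in `[a, b]) f x)%R - (\int[mu]_(x in `[a, b]) g x)%R| <= c * (b - a).
Proof.
move=> ab cf cg fg.
have If := cont_integrable cf; have Ig := cont_integrable cg.
rewrite -RintegralB//.
have Ifg : mu.-integrable `[a, b] (EFin \o (fun x => f x - g x)).
  by have := integrableB _ If Ig; apply.
apply: (le_trans (le_normr_Rintegral _ Ifg)) => //.
rewrite -(Rintegral_cst_itv c ab); apply: le_Rintegral => //.
- by have := integrable_norm Ifg; apply: eq_integrable.
- by apply: cont_integrable; apply: cont_within => x _; exact: cst_continuous.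
Qed.

End IntervalIntegral.

Section Compact.
Context {R : realType} {N : nat}.
Local Notation vec := 'rV[R]_N.

Lemma closed_ball_compact (p : vec) (r : R) : compact [set q : vec | `|p - q| <= r].
Proof.
apply: bounded_closed_compact.
  rewrite /bounded_set/=; exists (`|p| + r); split; first by rewrite num_real.
  move=> M HM q /= pq; apply/ltW/(le_lt_trans _ HM).
  rewrite -[q](subKr p) (le_trans (ler_normB _ _))// lerD2l//.
have -> : [set q : vec | `|p - q| <= r] = (fun q => `|p - q|) @^-1` [set x | x <= r] by [].
apply: closed_comp; last exact: closed_le.
move=> q _; apply: continuous_comp; last exact: norm_continuous.
by apply: continuousB; [exact: cst_continuous|exact: id].
Qed.

Lemma bounded_on_ball (p : vec) (r d : R) (u : vec -> R) : 0 <= r -> r < d ->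
  (forall q, `|p - q| < d -> {for q, continuous u}) ->
  exists2 C : R, 0 <= C & forall q, `|p - q| <= r -> `|u q| <= C.
Proof.
move=> r0 rd cu.
have n0 : [set q : vec | `|p - q| <= r] !=set0 by exists p => /=; rewrite subrr normr0.
have cu2 : {within [set q : vec | `|p - q| <= r], continuous (fun q => `|u q|)}.
  apply: continuous_in_subspaceT => q; rewrite inE/= => pq.
  apply: continuous_comp; last exact: norm_continuous.
  by apply: cu; exact: le_lt_trans rd.
have [c cB cm] := EVT_max_rV n0 (@closed_ball_compact p r) cu2.
exists `|u c| => // q pq; apply: cm; by rewrite inE.
Qed.

Lemma open_norm_ball (p : vec) (d : R) : open [set q : vec | `|p - q| < d].
Proof.
have -> : [set q : vec | `|p - q| < d] = (fun q => `|p - q|) @^-1` [set x | x < d] by [].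
apply: open_comp; last exact: open_lt.
move=> q _; apply: continuous_comp; last exact: norm_continuous.
by apply: continuousB; [exact: cst_continuous|exact: id].
Qed.

(** The partial derivatives are bounded on the smaller ball, by compactness,
    and the mean value theorem applies on segments since balls are convex. *)
Lemma Lipschitz_on_ball (p : vec) (d r : R) (u : vec -> R) : 0 <= r -> r < d ->
  Cinf [set q | `|p - q| < d] u ->
  exists2 C : R, 0 <= C & forall q q', `|p - q| <= r -> `|p - q'| <= r ->
    `|u q - u q'| <= C * `|q - q'|.
Proof.
move=> r0 rd Cu.
have oB := @open_norm_ball p d.
have /choice[C HC] : forall i : 'I_N, exists C : R, 0 <= C /\
    forall q, `|p - q| <= r -> `|'D_(delta_mx 0 i) u q| <= C.
  move=> i; have [|C C0 HC] := @bounded_on_ball p r d ('D_(delta_mx 0 i) u) r0 rd.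
    by move=> q pq; exact: Cinf_cont (Cinf_D _ Cu) q pq.
  by exists C.
exists (\sum_i C i); first by apply: sumr_ge0 => i _; have [] := HC i.
move=> q q' pq pq'.
have seg (t : R) : 0 <= t <= 1 -> `|p - (q' + t *: (q - q'))| <= r.
  move=> /andP[t0 t1].
  have -> : p - (q' + t *: (q - q')) = (1 - t) *: (p - q') + t *: (p - q).
    by apply/matrixP => i k; rewrite !mxE; ring.
  rewrite (le_trans (ler_normD _ _))// !normrZ ger0_norm ?subr_ge0// [`|t|]ger0_norm//.
  have -> : r = (1 - t) * r + t * r by ring.
  by rewrite lerD// ler_wpM2l// subr_ge0.
have [t t01 E] := @MVT_dir R _ u q' (q - q') (fun t t01 =>
   @Cinf_derivable _ _ _ _ Cu _ (q - q') (le_lt_trans (seg t t01) rd)).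
rewrite [q' + _]addrC subrK in E; rewrite E.
rewrite (derive_sum_coord _ oB (Cu 1%N) (le_lt_trans (seg t t01) rd)).
rewrite (le_trans (ler_norm_sum _ _ _))// mulr_suml ler_sum// => i _.
rewrite normrM mulrC ler_pM//; last exact: ler_mx_norm_coef.
by have [_] := HC i; apply; exact: seg.
Qed.

End Compact.

Section Hadamard.
Context {R : realType} {N : nat}.
Local Notation vec := 'rV[R]_N.
Local Notation mu := (@lebesgue_measure R).
Variables (p : vec) (d : R) (j : 'I_N).
Hypotheses (pj : p 0 j = 0).
Let B := [set q : vec | `|p - q| < d].
Let ej : vec := delta_mx 0 j.
Let sc (s : R) (q : vec) : vec := q + ((s - 1) * q 0 j) *: ej.

Let scE s q i : sc s q 0 i = if i == j then s * q 0 j else q 0 i.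
Proof.
rewrite !mxE eqxx/=; case: eqP => [->|_]; last by rewrite mulr0 addr0.
by rewrite mulr1 mulrBl mul1r addrC subrK.
Qed.

Let sc_norm s q q' : 0 <= s <= 1 -> `|sc s q - sc s q'| <= `|q - q'|.
Proof.
move=> /andP[s0 s1]; apply: mx_norm_le => // i k; rewrite ord1.
have -> : (sc s q - sc s q') 0 k = sc s q 0 k - sc s q' 0 k by rewrite !mxE.
rewrite !scE; have := ler_mx_norm_coef (q - q') 0 k; rewrite !mxE.
case: eqP => [->|//] H; rewrite -mulrBr normrM ger0_norm//.
by rewrite (le_trans _ H)// ler_piMl.
Qed.

Let scp s : sc s p = p.
Proof. by rewrite /sc pj mulr0 scale0r addr0. Qed.

Let sc_ball s q : 0 <= s <= 1 -> `|p - sc s q| <= `|p - q|.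
Proof. by move=> s01; rewrite -{1}(scp s); exact: sc_norm. Qed.

Let scB s q : 0 <= s <= 1 -> B q -> B (sc s q).
Proof. by move=> s01; apply: le_lt_trans; exact: sc_ball. Qed.

Let sc_cont q : continuous (sc ^~ q).
Proof.
move=> s; apply: (@mx_cvg _ _ (nbhs s) _) => i k; rewrite ord1.
have -> : (fun x => sc x q 0 k) = (if k == j then (fun x => x * q 0 j) else cst (q 0 k)).
  by apply/funext => x; rewrite scE; case: ifP.
rewrite scE; case: eqP => _; last exact: cst_continuous.
by apply: continuousM; [exact: id|exact: cst_continuous].
Qed.

Let I (m : nat) (u : vec -> R) (q : vec) : R :=
  (\int[mu]_(s in `[0, 1]) (s ^+ m * u (sc s q)))%R.

Let integrand_cont m u q : Cinf B u -> B q ->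
  {within `[0, 1], continuous (fun s => s ^+ m * u (sc s q))}.
Proof.
move=> Cu Bq; apply: cont_within => s; rewrite /= in_itv/= => s01.
apply: continuousM; first exact: exprn_continuous.
apply: (@continuous_comp _ _ _ (sc ^~ q) u); first exact: sc_cont.
by apply: Cinf_cont Cu _ (scB s01 Bq).
Qed.

Let I_cont m u : Cinf B u -> forall q, B q -> {for q, continuous (I m u)}.
Proof.
move=> Cu q Bq.
pose r := (`|p - q| + d) / 2.
have [rq rd] : `|p - q| < r /\ r < d by move: Bq; rewrite /B/= /r => ?; split; lra.
have r0 : 0 <= r by rewrite (le_trans (normr_ge0 _) (ltW rq)).
have [C C0 HC] := Lipschitz_on_ball r0 rd Cu.
apply/cont_normP => e e0.
exists (Num.min (r - `|p - q|) (e / (C + 1))).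
  by rewrite lt_min subr_gt0 rq divr_gt0// ltr_wpDl.
move=> q'; rewrite lt_min => /andP[q1 q2].
have rq' : `|p - q'| <= r.
  have -> : p - q' = (p - q) + (q - q') by rewrite addrA subrK.
  by rewrite (le_trans (ler_normD _ _))// -lerBrDl ltW.
have Bq' : B q' by exact: le_lt_trans rd.
have := @Rintegral_dist R 0 1 _ _ (C * `|q - q'|) ler01
  (@integrand_cont m _ _ Cu Bq) (@integrand_cont m _ _ Cu Bq').
rewrite subr0 mulr1 => H; apply: (le_lt_trans (H _)).
  move=> s s01; have /andP[s0 s1] := s01.
  rewrite -mulrBr normrM ger0_norm ?exprn_ge0//.
  apply: (@le_trans _ _ `|u (sc s q) - u (sc s q')|).
    by rewrite ler_piMl// exprn_ile1.
  apply: (le_trans (HC _ _ _ _)).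
  - by rewrite (le_trans (sc_ball _ s01))// ltW.
  - by rewrite (le_trans (sc_ball _ s01)).
  - by rewrite ler_wpM2l// sc_norm.
have C1 : 0 < C + 1 by rewrite ltr_wpDl.
apply: (@le_lt_trans _ _ ((C + 1) * `|q - q'|)); first by rewrite ler_wpM2r// lerDl.
by rewrite mulrC -ltr_pdivlMr.
Qed.

Let v' (v : vec) : vec := v - v 0 j *: ej.

Let dI m u v q := I m ('D_(v' v) u) q + v 0 j * I m.+1 ('D_ej u) q.

Let scD s q v t : sc s (q + t *: v) = sc s q + t *: sc s v.
Proof.
rewrite /sc !mxE scalerDr scalerA addrACA; congr (_ + _).
by rewrite -scalerDl; congr (_ *: _); ring.
Qed.

Let sc_v s v : sc s v = v' v + (s * v 0 j) *: ej.
Proof. by rewrite /sc /v' mulrBl mul1r scalerBl -addrA [- _ + _]addrC. Qed.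

Let D_sc u q s v : Cinf B u -> B q -> 'D_(sc s v) u q = 'D_(v' v) u q + s * v 0 j * 'D_ej u q.
Proof.
move=> Cu Bq; rewrite sc_v (deriveDv _ _ (@open_norm_ball R N p d) (Cu 1%N) Bq).
by rewrite (deriveZv _ (@Cinf_derivable _ _ _ _ Cu _ ej Bq)).2.
Qed.

Let I_derive m u v q : Cinf B u -> B q -> is_derive q v (I m u) (dI m u v q).
Proof.
move=> Cu Bq.
pose r := (`|p - q| + d) / 2.
have [rq rd] : `|p - q| < r /\ r < d by move: Bq; rewrite /B/= /r => ?; split; lra.
have r0 : 0 <= r by rewrite (le_trans (normr_ge0 _) (ltW rq)).
have [C C0 HC] := Lipschitz_on_ball r0 rd (Cinf_D (v' v) Cu).
have [C' C'0 HC'] := Lipschitz_on_ball r0 rd (Cinf_D ej Cu).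
suff H : (fun t : R => t^-1 *: ((I m u \o shift q) (t *: v) - I m u q)) @ 0^' --> dI m u v q.
  split; first by apply/cvg_ex; eexists; exact: H.
  exact: cvg_lim H.
apply/cvgrPdist_le => e e0.
pose K := (C + `|v 0 j| * C') * `|v|.
have K0 : 0 <= K by rewrite mulr_ge0// addr_ge0// mulr_ge0.
near=> t.
have t0 : t != 0 by near: t; exact: nbhs_dnbhs_neq.
have tr : `|t| < (r - `|p - q|) / (`|v| + 1).
  by near: t; apply: dnbhs0_lt; rewrite divr_gt0 ?subr_gt0// ltr_wpDl.
have te : `|t| < e / (K + 1) by near: t; apply: dnbhs0_lt; rewrite divr_gt0// ltr_wpDl.
have tv : `|t *: v| <= r - `|p - q|.
  rewrite normrZ (@le_trans _ _ (`|t| * (`|v| + 1)))//.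
    by rewrite ler_wpM2l// lerDl.
  by rewrite -ler_pdivlMr ?ltW// ltr_wpDl.
have seg (s : R) : 0 <= s <= 1 -> `|p - (q + s *: (t *: v))| <= r.
  move=> /andP[s0 s1]; rewrite opprD addrA (le_trans (ler_normB _ _))//.
  rewrite -lerBrDl (le_trans _ tv)// normrZ ger0_norm// ler_piMl//.
have Bt : B (q + t *: v).
  by have := seg 1; rewrite scale1r lexx ler01 => /(_ isT) H; exact: le_lt_trans rd.
have cD1 := @integrand_cont m _ _ (Cinf_D (v' v) Cu) Bq.
have cD2 := @integrand_cont m.+1 _ _ (Cinf_D ej Cu) Bq.
have c1 := @integrand_cont m _ _ Cu Bq; have c2 := @integrand_cont m _ _ Cu Bt.
have i1 := cont_integrable c1; have i2 := cont_integrable c2.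
have iD1 := cont_integrable cD1; have iD2 := cont_integrable cD2.
have E1 : dI m u v q = (\int[mu]_(s in `[0, 1])
    (s ^+ m * 'D_(v' v) u (sc s q) + v 0 j * (s ^+ m.+1 * 'D_ej u (sc s q))))%R.
  rewrite RintegralD//; last by have := integrableZl _ (v 0 j) iD2; exact.
  by rewrite RintegralZl.
have E2 : t^-1 *: ((I m u \o shift q) (t *: v) - I m u q) = (\int[mu]_(s in `[0, 1])
    (t^-1 * (s ^+ m * u (sc s (q + t *: v)) - s ^+ m * u (sc s q))))%R.
  rewrite RintegralZl//; last by have := integrableB _ i2 i1; exact.
  by rewrite RintegralB// /= [t *: v + q]addrC.
rewrite E1 E2.
have cA : {within `[0, 1], continuous (fun s => s ^+ m * 'D_(v' v) u (sc s q) +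
    v 0 j * (s ^+ m.+1 * 'D_ej u (sc s q)))}.
  exact (within_contD cD1 (@within_contZ R _ (v 0 j) _ cD2)).
have cB : {within `[0, 1], continuous (fun s =>
    (t^-1 * (s ^+ m * u (sc s (q + t *: v)) - s ^+ m * u (sc s q))))}.
  by apply: within_contZ; exact: within_contB.
have := @Rintegral_dist R 0 1 _ _ (K * `|t|) ler01 cA cB.
rewrite subr0 mulr1 => H; apply: (le_trans (H _)); last first.
  have K1 : 0 < K + 1 by rewrite ltr_wpDl.
  rewrite (@le_trans _ _ ((K + 1) * `|t|))//; first by rewrite ler_wpM2r// lerDl.
  by rewrite mulrC -ler_pdivlMr// ltW.
move=> s s01; have /andP[s0 s1] := s01.
have [a a01 Ea] : exists2 a : R, 0 <= a <= 1 &
    u (sc s q + t *: sc s v) - u (sc s q) = 'D_(t *: sc s v) u (sc s q + a *: (t *: sc s v)).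
  apply: MVT_dir => a a01; apply: Cinf_derivable Cu _ _ _.
  by rewrite scalerA -scD -scalerA; apply: scB => //; exact: le_lt_trans (seg _ a01) rd.
have Ba : B (sc s q + a *: (t *: sc s v)).
  by rewrite scalerA -scD -scalerA; apply: scB => //; exact: le_lt_trans (seg _ a01) rd.
rewrite (deriveZv t (@Cinf_derivable _ _ _ _ Cu _ (sc s v) Ba)).2 (D_sc _ _ Cu Ba) in Ea.
rewrite -mulrBr [t^-1 * _]mulrCA scD Ea mulKf//.
have -> : s ^+ m * 'D_(v' v) u (sc s q) + v 0 j * (s ^+ m.+1 * 'D_ej u (sc s q)) -
   s ^+ m * ('D_(v' v) u (sc s q + a *: (t *: sc s v)) + s * v 0 j *
     'D_ej u (sc s q + a *: (t *: sc s v))) =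
   s ^+ m * (('D_(v' v) u (sc s q) - 'D_(v' v) u (sc s q + a *: (t *: sc s v))) +
      s * v 0 j * ('D_ej u (sc s q) - 'D_ej u (sc s q + a *: (t *: sc s v)))).
  move: ('D_(v' v) u (sc s q)) ('D_(v' v) u (sc s q + a *: (t *: sc s v)))
     ('D_ej u (sc s q)) ('D_ej u (sc s q + a *: (t *: sc s v))) => A1 A2 A3 A4.
  by rewrite exprS; ring.
have dist : `|sc s q - (sc s q + a *: (t *: sc s v))| <= `|t| * `|v|.
  rewrite opprD addrA subrr sub0r normrN !normrZ.
  have /andP[a0 a1] := a01; rewrite (ger0_norm a0).
  apply: (@le_trans _ _ (`|t| * `|sc s v|)); first by rewrite ler_piMl// mulr_ge0.
  rewrite ler_wpM2l//; have := sc_norm v 0 s01.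
  have -> : sc s 0 = 0 by rewrite /sc mxE mulr0 scale0r addr0.
  by rewrite !subr0.
have n1 : `|p - sc s q| <= r by rewrite (le_trans (sc_ball _ s01))// ltW.
have n2 : `|p - (sc s q + a *: (t *: sc s v))| <= r.
  by rewrite scalerA -scD -scalerA (le_trans (sc_ball _ s01))// seg.
have L1 := HC _ _ n1 n2; have L2 := HC' _ _ n1 n2.
rewrite normrM (ger0_norm (exprn_ge0 m s0)).
apply: (@le_trans _ _ (C * (`|t| * `|v|) + `|v 0 j| * (C' * (`|t| * `|v|)))); last first.
  by rewrite /K le_eqVlt; apply/orP; left; apply/eqP; ring.
apply: (@le_trans _ _ (`|('D_(v' v) u (sc s q) - 'D_(v' v) u (sc s q + a *: (t *: sc s v))) +
      s * v 0 j * ('D_ej u (sc s q) - 'D_ej u (sc s q + a *: (t *: sc s v)))|)).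
  by rewrite ler_piMl// exprn_ile1.
apply: (le_trans (ler_normD _ _)); apply: lerD.
  by apply: (le_trans L1); rewrite ler_wpM2l.
rewrite normrM; apply: ler_pM => //.
  by rewrite normrM (ger0_norm s0) ler_piMl.
by apply: (le_trans L2); rewrite ler_wpM2l.
Unshelve. all: by end_near. Qed.

Let I_Ck k m u : Cinf B u -> Ck k B (I m u).
Proof.
have oB : open B := @open_norm_ball R N p d.
elim: k m u => [|k IH] m u Cu; first by split=> // q Bq; exact: I_cont.
split; first by move=> q Bq; exact: I_cont.
move=> v; split; first by move=> q Bq; have [] := I_derive m v Cu Bq.
apply: (@Ck_eq _ _ _ _ (dI m u v)) => //.
  by move=> q; rewrite inE => Bq; have [_ ->] := I_derive m v Cu Bq.
apply: Ck_add => //; first by apply: IH; exact: Cinf_D.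
apply: Ck_mul => //; first exact: Ck_cst.
by apply: IH; exact: Cinf_D.
Qed.

(** F q is the integral over s in [0, 1] of the derivative in s of F at the
    point whose j-th coordinate is scaled by s; a factor q_j comes out, and
    the remaining integral is smooth by differentiation under the integral
    sign. *)
Lemma Hadamard (F : vec -> R) : Cinf B F -> (forall q, B q -> q 0 j = 0 -> F q = 0) ->
  exists2 H : vec -> R, Cinf B H & forall q, B q -> F q = q 0 j * H q.
Proof.
move=> CF F0; exists (I 0 ('D_ej F)); first by move=> k; apply: I_Ck; exact: Cinf_D.
move=> q Bq.
have cI := @integrand_cont 0%N _ _ (Cinf_D ej CF) Bq.
have iI := cont_integrable cI.
rewrite /I -RintegralZl//.
have sc0 : F (sc 0 q) = 0.
  by apply: F0; [apply: scB => //; rewrite lexx ler01|rewrite scE eqxx mul0r].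
have sc1 : sc 1 q = q by rewrite /sc subrr mul0r scale0r addr0.
have D (s : R) : 0 <= s <= 1 -> is_derive s 1 (fun s => F (sc s q)) (q 0 j * 'D_ej F (sc s q)).
  move=> s01.
  have E : (fun s => F (sc s q)) = (fun s => F (sc 0 q + s *: (q 0 j *: ej))).
    apply/funext => s'; congr F; rewrite /sc -addrA; congr (_ + _).
    by rewrite scalerA -scalerDl; congr (_ *: _); ring.
  have E2 : sc s q = sc 0 q + s *: (q 0 j *: ej).
    rewrite /sc -addrA; congr (_ + _).
    by rewrite scalerA -scalerDl; congr (_ *: _); ring.
  rewrite E -(deriveZv (q 0 j) (@Cinf_derivable _ _ _ _ CF _ ej (scB s01 Bq))).2 E2.
  by apply: is_derive_line; rewrite -E2; apply: Cinf_derivable CF _ _ (scB s01 Bq).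
have FTC := @continuous_FTC2 R (fun s => q 0 j * (s ^+ 0 * 'D_ej F (sc s q)))
   (fun s => F (sc s q)) 0 1 ltr01.
rewrite /Rintegral FTC/=; first by rewrite sc1 sc0 subr0.
- exact: within_contZ.
- have c s : 0 <= s <= 1 -> {for s, continuous (fun s => F (sc s q))}.
    by move=> /D[dd _]; apply: differentiable_continuous; apply/derivable1_diffP.
  split.
  + by move=> s; rewrite in_itv/= => /andP[s0 s1]; have [] := D s _; rewrite ?ltW.
  + by apply: cvg_at_right_filter; apply: c; rewrite lexx ler01.
  + by apply: cvg_at_left_filter; apply: c; rewrite lexx ler01.
- move=> s; rewrite in_itv/= => /andP[s0 s1].
  by have [_ E] := D s ltac:(by rewrite !ltW); rewrite derive1E E expr0 mul1r.
Qed.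

End Hadamard.

(** * Ordinary differential equations *)

Section GeometricLimit.
Context {R : realType}.

(** The limit is the common point of the nested intervals of centre u k and
    radius 2 D 2^{-k}. *)
Lemma geometric_limit (u : nat -> R) (D : R) : 0 <= D ->
  (forall k, `|u k.+1 - u k| <= D * (2^-1) ^+ k) ->
  exists l : R, forall k, `|u k - l| <= 2 * D * (2^-1) ^+ k.
Proof.
move=> D0 uD.
pose a k := u k - 2 * D * (2^-1) ^+ k; pose b k := u k + 2 * D * (2^-1) ^+ k.
have ab k : a k <= b k.
  have : 0 <= 2 * D * (2^-1) ^+ k by apply: mulr_ge0; [exact: mulr_ge0|rewrite exprn_ge0// invr_ge0].
  by rewrite /a /b => ?; lra.
have aS k : a k <= a k.+1.
  have := uD k; rewrite ler_norml /a exprS => /andP[].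
  by move: (2^-1 ^+ k) => x; nra.
have bS k : b k.+1 <= b k.
  have := uD k; rewrite ler_norml /b exprS => /andP[].
  by move: (2^-1 ^+ k) => x; nra.
have amon k l : (k <= l)%N -> a k <= a l.
  elim: l => [|l IH]; first by rewrite leqn0 => /eqP->.
  by rewrite leq_eqVlt ltnS => /orP[/eqP->//|/IH H]; exact: le_trans (aS l).
have bmon k l : (k <= l)%N -> b l <= b k.
  elim: l => [|l IH]; first by rewrite leqn0 => /eqP->.
  by rewrite leq_eqVlt ltnS => /orP[/eqP->//|/IH H]; exact: le_trans (bS l) _.
have aleb k l : a k <= b l.
  by apply: (le_trans (amon _ _ (leq_maxl k l))); apply: (le_trans (ab _)); exact: bmon (leq_maxr k l).
have hs : has_sup (range a).
  by split; [exists (a 0%N), 0%N|exists (b 0%N) => _ [k _ <-]].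
exists (sup (range a)) => k.
have H1 : a k <= sup (range a) by apply: sup_upper_bound => //; exists k.
have H2 : sup (range a) <= b k by apply: ge_sup; [case: hs|move=> _ [l _ <-]].
by rewrite ler_norml; move: H1 H2; rewrite /a /b; move: (2 * D * _) => x; lra.
Qed.

Lemma le_geometric0 (x C : R) : (forall k, x <= C * (2^-1) ^+ k) -> x <= 0.
Proof.
move=> H.
have c0 : (fun k => C * (2^-1) ^+ k) @ \oo --> (0 : R).
  by apply: cvg_geometric; rewrite ger0_norm ?invr_ge0// invf_lt1 ?ltr1n.
have -> : (0 : R) = lim ((fun k => C * (2^-1) ^+ k) @ \oo) by apply/esym/cvg_lim.
apply: limr_ge; first by apply/cvg_ex; exists 0.
by apply: nearW.
Qed.

End GeometricLimit.

Lemma clamp_dist (R : realFieldType) (a b s t : R) :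
  `|Num.max a (Num.min b s) - Num.max a (Num.min b t)| <= `|s - t|.
Proof.
have Hmin (u v : R) : `|Num.min b u - Num.min b v| <= `|u - v|.
  have := ler_norm (u - v); have := ler_norm (v - u); rewrite [`|v - u|]distrC ler_norml.
  by case: (leP b u); case: (leP b v) => *; apply/andP; split; lra.
have Hmax (u v : R) : `|Num.max a u - Num.max a v| <= `|u - v|.
  have := ler_norm (u - v); have := ler_norm (v - u); rewrite [`|v - u|]distrC ler_norml.
  by case: (leP a u); case: (leP a v) => *; apply/andP; split; lra.
exact: le_trans (Hmax _ _) (Hmin _ _).
Qed.

Section Picard.
Context {R : realType} {m : nat}.
Local Notation vec := 'rV[R]_m.
Local Notation mu := (@lebesgue_measure R).
Variables (F : vec -> vec) (Mb L T : R) (z0 : vec).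
Hypotheses (Mb0 : 0 <= Mb) (L0 : 0 <= L) (T0 : 0 < T).
Hypotheses (FM : forall z, `|F z| <= Mb) (FL : forall z z', `|F z - F z'| <= L * `|z - z'|).
Hypothesis TL : 8 * T * L <= 1.

Let kap (t : R) := Num.max (- T) (Num.min T t).

Let kapP t : - T <= kap t <= T.
Proof. by rewrite /kap le_max lexx/= ge_max ge_min lexx/= andbT; have := T0; lra. Qed.

Let kapE t : - T <= t <= T -> kap t = t.
Proof. by move=> /andP[t1 t2]; rewrite /kap min_r// max_r. Qed.

Let kapL s t : `|kap s - kap t| <= `|s - t|.
Proof. exact: clamp_dist. Qed.

Let cont_comp (y : R -> vec) i : continuous y -> continuous (fun t => F (y t) 0 i).
Proof.
move=> cy t; apply/cont_normP => e e0.
have L1 : 0 < L + 1 by rewrite ltr_wpDl.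
have [d d0 H] := (cont_normP _ _).1 (cy t) _ (divr_gt0 e0 L1).
exists d => // s /H {}H.
have -> : F (y t) 0 i - F (y s) 0 i = (F (y t) - F (y s)) 0 i by rewrite !mxE.
apply: (le_lt_trans (ler_mx_norm_coef _ _ _)); apply: (le_lt_trans (FL _ _)).
apply: (@le_lt_trans _ _ ((L + 1) * `|y t - y s|)); first by rewrite ler_wpM2r// lerDl.
by rewrite mulrC -ltr_pdivlMr.
Qed.

Let prim (f : R -> R) (t : R) : R := (\int[mu]_(s in `[- T, t]) f s)%R.

Let prim_Lip f (c : R) s t : continuous f -> (forall x, `|f x| <= c) -> - T <= s <= T ->
  - T <= t <= T -> `|prim f t - prim f s| <= c * `|t - s|.
Proof.
move=> cf fc.
have cW (A : set R) : {within A, continuous f} by apply: cont_within => x _; exact: cf.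
wlog : s t / s <= t.
  move=> H sT tT; case: (leP s t) => st; first exact: H.
  by rewrite distrC [`|t - s|]distrC; apply: H => //; exact: ltW.
move=> st /andP[s1 s2] /andP[t1 t2].
have i1 : mu.-integrable `[- T, t] (EFin \o f) by exact: cont_integrable.
rewrite /prim Rintegral_itvB ?bnd_simp//.
rewrite Rintegral_itv_obnd_cbnd; last first.
  apply: (@integrableS _ _ _ mu `[s, t]) => //; last exact: cont_integrable.
  by apply: subset_itvr; rewrite bnd_simp.
have := @Rintegral_dist R s t f (fun=> 0) c st (cW _) (@cont_within R `[s, t]%classic _ (fun x _ => @cst_continuous R R 0 x)).
rewrite Rintegral_cst_itv// mul0r subr0 [`|t - s|]ger0_norm ?subr_ge0//; apply.
by move=> x _; rewrite subr0.
Qed.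

Let prim_dist f g (c : R) t : continuous f -> continuous g -> (forall x, `|f x - g x| <= c) ->
  - T <= t <= T -> `|prim f t - prim g t| <= c * (2 * T).
Proof.
move=> cf cg fc /andP[t1 t2].
have c0 : 0 <= c by rewrite (le_trans _ (fc 0)).
apply: (@le_trans _ _ (c * (t - - T))).
  by apply: Rintegral_dist => //; apply: cont_within => x _; [exact: cf|exact: cg].
by rewrite ler_wpM2l//; lra.
Qed.

Let P (y : R -> vec) (t : R) : vec :=
  \row_i (z0 0 i + (prim (fun s => F (y s) 0 i) (kap t) - prim (fun s => F (y s) 0 i) 0)).

Let T00 : - T <= 0 <= T. Proof. by have := T0; lra. Qed.

Let P_Lip y s t : continuous y -> `|P y t - P y s| <= Mb * `|t - s|.
Proof.
move=> cy; apply: mx_norm_le => [|i j]; first by rewrite mulr_ge0.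
rewrite !mxE.
have -> (a b c d : R) : (a + (b - c)) - (a + (d - c)) = b - d by ring.
apply: (@le_trans _ _ (Mb * `|kap t - kap s|)); last by rewrite ler_wpM2l.
apply: prim_Lip => //; first exact: cont_comp.
by move=> x; exact: le_trans (ler_mx_norm_coef _ _ _) (FM _).
Qed.

Let P_dist y y' (c : R) t : continuous y -> continuous y' -> (forall t, `|y t - y' t| <= c) ->
  `|P y t - P y' t| <= c / 2.
Proof.
move=> cy cy' yy'.
have c0 : 0 <= c by rewrite (le_trans _ (yy' 0)).
apply: mx_norm_le => [|i j]; first by rewrite divr_ge0.
rewrite !mxE.
have -> (a b c' d e : R) : (a + (b - c')) - (a + (d - e)) = (b - d) - (c' - e) by ring.
have D s : `|F (y s) 0 j - F (y' s) 0 j| <= L * c.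
  have -> : F (y s) 0 j - F (y' s) 0 j = (F (y s) - F (y' s)) 0 j by rewrite !mxE.
  apply: (le_trans (ler_mx_norm_coef _ _ _)); apply: (le_trans (FL _ _)).
  by rewrite ler_wpM2l.
have c1 := @cont_comp _ j cy; have c2 := @cont_comp _ j cy'.
have H1 := prim_dist c1 c2 D (kapP t); have H2 := prim_dist c1 c2 D T00.
apply: (le_trans (ler_normB _ _)); apply: (le_trans (lerD H1 H2)).
have : (8 * T * L) * c <= c by rewrite ler_piMl.
have : 0 <= T * L * c by rewrite !mulr_ge0// ltW.
by nra.
Qed.

Let Y k : R -> vec := iter k P (fun=> z0).

Let Lip_cont (y : R -> vec) : (forall s t, `|y t - y s| <= Mb * `|t - s|) -> continuous y.
Proof.
move=> yL t; apply/cont_normP => e e0.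
have M1 : 0 < Mb + 1 by rewrite ltr_wpDl.
exists (e / (Mb + 1)); first by rewrite divr_gt0.
move=> s ts; apply: (le_lt_trans (yL _ _)).
apply: (@le_lt_trans _ _ ((Mb + 1) * `|t - s|)); first by rewrite ler_wpM2r// lerDl.
by rewrite mulrC -ltr_pdivlMr.
Qed.

Let Y_Lip k s t : `|Y k t - Y k s| <= Mb * `|t - s|.
Proof.
elim: k s t => [|k IH] s t; first by rewrite subrr normr0 mulr_ge0.
by apply: P_Lip; exact: Lip_cont.
Qed.

Let Y_cont k : continuous (Y k). Proof. by apply: Lip_cont => s t; exact: Y_Lip. Qed.

Let D := Mb * (2 * T).

Let P0E y : P y 0 = z0.
Proof. by apply/rowP => i; rewrite !mxE kapE// subrr addr0. Qed.

Let Y_step k t : `|Y k.+1 t - Y k t| <= D * (2^-1) ^+ k.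
Proof.
elim: k t => [|k IH] t; last first.
  have -> : D * 2^-1 ^+ k.+1 = (D * 2^-1 ^+ k) / 2 by rewrite exprSr mulrA.
  change (Y k.+2 t) with (P (Y k.+1) t); change (Y k.+1 t) with (P (Y k) t).
  by apply: P_dist; [exact: (@Y_cont k.+1)|exact: (@Y_cont k)|exact: IH].
rewrite expr0 mulr1 /= -{2}(P0E (fun=> z0)).
have Pk : P (fun=> z0) t = P (fun=> z0) (kap t) by rewrite /P (@kapE (kap t) (kapP t)).
rewrite Pk; apply: (le_trans (P_Lip _ _ _)); first by move=> ?; exact: cst_continuous.
rewrite /D ler_wpM2l// subr0 ler_norml; have := kapP t; have := T0; lra.
Qed.

(** Successive approximations converge geometrically because T is small
    against the Lipschitz constant. The clamp of the time to [- T, T] makes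
    every iterate a function on the whole line. *)
Theorem picard : exists z : R -> vec, [/\ z 0 = z0,
  forall s t, `|z t - z s| <= Mb * `|t - s| &
  forall t, - T < t < T -> is_derive t 1 z (F (z t))].
Proof.
have D0 : 0 <= D by rewrite !mulr_ge0// ltW.
have /choice[z Hz] : forall t, exists z : vec, forall k, `|Y k t - z| <= 2 * D * (2^-1) ^+ k.
  move=> t.
  have /choice[z Hz] : forall i, exists l : R, forall k, `|Y k t 0 i - l| <= 2 * D * (2^-1) ^+ k.
    move=> i; apply: geometric_limit => // k.
    have -> : Y k.+1 t 0 i - Y k t 0 i = (Y k.+1 t - Y k t) 0 i by rewrite !mxE.
    exact: le_trans (ler_mx_norm_coef _ _ _) (Y_step k t).
  exists (\row_i z i) => k; apply: mx_norm_le => [|i j].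
    by apply: mulr_ge0; [exact: mulr_ge0|rewrite exprn_ge0// invr_ge0].
  by rewrite !mxE ord1; exact: Hz.
have zL s t : `|z t - z s| <= Mb * `|t - s|.
  rewrite -subr_le0; apply: (@le_geometric0 _ _ (4 * D)) => k.
  have := Hz t k; have := Hz s k; have := Y_Lip k s t.
  have : `|z t - z s| <= `|Y k t - z t| + `|Y k t - Y k s| + `|Y k s - z s|.
    have -> : z t - z s = (z t - Y k t) + (Y k t - Y k s) + (Y k s - z s).
      by apply/rowP => i; rewrite !mxE; ring.
    by rewrite (le_trans (ler_normD _ _))// lerD2r (le_trans (ler_normD _ _))// lerD2r distrC.
  by move: (2^-1 ^+ k) => x; lra.
have cz : continuous z by exact: Lip_cont.
have zP t : z t = P z t.
  apply/eqP; rewrite -subr_eq0 -normr_le0; apply: (@le_geometric0 _ _ (2 * D)) => k.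
  have H1 := Hz t k.+1.
  have H2 := @P_dist _ _ _ t (@Y_cont k) cz (fun t => Hz t k).
  have : `|z t - P z t| <= `|Y k.+1 t - z t| + `|P (Y k) t - P z t|.
    have -> : z t - P z t = (z t - Y k.+1 t) + (P (Y k) t - P z t).
      by apply/rowP => i; rewrite !mxE; ring.
    by rewrite (le_trans (ler_normD _ _))// lerD2r distrC.
  by move: H1 H2; rewrite exprS; move: (2^-1 ^+ k) => x; lra.
exists z; split=> //; first by rewrite zP P0E.
move=> t /andP[t1 t2].
have dc i : is_derive t 1 (fun s => z s 0 i) (F (z t) 0 i).
  have cf := @cont_comp _ i cz.
  have tT : t < (t + T) / 2 by lra.
  have i1 : mu.-integrable `[- T, (t + T) / 2] (EFin \o (fun s => F (z s) 0 i)).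
    by apply: cont_integrable; apply: cont_within => x _; exact: cf.
  have [d1 d2] := continuous_FTC1_closed tT i1 t1 (cf t).
  have D1 : is_derive t 1 (fun s => z0 0 i + (prim (fun s => F (z s) 0 i) s - prim (fun s => F (z s) 0 i) 0)) (F (z t) 0 i).
    have dp : is_derive t 1 (prim (fun s => F (z s) 0 i)) (F (z t) 0 i).
      by split; [exact: d1|rewrite -derive1E; exact: d2].
    have H := is_deriveD (is_derive_cst (z0 0 i) t 1) (is_deriveB dp
      (is_derive_cst (prim (fun s => F (z s) 0 i) 0) t 1)).
    by rewrite add0r subr0 in H; exact: H.
  have nE : {near t, (fun s => z0 0 i + (prim (fun s => F (z s) 0 i) s -
      prim (fun s => F (z s) 0 i) 0)) =1 (fun s => z s 0 i)}; last first.
    exact: (near_eq_is_derive nE D1).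
  have : \forall s \near t, - T < s < T.
    near=> s; apply/andP; split; near: s; [exact: lt_nbhsr|exact: lt_nbhsl].
  apply: filterS => s /andP[s1 s2].
  by rewrite [in RHS]zP mxE kapE// !ltW.
by apply: is_derive_mxP => k i; rewrite ord1; exact: dc.
Unshelve. all: by end_near. Qed.

End Picard.

Section LocalODE.
Context {R : realType} {m : nat}.
Local Notation vec := 'rV[R]_m.

Let clamp (c : vec) (r : R) (z : vec) : vec :=
  \row_i Num.max (c 0 i - r) (Num.min (c 0 i + r) (z 0 i)).

Let clamp_in c r z : 0 <= r -> `|c - clamp c r z| <= r.
Proof.
move=> r0; apply: mx_norm_le => // i j; rewrite ord1 !mxE ler_norml.
rewrite /Num.max /Num.min.
by repeat case: ifP => //; rewrite -?leNgt => *; apply/andP; split; lra.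
Qed.

Let clamp_id c r z : `|c - z| <= r -> clamp c r z = z.
Proof.
move=> cz; apply/rowP => i; rewrite !mxE.
have := le_trans (ler_mx_norm_coef (c - z) 0 i) cz; rewrite !mxE ler_norml => /andP[h1 h2].
by rewrite min_r ?max_r//; lra.
Qed.

Let clamp_Lip c r z z' : 0 <= r -> `|clamp c r z - clamp c r z'| <= `|z - z'|.
Proof.
move=> r0; apply: mx_norm_le => // i j; rewrite ord1.
have := ler_mx_norm_coef (z - z') 0 j; rewrite !mxE; apply: le_trans.
exact: clamp_dist.
Qed.

Lemma smooth_field_bounds (c : vec) (d : R) (F : vec -> vec) : 0 < d ->
  (forall i, Cinf [set z | `|c - z| < d] (fun z => F z 0 i)) ->
  exists K : R, 0 <= K /\
    (forall z, `|c - z| <= d / 2 -> `|F z| <= K) /\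
    (forall z z', `|c - z| <= d / 2 -> `|c - z'| <= d / 2 -> `|F z - F z'| <= K * `|z - z'|).
Proof.
move=> d0 CF.
have d20 : 0 <= d / 2 by rewrite divr_ge0// ltW.
have d2d : d / 2 < d by lra.
have /choice[C HC] : forall i : 'I_m, exists C : R, 0 <= C /\
    forall q, `|c - q| <= d / 2 -> `|F q 0 i| <= C.
  move=> i; have [|C C0 HC] := @bounded_on_ball _ _ c (d / 2) d (fun z => F z 0 i) d20 d2d.
    by move=> q pq; exact: Cinf_cont (CF i) q pq.
  by exists C.
have /choice[C' HC'] : forall i : 'I_m, exists C : R, 0 <= C /\
    forall q q', `|c - q| <= d / 2 -> `|c - q'| <= d / 2 -> `|F q 0 i - F q' 0 i| <= C * `|q - q'|.
  by move=> i; have [C1 C10 HC0] := Lipschitz_on_ball d20 d2d (CF i); exists C1.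
pose K := \sum_i (C i + C' i).
have CK i : C i <= K /\ C' i <= K.
  have H : C i + C' i <= K.
    rewrite /K (bigD1 i)//= lerDl sumr_ge0// => k _; rewrite addr_ge0//.
      by have [] := HC k.
    by have [] := HC' k.
  by have [h1 _] := HC i; have [h2 _] := HC' i; split; lra.
have K0 : 0 <= K.
  rewrite sumr_ge0// => k _; rewrite addr_ge0//; first by have [] := HC k.
  by have [] := HC' k.
exists K; split=> //; split.
  move=> z cz; apply: mx_norm_le => // i j; rewrite ord1.
  by apply: (le_trans ((HC j).2 _ cz)); have [] := CK j.
move=> z z' cz cz'; apply: mx_norm_le => [|i j]; first by rewrite mulr_ge0.
rewrite ord1 !mxE; apply: (le_trans ((HC' j).2 _ _ cz cz')).
by rewrite ler_wpM2r//; have [] := CK j.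
Qed.

(** The field is clamped outside the ball to make it globally bounded and
    Lipschitz; a solution of speed at most K stays in the ball for a time that
    does not depend on the initial value. That uniformity is needed since the
    initial velocities below tend to a tangent one. *)
Lemma ode_exists (c : vec) (d K : R) (F : vec -> vec) : 0 < d -> 0 <= K ->
  (forall z, `|c - z| <= d / 2 -> `|F z| <= K) ->
  (forall z z', `|c - z| <= d / 2 -> `|c - z'| <= d / 2 -> `|F z - F z'| <= K * `|z - z'|) ->
  exists2 T : R, 0 < T & forall z0, `|c - z0| <= d / 4 ->
  exists z : R -> vec, [/\ z 0 = z0,
    forall s t, `|z t - z s| <= K * `|t - s|,
    forall t, - T < t < T -> `|c - z t| < d / 2 &
    forall t, - T < t < T -> is_derive t 1 z (F (z t))].
Proof.
move=> d0 K0 FM FL.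
have d20 : 0 <= d / 2 by rewrite divr_ge0// ltW.
pose G z := F (clamp c (d / 2) z).
have GM z : `|G z| <= K by apply: FM; exact: clamp_in.
have GL z z' : `|G z - G z'| <= K * `|z - z'|.
  by apply: (le_trans (FL _ _ _ _)); rewrite ?clamp_in// ler_wpM2l// clamp_Lip.
pose T := Num.min 1 (d / 4) / (8 * (K + 1)).
have K1 : 0 < 8 * (K + 1) by rewrite mulr_gt0// ltr_wpDl.
have T0 : 0 < T by rewrite divr_gt0// lt_min ltr01 divr_gt0.
have TK (x : R) : Num.min 1 (d / 4) <= x -> 0 <= x -> 8 * T * K <= x.
  move=> H x0; have E : T * (8 * (K + 1)) = Num.min 1 (d / 4) by rewrite /T divfK// lt0r_neq0.
  have := ltW T0; nra.
have TL : 8 * T * K <= 1 by apply: TK => //; rewrite ge_min lexx.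
have TM : 8 * T * K <= d / 4 by apply: TK; [rewrite ge_min lexx orbT|rewrite divr_ge0// ltW].
exists T => // z0 cz0.
have [z [z00 zL zD]] := picard z0 K0 K0 T0 GM GL TL.
have zin t : - T < t < T -> `|c - z t| < d / 2.
  move=> /andP[t1 t2].
  have : `|c - z t| <= `|c - z0| + `|z t - z 0|.
    have -> : c - z t = (c - z0) - (z t - z0) by rewrite opprB addrA subrK.
    by rewrite z00 (le_trans (ler_normB _ _)).
  have := zL 0 t; rewrite subr0.
  have : K * `|t| <= K * T by rewrite ler_wpM2l// ler_norml; lra.
  have : 0 <= T * K by rewrite mulr_ge0// ltW.
  lra.
exists z; split=> // t tT; have := zD _ tT.
by rewrite /G clamp_id// ltW// zin.
Qed.

(** The maximum D of the distance of two solutions satisfies D <= K (e - s)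
    D. *)
Lemma ode_unique (B : set vec) (K s e : R) (F : vec -> vec) (z1 z2 : R -> vec) :
  s < e -> 0 <= K -> K * (e - s) < 1 ->
  (forall z z', B z -> B z' -> `|F z - F z'| <= K * `|z - z'|) ->
  {within `[s, e], continuous z1} -> {within `[s, e], continuous z2} ->
  (forall t, s <= t <= e -> B (z1 t)) -> (forall t, s <= t <= e -> B (z2 t)) ->
  (forall t, s < t < e -> is_derive t 1 z1 (F (z1 t))) ->
  (forall t, s < t < e -> is_derive t 1 z2 (F (z2 t))) ->
  z1 s = z2 s -> forall t, s <= t <= e -> z1 t = z2 t.
Proof.
move=> se K0 Kse FL c1 c2 B1 B2 D1 D2 E0.
have cn : {within `[s, e], continuous (fun t => `|z1 t - z2 t|)}.
  by move=> t; apply: cvg_norm; apply: cvgB; [exact: c1|exact: c2].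
have [t0 t0i t0m] := EVT_max (ltW se) cn.
rewrite in_itv/= in t0i; have /andP[t0s t0e] := t0i.
set D := `|z1 t0 - z2 t0| in t0m.
have D0 : 0 <= D := normr_ge0 _.
have DD : D <= K * (e - s) * D.
  apply: mx_norm_le => [|i j]; first by rewrite !mulr_ge0// subr_ge0 ltW.
  rewrite ord1.
  have [E|st0] := eqVneq s t0.
    by rewrite -E E0 subrr mxE normr0 !mulr_ge0// subr_ge0 ltW.
  have {st0} st0 : s < t0 by rewrite lt_neqAle st0.
  have Dj t : t \in `]s, t0[ -> is_derive t 1 (fun t => z1 t 0 j - z2 t 0 j)
      (F (z1 t) 0 j - F (z2 t) 0 j).
    rewrite in_itv/= => /andP[ts tt0].
    have ste : s < t < e by rewrite ts (lt_le_trans tt0).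
    have d1j := is_derive_coef 0 j (D1 _ ste); have d2j := is_derive_coef 0 j (D2 _ ste).
    exact: is_deriveB.
  have cj : {within `[s, t0], continuous (fun t => z1 t 0 j - z2 t 0 j)}.
    have sub : `[s, t0] `<=` `[s, e] by apply: subset_itvl; rewrite bnd_simp.
    have W (y : R -> vec) : {within `[s, e], continuous y} ->
        {within `[s, t0], continuous (fun t => y t 0 j)}.
      move=> cy; have {}cy := continuous_subspaceW sub cy.
      by move=> t; apply: cvg_coef; exact: cy.
    by apply: within_contB; exact: W.
  have [u ui Eu] := MVT st0 Dj cj.
  have -> : (z1 t0 - z2 t0) 0 j = z1 t0 0 j - z2 t0 0 j by rewrite !mxE.
  have := Eu; rewrite E0 subrr subr0 => ->.
  move: ui; rewrite in_itv/= => /andP[us ut].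
  have sue : s <= u <= e by rewrite (ltW us) (le_trans (ltW ut)).
  rewrite normrM mulrAC [`|t0 - s|]ger0_norm ?subr_ge0//.
  apply: ler_pM => //; rewrite ?subr_ge0 ?lerB//.
  have -> : F (z1 u) 0 j - F (z2 u) 0 j = (F (z1 u) - F (z2 u)) 0 j by rewrite !mxE.
  apply: (le_trans (ler_mx_norm_coef _ _ _)); apply: (le_trans (FL _ _ (B1 _ sue) (B2 _ sue))).
  by rewrite ler_wpM2l// t0m// in_itv/=.
have D00 : D = 0.
  apply/eqP; rewrite eq_le D0 andbT leNgt; apply/negP => Dp.
  by have := mulr_gt0 Dp (_ : 0 < 1 - K * (e - s)); rewrite subr_gt0 => /(_ Kse); move: DD; clear; nra.
move=> t tse; apply/eqP; rewrite -subr_eq0 -normr_le0 -D00.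
by apply: t0m; rewrite in_itv/=.
Qed.

End LocalODE.

(** * A flat function *)

Section FlatFunction.
Context {R : realType}.

(** The derivatives of exp(-1/x) are linear combinations of these
    functions. *)
Definition flat (k : nat) (x : R) : R := if 0 < x then x ^- k * expR (- x^-1) else 0.

Lemma flat_gt0 k x : 0 < x -> 0 < flat k x.
Proof. by move=> x0; rewrite /flat x0 mulr_gt0 ?expR_gt0// invr_gt0 exprn_gt0. Qed.

Lemma flat_le0 k x : x <= 0 -> flat k x = 0.
Proof. by rewrite /flat ltNge => ->. Qed.

Lemma flat_ge0 k x : 0 <= flat k x.
Proof. by case: (ltP 0 x) => [/(flat_gt0 k)/ltW//|/flat_le0->]. Qed.

(** From exp(t) >= t^n / n! with t = 1 / x; the quadratic bound gives
    differentiability at 0, with derivative 0. *)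
Lemma flat_bound k x : 0 < x -> flat k x <= (k.+2)`!%:R * x ^+ 2.
Proof.
move=> x0; rewrite /flat x0.
have t0 : 0 <= x^-1 by rewrite invr_ge0 ltW.
have H := expR_ge1Dxn k.+1 t0.
have H2 : x^-1 ^+ k.+2 <= (k.+2)`!%:R * expR x^-1.
  have f0 : (0 : R) < (k.+2)`!%:R by rewrite ltr0n fact_gt0.
  by rewrite mulrC -ler_pdivrMr//; apply: le_trans H; rewrite lerDr.
rewrite expRN -(ler_pM2r (expR_gt0 x^-1)) divfK ?gt_eqF ?expR_gt0//.
rewrite -exprVn -mulrA [_ ^+ 2 * _]mulrC mulrA.
have x2 : 0 < x ^- 2 by rewrite invr_gt0 exprn_gt0.
rewrite -(ler_pM2r x2) mulfK ?gt_eqF ?exprn_gt0//.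
by rewrite -[x ^- 2]exprVn -exprD addn2.
Qed.

Lemma flat_derive k (x : R) : is_derive x 1 (flat k) (- k%:R * flat k.+1 x + flat k.+2 x).
Proof.
case: (ltgtP x 0) => x0.
- rewrite !flat_le0 ?ltW// mulr0 addr0.
  have nE : {near x, cst 0 =1 flat k}.
    by near=> y; rewrite flat_le0// ltW//; near: y; exact: lt_nbhsl.
  exact: near_eq_is_derive nE (is_derive_cst _ _ _).
- have n0 : x != 0 by rewrite gt_eqF.
  have D : is_derive x 1 (fun y => (y^-1) ^+ k * expR (- y^-1))
      (- k%:R * flat k.+1 x + flat k.+2 x).
    have dV : is_derive x 1 (fun y : R => y^-1) (- x ^- 2).
      have dI : derivable (id : R -> R) x 1 by exact: derivable_id.
      split; first exact: (derivableV n0 dI).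
      by have := deriveV n0 dI; rewrite derive_id [_ *: _]mulr1.
    have dX : is_derive x 1 (fun y : R => y^-1 ^+ k) (k%:R * x^-1 ^+ k.-1 * (- x ^- 2)).
      have dP : is_derive (x^-1) 1 (fun y : R => y ^+ k) (k%:R * x^-1 ^+ k.-1).
        split; first exact: exprn_derivable.
        by rewrite exp_derive [_ *: 1]mulr1 [_ *: _]/(_ * _).
      exact: is_derive1_comp dP dV.
    have dN : is_derive x 1 (fun y : R => - y^-1) (x ^- 2).
      by have := is_deriveN dV; rewrite opprK.
    have dE : is_derive x 1 (fun y : R => expR (- y^-1)) (x ^- 2 * expR (- x^-1)).
      have := @is_derive1_comp R expR (fun y => - y^-1) x _ _ (is_derive_expR (- x^-1)) dN.
      by rewrite mulrC.
    have E : - k%:R * flat k.+1 x + flat k.+2 x =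
        (x^-1 ^+ k) *: (x ^- 2 * expR (- x^-1)) +
        expR (- x^-1) *: (k%:R * x^-1 ^+ k.-1 * - x ^- 2).
      rewrite /flat x0 -!exprVn; move: (expR _) => e.
      have W (a b : R) : a *: b = a * b by [].
      rewrite !W; case: k {dX} => [|k] /=; first by rewrite !expr0; ring.
      by rewrite !exprS; ring.
    by rewrite E; exact: is_deriveM dX dE.
  apply: (near_eq_is_derive _ D).
  by near=> y; rewrite /flat ifT ?exprVn//; near: y; exact: lt_nbhsr.
- rewrite x0 !flat_le0// mulr0 addr0.
  have H : (fun h : R => h^-1 *: ((flat k \o shift 0) (h *: 1) - flat k 0)) @ 0^' --> (0 : R).
    apply/cvgrPdist_le => e e0.
    have f0 : (0 : R) < (k.+2)`!%:R by rewrite ltr0n fact_gt0.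
    near=> h; rewrite sub0r normrN /= addr0 [h *: 1]mulr1 [flat k 0]flat_le0// subr0.
    have h0 : h != 0 by near: h; exact: nbhs_dnbhs_neq.
    have he : `|h| < e / (k.+2)`!%:R by near: h; apply: dnbhs0_lt; rewrite divr_gt0.
    rewrite normrM normfV.
    case: (ltP 0 h) => hp; last by rewrite flat_le0// normr0 mulr0 ltW.
    rewrite (gtr0_norm hp) in he *; rewrite (ger0_norm (flat_ge0 _ _)) mulrC ler_pdivrMr//.
    apply: (le_trans (flat_bound k hp)); rewrite expr2 mulrA ler_wpM2r ?ltW//.
    by rewrite mulrC -ltr_pdivlMr.
  split; first by apply/cvg_ex; exists 0; exact: H.
  exact: cvg_lim H.
Unshelve. all: by end_near. Qed.

Lemma Cinf_flat N (O : set 'rV[R]_N) g : open O -> Cinf O g -> Cinf O (fun p => flat 0 (g p)).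
Proof.
move=> oO Cg; apply: (@Cinf_comp1 _ _ _ setT (flat 0)) => //; first exact: openT.
apply: (@Cinf1_family _ _ _ flat); first exact: openT.
move=> k; exists [:: (- k%:R, k.+1); (1, k.+2)] => x _.
by rewrite big_cons big_seq1/= mul1r; exact: flat_derive k x.
Qed.

End FlatFunction.

(** * Functions with nearly constant second derivative *)

Section Parabola.
Context {R : realType}.
Implicit Types (h k : R -> R).

Lemma mvt1 h h1 (a b : R) : a < b -> (forall t, a <= t <= b -> is_derive t 1 h (h1 t)) ->
  exists2 c, a < c < b & h b - h a = h1 c * (b - a).
Proof.
move=> ab dh.
have H := @MVT R h h1 a b ab.
have [||c] := H; last by rewrite in_itv/=; exists c.
- by move=> t; rewrite in_itv/= => /andP[? ?]; apply: dh; rewrite !ltW.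
- apply: cont_within => t; rewrite /= in_itv/= => /dh[dht _].
  by apply: differentiable_continuous; apply/derivable1_diffP.
Qed.

(** Two applications of the mean value theorem. *)
Lemma convex_ge0 h h1 h2 (b : R) : 0 <= b ->
  (forall t, 0 <= t <= b -> is_derive t 1 h (h1 t)) ->
  (forall t, 0 <= t <= b -> is_derive t 1 h1 (h2 t)) ->
  (forall t, 0 <= t <= b -> 0 <= h2 t) -> h 0 = 0 -> h1 0 = 0 -> 0 <= h b.
Proof.
rewrite le_eqVlt => /predU1P[<- _ _ _ ->//|b0] d1 d2 c2 h0 h10.
have [c /andP[c0 cb] E] := mvt1 b0 d1.
have [|e /andP[e0 ec] E2] := mvt1 c0 (h := h1) (h1 := h2).
  by move=> t /andP[t0 tc]; apply: d2; rewrite t0 (le_trans tc)// ltW.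
move: E E2; rewrite h0 h10 !subr0 => -> ->.
have e2 : 0 <= h2 e by apply: c2; rewrite !ltW//; exact: lt_trans cb.
by apply: mulr_ge0; [apply: mulr_ge0|]; rewrite ?e2// ltW.
Qed.

Lemma concave_ge0 h h1 h2 (b : R) :
  (forall t, 0 <= t <= b -> is_derive t 1 h (h1 t)) ->
  (forall t, 0 <= t <= b -> is_derive t 1 h1 (h2 t)) ->
  (forall t, 0 <= t <= b -> h2 t <= 0) -> h 0 = 0 -> h b = 0 ->
  forall t, 0 <= t <= b -> 0 <= h t.
Proof.
move=> d1 d2 c2 h0 hb t /andP[]; rewrite le_eqVlt => /predU1P[<-|t0]; first by rewrite h0.
rewrite le_eqVlt => /predU1P[->|tb]; first by rewrite hb.
have [|a /andP[a0 at_] E] := mvt1 t0 (h := h) (h1 := h1).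
  by move=> s /andP[s0 st]; apply: d1; rewrite s0 (le_trans st)// ltW.
have [|c /andP[tc cb] E2] := mvt1 tb (h := h) (h1 := h1).
  by move=> s /andP[s0 st]; apply: d1; rewrite st (le_trans _ s0)// ltW.
have ac : a < c by exact: lt_trans tc.
have [|e /andP[ae ec] E3] := mvt1 ac (h := h1) (h1 := h2).
  by move=> s /andP[s0 st]; apply: d2; rewrite !(le_trans _ s0) ?(le_trans st) ?ltW.
have e2 : h2 e <= 0 by apply: c2; rewrite (le_trans (ltW a0)) ?(le_trans (ltW ec)) ?ltW.
have ca : h1 c <= h1 a by rewrite -subr_le0 E3 mulr_le0_ge0// subr_ge0 ltW.
rewrite leNgt; apply/negP => tn.
have a1 : h1 a < 0 by move: E tn; rewrite h0 !subr0 => ->; rewrite pmulr_llt0.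
have c1 : 0 < h1 c.
  by move: E2 tn; rewrite hb sub0r -oppr_gt0 => ->; rewrite pmulr_lgt0// subr_gt0.
by have := lt_trans a1 c1; rewrite ltNge ca.
Qed.

Lemma quad_derive h (l q r s : R) h1 : is_derive s 1 h (h1 s) ->
  is_derive s 1 (fun t => l * h t + (q * t + r * (t * t))) (l * h1 s + (q + 2 * r * s)).
Proof.
move=> dh; have dt : is_derive s 1 (fun t : R => t) 1 by exact: is_derive_id.
have := is_deriveD (is_deriveZ l dh) (is_deriveD (is_deriveZ q dt) (is_deriveZ r (is_deriveM dt dt))).
move=> H; apply: (is_derive_eq H); rewrite /GRing.scale/=; ring.
Qed.

Lemma lin_derive h (l q r s : R) h1 : is_derive s 1 h (h1 s) ->
  is_derive s 1 (fun t => l * h t + (q + 2 * r * t)) (l * h1 s + 2 * r).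
Proof.
move=> dh; have dt : is_derive s 1 (fun t : R => t) 1 by exact: is_derive_id.
have := is_deriveD (is_deriveZ l dh) (is_deriveD (is_derive_cst q s 1) (is_deriveZ (2 * r) dt)).
move=> H; apply: (is_derive_eq H); rewrite /GRing.scale/=; ring.
Qed.

(** The height of a grazing geodesic. Comparing h with the parabolas h1 0 t -
    A (1 +- e) t^2 shows that h returns to 0 at some tau, and comparing it
    with multiples of t (tau - t), which vanish at both ends, gives bounds
    with a ratio tending to 1 up to the end points, as is needed to integrate
    powers of h with a negative exponent. *)
Lemma parabola h h1 h2 (T A e : R) : 0 < T -> 0 < A -> 0 < e < 1 ->
  (forall t, 0 <= t <= T -> is_derive t 1 h (h1 t)) ->
  (forall t, 0 <= t <= T -> is_derive t 1 h1 (h2 t)) ->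
  (forall t, 0 <= t <= T -> - (2 * A * (1 + e)) <= h2 t <= - (2 * A * (1 - e))) ->
  h 0 = 0 -> 0 < h1 0 < A * (1 - e) * T ->
  exists tau : R, [/\ 0 < tau < T,
    forall t, 0 <= t <= tau -> A * (1 - e) * (t * (tau - t)) <= h t <= A * (1 + e) * (t * (tau - t)),
    forall t, tau < t < T -> h t < 0 &
    A * (1 - e) * tau <= h1 0 <= A * (1 + e) * tau].
Proof.
move=> T0 A0 /andP[e0 e1] d1 d2 c2 h0 /andP[v0 vT].
set v := h1 0 in v0 vT *.
pose a := A * (1 - e); pose b := A * (1 + e).
have a0 : 0 < a by rewrite mulr_gt0// subr_gt0.
have b0 : 0 < b by rewrite mulr_gt0// addr_gt0.
have ab : a <= b by rewrite ler_wpM2l ?ltW//; lra.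
have c2' t : 0 <= t <= T -> - (2 * b) <= h2 t <= - (2 * a).
  by move=> /c2; rewrite /a /b !mulrA.
have sub t (T' : R) : T' <= T -> 0 <= t <= T' -> 0 <= t <= T.
  by move=> T'T /andP[-> /le_trans->].
have lo t : 0 <= t <= T -> v * t - b * t ^+ 2 <= h t.
  move=> /andP[t0 tT]; rewrite -subr_ge0.
  have -> : h t - (v * t - b * t ^+ 2) = 1 * h t + (- v * t + b * (t * t)) by ring.
  apply: (@convex_ge0 _ _ (fun t => 1 * h2 t + 2 * b) _ t0
    (fun s st => quad_derive 1 (- v) b (d1 s (sub _ _ tT st)))
    (fun s st => lin_derive 1 (- v) b (d2 s (sub _ _ tT st)))).
  - by move=> s /(sub _ _ tT)/c2'/andP[]; lra.
  - by rewrite h0; ring.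
  - by rewrite /v; ring.
have up t : 0 <= t <= T -> h t <= v * t - a * t ^+ 2.
  move=> /andP[t0 tT]; rewrite -subr_ge0.
  have -> : v * t - a * t ^+ 2 - h t = -1 * h t + (v * t + - a * (t * t)) by ring.
  apply: (@convex_ge0 _ _ (fun t => -1 * h2 t + 2 * - a) _ t0
    (fun s st => quad_derive (-1) v (- a) (d1 s (sub _ _ tT st)))
    (fun s st => lin_derive (-1) v (- a) (d2 s (sub _ _ tT st)))).
  - by move=> s /(sub _ _ tT)/c2'/andP[]; lra.
  - by rewrite h0; ring.
  - by rewrite /v; ring.
pose t1 := v / (2 * b).
have t10 : 0 < t1 by rewrite divr_gt0// mulr_gt0.
have t1T : t1 < T.
  have b20 : 0 < 2 * b by rewrite mulr_gt0.
  rewrite ltr_pdivrMr//; move: (vT : v < a * T).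
  have : a * T <= b * T by rewrite ler_wpM2r// ltW.
  have : 0 < a * T by rewrite mulr_gt0.
  by move: (a * T) => y ? ? ?; rewrite mulrCA [T * b]mulrC; lra.
have ht1 : 0 < h t1.
  have t1T' : 0 <= t1 <= T by rewrite !ltW.
  have L1 := lo t1 t1T'; apply: lt_le_trans L1.
  have -> : v * t1 - b * t1 ^+ 2 = v * t1 / 2.
    rewrite /t1; field; exact: lt0r_neq0.
  by rewrite divr_gt0// mulr_gt0.
have hT : h T < 0.
  have TT : 0 <= T <= T by rewrite lexx ltW.
  have U1 := up T TT; apply: (le_lt_trans U1).
  by rewrite expr2 mulrA -mulrBl pmulr_llt0// subr_lt0.
have cont x y : 0 <= x -> y <= T -> {within `[x, y], continuous h}.
  move=> x0 yT; apply: cont_within => t; rewrite /= in_itv/= => /andP[xt ty].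
  have [dht _] := d1 t (ltac:(by rewrite (le_trans x0)// (le_trans ty))).
  by apply: differentiable_continuous; apply/derivable1_diffP.
have [tau] := @IVT R h t1 T 0 (ltW t1T) (cont _ _ (ltW t10) (lexx T))
  (ltac:(by rewrite ge_min le_max (ltW hT) (ltW ht1) orbT)).
rewrite in_itv/= => /andP[tau1 tauT] htau.
have tau0 : 0 < tau by exact: lt_le_trans tau1.
have tauT' : tau < T by rewrite lt_neqAle tauT andbT; apply/eqP => E; rewrite -E htau ltxx in hT.
exists tau; split.
- by rewrite tau0.
- have tT : tau <= T by exact: ltW.
  move=> t tt; rewrite -/a -/b; apply/andP; split; rewrite -subr_ge0.
    have -> : h t - a * (t * (tau - t)) = 1 * h t + (- (a * tau) * t + a * (t * t)) by ring.
    apply: (@concave_ge0 _ _ (fun t => 1 * h2 t + 2 * a) tau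
      (fun s st => quad_derive 1 (- (a * tau)) a (d1 s (sub _ _ tT st)))
      (fun s st => lin_derive 1 (- (a * tau)) a (d2 s (sub _ _ tT st)))) => //.
    + by move=> s /(sub _ _ tT)/c2'/andP[]; lra.
    + by rewrite h0; ring.
    + by rewrite htau; ring.
  have -> : b * (t * (tau - t)) - h t = -1 * h t + (b * tau * t + - b * (t * t)) by ring.
  apply: (@concave_ge0 _ _ (fun t => -1 * h2 t + 2 * - b) tau
      (fun s st => quad_derive (-1) (b * tau) (- b) (d1 s (sub _ _ tT st)))
      (fun s st => lin_derive (-1) (b * tau) (- b) (d2 s (sub _ _ tT st)))) => //.
  + by move=> s /(sub _ _ tT)/c2'/andP[]; lra.
  + by rewrite h0; ring.
  + by rewrite htau; ring.
- move=> t /andP[taut tT].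
  have [|x /andP[x0 xtau] E] := mvt1 tau0 (h := h) (h1 := h1).
    by move=> s /andP[s0 st]; apply: d1; rewrite s0 (le_trans st).
  have x1 : h1 x = 0.
    move: E; rewrite htau h0 subrr => /esym/eqP; rewrite mulf_eq0 subr0 (gt_eqF tau0) orbF.
    by move/eqP.
  have [|y /andP[tauy yt] E2] := mvt1 taut (h := h) (h1 := h1).
    by move=> s /andP[s0 st]; apply: d1; rewrite !(le_trans _ s0) ?(le_trans st) ?ltW.
  have xy : x < y by exact: lt_trans tauy.
  have [|u /andP[xu uy] E3] := mvt1 xy (h := h1) (h1 := h2).
    move=> s /andP[s0 st]; apply: d2.
    by rewrite (le_trans (ltW x0) s0) (le_trans st)// ltW// (lt_trans yt).
  have u2 : h2 u < 0.
    have /andP[_ le] := c2' u (ltac:(by rewrite !ltW ?(lt_trans x0 xu)// (lt_trans uy)// (lt_trans yt))).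
    by apply: le_lt_trans le _; rewrite oppr_lt0 mulr_gt0.
  have y1 : h1 y < 0.
    by move: E3; rewrite x1 subr0 => ->; rewrite pmulr_llt0// subr_gt0.
  by move: E2; rewrite htau subr0 => ->; rewrite pmulr_llt0// subr_gt0.
- have tT : 0 <= tau <= T by rewrite !ltW.
  rewrite -/a -/b; apply/andP; split; rewrite -(ler_pM2r tau0) -subr_ge0.
    by have := up tau tT; rewrite htau expr2 mulrA.
  by have := lo tau tT; rewrite htau expr2 mulrA -[in X in _ -> X]opprB oppr_ge0.
Qed.

End Parabola.

(** * Integrals over open intervals *)

Section OpenInterval.
Context {R : realType}.
Local Notation mu := (@lebesgue_measure R).
Local Notation oo tau := [set` `]0%R, tau[%R].
Implicit Types (f g F : R -> R) (tau : R).

Lemma FTC_closed f F (a b : R) : a < b ->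
  (forall t, a <= t <= b -> is_derive t 1 F (f t)) ->
  (forall t, a <= t <= b -> {for t, continuous f}) ->
  (\int[mu]_(t in `[a, b]) f t)%R = F b - F a.
Proof.
move=> ab dF cf; rewrite /Rintegral (@continuous_FTC2 R f F a b)//.
- by apply: cont_within => t; rewrite /= in_itv/=; exact: cf.
- have cF t : a <= t <= b -> {for t, continuous F}.
    by move=> /dF[dFt _]; apply: differentiable_continuous; apply/derivable1_diffP.
  split.
  + by move=> t; rewrite in_itv/= => /andP[t1 t2]; have [] := dF t (ltac:(by rewrite !ltW)).
  + by apply: cvg_at_right_filter; apply: cF; rewrite lexx ltW.
  + by apply: cvg_at_left_filter; apply: cF; rewrite lexx ltW.
- move=> t; rewrite in_itv/= => /andP[t1 t2]; rewrite derive1E.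
  by have [] := dF t (ltac:(by rewrite !ltW)).
Qed.

(** The closed intervals that exhaust ]0, tau[ : the integrands below may be
    singular at both end points. *)
Definition exh tau (k : nat) : set R := [set` `[tau / k.+3%:R, tau - tau / k.+3%:R]].

Lemma exh_sub tau k : 0 < tau -> exh tau k `<=` (oo tau).
Proof.
move=> tau0 t; rewrite /exh /= !in_itv/= => /andP[t1 t2].
have : 0 < tau / k.+3%:R by rewrite divr_gt0.
by move: t1 t2; move: (tau / k.+3%:R) => e *; apply/andP; split; lra.
Qed.

Lemma exh_lt tau k : 0 < tau -> tau / k.+3%:R < tau - tau / k.+3%:R.
Proof.
move=> tau0; have : tau / k.+3%:R <= tau / 3%:R.
  by rewrite ler_pM2l// lef_pV2 ?posrE ?ltr0n// ler_nat.
by move: (tau / k.+3%:R) => e; lra.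
Qed.

Lemma exh_nd tau : 0 < tau -> nondecreasing_seq (exh tau).
Proof.
move=> tau0 k l kl; rewrite subsetEset => t; rewrite /exh /= !in_itv/= => /andP[t1 t2].
have : tau / l.+3%:R <= tau / k.+3%:R.
  by rewrite ler_pM2l// lef_pV2 ?posrE ?ltr0n// ler_nat.
by move: t1 t2; move: (tau / k.+3%:R) (tau / l.+3%:R) => e e' *; apply/andP; split; lra.
Qed.

Lemma exh_bigcup tau : 0 < tau -> \bigcup_k exh tau k = (oo tau).
Proof.
move=> tau0; apply/seteqP; split=> [t [k _]|t]; first exact: exh_sub.
rewrite /= in_itv/= => /andP[t0 tt].
pose m := Num.min t (tau - t).
have m0 : 0 < m by rewrite lt_min t0 subr_gt0.
have [m1 m2] : m <= t /\ m <= tau - t by rewrite /m !ge_min !lexx orbT.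
pose k := Num.truncn (tau / m); exists k => //.
have H : tau / k.+3%:R <= m.
  rewrite ler_pdivrMr ?ltr0n// mulrC -ler_pdivrMr//.
  apply: (@le_trans _ _ k.+1%:R); first by apply: ltW; rewrite /k truncnS_gt.
  by rewrite ler_nat; exact: (leq_trans (leqnSn _) (leqnSn _)).
by rewrite /exh /= in_itv/=; move: H; move: (tau / k.+3%:R) => e H; apply/andP; split; lra.
Qed.

Section Continuous.
Variables (tau : R) (tau0 : 0 < tau).

Lemma oo_measurable_fun f : (forall t, 0 < t < tau -> {for t, continuous f}) ->
  measurable_fun (oo tau) f.
Proof.
move=> cf; apply: open_continuous_measurable_fun; first exact: interval_open.
by move=> t; rewrite inE/= in_itv/=; exact: cf.
Qed.

Lemma exh_cont f k : (forall t, 0 < t < tau -> {for t, continuous f}) ->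
  {within exh tau k, continuous f}.
Proof.
move=> cf; apply: cont_within => t /(exh_sub tau0); rewrite /= in_itv/=; exact: cf.
Qed.

Lemma exh_integrable f k : (forall t, 0 < t < tau -> {for t, continuous f}) ->
  mu.-integrable (exh tau k) (EFin \o f).
Proof. by move=> cf; apply: cont_integrable; exact: exh_cont. Qed.

Lemma exh_cvg_ge0 f : (forall t, 0 < t < tau -> {for t, continuous f}) ->
  (forall t, 0 < t < tau -> 0 <= f t) ->
  (\int[mu]_(t in exh tau k) (f t)%:E @[k --> \oo] --> \int[mu]_(t in oo tau) (f t)%:E)%E.
Proof.
move=> cf f0; rewrite -(exh_bigcup tau0).
apply: ge0_nondecreasing_set_cvg_integral.
- exact: exh_nd.
- by move=> k; exact: measurable_itv.
- move=> k; apply/measurable_EFinP.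
  by apply: measurable_funS (oo_measurable_fun cf) => //; exact: exh_sub.
- by move=> k t /(exh_sub tau0); rewrite /= in_itv/= lee_fin; exact: f0.
Qed.

Lemma integral_EFin_Rint f (D : set (measurableTypeR R)) : mu.-integrable D (EFin \o f) ->
  measurable D ->
  (\int[mu]_(t in D) (f t)%:E = (\int[mu]_(t in D) f t)%R%:E)%E.
Proof.
move=> itf mD; rewrite /Rintegral fineK//.
exact: (integrable_fin_num mD itf).
Qed.

(** Monotone convergence along the exhaustion. *)
Lemma exh_integrableP f (C : R) : (forall t, 0 < t < tau -> {for t, continuous f}) ->
  (forall k, (\int[mu]_(t in exh tau k) `|f t|)%R <= C) ->
  mu.-integrable (oo tau) (EFin \o f).
Proof.
move=> cf HC; apply/integrableP; split.
  by apply/measurable_EFinP; exact: oo_measurable_fun.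
have cn t : 0 < t < tau -> {for t, continuous (fun t => `|f t|)}.
  by move=> /cf c; apply: (continuous_comp c); exact: norm_continuous.
have H := exh_cvg_ge0 cn (fun t _ => normr_ge0 (f t)).
apply: (@le_lt_trans _ _ C%:E); last by rewrite ltry.
have -> : (\int[mu]_(t in oo tau) `|(EFin \o f) t|)%E = (\int[mu]_(t in oo tau) `|f t|%:E)%E by [].
rewrite -(cvg_lim _ H)//; apply: lime_le; first by apply/cvg_ex; eexists; exact: H.
apply: nearW => k; rewrite integral_EFin_Rint ?lee_fin//; last exact: measurable_itv.
exact: exh_integrable.
Qed.

Lemma exh_cvg_ge0R f : (forall t, 0 < t < tau -> {for t, continuous f}) ->
  (forall t, 0 < t < tau -> 0 <= f t) -> mu.-integrable (oo tau) (EFin \o f) ->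
  (\int[mu]_(t in exh tau k) f t)%R @[k --> \oo] --> (\int[mu]_(t in oo tau) f t)%R.
Proof.
move=> cf f0 itf; have H := exh_cvg_ge0 cf f0.
rewrite (integral_EFin_Rint itf) in H; last exact: measurable_itv.
by have /fine_cvgP[_] := H; exact.
Qed.

Lemma exh_le f k : (forall t, 0 < t < tau -> {for t, continuous f}) ->
  (forall t, 0 < t < tau -> 0 <= f t) -> mu.-integrable (oo tau) (EFin \o f) ->
  (\int[mu]_(t in exh tau k) f t)%R <= (\int[mu]_(t in oo tau) f t)%R.
Proof.
move=> cf f0 itf; have itk := exh_integrable k cf.
have mk : measurable (exh tau k : set (measurableTypeR R)) by exact: measurable_itv.
have mI : measurable (oo tau : set (measurableTypeR R)) by exact: measurable_itv.
rewrite -lee_fin -integral_EFin_Rint// -integral_EFin_Rint//.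
apply: ge0_subset_integral => //.
- exact: (measurable_int mu itf).
- exact: exh_sub.
Qed.

(** f is the difference of the nonnegative functions f + |f| and |f|, to which
    monotone convergence applies. *)
Lemma exh_cvg f : (forall t, 0 < t < tau -> {for t, continuous f}) ->
  mu.-integrable (oo tau) (EFin \o f) ->
  (\int[mu]_(t in exh tau k) f t)%R @[k --> \oo] --> (\int[mu]_(t in oo tau) f t)%R.
Proof.
move=> cf itf.
have cn t : 0 < t < tau -> {for t, continuous (fun t => `|f t|)}.
  by move=> /cf c; apply: (continuous_comp c); exact: norm_continuous.
have cp t : 0 < t < tau -> {for t, continuous (fun t => f t + `|f t|)}.
  by move=> tt; apply: continuousD; [exact: cf|exact: cn].
have mI : measurable (oo tau : set (measurableTypeR R)) by exact: measurable_itv.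
have itn : mu.-integrable (oo tau) (EFin \o (fun t => `|f t|)).
  exact: (integrable_norm itf).
have itp : mu.-integrable (oo tau) (EFin \o (fun t => f t + `|f t|)).
  by have := @integrableD _ _ R mu (oo tau) mI _ _ itf itn; exact.
have E D : measurable D -> mu.-integrable D (EFin \o (fun t => f t + `|f t|)) ->
    mu.-integrable D (EFin \o (fun t => `|f t|)) ->
    (\int[mu]_(t in D) f t)%R = (\int[mu]_(t in D) (f t + `|f t|))%R - (\int[mu]_(t in D) `|f t|)%R.
  move=> mD i1 i2; rewrite -RintegralB//; congr fine; apply: eq_integral => t _.
  by rewrite addrK.
rewrite E//.
have -> : (fun k => (\int[mu]_(t in exh tau k) f t)%R) =
    (fun k => (\int[mu]_(t in exh tau k) (f t + `|f t|))%R - (\int[mu]_(t in exh tau k) `|f t|)%R).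
  by apply/funext => k; apply: E; [exact: measurable_itv|exact: exh_integrable|exact: exh_integrable].
apply: cvgB; apply: exh_cvg_ge0R => //.
by move=> t _; have := ler_norm (- f t); rewrite normrN; lra.
Qed.

End Continuous.

(** Substitution on the closed intervals of the exhaustion, then passage to
    the limit. *)
Lemma Rintegral_scale tau (h : R -> R) : 0 < tau -> (forall t, 0 < t < 1 -> {for t, continuous h}) ->
  mu.-integrable (oo 1) (EFin \o h) ->
  mu.-integrable (oo tau) (EFin \o (fun t => h (t / tau))) /\
  (\int[mu]_(t in oo tau) h (t / tau))%R = tau * (\int[mu]_(s in oo 1) h s)%R.
Proof.
move=> tau0 ch ith.
have sc t : 0 < t < tau -> 0 < t / tau < 1.
  by move=> /andP[t0 tt]; rewrite divr_gt0//= ltr_pdivrMr// mul1r.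
have ch' (q : R -> R) : (forall t, 0 < t < 1 -> {for t, continuous q}) ->
    forall t, 0 < t < tau -> {for t, continuous (fun t : R => q (t / tau))}.
  move=> cq t /sc /cq c; apply: (@continuous_comp _ _ _ (fun t : R => t / tau) q) => //.
  by apply: continuousM; [exact: cvg_id|exact: cvg_cst].
have subst (q : R -> R) k : (forall t, 0 < t < 1 -> {for t, continuous q}) ->
    (\int[mu]_(t in exh tau k) q (t / tau))%R = tau * (\int[mu]_(s in exh 1 k) q s)%R.
  move=> cq.
  have l1 := exh_lt k tau0; have cq1 := @exh_cont 1 ltr01 q k cq; rewrite /exh in cq1 *.
  set a := tau / k.+3%:R in l1 *; set b := tau - a in l1 *.
  pose F (t : R) := t / tau.
  have Fa : 1 / k.+3%:R = F a by rewrite /F /a mulrAC divff ?gt_eqF// mul1r.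
  have Fb : 1 - 1 / k.+3%:R = F b by rewrite Fa /F /b mulrBl divff// gt_eqF.
  have dF (t : R) : is_derive t 1 F tau^-1.
    rewrite /F; have dt : is_derive t 1 (fun t : R => t) 1 by exact: is_derive_id.
    have H := is_deriveZ tau^-1 dt.
    rewrite (_ : (fun t : R => t / tau) = tau^-1 \*: (fun t : R => t)); last first.
      by apply/funext => u /=; rewrite mulrC.
    by apply: (is_derive_eq H); rewrite /GRing.scale/= mulr1.
  have F' : derive1 F = cst tau^-1 by apply/funext => t; rewrite derive1E; have [] := dF t.
  have cF (t : R) : {for t, continuous F}.
    by have [dFt _] := dF t; apply: differentiable_continuous; apply/derivable1_diffP.
  have := @integration_by_substitution_increasing R F q a b (ltW l1).
  rewrite F' => H; rewrite Fb Fa in cq1 *.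
  have {}H : (\int[mu]_(x in [set` `[F a, F b]%R]) (q x)%:E = \int[mu]_(x in [set` `[a, b]%R]) (q (x / tau) * tau^-1)%:E)%E.
    apply: H => //.
    - by move=> x y _ _ xy; rewrite /F ltr_pM2r ?invr_gt0.
    - by move=> x _; exact: cvg_cst.
    - exact: is_cvg_cst.
    - exact: is_cvg_cst.
    - split; first by move=> x _; have [] := dF x.
      by apply: cvg_at_right_filter; exact: cF.
      by apply: cvg_at_left_filter; exact: cF.
  have mi := @exh_integrable tau tau0 (fun t => q (t / tau)) k (ch' q cq); rewrite /exh -/a -/b in mi.
  have H2 : (\int[mu]_(x in [set` `[F a, F b]%R]) q x)%R = (\int[mu]_(x in [set` `[a, b]%R]) (q (x / tau) * tau^-1))%R.
    by rewrite /Rintegral H.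
  rewrite H2 RintegralZr//.
  by rewrite mulrCA divff ?mulr1// gt_eqF.
have nh (t : R) : 0 < t < 1 -> {for t, continuous (fun t => `|h t|)}.
  by move=> /ch c; apply: (continuous_comp c); exact: norm_continuous.
have ithn : mu.-integrable (oo 1) (EFin \o (fun t => `|h t|)) by exact: (integrable_norm ith).
have itq : mu.-integrable (oo tau) (EFin \o (fun t => h (t / tau))).
  apply: (@exh_integrableP tau tau0 _ (tau * (\int[mu]_(t in oo 1) `|h t|)%R) (ch' h ch)) => k.
  rewrite (subst (fun s => `|h s|) k nh) ler_pM2l//.
  exact: (@exh_le 1 ltr01 (fun t => `|h t|) k nh (fun t _ => normr_ge0 (h t)) ithn).
split=> //.
have E1 := exh_cvg ltr01 ch ith; have E2 := exh_cvg tau0 (ch' h ch) itq.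
have E3 : (\int[mu]_(t in exh tau k) h (t / tau))%R @[k --> \oo] --> tau * (\int[mu]_(s in oo 1) h s)%R.
  have -> : (fun k => (\int[mu]_(t in exh tau k) h (t / tau))%R) = (fun k => tau * (\int[mu]_(s in exh 1 k) h s)%R).
    by apply/funext => k; exact: subst.
  by apply: cvgMr.
exact: (cvg_unique _ E2 E3).
Qed.

End OpenInterval.

(** * The beta integral of complex powers of s (1 - s) *)

Section Beta.
Context {R : realType}.
Local Notation mu := (@lebesgue_measure R).
Local Notation oo tau := [set` `]0%R, tau[%R].

Implicit Types (a b th s : R).

Lemma Rint_comb (D : set (measurableTypeR R)) (c d : R) (f h : R -> R) : measurable D ->
  mu.-integrable D (EFin \o f) -> mu.-integrable D (EFin \o h) ->
  mu.-integrable D (EFin \o (fun s => c * f s + d * h s)) /\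
  (\int[mu]_(s in D) (c * f s + d * h s))%R = c * (\int[mu]_(s in D) f s)%R + d * (\int[mu]_(s in D) h s)%R.
Proof.
move=> mD itf ith.
have i1 : mu.-integrable D (EFin \o (fun s => c * f s)) by exact: (integrableZl mD c itf).
have i2 : mu.-integrable D (EFin \o (fun s => d * h s)) by exact: (integrableZl mD d ith).
split; first exact: (@integrableD _ _ R mu D mD _ _ i1 i2).
by rewrite (RintegralD mD i1 i2) (RintegralZl c mD itf) (RintegralZl d mD ith).
Qed.

Definition parab (s : R) : R := s * (1 - s).

Lemma parab_gt0 s : 0 < s < 1 -> 0 < parab s.
Proof. by move=> /andP[s0 s1]; rewrite mulr_gt0// subr_gt0. Qed.

Lemma parab_le s : parab s <= 4^-1.
Proof. by have := sqr_ge0 (s - 2^-1); rewrite /parab expr2; lra. Qed.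

(** The real part of e^{i th} (s (1 - s))^{a + i b}. Allowing a phase th keeps
    all computations real: multiplication by i is th |-> th + pi / 2. *)
Definition ebeta (a b th s : R) : R := expR (a * ln (parab s)) * cos (b * ln (parab s) + th).

Lemma is_derive_ebeta a b th s : 0 < s < 1 -> is_derive s 1 (ebeta a b th)
  ((1 - 2 * s) / parab s * (a * ebeta a b th s + b * ebeta a b (th + pi / 2) s)).
Proof.
move=> s01; have P0 := parab_gt0 s01.
have dt : is_derive s 1 (fun t : R => t) 1 by exact: is_derive_id.
have dP : is_derive s 1 parab (1 - 2 * s).
  have := quad_derive 0 1 (-1) (h := fun t => t) (h1 := fun=> 1) (s := s) dt.
  rewrite (_ : (fun t : R => 0 * t + (1 * t + -1 * (t * t))) = parab).
    by move=> H; apply: (is_derive_eq H); ring.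
  by apply/funext => t; rewrite /parab; ring.
have dl : is_derive s 1 (fun t => ln (parab t)) ((1 - 2 * s) / parab s).
  have H := @is_derive1_comp R (@ln R) parab s _ _ (is_derive1_ln P0) dP.
  by apply: (is_derive_eq H); rewrite mulrC.
set l := (1 - 2 * s) / parab s in dl *.
have de : is_derive s 1 (fun t => expR (a * ln (parab t))) (a * l * expR (a * ln (parab s))).
  have H := @is_derive1_comp R (@expR R) (fun t => a * ln (parab t)) s _ _ (is_derive_expR _) (is_deriveZ a dl).
  by apply: (is_derive_eq H); rewrite /GRing.scale/= mulrC.
have dc : is_derive s 1 (fun t => cos (b * ln (parab t) + th)) (- (b * l) * sin (b * ln (parab s) + th)).
  have H := @is_derive1_comp R (@cos R) (fun t => b * ln (parab t) + th) s _ _ (is_derive_cos _)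
    (is_deriveD (is_deriveZ b dl) (is_derive_cst th s 1)).
  apply: (is_derive_eq H); rewrite /GRing.scale/=; ring.
have H := is_deriveM de dc.
apply: (is_derive_eq H); rewrite /GRing.scale/= /ebeta addrA [cos (_ + _ + pi / 2)]cosDpihalf; ring.
Qed.

Lemma ebeta_cont a b th s : 0 < s < 1 -> {for s, continuous (ebeta a b th)}.
Proof.
move=> s01; have [d _] := is_derive_ebeta a b th s01.
by apply: differentiable_continuous; apply/derivable1_diffP.
Qed.

Lemma ebetaS a b th s : 0 < s < 1 -> ebeta (a + 1) b th s = parab s * ebeta a b th s.
Proof.
move=> s01; rewrite /ebeta mulrDl mul1r expRD lnK ?posrE ?parab_gt0//; ring.
Qed.

Lemma ebeta_le a b th s : `|ebeta a b th s| <= expR (a * ln (parab s)).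
Proof.
by rewrite /ebeta normrM ger0_norm ?expR_ge0// ler_piMr ?expR_ge0// cos_max.
Qed.

Lemma expR_ln_le (a c x : R) : 0 <= a -> 0 < x -> x <= c -> expR (a * ln x) <= expR (a * ln c).
Proof.
by move=> a0 x0 xc; rewrite ler_expR ler_wpM2l// ler_ln// posrE// (lt_le_trans x0).
Qed.

Lemma ebeta_le1 a s : 0 <= a -> 0 < s < 1 -> expR (a * ln (parab s)) <= 1.
Proof.
move=> a0 s01; rewrite -(expR0) ler_expR mulr_ge0_le0// ln_le0//.
by have := parab_le s; lra.
Qed.

(** The function (1 - 2 s) (s (1 - s))^{z + 1}, whose derivative is (z + 1) (s
    (1 - s))^z - (4 z + 6) (s (1 - s))^{z + 1}, because (1 - 2 s)^2 = 1 - 4 s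
    (1 - s). *)
Definition ebdry (a b th s : R) : R := (1 - 2 * s) * ebeta (a + 1) b th s.

(** The real part of e^{i th} ((z + 1) P^z - (4 z + 6) P^{z + 1}) for P = s (1
    - s) and z = a + i b. *)
Definition erec (a b th s : R) : R :=
  ((a + 1) * ebeta a b th s + b * ebeta a b (th + pi / 2) s) -
  ((4 * a + 6) * ebeta (a + 1) b th s + 4 * b * ebeta (a + 1) b (th + pi / 2) s).

Lemma is_derive_ebdry a b th s : 0 < s < 1 -> is_derive s 1 (ebdry a b th) (erec a b th s).
Proof.
move=> s01; have dt : is_derive s 1 (fun t : R => t) 1 by exact: is_derive_id.
have dl : is_derive s 1 (fun t : R => 1 - 2 * t) (- 2).
  have := lin_derive 0 1 (-1) (h := fun t => t) (h1 := fun=> 1) (s := s) dt.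
  rewrite (_ : (fun t : R => 0 * t + (1 + 2 * -1 * t)) = (fun t : R => 1 - 2 * t)).
    by move=> H; apply: (is_derive_eq H); ring.
  by apply/funext => t; ring.
have H := is_deriveM dl (is_derive_ebeta (a + 1) b th s01).
apply: (is_derive_eq H); rewrite /GRing.scale/= /erec !ebetaS// /parab.
have /andP[s0 s1] := s01; field.
by rewrite !gt_eqF// subr_gt0.
Qed.

Lemma erec_cont a b th s : 0 < s < 1 -> {for s, continuous (erec a b th)}.
Proof.
move=> s01; rewrite /erec; apply: continuousB; apply: continuousD;
  by apply: continuousM; [exact: cvg_cst|exact: ebeta_cont].
Qed.

Lemma exh01 k (s : R) : exh 1 k s -> 0 < s < 1.
Proof. by move=> /(exh_sub (ltr01 : 0 < (1 : R))); rewrite /= in_itv. Qed.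

Lemma exh_erec a b th k : (\int[mu]_(s in exh 1 k) erec a b th s)%R =
  - 2 * ebdry a b th (1 / k.+3%:R).
Proof.
have l1 := exh_lt k (ltr01 : 0 < (1 : R)).
have in01 (t : R) : 1 / k.+3%:R <= t <= 1 - 1 / k.+3%:R -> 0 < t < 1.
  by move=> tt; apply: (@exh01 k); rewrite /exh /= in_itv.
have D t tt := is_derive_ebdry a b th (in01 t tt).
have Ct t tt := @erec_cont a b th t (in01 t tt).
rewrite /exh (FTC_closed l1 D Ct) /ebdry; set e := 1 / k.+3%:R.
have -> : ebeta (a + 1) b th (1 - e) = ebeta (a + 1) b th e.
  by rewrite /ebeta /parab subKr [(1 - e) * e]mulrC.
ring.
Qed.

Lemma ebdry_le a b th k : -1 < a ->
  `|ebdry a b th (1 / k.+3%:R)| <= expR ((a + 1) * ln (1 / k.+3%:R)).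
Proof.
move=> a1; set e := 1 / k.+3%:R.
have e0 : 0 < e by rewrite divr_gt0.
have e3 : e <= 3^-1 by rewrite /e div1r lef_pV2 ?posrE ?ltr0n// ler_nat.
rewrite /ebdry normrM; apply: (@le_trans _ _ `|ebeta (a + 1) b th e|).
  by rewrite ler_piMl// ler_norml; apply/andP; split; lra.
apply: (le_trans (ebeta_le _ _ _ _)); apply: expR_ln_le; first by lra.
  by apply: parab_gt0; apply/andP; split; lra.
by rewrite /parab ler_piMr// ?ltW//; lra.
Qed.

Lemma ebdry_cvg0 a b th : -1 < a ->
  (fun k => - 2 * ebdry a b th (1 / k.+3%:R)) @ \oo --> (0 : R).
Proof.
move=> a1; rewrite -(mulr0 (-2)); apply: cvgMr.
apply/cvgrPdist_le => e e0.
have c0 : 0 < a + 1 by lra.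
pose x := expR (ln e / (a + 1)).
near=> k; rewrite sub0r normrN (le_trans (ebdry_le _ _ _ a1))//.
have H : 1 / k.+3%:R <= x.
  rewrite ler_pdivrMr ?ltr0n// mulrC -ler_pdivrMr ?expR_gt0//.
  apply: (@le_trans _ _ k%:R); last by rewrite ler_nat; exact: leq_addl 3 k.
  by near: k; exact: nbhs_infty_ger.
have := @expR_ln_le (a + 1) x (1 / k.+3%:R) (ltW c0) _ H.
have -> : (a + 1) * ln x = ln e by rewrite /x expRK mulrC divfK// gt_eqF.
by rewrite lnK ?posrE//; apply; rewrite divr_gt0.
Unshelve. all: by end_near. Qed.

(** The recurrence bounds the integrals of P^a over the exhaustion by those of
    P^{a + 1}, which is bounded as a + 1 > 0. *)
Lemma ebeta_integrable a b th : -1 < a -> mu.-integrable (oo 1) (EFin \o ebeta a b th).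
Proof.
move=> a1; have c0 : 0 < a + 1 by lra.
apply: (@exh_integrableP R 1 ltr01 _ ((4 * a + 8) / (a + 1))).
  by move=> s; exact: ebeta_cont.
move=> k.
have ie a' b' th' : mu.-integrable (exh 1 k) (EFin \o ebeta a' b' th').
  by apply: (exh_integrable ltr01) => s; exact: ebeta_cont.
have mk : measurable (exh 1 k : set (measurableTypeR R)) by exact: measurable_itv.
have E0 a' s : ebeta a' 0 0 s = expR (a' * ln (parab s)).
  by rewrite /ebeta mul0r addr0 cos0 mulr1.
have H1 : (\int[mu]_(s in exh 1 k) `|ebeta a b th s|)%R <= (\int[mu]_(s in exh 1 k) ebeta a 0 0 s)%R.
  apply: le_Rintegral => //; first exact: (integrable_norm (ie a b th)).
  by move=> s _; rewrite E0; exact: ebeta_le.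
apply: (le_trans H1); rewrite ler_pdivlMr//.
have H2 := exh_erec a 0 0 k.
have E2 : (\int[mu]_(s in exh 1 k) erec a 0 0 s)%R =
    (a + 1) * (\int[mu]_(s in exh 1 k) ebeta a 0 0 s)%R - (4 * a + 6) * (\int[mu]_(s in exh 1 k) ebeta (a + 1) 0 0 s)%R.
  rewrite -!RintegralZl// -RintegralB//; [|exact: (integrableZl _ _ (ie _ _ _))|exact: (integrableZl _ _ (ie _ _ _))].
  by apply: eq_Rintegral => s _; rewrite /erec mulr0 !mul0r !addr0.
have H3 : (\int[mu]_(s in exh 1 k) ebeta (a + 1) 0 0 s)%R <= 1.
  have i1 : mu.-integrable (exh 1 k) (EFin \o (fun=> 1 : R)).
    by apply: (exh_integrable ltr01) => s _; exact: cvg_cst.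
  apply: (@le_trans _ _ (\int[mu]_(s in exh 1 k) 1)%R).
    apply: le_Rintegral => // s /exh01 s01; rewrite E0; apply: ebeta_le1 => //; exact: ltW.
  rewrite /exh Rintegral_cst_itv; last exact: ltW (exh_lt k ltr01).
  have : 0 < 1 / k.+3%:R :> R by rewrite divr_gt0.
  by move: (1 / k.+3%:R : R) => e e0; clear - e0; lra.
have H4 := @ebdry_le a 0 0 k a1.
have H5 : expR ((a + 1) * ln (1 / k.+3%:R)) <= 1 :> R.
  rewrite -[leRHS]expR0 ler_expR; apply: mulr_ge0_le0; [exact: ltW|apply: ln_le0].
  by rewrite div1r invf_le1 ?ltr0n// ler1n.
have H6 : `|ebdry a 0 0 (1 / k.+3%:R)| <= 1 := le_trans H4 H5.
move: H6; rewrite ler_norml => /andP[H6 H7].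
rewrite H2 in E2; move: E2 H3 H6 H7.
move: (ebdry _ _ _ _) => f; move: (\int[mu]_(s in exh 1 k) ebeta a 0 0 s)%R => I1.
move: (\int[mu]_(s in exh 1 k) ebeta (a + 1) 0 0 s)%R => I2 E2 H3 H6 H7.
have : (4 * a + 6) * I2 <= 4 * a + 6 by rewrite ler_piMr//; lra.
by rewrite mulrC; lra.
Qed.

(** The real part of e^{i th} J(a + i b), where J(z) is the integral of (s (1
    - s))^z over the unit interval. *)
Definition beta (a b th : R) : R := (\int[mu]_(s in oo 1) ebeta a b th s)%R.

Lemma measurable_oo01 : measurable (oo 1 : set (measurableTypeR R)).
Proof. exact: measurable_itv. Qed.

(** The recurrence (z + 1) J(z) = (4 z + 6) J(z + 1): the boundary term ebdry
    vanishes at 0 and 1 because z + 1 has positive real part. *)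
Lemma beta_rec a b th : -1 < a ->
  (a + 1) * beta a b th + b * beta a b (th + pi / 2) =
  (4 * a + 6) * beta (a + 1) b th + 4 * b * beta (a + 1) b (th + pi / 2).
Proof.
move=> a1; have a1' : -1 < a + 1 by lra.
have ie th' := @ebeta_integrable a b th' a1; have ie' th' := @ebeta_integrable (a + 1) b th' a1'.
have [i1 E1] := Rint_comb (a + 1) b measurable_oo01 (ie th) (ie (th + pi / 2)).
have [i2 E2] := Rint_comb (4 * a + 6) (4 * b) measurable_oo01 (ie' th) (ie' (th + pi / 2)).
have i3 : mu.-integrable (oo 1) (EFin \o erec a b th).
  exact: (@integrableB _ _ R mu (oo 1) measurable_oo01 _ _ i1 i2).
have E : (\int[mu]_(s in oo 1) erec a b th s)%R = 0.
  have C1 := exh_cvg ltr01 (@erec_cont a b th) i3.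
  have C2 : (\int[mu]_(s in exh 1 k) erec a b th s)%R @[k --> \oo] --> (0 : R).
    under eq_fun do rewrite exh_erec.
    exact: ebdry_cvg0.
  exact: (cvg_unique _ C1 C2).
have := RintegralB measurable_oo01 i1 i2; rewrite E1 E2 => E3.
by apply/eqP; rewrite -subr_eq0; apply/eqP; exact: etrans (esym E3) E.
Qed.

Lemma beta_phase a b th : -1 < a ->
  beta a b th = cos th * beta a b 0 + sin th * beta a b (pi / 2).
Proof.
move=> a1; have ie th' := @ebeta_integrable a b th' a1.
have [_ <-] := Rint_comb (cos th) (sin th) measurable_oo01 (ie 0) (ie (pi / 2)).
apply: eq_Rintegral => s _; rewrite /ebeta addr0 cosDpihalf cosD; ring.
Qed.

Lemma beta_pi a b th : -1 < a -> beta a b (th + pi / 2 + pi / 2) = - beta a b th.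
Proof.
move=> a1; rewrite (beta_phase b (th + pi / 2 + pi / 2) a1) (beta_phase b th a1).
by rewrite cosDpihalf sinDpihalf sinDpihalf cosDpihalf; ring.
Qed.

(** A zero of J at z is a zero at z + 1, as 4 z + 6 <> 0. *)
Lemma beta_vanish_step a b : -1 < a -> (forall th, beta a b th = 0) ->
  forall th, beta (a + 1) b th = 0.
Proof.
move=> a1 H th; have a1' : -1 < a + 1 by lra.
have := beta_rec b th a1; have := beta_rec b (th + pi / 2) a1.
rewrite !H !mulr0 addr0 beta_pi//.
move: (beta (a + 1) b th) (beta (a + 1) b (th + pi / 2)) => x y E1 E2.
have A0 : 0 < 4 * a + 6 by lra.
have E3 : ((4 * a + 6) ^+ 2 + (4 * b) ^+ 2) * x = 0.
  transitivity ((4 * a + 6) * ((4 * a + 6) * x + 4 * b * y)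
     - 4 * b * ((4 * a + 6) * y + 4 * b * - x)); first by ring.
  by rewrite -E1 -E2 !mulr0 subrr.
move: E3 => /eqP; rewrite mulf_eq0 => /orP[|/eqP//].
by rewrite gt_eqF// ltr_pwDl ?sqr_ge0// exprn_gt0.
Qed.

Lemma Rint_subset (A B : set (measurableTypeR R)) (f : R -> R) : measurable A -> measurable B ->
  A `<=` B -> mu.-integrable B (EFin \o f) -> (forall s, B s -> 0 <= f s) ->
  (\int[mu]_(s in A) f s)%R <= (\int[mu]_(s in B) f s)%R.
Proof.
move=> mA mB AB itf f0; have itA : mu.-integrable A (EFin \o f) by exact: integrableS itf.
rewrite -lee_fin -integral_EFin_Rint// -integral_EFin_Rint//.
by apply: ge0_subset_integral => //; exact: (measurable_int mu itf).
Qed.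

(** For the phase b ln 4 the integrand is P^c cos (b ln (4 P)), and the cosine
    is close to 1 where 4 P is close to 1, that is near s = 1 / 2. There the
    integral of P^c is bounded below, and elsewhere P^c is exponentially
    smaller in c: for large c the integral cannot vanish. *)
Lemma beta_concentration b : exists eta m : R, [/\ 0 < eta, 0 < m &
  forall c : R, 0 <= c -> m - expR (- (c * eta)) <= 0 \/ beta c b (b * ln 4) != 0].
Proof.
have cc : {for (0 : R), continuous (fun x : R => cos (b * x))}.
  apply: (@continuous_comp _ _ _ (fun x : R => b * x) (@cos R)); last exact: continuous_cos.
  by apply: continuousM; [exact: cvg_cst|exact: cvg_id].
have [d d0 Hd] := (cont_normP _ _).1 cc 2^-1 (ltac:(by rewrite invr_gt0)).
(* 4 P >= exp(- 2 eta) = ka^2 puts ln (4 P) within d of 0, where the cosine is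
   at least 1 / 2 *)
pose eta := d / 4; have eta0 : 0 < eta by rewrite divr_gt0.
pose ka := expR (- eta).
have ka0 : 0 < ka by exact: expR_gt0.
have ka1 : ka < 1 by rewrite -expR0 ltr_expR oppr_lt0.
pose m := (1 - ka) / 4; have m0 : 0 < m by rewrite divr_gt0// subr_gt0.
exists eta, m; split=> // c c0.
have [|B0] := eqVneq (beta c b (b * ln 4)) 0; last by right.
move=> B0; left; rewrite subr_le0.
have l4 : 0 < 4 :> R by [].
have fE s : 0 < s < 1 -> ebeta c b (b * ln 4) s = expR (c * ln (parab s)) * cos (b * ln (4 * parab s)).
  by move=> s01; rewrite /ebeta -mulrDr lnM ?posrE ?parab_gt0// [ln 4 + _]addrC.
have k20 : 0 < ka ^+ 2 / 4 by rewrite divr_gt0// exprn_gt0.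
pose D := expR (c * ln (ka ^+ 2 / 4)).
have near s : 0 < s < 1 -> ka ^+ 2 <= 4 * parab s ->
    expR (c * ln (parab s)) / 2 <= ebeta c b (b * ln 4) s.
  move=> s01 Ps; rewrite fE// ler_pM2l ?expR_gt0//.
  have P4 : 0 < 4 * parab s by rewrite mulr_gt0// parab_gt0.
  have l0 : ln (4 * parab s) <= 0 by apply: ln_le0; have := parab_le s; lra.
  have l1 : - (2 * eta) <= ln (4 * parab s).
    have : ln (ka ^+ 2) <= ln (4 * parab s) by rewrite ler_ln ?posrE// exprn_gt0.
    by rewrite lnXn// expRK; lra.
  have : `|0 - ln (4 * parab s)| < d.
    by rewrite sub0r normrN ler0_norm//; move: l1; rewrite /eta; lra.
  by move=> /Hd; rewrite mulr0 cos0 ltr_norml => /andP[? ?]; lra.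
have far s : 0 < s < 1 -> 0 <= ebeta c b (b * ln 4) s + D.
  move=> s01; have [Ps|Ps] := leP (ka ^+ 2) (4 * parab s).
    by rewrite addr_ge0 ?expR_ge0// (le_trans _ (near s s01 Ps))// divr_ge0// expR_ge0.
  have H1 := ebeta_le c b (b * ln 4) s.
  have H2 : expR (c * ln (parab s)) <= D.
    by apply: expR_ln_le => //; [exact: parab_gt0|rewrite ler_pdivlMr// mulrC ltW].
  by have := le_trans H1 H2; rewrite ler_norml => /andP[? _]; lra.
have a1 : -1 < c by lra.
have itf := ebeta_integrable b (b * ln 4) a1.
have itD : mu.-integrable (oo 1) (EFin \o (fun=> D : R)).
  have itc : mu.-integrable [set` `[0, 1]%R] (EFin \o (fun=> D : R)).
    by apply: cont_integrable; apply: cont_within => x _; exact: cvg_cst.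
  apply: integrableS itc => //; exact: subset_itv_oo_cc.
have [it1 E1] := Rint_comb 1 1 measurable_oo01 itf itD.
have D1 : (\int[mu]_(s in oo 1) D)%R = D.
  rewrite Rintegral_itv_obnd_cbnd//.
  rewrite Rintegral_itv_bndo_bndc; first by rewrite Rintegral_cst_itv ?ler01// subr0 mulr1.
  have itc : mu.-integrable [set` `[0, 1]%R] (EFin \o (fun=> D : R)).
    by apply: cont_integrable; apply: cont_within => x _; exact: cvg_cst.
  apply: integrableS itc => //; apply: subset_itvl; by rewrite bnd_simp.
have {}E1 := etrans E1 (congr2 +%R (etrans (congr1 (fun x => 1 * x) B0) (mulr0 1)) (congr1 (fun x => 1 * x) D1)).
rewrite add0r [RHS]mul1r in E1.
pose lo := 2^-1 - m; pose hi := 2^-1 + m.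
have m4 : m < 4^-1 by rewrite /m; move: ka0; lra.
have lohi : lo < hi by rewrite /lo /hi; lra.
have in01 s : lo <= s <= hi -> 0 < s < 1.
  by rewrite /lo /hi => /andP[? ?]; apply/andP; split; lra.
have itK : mu.-integrable [set` `[lo, hi]%R] (EFin \o (fun s => 1 * ebeta c b (b * ln 4) s + 1 * D)).
  apply: integrableS it1 => // s; rewrite /= !in_itv/=; exact: in01.
have S1 : (\int[mu]_(s in [set` `[lo, hi]%R]) (1 * ebeta c b (b * ln 4) s + 1 * D))%R <= D.
  rewrite -[leRHS]E1; apply: Rint_subset => //.
  by move=> s; rewrite /= in_itv/= !mul1r; exact: far.
pose q := expR (c * ln (ka / 4)) / 2.
have S2 : q * (hi - lo) <= (\int[mu]_(s in [set` `[lo, hi]%R]) (1 * ebeta c b (b * ln 4) s + 1 * D))%R.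
  rewrite -(Rintegral_cst_itv q (ltW lohi)); apply: le_Rintegral => //.
    by apply: cont_integrable; apply: cont_within => x _; exact: cvg_cst.
  move=> s; rewrite /= in_itv/= => sK; have s01 := in01 s sK.
  have P4 : ka <= 4 * parab s.
    have H : (s - 2^-1) ^+ 2 <= m ^+ 2.
      move: sK; rewrite /lo /hi => /andP[k1 k2].
      have h1 : 0 <= m - (s - 2^-1) by clear - k1 k2; lra.
      have h2 : 0 <= m + (s - 2^-1) by clear - k1 k2; lra.
      rewrite -subr_ge0; have -> : m ^+ 2 - (s - 2^-1) ^+ 2 = (m - (s - 2^-1)) * (m + (s - 2^-1)) by ring.
      exact: mulr_ge0.
    have H2 : m ^+ 2 <= m / 4 by rewrite expr2 ler_wpM2l// ltW.
    move: H H2; rewrite /parab expr2 => H H2.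
    have -> : 4 * (s * (1 - s)) = 1 - 4 * ((s - 2^-1) * (s - 2^-1)) by field.
    by move: H H2; move: ((s - 2^-1) * (s - 2^-1)) (m ^+ 2) => u u'; rewrite /m; lra.
  have P5 : ka ^+ 2 <= 4 * parab s by apply: le_trans P4; rewrite expr2 ler_piMl ?ltW.
  rewrite !mul1r (le_trans (le_trans _ (near s s01 P5)))// ?lerDl ?expR_ge0//.
  rewrite /q ler_pM2r// expR_ln_le//; first by rewrite divr_gt0.
  by rewrite ler_pdivrMr// mulrC.
have S3 := le_trans S2 S1.
have E3 : D = expR (c * ln (ka / 4)) * expR (- (c * eta)).
  rewrite /D -expRD; congr expR.
  have -> : ka ^+ 2 / 4 = (ka / 4) * ka by rewrite expr2; ring.
  by rewrite lnM ?posrE ?divr_gt0// [ln ka]expRK; ring.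
move: S3; rewrite E3 /q.
have -> : hi - lo = 2 * m by rewrite /hi /lo; ring.
have := expR_gt0 (c * ln (ka / 4)); move: (expR (c * ln (ka / 4))) => x x0.
have -> : x / 2 * (2 * m) = x * m by field.
by rewrite ler_pM2l.
Qed.

(** The two values are the real and the imaginary part of J(a + i b). If both
    vanish then so does J at a + N + i b for all N, which contradicts
    concentration. *)
Lemma beta_neq0 a b : -1 < a -> ~ (beta a b 0 = 0 /\ beta a b (- (pi / 2)) = 0).
Proof.
move=> a1 [B0 B1].
have H th : beta a b th = 0.
  have := @beta_pi a b (- (pi / 2)) a1; rewrite addNr add0r B1 oppr0 => B2.
  by rewrite (beta_phase b th a1) B0 B2 !mulr0 addr0.
have HN N th : beta (a + N%:R) b th = 0.
  elim: N th => [|N IH] th; first by rewrite addr0.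
  have -> : a + N.+1%:R = a + N%:R + 1 by rewrite -natr1 addrA.
  by apply: beta_vanish_step => //; have : 0 <= N%:R :> R by []; lra.
have [eta [m [eta0 m0 Hc]]] := beta_concentration b.
(* any N > x makes the alternative m <= exp(- (a + N) eta) impossible *)
pose x := (- ln m) / eta + 1 - a.
pose N := (Num.truncn (Num.max x (1 + `|a|))).+1.
have N1 : Num.max x (1 + `|a|) < N%:R by rewrite truncnS_gt.
have [N2 N3] : x < N%:R /\ 1 + `|a| < N%:R by move: N1; rewrite gt_max => /andP[].
have c0 : 0 <= a + N%:R by have := ler_norm (- a); rewrite normrN; lra.
case: (Hc _ c0) => [|]; last by rewrite HN eqxx.
rewrite subr_le0 => H1.
have : ln m <= - ((a + N%:R) * eta).
  by rewrite -[leRHS]expRK ler_ln ?posrE ?expR_gt0.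
have : (- ln m) / eta < a + N%:R by move: N2; rewrite /x; lra.
by rewrite ltr_pdivrMr//; lra.
Qed.

End Beta.

(** * Charts, tangent vectors and the boundary *)

Lemma common_radius (R : realType) (m : nat) (P : 'I_m -> R -> Prop) :
  (forall k d d', d' <= d -> P k d -> P k d') ->
  (forall k, exists2 d, 0 < d & P k d) -> exists2 d, 0 < d & forall k, P k d.
Proof.
move=> Pmon H.
have /choice[d Hd] : forall k, exists d, 0 < d /\ P k d by move=> k; have [d] := H k; exists d.
exists (\big[Order.min/1]_k d k).
  by apply: lt_bigmin => // k _; have [] := Hd k.
move=> k; have [_] := Hd k; apply: Pmon.
exact: bigmin_le_cond.
Qed.

(** Only the values on the line through p in the direction v matter. *)
Lemma derive_line_zero (R : realType) (N : nat) (h : 'rV[R]_N -> R) p v (d : R) : 0 < d ->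
  (forall t : R, `|t| < d -> h (p + t *: v) = 0) -> is_derive p v h 0.
Proof.
move=> d0 H.
have C : (fun t : R => t^-1 *: ((h \o shift p) (t *: v) - h p)) @ 0^' --> (0 : R).
  have E : {near 0^', cst 0 =1 (fun t : R => t^-1 *: ((h \o shift p) (t *: v) - h p))}.
    near=> t; rewrite /= [t *: v + p]addrC H; last by near: t; exact: dnbhs0_lt.
    by have := H 0; rewrite normr0 scale0r addr0 => -> //; rewrite subrr scaler0.
  by apply: cvg_trans (near_eq_cvg E) _; exact: cvg_cst.
split; first by apply/cvg_ex; exists 0; exact: C.
exact: cvg_lim C.
Unshelve. all: by end_near. Qed.

Section LocalExt.
Context {R : realType} {Z : Type} {N : nat}.
Variable C : coords R Z N.

Lemma local_ext_ball (P : set Z) (i : cidx C) z h g : local_ext P i z h g ->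
  exists2 d : R, 0 < d & [/\ Cinf [set X | `|crd i z - X| < d] g &
    forall z', P z' -> cdom i z' -> `|crd i z - crd i z'| < d -> h z' = g (crd i z')].
Proof.
move=> [U [oO Oz CO HO]]; have [d d0 dO] := open_normP oO Oz.
exists d => //; split; first by apply: Cinf_restrict CO => X /=; exact: dO.
by move=> z' Pz' iz' /dO; exact: HO.
Qed.

End LocalExt.

Section BallDef.
Context {R : realType} {N : nat}.
Local Notation vec := 'rV[R]_N.

Definition Ball (X : vec) (d : R) : set vec := [set Y | `|X - Y| < d].

Lemma Ball_open X d : open (Ball X d).
Proof.
rewrite /Ball; have -> : [set Y : vec | `|X - Y| < d] = (fun q => `|X - q|) @^-1` [set x | x < d] by [].
apply: open_comp; last exact: open_lt.
move=> q _; apply: continuous_comp; last exact: norm_continuous.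
by apply: continuousB; [exact: cst_continuous|exact: id].
Qed.

Lemma Ball_center (X : vec) d : 0 < d -> Ball X d X.
Proof. by move=> d0; rewrite /Ball/= subrr normr0. Qed.

Lemma Ball_sub (X : vec) d d' : d <= d' -> Ball X d `<=` Ball X d'.
Proof. by move=> dd Y /= /lt_le_trans; exact. Qed.

End BallDef.

Arguments Ball_open {R N} X d.

Section Charts.
Context {R : realType} {n : nat}.
Variable M : bmanifold R n.
Local Notation vec := 'rV[R]_n.+1.
Local Notation C := (atlas M).
Local Notation idx := (cidx C).
Implicit Types (i j : idx) (x y : M).

Lemma crd_half i x : cdom i x -> 0 <= crd i x 0 ord0.
Proof.
move=> ix; have [U oO E] := chart_open (chart_dom_open i) (@subset_refl _ _).
have : (crd i @` (cdom i)) (crd i x) by exists x.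
by rewrite E => -[_]; rewrite /half_space.
Qed.

Lemma chart_ball i x (A : set M) : open A -> A x -> cdom i x ->
  exists2 d : R, 0 < d & (forall X, Ball (crd i x) d X -> 0 <= X 0 ord0 ->
     exists y, [/\ A y, cdom i y & crd i y = X]) /\
   (forall y, cdom i y -> Ball (crd i x) d (crd i y) -> A y).
Proof.
move=> oA Ax ix.
have oAi : open (A `&` cdom i) by apply: openI => //; exact: chart_dom_open.
have sub : A `&` cdom i `<=` cdom i by exact: subIsetr.
have [U oO E] := chart_open oAi sub.
have Ox : U (crd i x).
  have : (crd i @` (A `&` cdom i)) (crd i x) by exists x.
  by rewrite E => -[].
have [d d0 dO] := open_normP oO Ox.
have H X : Ball (crd i x) d X -> 0 <= X 0 ord0 -> exists y, [/\ A y, cdom i y & crd i y = X].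
  move=> /dO OX X0; have : (U `&` @half_space R n) X by split.
  by rewrite -E => -[y [Ay iy] <-]; exists y.
exists d => //; split=> // y iy yB.
have [y' [Ay' iy' E']] := H _ yB (crd_half iy).
by rewrite -(chart_inj iy' iy E').
Qed.

(** A change of charts extended smoothly to a full ball, so that it can be
    differentiated at boundary points; its domain contains the whole
    half-ball. *)
Definition transition i j x (T : vec -> vec) (d : R) : Prop :=
  [/\ 0 < d, forall k, Cinf (Ball (crd i x) d) (fun X => T X 0 k),
   forall y, cdom i y -> Ball (crd i x) d (crd i y) -> cdom j y /\ crd j y = T (crd i y) &
   forall X, Ball (crd i x) d X -> 0 <= X 0 ord0 -> exists2 y, cdom i y & crd i y = X].

Lemma transitionP i j x : cdom i x -> cdom j x -> exists T, exists d, transition i j x T d.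
Proof.
move=> ix jx.
have [d0 d00 [full dom]] := chart_ball (chart_dom_open j) jx ix.
have /choice[g Hg] : forall k : 'I_n.+1, exists g : vec -> R, local_ext (cdom j) i x (fun y => crd j y 0 k) g.
  by move=> k; apply: chart_smooth.
pose P k d := Cinf (Ball (crd i x) d) (g k) /\ (forall z', cdom j z' -> cdom i z' ->
   Ball (crd i x) d (crd i z') -> crd j z' 0 k = g k (crd i z')).
have Pmon k d d' : d' <= d -> P k d -> P k d'.
  move=> dd [P1 P2]; split; first by apply: Cinf_restrict P1; exact: Ball_sub.
  by move=> z' jz iz /(Ball_sub dd); exact: P2.
have Pex k : exists2 d, 0 < d & P k d.
  by have [d d1 [h1 h2]] := local_ext_ball (Hg k); exists d.
have [d d1 Pd] := common_radius Pmon Pex.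
exists (fun X => \row_k g k X), (Num.min d d0).
have m1 : Num.min d d0 <= d by rewrite ge_min lexx.
have m2 : Num.min d d0 <= d0 by rewrite ge_min lexx orbT.
split.
- by rewrite lt_min d1.
- move=> k; apply: (@Cinf_eq _ _ _ (g k)); first exact: Ball_open.
    by move=> X _; rewrite mxE.
  by apply: Cinf_restrict (Pd k).1; exact: Ball_sub.
- move=> y iy yB; have jy := dom y iy (Ball_sub m2 yB); split=> //.
  by apply/rowP => k; rewrite mxE; apply: (Pd k).2 => //; exact: Ball_sub yB.
- by move=> X /(Ball_sub m2) XB X0; have [y [_ iy yX]] := full X XB X0; exists y.
Qed.

(** The two extensions agree on a half-ball, where derive_half_zero applies to
    their difference. *)
Lemma ext_derive_unique i x (g g' : vec -> R) (O O' : set vec) (A : set M) v :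
  cdom i x -> open O -> O (crd i x) -> Cinf O g -> open O' -> O' (crd i x) -> Cinf O' g' ->
  open A -> A x ->
  (forall y, A y -> cdom i y -> O (crd i y) -> O' (crd i y) -> g (crd i y) = g' (crd i y)) ->
  'D_v g (crd i x) = 'D_v g' (crd i x).
Proof.
move=> ix oO Ox Cg oO' Ox' Cg' oA Ax H.
have [d d0 [full _]] := chart_ball oA Ax ix.
have oI : open (O `&` O' `&` Ball (crd i x) d).
  by apply: openI; [exact: openI|exact: Ball_open].
have Ix : (O `&` O' `&` Ball (crd i x) d) (crd i x) by split=> //; exact: Ball_center.
have C1 : Cinf (O `&` O' `&` Ball (crd i x) d) g by apply: Cinf_restrict Cg => X [[]].
have C2 : Cinf (O `&` O' `&` Ball (crd i x) d) g' by apply: Cinf_restrict Cg' => X [[]].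
have Z : 'D_v (fun X => g X - g' X) (crd i x) = 0.
  apply: (derive_half_zero (j := ord0) v oI (Cinf_diff oI C1 C2) Ix (crd_half ix)).
  move=> X [[OX O'X] BX] X0; have [y [Ay iy E]] := full X BX X0.
  by apply/eqP; rewrite subr_eq0; apply/eqP; rewrite -E; apply: H; rewrite ?E.
have D1 := @Cinf_derivable _ _ _ _ C1 _ v Ix; have D2 := @Cinf_derivable _ _ _ _ C2 _ v Ix.
by move: Z; rewrite deriveB// => /eqP; rewrite subr_eq0 => /eqP.
Qed.

Lemma ddirE i x (P : set M) (h : M -> R) (g : vec -> R) (O : set vec) v :
  open P -> P x -> cdom i x -> open O -> O (crd i x) -> Cinf O g ->
  (forall y, P y -> cdom i y -> O (crd i y) -> h y = g (crd i y)) ->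
  ddir P i x h v = 'D_v g (crd i x).
Proof.
move=> oP Px ix oO Ox Cg H; rewrite /ddir.
set S := [set r | _].
have SE r : S r -> r = 'D_v g (crd i x).
  move=> [g' [U [oO' O'x Cg' H']] ->].
  apply: (ext_derive_unique v ix oO' O'x Cg' oO Ox Cg oP Px) => y Py iy O'y Oy.
  by rewrite -H'// H.
apply: SE; apply: xgetPex; exists ('D_v g (crd i x)), g => //.
by exists O.
Qed.

Definition Jac i j x : 'M[R]_n.+1 :=
  \matrix_(l, k) ddir (cdom j) i x (fun y => crd j y 0 k) (delta_mx 0 l).

Lemma ddir_crdE i j x T d y k v : cdom i x -> transition i j x T d ->
  cdom i y -> Ball (crd i x) d (crd i y) ->
  ddir (cdom j) i y (fun y => crd j y 0 k) v = 'D_v (fun X => T X 0 k) (crd i y).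
Proof.
move=> ix [d0 CT TE _] iy yB; have [jy _] := TE y iy yB.
apply: (ddirE v (chart_dom_open j) jy iy (Ball_open _ _) yB (CT k)).
by move=> z jz iz zB; have [_ ->] := TE z iz zB.
Qed.

Lemma JacE i j x T d y l k : cdom i x -> transition i j x T d ->
  cdom i y -> Ball (crd i x) d (crd i y) ->
  Jac i j y l k = 'D_(delta_mx 0 l) (fun X => T X 0 k) (crd i y).
Proof. by move=> ix tT iy yB; rewrite mxE (ddir_crdE _ _ ix tT iy yB). Qed.

Lemma transition_center i j x T d : cdom i x -> transition i j x T d ->
  Ball (crd i x) d (crd i x).
Proof. by move=> ix [d0 _ _ _]; exact: Ball_center. Qed.

Lemma ddir_crd_Jac i j x k (v : vec) : cdom i x -> cdom j x ->
  ddir (cdom j) i x (fun y => crd j y 0 k) v = (v *m Jac i j x) 0 k.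
Proof.
move=> ix jx; have [T [d tT]] := transitionP ix jx.
have xB := transition_center ix tT.
rewrite (ddir_crdE _ _ ix tT ix xB) mxE.
have [_ CT _ _] := tT.
rewrite (derive_sum_coord _ (Ball_open _ _) (CT k 1%N) xB).
by apply: eq_bigr => l _; rewrite (JacE _ _ ix tT ix xB).
Qed.

Lemma tangentE x a : tangent x a <->
  (forall i, ~ cdom i x -> a i = 0) /\
  (forall i j, cdom i x -> cdom j x -> a j = a i *m Jac i j x).
Proof.
split=> -[a0 H]; split=> // i j ix jx.
  by apply/rowP => k; rewrite (H i j ix jx) ddir_crd_Jac.
by move=> k; rewrite ddir_crd_Jac// -H.
Qed.

Lemma Jac_id i x : cdom i x -> Jac i i x = 1%:M.
Proof.
move=> ix; apply/matrixP => l k; rewrite !mxE.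
have := @ddirE i x (cdom i) (fun y => crd i y 0 k) (fun X => X 0 k) setT (delta_mx 0 l)
  (chart_dom_open i) ix ix openT I (Cinf_coord k openT) (fun y _ _ _ => erefl).
move=> ->; have [_ ->] := is_derive_coord k (crd i x) (delta_mx 0 l).
by rewrite mxE eqxx/= eq_sym.
Qed.

Lemma Jac_comp i j (k : idx) x : cdom i x -> cdom j x -> cdom k x ->
  Jac i j x *m Jac j k x = Jac i k x.
Proof.
move=> ix jx kx.
have [T [d tT]] := transitionP ix jx; have [S [e tS]] := transitionP jx kx.
have [U [f tU]] := transitionP ix kx.
have xB := transition_center ix tT; have xS := transition_center jx tS.
have xU := transition_center ix tU.
have [d0 CT TE _] := tT; have [e0 CS SE _] := tS; have [f0 CU UE _] := tU.
have [_ TX] := TE x ix xB.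
have cT : {for crd i x, continuous T}.
  apply: (@mx_cvg _ _ (nbhs (crd i x)) (nbhs_filter _)) => a b; rewrite ord1.
  exact: Cinf_cont (CT b) _ xB.
have [r r0 Hr] := (cont_normP _ _).1 cT _ e0.
pose D := Num.min (Num.min d f) r.
have D0 : 0 < D by rewrite !lt_min d0 f0 r0.
have Dd : D <= d by rewrite /D !ge_min lexx.
have Df : D <= f by rewrite /D !ge_min lexx orbT.
have Dr : D <= r by rewrite /D !ge_min lexx !orbT.
have TB X : Ball (crd i x) D X -> Ball (crd j x) e (T X).
  by move=> /(Ball_sub Dr) XB; rewrite /Ball/= TX; exact: Hr.
apply/matrixP => l m; rewrite mxE.
have CST : Cinf (Ball (crd i x) D) (fun X => S (T X) 0 m).
  apply: (Cinf_comp (O' := Ball (crd j x) e) (Ball_open _ _) (Ball_open _ _) TB _ (CS m)).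
  by move=> b; apply: Cinf_restrict (CT b); exact: Ball_sub.
have CU' : Cinf (Ball (crd i x) D) (fun X => U X 0 m).
  by apply: Cinf_restrict (CU m); exact: Ball_sub.
have xD := Ball_center (crd i x) D0.
rewrite (JacE _ _ ix tU ix xU).
have <- : 'D_(delta_mx 0 l) (fun X => S (T X) 0 m) (crd i x) =
          'D_(delta_mx 0 l) (fun X => U X 0 m) (crd i x).
  apply: (ext_derive_unique _ ix (Ball_open _ _) xD CST (Ball_open _ _) xD CU'
    (chart_dom_open i) ix).
  move=> y _ iy yB _.
  have [jy Ey] := TE y iy (Ball_sub Dd yB).
  have [_ Uy] := UE y iy (Ball_sub Df yB).
  by have := TB _ yB; rewrite -Ey => /(SE y jy)[_ <-]; rewrite -Uy.
have dT : derivable T (crd i x) (delta_mx 0 l).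
  by apply/derivable_mxP => a b; rewrite ord1; exact: Cinf_derivable (CT b) _ _ xB.
have TxB : Ball (crd j x) e (T (crd i x)) by rewrite -TX.
have [_ ->] := is_derive_compC1 dT (Ball_open _ _) (CS m 1%N) TxB.
apply: eq_bigr => b _; rewrite (JacE _ _ ix tT ix xB) (JacE _ _ jx tS jx xS).
by rewrite derive_mx// mxE TX.
Qed.

(** Tangent vectors are determined by their components in one chart; this is
    the tangent vector with components u in the chart i. *)
Definition tv i x (u : vec) : tvec M :=
  fun j => if `[< cdom j x >] then u *m Jac i j x else 0.

Lemma tvE i x u : cdom i x -> tv i x u i = u.
Proof. by move=> ix; rewrite /tv asboolT// Jac_id// mulmx1. Qed.

Lemma tv_chart i x u j : cdom j x -> tv i x u j = u *m Jac i j x.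
Proof. by move=> jx; rewrite /tv asboolT. Qed.

Lemma tv_tangent i x u : cdom i x -> tangent x (tv i x u).
Proof.
move=> ix; apply/tangentE; split=> [j jx|j k jx kx]; first by rewrite /tv asboolF.
by rewrite (@tv_chart i x u j jx) (@tv_chart i x u k kx) -mulmxA Jac_comp.
Qed.

Lemma tangent_tv i x a : cdom i x -> tangent x a -> a = tv i x (a i).
Proof.
move=> ix /tangentE[a0 H]; apply/funext => j; rewrite /tv.
by case: asboolP => [jx|/a0//]; exact: H.
Qed.

Lemma tangent_eq i x a b : cdom i x -> tangent x a -> tangent x b -> a i = b i -> a = b.
Proof. by move=> ix /(tangent_tv ix) {2}-> /(tangent_tv ix) {2}-> ->. Qed.

Lemma Jac_inv i j x : cdom i x -> cdom j x -> Jac i j x *m Jac j i x = 1%:M.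
Proof. by move=> ix jx; rewrite Jac_comp// Jac_id. Qed.

(** If x were interior for j, the coordinate 0 of the chart i, read in the
    chart j, would have an interior minimum at x, so that a column of the
    invertible Jacobian would vanish. *)
Lemma boundary_chart i j x : cdom i x -> cdom j x ->
  crd i x 0 ord0 = 0 -> crd j x 0 ord0 = 0.
Proof.
move=> ix jx x0; apply/eqP; rewrite eq_le crd_half// andbT leNgt; apply/negP => xj.
have [T [d tT]] := transitionP jx ix; have xB := transition_center jx tT.
have [d0 CT TE full] := tT.
have J0 l : Jac j i x l ord0 = 0.
  rewrite (JacE _ _ jx tT jx xB).
  pose D := Num.min d (crd j x 0 ord0) / 2.
  have D0 : 0 < D by rewrite divr_gt0// lt_min d0.
  have Dd : D < d by rewrite /D; have := ge_min d d (crd j x 0 ord0); rewrite lexx/= => ?; lra.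
  have Dx : D < crd j x 0 ord0.
    by rewrite /D; have := ge_min (crd j x 0 ord0) d (crd j x 0 ord0); rewrite lexx orbT => ?; lra.
  have nd (t : R) : `|t| <= D -> `|t *: (delta_mx 0 l : vec)| <= D.
    move=> tD; apply: mx_norm_le => [|a b]; first exact: ltW.
    rewrite !mxE normrM (le_trans _ tD)// ler_piMr//.
    by case: (_ && _); rewrite ?normr1 ?normr0.
  have inB (t : R) : `|t| <= D -> Ball (crd j x) d (crd j x + t *: delta_mx 0 l).
    by move=> /nd tD; rewrite /Ball/= opprD addrA subrr sub0r normrN (le_lt_trans tD).
  have pos (t : R) : `|t| <= D -> 0 <= (crd j x + t *: delta_mx 0 l) 0 ord0.
    move=> /nd tD; have := le_trans (ler_mx_norm_coef (t *: (delta_mx 0 l : vec)) 0 ord0) tD.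
    by rewrite ler_norml => /andP[h1 h2]; rewrite [X in 0 <= X]mxE; move: h1 h2 Dx; lra.
  have Dl (t : R) : `|t| <= D -> is_derive t 1 (fun s : R => T (crd j x + s *: delta_mx 0 l) 0 ord0)
     ('D_(delta_mx 0 l) (fun X => T X 0 ord0) (crd j x + t *: delta_mx 0 l)).
    by move=> tD; apply: is_derive_line; apply: Cinf_derivable (CT ord0) _ _ (inB _ tD).
  have := @derive1_at_min R (fun s : R => T (crd j x + s *: delta_mx 0 l) 0 ord0) (- D) D 0.
  have D2 : - D <= D by lra.
  case=> //.
  - move=> t; rewrite in_itv/= => /andP[t1 t2].
    by have [] := Dl t _; rewrite ?ler_norml ?(ltW t1) ?(ltW t2).
  - by rewrite in_itv/= D0 oppr_lt0 D0.
  - move=> t; rewrite in_itv/= => /andP[t1 t2].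
    have tD : `|t| <= D by rewrite ler_norml ltW ?(ltW t2).
    rewrite scale0r addr0.
    have [_ <-] := TE x jx xB; rewrite x0.
    have [y jy yE] := full _ (inB _ tD) (pos _ tD).
    have := TE y jy; rewrite yE => /(_ (inB _ tD))[iy <-].
    exact: crd_half.
  move=> _ <-; have [] := Dl 0; rewrite ?normr0 ?ltW// => _.
  by rewrite scale0r addr0 => ->.
have /matrixP/(_ ord0 ord0) := Jac_inv ix jx; rewrite !mxE.
rewrite big1 => [|l _]; last by rewrite J0 mulr0.
by move/eqP; rewrite eqxx eq_sym oner_eq0.
Qed.

Lemma boundaryP i x : cdom i x -> boundary M x <-> crd i x 0 ord0 = 0.
Proof.
move=> ix; split; apply: boundary_chart => //; exact: chart_at_dom.
Qed.

(** The change of charts maps boundary points to boundary points. *)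
Lemma Jac_boundary i j x l : cdom i x -> cdom j x -> boundary M x -> l != ord0 ->
  Jac i j x l ord0 = 0.
Proof.
move=> ix jx bx l0.
have [T [d tT]] := transitionP ix jx; have xB := transition_center ix tT.
have [d0 CT TE full] := tT.
rewrite (JacE _ _ ix tT ix xB).
have [_ ->//] : is_derive (crd i x) (delta_mx 0 l) (fun X => T X 0 ord0) 0.
apply: (derive_line_zero d0) => t td.
have XB : Ball (crd i x) d (crd i x + t *: delta_mx 0 l).
  rewrite /Ball/= opprD addrA subrr sub0r normrN (le_lt_trans _ td)//.
  apply: mx_norm_le => // a b; rewrite !mxE normrM ler_piMr//.
  by case: (_ && _); rewrite ?normr1 ?normr0.
have X0 : (crd i x + t *: delta_mx 0 l) 0 ord0 = 0.
  by rewrite !mxE (boundaryP ix).1// eqxx/= eq_sym (negbTE l0) mulr0 addr0.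
have [y iy yE] := full _ XB ltac:(by rewrite X0).
have := TE y iy; rewrite yE => /(_ XB)[jy <-].
by apply/(boundaryP jy)/(boundaryP iy); rewrite yE.
Qed.

(** The diagonal entry is nonzero because the Jacobian is invertible, and
    nonnegative because inward points are mapped to inward points. *)
Lemma Jac_boundary_gt0 i j x : cdom i x -> cdom j x -> boundary M x ->
  0 < Jac i j x ord0 ord0.
Proof.
move=> ix jx bx.
have n0 : Jac i j x ord0 ord0 != 0.
  apply/negP => /eqP J0; have /matrixP/(_ ord0 ord0) := Jac_inv jx ix; rewrite !mxE.
  rewrite big1 => [/eqP|l _]; first by rewrite eqxx eq_sym oner_eq0.
  have [->|l0] := eqVneq l ord0; first by rewrite J0 mulr0.
  by rewrite (Jac_boundary ix jx bx l0) mulr0.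
rewrite lt_neqAle eq_sym n0/=.
have [T [d tT]] := transitionP ix jx; have xB := transition_center ix tT.
have [d0 CT TE full] := tT.
rewrite (JacE _ _ ix tT ix xB).
have D := @Cinf_derivable _ _ _ _ (CT ord0) _ (delta_mx 0 ord0) xB.
have T0 : T (crd i x) 0 ord0 = 0.
  by have [_ <-] := TE x ix xB; apply/(boundaryP jx).
have DR : (fun h : R => h^-1 *: (T (h *: delta_mx 0 ord0 + crd i x) 0 ord0 -
    T (crd i x) 0 ord0)) @ 0^'+ --> 'D_(delta_mx 0 ord0) (fun X => T X 0 ord0) (crd i x).
  by apply: cvg_dnbhs_at_right; exact: D.
rewrite -(cvg_lim (@Rhausdorff R) DR).
apply: limr_ge; first by apply/cvg_ex; eexists; exact: DR.
near=> h.
have h0 : 0 < h by near: h; exact: nbhs_right_gt.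
rewrite T0 subr0 [_ *: _]/(_ * _) mulr_ge0 ?invr_ge0 ?(ltW h0)//.
have XB : Ball (crd i x) d (h *: delta_mx 0 ord0 + crd i x).
  rewrite /Ball/= [_ + crd i x]addrC opprD addrA subrr sub0r normrN.
  have hd : `|h| < d by rewrite gtr0_norm//; near: h; exact: nbhs_right_lt.
  apply: (le_lt_trans _ hd).
  apply: mx_norm_le => // a b; rewrite !mxE normrM ler_piMr//.
  by case: (_ && _); rewrite ?normr1 ?normr0.
have X0 : 0 <= (h *: delta_mx 0 ord0 + crd i x) 0 ord0.
  by rewrite !mxE !eqxx mulr1; apply: addr_ge0; [exact: ltW|exact: crd_half].
have [y iy yE] := full _ XB X0.
by have := TE y iy; rewrite yE => /(_ XB)[jy <-]; exact: crd_half.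
Unshelve. all: by end_near. Qed.

End Charts.

(** * Metric, Christoffel symbols and unit normal *)

Section MatrixSmooth.
Context {R : realType} {N : nat}.
Implicit Types (O : set 'rV[R]_N).

Lemma Cinf_det O m (A : 'rV[R]_N -> 'M[R]_m) : open O ->
  (forall k l, Cinf O (fun X => A X k l)) -> Cinf O (fun X => \det (A X)).
Proof.
move=> oO CA; apply: Cinf_sum => // s _; apply: Cinf_scale => //.
by apply: Cinf_prod => // k _; exact: CA.
Qed.

Lemma Cinf_invmx O m (A : 'rV[R]_N -> 'M[R]_m) : open O ->
  (forall k l, Cinf O (fun X => A X k l)) -> (forall X, O X -> A X \in unitmx) ->
  forall k l, Cinf O (fun X => invmx (A X) k l).
Proof.
move=> oO CA uA k l.
apply: (@Cinf_eq _ _ _ (fun X => (\det (A X))^-1 * \adj (A X) k l)) => //.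
  by move=> X; rewrite inE => /uA AX; rewrite [in RHS]/invmx AX [RHS]mxE.
apply: Cinf_mul => //.
  apply: Cinf_inv => //; last exact: Cinf_det.
  by move=> X /uA; rewrite unitmxE unitfE.
apply: (@Cinf_eq _ _ _ (fun X => (-1) ^+ (l + k) * \det (row' l (col' k (A X))))) => //.
  by move=> X _; rewrite mxE.
apply: Cinf_scale => //; apply: Cinf_det => // a b.
by apply: (@Cinf_eq _ _ _ (fun X => A X (lift l a) (lift k b))) => // X _; rewrite !mxE.
Qed.

End MatrixSmooth.

Section Bil.
Context {R : realType} {m : nat}.
Implicit Types (A B : 'M[R]_m) (u v w : 'rV[R]_m).

Definition bil A u v : R := (u *m A *m v^T) 0 0.

Lemma bilE A u v : bil A u v = \sum_k \sum_l u 0 k * A k l * v 0 l.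
Proof.
rewrite /bil mxE exchange_big/=; apply: eq_bigr => l _.
by rewrite mxE mulr_suml; apply: eq_bigr => k _; rewrite mxE.
Qed.

Lemma bil_sym A u v : A^T = A -> bil A u v = bil A v u.
Proof.
move=> sA; rewrite /bil.
have -> : (u *m A *m v^T) 0 0 = ((u *m A *m v^T)^T) 0 0 by rewrite [RHS]mxE.
by rewrite !trmx_mul trmxK sA mulmxA.
Qed.

Lemma bil_mulmx A J u v : bil A (u *m J) (v *m J) = bil (J *m A *m J^T) u v.
Proof. by rewrite /bil trmx_mul !mulmxA. Qed.

Lemma bilDl A u u' v : bil A (u + u') v = bil A u v + bil A u' v.
Proof. by rewrite /bil !mulmxDl mxE. Qed.

Lemma bilZl A c u v : bil A (c *: u) v = c * bil A u v.
Proof. by rewrite /bil -!scalemxAl mxE. Qed.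

Lemma bilDr A u v v' : bil A u (v + v') = bil A u v + bil A u v'.
Proof. by rewrite /bil linearD/= mulmxDr mxE. Qed.

Lemma bilZr A c u v : bil A u (c *: v) = c * bil A u v.
Proof. by rewrite /bil linearZ/= -scalemxAr mxE. Qed.

Lemma bil0l A u : bil A 0 u = 0.
Proof. by rewrite /bil !mul0mx mxE. Qed.

Lemma bil0r A u : bil A u 0 = 0.
Proof. by rewrite /bil trmx0 mulmx0 mxE. Qed.

Lemma bilNl A u v : bil A (- u) v = - bil A u v.
Proof. by rewrite -scaleN1r bilZl mulN1r. Qed.

Lemma bil_def A u v : (u *m A *m v^T) 0 0 = bil A u v.
Proof. by []. Qed.

Lemma posdef_unitmx A : (forall v, v != 0 -> 0 < bil A v v) -> A \in unitmx.
Proof.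
move=> pA; rewrite unitmxE unitfE; apply/negP => /det0P[v v0 vA].
by have := pA v v0; rewrite /bil vA mul0mx mxE ltxx.
Qed.

Lemma bil_nondeg A u u' : A \in unitmx -> (forall v, bil A u v = bil A u' v) -> u = u'.
Proof.
move=> uA H; rewrite -[u](mulmxK uA) -[u'](mulmxK uA); congr (_ *m _).
apply/rowP => l; have := H (delta_mx 0 l); rewrite /bil trmx_delta.
by rewrite -!colE !mxE.
Qed.

Lemma bil_sumA (I : finType) (A : I -> 'M[R]_m) (c : I -> R) u v :
  bil (\sum_l c l *: A l) u v = \sum_l c l * bil (A l) u v.
Proof.
rewrite /bil mulmx_sumr mulmx_suml summxE; apply: eq_bigr => l _.
by rewrite -scalemxAr -scalemxAl mxE.
Qed.

Lemma bil_deltar (A : 'M[R]_m) u (r : 'I_m) : bil A u (delta_mx 0 r) = (u *m A) 0 r.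
Proof. by rewrite /bil trmx_delta -colE mxE. Qed.

Lemma bil_sum_deltar A z u : bil A z u = \sum_r u 0 r * bil A z (delta_mx 0 r).
Proof.
rewrite [LHS]/bil mxE; apply: eq_bigr => r _.
by rewrite bil_deltar mulrC [_^T _ _]mxE.
Qed.

(** With one index lowered the Christoffel symbols become a sum of derivatives
    of the metric, free of the inverse matrix. *)
Lemma christ_lower A (D : 'I_m -> 'M[R]_m) v w u : A \in unitmx -> A^T = A ->
  bil A (\row_k \sum_l \sum_q 2^-1 * (\sum_r invmx A k r * (D l q r + D q l r - D r l q))
     * v 0 l * w 0 q) u =
  2^-1 * (bil (\sum_q w 0 q *: D q) v u + bil (\sum_l v 0 l *: D l) w u -
          bil (\sum_r u 0 r *: D r) v w).
Proof.
move=> uA sA.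
pose b r := \sum_l \sum_q v 0 l * w 0 q * (D l q r + D q l r - D r l q).
have E1 r : bil (\sum_q w 0 q *: D q) v (delta_mx 0 r) = \sum_l \sum_q v 0 l * w 0 q * D q l r.
  rewrite bil_sumA exchange_big/=; apply: eq_bigr => q _.
  by rewrite bil_deltar mxE mulr_sumr; apply: eq_bigr => l _; rewrite mulrA [w _ _ * _]mulrC.
have E2 r : bil (\sum_l v 0 l *: D l) w (delta_mx 0 r) = \sum_l \sum_q v 0 l * w 0 q * D l q r.
  rewrite bil_sumA; apply: eq_bigr => l _.
  by rewrite bil_deltar mxE mulr_sumr; apply: eq_bigr => q _; rewrite mulrA.
have E3 r : bil (D r) v w = \sum_l \sum_q v 0 l * w 0 q * D r l q.
  by rewrite bilE; apply: eq_bigr => l _; apply: eq_bigr => q _; rewrite mulrAC.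
have bE r : b r = bil (\sum_q w 0 q *: D q) v (delta_mx 0 r) +
    bil (\sum_l v 0 l *: D l) w (delta_mx 0 r) - bil (D r) v w.
  rewrite E1 E2 E3 /b -sumrN -!big_split/=; apply: eq_bigr => l _.
  rewrite -sumrN -!big_split/=; apply: eq_bigr => q _.
  by rewrite mulrBr mulrDr [X in X - _]addrC.
have -> : (\row_k \sum_l \sum_q 2^-1 * (\sum_r invmx A k r * (D l q r + D q l r - D r l q))
     * v 0 l * w 0 q) = (\row_r (2^-1 * b r)) *m invmx A.
  apply/rowP => k; rewrite !mxE.
  transitivity (\sum_r \sum_l \sum_q 2^-1 * invmx A k r * (v 0 l * w 0 q) *
     (D l q r + D q l r - D r l q)).
    rewrite [RHS]exchange_big/=; apply: eq_bigr => l _.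
    rewrite [RHS]exchange_big/=; apply: eq_bigr => q _.
    by rewrite mulr_sumr !mulr_suml; apply: eq_bigr => r _; ring.
  apply: eq_bigr => r _; rewrite mxE.
  have -> : invmx A r k = invmx A k r by rewrite -[in LHS]sA -trmx_inv mxE.
  rewrite /b mulr_sumr mulr_suml; apply: eq_bigr => l _.
  by rewrite mulr_sumr mulr_suml; apply: eq_bigr => q _; ring.
rewrite [LHS]/bil -mulmxA -mulmxA (mulmxA (invmx _)) mulVmx// mul1mx mxE.
rewrite [bil _ v u]bil_sum_deltar [bil _ w u]bil_sum_deltar (bil_sumA D).
rewrite -sumrN -!big_split/= mulr_sumr; apply: eq_bigr => r _.
rewrite [(\row_r _) _ _]mxE [_^T _ _]mxE bE.
by move: (bil _ _ _) (bil _ _ _) (bil _ _ _) => a b' c; ring.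
Qed.

End Bil.

Section Metric.
Context {R : realType} {n : nat}.
Variable M : bmanifold R n.
Variable g : metric M.
Local Notation vec := 'rV[R]_n.+1.
Local Notation C := (atlas M).
Local Notation idx := (cidx C).
Implicit Types (i j : idx) (x y : M) (u v w : vec).
Local Notation G := (gram g).

Lemma gram_bil_pos i x v : cdom i x -> v != 0 -> 0 < bil (G i x) v v.
Proof. exact: gram_pos. Qed.

Lemma gram_unit i x : cdom i x -> G i x \in unitmx.
Proof. by move=> ix; apply: posdef_unitmx => v; exact: gram_bil_pos. Qed.

Lemma bil_invmx_row (A : 'M[R]_n.+1) (k : 'I_n.+1) u : A \in unitmx ->
  bil A (row k (invmx A)) u = u 0 k.
Proof.
move=> uA; rewrite /bil -row_mul mulVmx// row1 -rowE.
by rewrite !mxE.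
Qed.

Lemma ginv00_gt0 i x : cdom i x -> 0 < invmx (G i x) ord0 ord0.
Proof.
move=> ix; have uG := gram_unit ix.
have := bil_invmx_row ord0 (row ord0 (invmx (G i x))) uG; rewrite mxE => <-.
apply: gram_bil_pos => //; apply/negP => /eqP r0.
have : row ord0 (invmx (G i x)) *m G i x = 0 by rewrite r0 mul0mx.
rewrite -row_mul mulVmx// row1 => /rowP/(_ ord0); rewrite !mxE eqxx/=.
by move/eqP; rewrite oner_eq0.
Qed.

(** The metric extended smoothly across the boundary. The extension is kept
    symmetric and invertible, so that the geodesic equation makes sense in a
    full ball of R^{n+1}. *)
Definition gram_ext i x (Gt : vec -> 'M[R]_n.+1) (d : R) : Prop :=
  [/\ 0 < d, forall k l, Cinf (Ball (crd i x) d) (fun X => Gt X k l),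
    forall y, cdom i y -> Ball (crd i x) d (crd i y) -> G i y = Gt (crd i y),
    forall X, (Gt X)^T = Gt X &
    forall X, Ball (crd i x) d X -> Gt X \in unitmx /\ 0 < invmx (Gt X) ord0 ord0].

(** The entries are extended separately and symmetrized; invertibility holds
    in a smaller ball by continuity. *)
Lemma gram_extP i x : cdom i x -> exists Gt, exists d, gram_ext i x Gt d.
Proof.
move=> ix.
have /choice[h Hh] : forall kl : 'I_n.+1 * 'I_n.+1, exists h : vec -> R,
    local_ext (cdom i) i x (fun y => G i y kl.1 kl.2) h.
  by move=> [k l]; apply: gram_smooth.
pose P (kl : 'I_n.+1) d := forall l, Cinf (Ball (crd i x) d) (h (kl, l)) /\
  (forall z', cdom i z' -> Ball (crd i x) d (crd i z') -> G i z' kl l = h (kl, l) (crd i z')).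
have Pmon k d d' : d' <= d -> P k d -> P k d'.
  move=> dd Pk l; have [P1 P2] := Pk l; split; first by apply: Cinf_restrict P1; exact: Ball_sub.
  by move=> z' iz /(Ball_sub dd); exact: P2.
have Pex k : exists2 d, 0 < d & P k d.
  pose Q (l : 'I_n.+1) d := Cinf (Ball (crd i x) d) (h (k, l)) /\
    (forall z', cdom i z' -> Ball (crd i x) d (crd i z') -> G i z' k l = h (k, l) (crd i z')).
  have Qmon l d d' : d' <= d -> Q l d -> Q l d'.
    move=> dd [P1 P2]; split; first by apply: Cinf_restrict P1; exact: Ball_sub.
    by move=> z' iz /(Ball_sub dd); exact: P2.
  have Qex l : exists2 d, 0 < d & Q l d.
    have [d d1 [h1 h2]] := local_ext_ball (Hh (k, l)); exists d => //; split=> // z' iz'.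
    exact: h2.
  by have [d d0 Qd] := common_radius Qmon Qex; exists d.
have [d d0 Pd] := common_radius Pmon Pex.
pose Gt X : 'M[R]_n.+1 := \matrix_(k, l) (2^-1 * (h (k, l) X + h (l, k) X)).
have CG k l : Cinf (Ball (crd i x) d) (fun X => Gt X k l).
  apply: (@Cinf_eq _ _ _ (fun X => 2^-1 * (h (k, l) X + h (l, k) X))); first exact: Ball_open.
    by move=> X _; rewrite mxE.
  apply: Cinf_scale; first exact: Ball_open.
  by apply: Cinf_add; [exact: Ball_open|exact: (Pd k l).1|exact: (Pd l k).1].
have GE y : cdom i y -> Ball (crd i x) d (crd i y) -> G i y = Gt (crd i y).
  move=> iy yB; apply/matrixP => k l; rewrite mxE -(Pd k l).2// -(Pd l k).2//.
  have := gram_sym g iy => /matrixP/(_ k l); rewrite mxE => ->.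
  by field.
have Gx := GE x ix (Ball_center _ d0).
have cdet : {for crd i x, continuous (fun X => \det (Gt X))}.
  exact: Cinf_cont (Cinf_det (Ball_open _ _) CG) _ (Ball_center _ d0).
have dx : \det (Gt (crd i x)) != 0.
  by rewrite -Gx; have := gram_unit ix; rewrite unitmxE unitfE.
have [d1 d10 Hd1] := (cont_normP _ _).1 cdet _ (ltac:(by rewrite normr_gt0) : 0 < `|\det (Gt (crd i x))|).
pose d2 := Num.min d d1.
have d20 : 0 < d2 by rewrite lt_min d0.
have d2d : d2 <= d by rewrite ge_min lexx.
have d2d1 : d2 <= d1 by rewrite ge_min lexx orbT.
have uG X : Ball (crd i x) d2 X -> Gt X \in unitmx.
  move=> /(Ball_sub d2d1)/Hd1; rewrite unitmxE unitfE => H; apply/negP => /eqP dX.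
  by move: H; rewrite dX subr0 ltxx.
have CG2 k l : Cinf (Ball (crd i x) d2) (fun X => Gt X k l).
  by apply: Cinf_restrict (CG k l); exact: Ball_sub.
have cinv : {for crd i x, continuous (fun X => invmx (Gt X) ord0 ord0)}.
  exact: Cinf_cont (Cinf_invmx (Ball_open _ _) CG2 uG ord0 ord0) _ (Ball_center _ d20).
have gx : 0 < invmx (Gt (crd i x)) ord0 ord0 by rewrite -Gx; exact: ginv00_gt0.
have [d3 d30 Hd3] := (cont_normP _ _).1 cinv _ gx.
pose d4 := Num.min d2 d3.
have d42 : d4 <= d2 by rewrite ge_min lexx.
have d43 : d4 <= d3 by rewrite ge_min lexx orbT.
exists Gt, d4; split.
- by rewrite lt_min d20.
- by move=> k l; apply: Cinf_restrict (CG2 k l); exact: Ball_sub.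
- by move=> y iy /(Ball_sub d42)/(Ball_sub d2d); exact: GE.
- by move=> X; apply/matrixP => k l; rewrite !mxE addrC.
- move=> X XB; split; first by apply: uG; exact: Ball_sub XB.
  have /Hd3 := Ball_sub d43 XB; rewrite ltr_norml; move: gx.
  by move: (invmx _ _ _) (invmx _ _ _) => a b; lra.
Qed.

Definition dG i x w : 'M[R]_n.+1 :=
  \matrix_(k, l) ddir (cdom i) i x (fun y => G i y k l) w.

Lemma gram_ext_le i x Gt d d' : 0 < d' -> d' <= d -> gram_ext i x Gt d -> gram_ext i x Gt d'.
Proof.
move=> d'0 dd [d0 CG GE sG uG]; split=> //.
- by move=> k l; apply: Cinf_restrict (CG k l); exact: Ball_sub.
- by move=> y iy /(Ball_sub dd); exact: GE.
- by move=> X /(Ball_sub dd); exact: uG.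
Qed.

Lemma dGE i x Gt d y w : cdom i x -> gram_ext i x Gt d -> cdom i y ->
  Ball (crd i x) d (crd i y) ->
  dG i y w = \matrix_(k, l) 'D_w (fun X => Gt X k l) (crd i y).
Proof.
move=> ix [d0 CG GE sG uG] iy yB; apply/matrixP => k l; rewrite !mxE.
apply: (ddirE w (chart_dom_open i) iy iy (Ball_open _ _) yB (CG k l)).
by move=> z iz _ zB; rewrite GE.
Qed.

Lemma dG_sym i x w : cdom i x -> (dG i x w)^T = dG i x w.
Proof.
move=> ix; have [Gt [d gE]] := gram_extP ix.
have xB := Ball_center (crd i x) (ltac:(by case: gE) : 0 < d).
rewrite (dGE w ix gE ix xB); have [d0 CG GE sG uG] := gE.
apply/matrixP => k l; rewrite !mxE; apply: (congr1 (fun h : vec -> R => 'D_w h (crd i x))).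
apply/funext => X; by have /matrixP/(_ k l) := sG X; rewrite mxE.
Qed.

Lemma dG_sum i x w : cdom i x -> dG i x w = \sum_l w 0 l *: dG i x (delta_mx 0 l).
Proof.
move=> ix; have [Gt [d gE]] := gram_extP ix.
have xB := Ball_center (crd i x) (ltac:(by case: gE) : 0 < d).
have [d0 CG GE sG uG] := gE.
apply/matrixP => k l; rewrite (dGE w ix gE ix xB) summxE mxE.
rewrite (derive_sum_coord _ (Ball_open _ _) (CG k l 1%N) xB); apply: eq_bigr => a _.
by rewrite (dGE _ ix gE ix xB) !mxE.
Qed.

(** The bilinear map v, w |-> Gamma(v, w), so that the geodesic equation reads
    X'' = - Gamma(X', X'). *)
Definition Gam2 i x v w : vec :=
  \row_k \sum_l \sum_m christoffel g i x k l m * v 0 l * w 0 m.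

Lemma Gam2E i x v w k : Gam2 i x v w 0 k =
  \sum_l \sum_m christoffel g i x k l m * v 0 l * w 0 m.
Proof. by rewrite mxE. Qed.

Lemma christoffel_dG i x k l m : cdom i x -> christoffel g i x k l m =
  2^-1 * \sum_r invmx (G i x) k r * (dG i x (delta_mx 0 l) m r + dG i x (delta_mx 0 m) l r
    - dG i x (delta_mx 0 r) l m).
Proof.
move=> ix; rewrite /christoffel; congr (_ * _); apply: eq_bigr => r _; congr (_ * _).
have s w a b : ddir (cdom i) i x (fun y => G i y a b) w = dG i x w b a.
  by rewrite -(dG_sym _ ix) !mxE.
have dGs w a b : dG i x w a b = dG i x w b a.
  by have /matrixP/(_ b a) := dG_sym w ix; rewrite mxE.
congr (_ + _ - _); [exact: s|exact: s|apply: (etrans (s _ _ _)); exact: dGs].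
Qed.

Lemma Gam_lower i x v w u : cdom i x ->
  bil (G i x) (Gam2 i x v w) u =
  2^-1 * (bil (dG i x w) v u + bil (dG i x v) w u - bil (dG i x u) v w).
Proof.
move=> ix; rewrite (dG_sum w ix) (dG_sum v ix) (dG_sum u ix).
rewrite -(christ_lower _ _ _ _ (gram_unit ix) (gram_sym g ix)).
congr (bil _ _ u); apply/rowP => k; rewrite !mxE.
apply: eq_bigr => l _; apply: eq_bigr => m _; congr (_ * _ * _).
exact: christoffel_dG.
Qed.

Definition christ_ext (Gt : vec -> 'M[R]_n.+1) (X : vec) (k l m : 'I_n.+1) : R :=
  2^-1 * \sum_r invmx (Gt X) k r * ('D_(delta_mx 0 l) (fun Y => Gt Y r m) X
    + 'D_(delta_mx 0 m) (fun Y => Gt Y r l) X - 'D_(delta_mx 0 r) (fun Y => Gt Y l m) X).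

Lemma christ_extE i x Gt d y k l m : cdom i x -> gram_ext i x Gt d -> cdom i y ->
  Ball (crd i x) d (crd i y) -> christoffel g i y k l m = christ_ext Gt (crd i y) k l m.
Proof.
move=> ix gE iy yB; rewrite /christoffel /christ_ext; congr (_ * _).
apply: eq_bigr => r _.
have H w a b : ddir (cdom i) i y (fun y => G i y a b) w = 'D_w (fun X => Gt X a b) (crd i y).
  by have /matrixP/(_ a b) := dGE w ix gE iy yB; rewrite !mxE.
by rewrite !H; have [_ _ -> //] := gE.
Qed.

Lemma christ_ext_smooth i x Gt d k l m : gram_ext i x Gt d ->
  Cinf (Ball (crd i x) d) (fun X => christ_ext Gt X k l m).
Proof.
move=> [d0 CG GE sG uG]; have oB := Ball_open (crd i x) d.
apply: Cinf_scale => //; apply: Cinf_sum => // r _; apply: Cinf_mul => //.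
  by apply: Cinf_invmx => // X /uG[].
apply: Cinf_diff => //; last exact: Cinf_D.
by apply: Cinf_add => //; exact: Cinf_D.
Qed.

Lemma inner_chart i x a b : cdom i x -> tangent x a -> tangent x b ->
  inner g x a b = bil (G i x) (a i) (b i).
Proof.
move=> ix ta tb; rewrite /inner /bil.
by rewrite (gram_compat g (chart_at_dom x) ix ta tb).
Qed.

Lemma gram_Jac i j x : cdom i x -> cdom j x ->
  G i x = Jac i j x *m G j x *m (Jac i j x)^T.
Proof.
move=> ix jx.
have H u v : bil (G i x) u v = bil (Jac i j x *m G j x *m (Jac i j x)^T) u v.
  have := gram_compat g ix jx (tv_tangent u ix) (tv_tangent v ix).
  rewrite !tvE// !(tv_chart _ _ jx) => /matrixP/(_ 0 0).
  by rewrite -bil_mulmx.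
apply/matrixP => k l; have := H (delta_mx 0 k) (delta_mx 0 l).
by rewrite !bil_deltar -!rowE !mxE.
Qed.

Lemma tangent_chart0 i j x a : cdom i x -> cdom j x -> boundary M x -> tangent x a ->
  a j 0 ord0 = a i 0 ord0 * Jac i j x ord0 ord0.
Proof.
move=> ix jx bx /tangentE[_ H]; rewrite (H i j ix jx) mxE (bigD1 ord0)//= big1 ?addr0//.
by move=> l l0; rewrite (Jac_boundary ix jx bx l0) mulr0.
Qed.

Lemma tangent_boundaryP i x a : cdom i x -> boundary M x ->
  tangent_boundary x a <-> tangent x a /\ a i 0 ord0 = 0.
Proof.
move=> ix bx; have cx := chart_at_dom x.
split=> -[ta a0]; split=> //.
  by rewrite (tangent_chart0 cx ix bx ta) a0 mul0r.
by rewrite (tangent_chart0 ix cx bx ta) a0 mul0r.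
Qed.

(** The components of the unit inward normal for the Gram matrix A: the
    gradient of the coordinate 0, normalized. *)
Definition nuc (A : 'M[R]_n.+1) : vec :=
  (Num.sqrt (invmx A ord0 ord0))^-1 *: row ord0 (invmx A).

Lemma bil_nuc A u : A \in unitmx -> bil A (nuc A) u = u 0 ord0 / Num.sqrt (invmx A ord0 ord0).
Proof. by move=> uA; rewrite /nuc bilZl bil_invmx_row// mulrC. Qed.

Lemma nuc0 A : 0 < invmx A ord0 ord0 -> nuc A 0 ord0 = Num.sqrt (invmx A ord0 ord0).
Proof.
move=> A0; rewrite !mxE -{2}(sqr_sqrtr (ltW A0)) expr2 mulrA mulVf ?mul1r//.
by rewrite gt_eqF// sqrtr_gt0.
Qed.

(** A vector orthogonal to all vectors with vanishing coordinate 0 is a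
    multiple of the gradient of that coordinate; the norm and the sign fix the
    factor. *)
Lemma unit_inward_normal_chart i x a : cdom i x -> boundary M x ->
  unit_inward_normal g x a <-> a = tv i x (nuc (G i x)).
Proof.
move=> ix bx; have uG := gram_unit ix; have g0 := ginv00_gt0 ix.
have s0 : 0 < Num.sqrt (invmx (G i x) ord0 ord0) by rewrite sqrtr_gt0.
have cx := chart_at_dom x; have J0 := Jac_boundary_gt0 ix cx bx.
split=> [[ta a1 aw a0]|->].
  apply: (tangent_eq ix ta (tv_tangent _ ix)); rewrite tvE//.
  have ai0 : 0 < a i 0 ord0.
    by move: a0; rewrite (tangent_chart0 ix cx bx ta) pmulr_lgt0.
  pose c := bil (G i x) (a i) (delta_mx 0 ord0).
  have aE u : bil (G i x) (a i) u = c * u 0 ord0.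
    have [w [w0 uE]] : exists w : vec, w 0 ord0 = 0 /\ u = u 0 ord0 *: delta_mx 0 ord0 + w.
      exists (u - u 0 ord0 *: delta_mx 0 ord0); split; last by rewrite addrC subrK.
      by rewrite !mxE !eqxx mulr1 subrr.
    rewrite {1}uE bilDr bilZr -/c mulrC.
    have tw : tangent_boundary x (tv i x w).
      by apply/(tangent_boundaryP _ ix bx); split; [exact: tv_tangent|rewrite tvE].
    have := aw _ tw; rewrite (inner_chart ix ta (tv_tangent _ ix)) tvE// => ->.
    by rewrite addr0.
  have aN : a i = (c * Num.sqrt (invmx (G i x) ord0 ord0)) *: nuc (G i x).
    apply: (bil_nondeg uG) => u; rewrite aE bilZl bil_nuc//.
    by field; rewrite gt_eqF.
  have c0 : 0 < c.
    move: ai0; rewrite aN mxE nuc0// -mulrA pmulr_lgt0// mulr_gt0//.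
  have := a1; rewrite (inner_chart ix ta ta) aE aN mxE nuc0// => E.
  suff -> : c * Num.sqrt (invmx (G i x) ord0 ord0) = 1 by rewrite scale1r.
  have : (c * Num.sqrt (invmx (G i x) ord0 ord0)) ^+ 2 = 1 by rewrite -E; ring.
  move/eqP; rewrite sqrf_eq1 => /orP[/eqP//|/eqP E2].
  have : 0 < c * Num.sqrt (invmx (G i x) ord0 ord0) by rewrite mulr_gt0.
  by rewrite E2; lra.
have tn := tv_tangent (nuc (G i x)) ix.
split=> //.
- by rewrite (inner_chart ix tn tn) tvE// bil_nuc// nuc0// divff// gt_eqF.
- move=> w /(tangent_boundaryP _ ix bx)[tw w0].
  by rewrite (inner_chart ix tn tw) tvE// bil_nuc// w0 mul0r.
- by rewrite (tangent_chart0 ix cx bx tn) tvE// nuc0// mulr_gt0.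
Qed.

Lemma nu_chart i x : cdom i x -> boundary M x -> nu g x = tv i x (nuc (G i x)).
Proof.
move=> ix bx; apply/(unit_inward_normal_chart _ ix bx).
rewrite /nu; apply: (@xgetPex _ _ [set a | unit_inward_normal g x a]).
by exists (tv i x (nuc (G i x))); apply/(unit_inward_normal_chart _ ix bx).
Qed.

Lemma inner_nu i x a : cdom i x -> boundary M x -> tangent x a ->
  inner g x a (nu g x) = a i 0 ord0 / Num.sqrt (invmx (G i x) ord0 ord0).
Proof.
move=> ix bx ta; have tn := tv_tangent (nuc (G i x)) ix.
rewrite (nu_chart ix bx) (inner_chart ix ta tn) tvE//.
by rewrite bil_sym ?gram_sym// bil_nuc// gram_unit.
Qed.

End Metric.

(** * Second fundamental form and covariance of the geodesic equation *)

Opaque bil dG Gam2 nuc.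

Section DeriveBil.
Context {R : realType} {m : nat} {V : normedModType R}.

Lemma is_derive_fsum (I : finType) (F : I -> V -> R) (dF : I -> R) (p v : V) :
  (forall k, is_derive p v (F k) (dF k)) ->
  is_derive p v (fun X => \sum_k F k X) (\sum_k dF k).
Proof.
move=> H.
suff : forall r : seq I, is_derive p v (fun X => \sum_(k <- r) F k X) (\sum_(k <- r) dF k) by exact.
elim=> [|k r IH].
  have -> : (fun X => \sum_(k <- [::]) F k X) = cst 0 by apply/funext => X; rewrite big_nil.
  by rewrite big_nil; exact: is_derive_cst.
have -> : (fun X => \sum_(k0 <- k :: r) F k0 X) = (F k + (fun X => \sum_(k <- r) F k X)).
  by apply/funext => X; rewrite big_cons.
by rewrite big_cons; exact: is_deriveD.
Qed.

Lemma is_deriveM3 (a b c : V -> R) (da db dc : R) (p v : V) :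
  is_derive p v a da -> is_derive p v b db -> is_derive p v c dc ->
  is_derive p v (fun X => a X * b X * c X) (da * b p * c p + a p * db * c p + a p * b p * dc).
Proof.
move=> Da Db Dc; have H := is_deriveM (is_deriveM Da Db) Dc.
apply: (is_derive_eq H).
have W (x y : R) : x *: y = x * y by [].
have -> : (a * b) p = a p * b p by [].
by rewrite !W; ring.
Qed.

Lemma derive_bil3 (A : V -> 'M[R]_m) (U W : V -> 'rV[R]_m) dA dU dW (p v : V) :
  is_derive p v A dA -> is_derive p v U dU -> is_derive p v W dW ->
  is_derive p v (fun X => bil (A X) (U X) (W X))
    (bil dA (U p) (W p) + bil (A p) dU (W p) + bil (A p) (U p) dW).
Proof.
move=> DA DU DW.
have -> : (fun X => bil (A X) (U X) (W X)) = (fun X => \sum_k \sum_l U X 0 k * A X k l * W X 0 l).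
  by apply/funext => Y; rewrite bilE.
have D k l := is_deriveM3 (is_derive_coef 0 k DU) (is_derive_coef k l DA) (is_derive_coef 0 l DW).
have H := is_derive_fsum (fun k => is_derive_fsum (D k)).
apply: (is_derive_eq H).
rewrite !bilE -!big_split/=; apply: eq_bigr => k _.
rewrite -!big_split/=; apply: eq_bigr => l _.
by rewrite [X in X + _ = _]addrC.
Qed.

End DeriveBil.

Section SecondFundamentalForm.
Context {R : realType} {n : nat}.
Variable M : bmanifold R n.
Variable g : metric M.
Local Notation vec := 'rV[R]_n.+1.
Local Notation idx := (cidx (atlas M)).
Local Notation G := (gram g).
Implicit Types (i j : idx) (x y : M) (u v w : vec).

(** Extensions from the boundary agree only along the boundary, which
    determines their derivatives in the directions tangent to it. *)
Lemma ddir_boundaryE i x (h : M -> R) (f : vec -> R) (d : R) v : boundary M x -> cdom i x ->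
  0 < d -> Cinf (Ball (crd i x) d) f ->
  (forall y, boundary M y -> cdom i y -> Ball (crd i x) d (crd i y) -> h y = f (crd i y)) ->
  v 0 ord0 = 0 -> ddir (boundary M) i x h v = 'D_v f (crd i x).
Proof.
move=> bx ix d0 Cf H v0; rewrite /ddir; set S := [set r | _].
have xB := Ball_center (crd i x) d0.
have SE r : S r -> r = 'D_v f (crd i x).
  move=> [f' [U [oU Ux Cf' H']] ->].
  have [d1 d10 [full _]] := chart_ball (chart_dom_open i) ix ix.
  have [d2 d20 d2U] := open_normP oU Ux.
  have [c c0 Hc] : exists2 c : R, 0 < c & forall t : R, `|t| < c -> `|t *: v| < Num.min d (Num.min d1 d2).
    exists (Num.min d (Num.min d1 d2) / (`|v| + 1)).
      by rewrite divr_gt0 ?ltr_wpDl// !lt_min d0 d10.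
    move=> t tc; rewrite normrZ (@le_lt_trans _ _ (`|t| * (`|v| + 1)))//.
      by rewrite ler_wpM2l// lerDl.
    by rewrite -ltr_pdivlMr// ltr_wpDl.
  have D1 := @Cinf_derivable _ _ _ _ Cf _ v xB; have D2 := @Cinf_derivable _ _ _ _ Cf' _ v Ux.
  have := @derive_line_zero _ _ (fun X => f' X - f X) (crd i x) v c c0.
  case.
    move=> t /Hc; rewrite !lt_min => /and3P[h0 h1 h2].
    have nX : `|crd i x - (crd i x + t *: v)| = `|t *: v| by rewrite opprD addrA subrr sub0r normrN.
    have X0 : (crd i x + t *: v) 0 ord0 = 0.
      by rewrite !mxE v0 mulr0 addr0; apply/(boundaryP ix).
    have [|| y [_ iy yE]] := full (crd i x + t *: v); [by rewrite /Ball/= nX|by rewrite X0|].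
    have by_ : boundary M y by apply/(boundaryP iy); rewrite yE.
    rewrite -yE -H' ?H ?subrr// yE; last by apply: d2U; rewrite nX.
    by rewrite /Ball/= nX.
  by move=> _; rewrite deriveB// => /eqP; rewrite subr_eq0 => /eqP.
apply: SE; apply: xgetPex; exists ('D_v f (crd i x)), f => //.
by exists (Ball (crd i x) d); split=> //; exact: Ball_open.
Qed.

Lemma Cinf_nuc (O : set vec) (Gt : vec -> 'M[R]_n.+1) k : open O ->
  (forall k l, Cinf O (fun X => Gt X k l)) ->
  (forall X, O X -> Gt X \in unitmx /\ 0 < invmx (Gt X) ord0 ord0) ->
  Cinf O (fun X => nuc (Gt X) 0 k).
Proof.
move=> oO CG uG.
have CI k' l : Cinf O (fun X => invmx (Gt X) k' l) by apply: Cinf_invmx => // X /uG[].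
apply: (@Cinf_eq _ _ _ (fun X => (Num.sqrt (invmx (Gt X) ord0 ord0))^-1 * invmx (Gt X) ord0 k)) => //.
  by move=> X _; rewrite !mxE.
apply: Cinf_mul => //; apply: Cinf_inv => //.
  by move=> X /uG[_ X0]; rewrite gt_eqF// sqrtr_gt0.
by apply: Cinf_sqrt => // X /uG[].
Qed.

(** Differentiating g(nu, v) = 0 along the boundary, with v a constant vector
    field in the chart, turns - g(nabla_v nu, v) into g(Gamma(v, v), nu), and
    g(., nu) is the coordinate 0 divided by its norm. So strict convexity says
    that the coordinate 0 has a negative second derivative along tangent
    geodesics. *)
Lemma II_Gam x v (i := chart_at x) : boundary M x -> v 0 ord0 = 0 ->
  second_fundamental_form g x (tv i x v) (tv i x v) =
  Gam2 g i x v v 0 ord0 / Num.sqrt (invmx (G i x) ord0 ord0).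
Proof.
move=> bx v0; have ix : cdom i x := chart_at_dom x.
have uG := gram_unit g ix; have sG := gram_sym g ix.
have [Gt [d gE]] := gram_extP g ix.
have [d0 CG GE sGt uGt] := gE; have xB := Ball_center (crd i x) d0.
have Gx := GE x ix xB.
pose nut X := nuc (Gt X).
have Cnu k : Cinf (Ball (crd i x) d) (fun X => nut X 0 k) by apply: Cinf_nuc => //; exact: Ball_open.
pose dnu : vec := \row_k 'D_v (fun X => nut X 0 k) (crd i x).
have nuE y : boundary M y -> cdom i y -> Ball (crd i x) d (crd i y) -> nu g y i = nut (crd i y).
  by move=> by_ iy yB; rewrite (nu_chart g iy by_) tvE// /nut GE.
have E1 : nabla_nu g x (tv i x v) = dnu + Gam2 g i x v (nuc (G i x)).
  rewrite /nabla_nu -/i !tvE//; apply/rowP => k; rewrite !mxE; congr (_ + _).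
    apply: (ddir_boundaryE bx ix d0 (Cnu k) _ v0) => y by_ iy yB.
    by rewrite nuE.
  apply: eq_bigr => l _; apply: eq_bigr => q _.
  by rewrite (nu_chart g ix bx) tvE.
have E2 : bil (dG g i x v) (nuc (G i x)) v + bil (G i x) dnu v = 0.
  have DA : is_derive (crd i x) v Gt (\matrix_(k, l) 'D_v (fun X => Gt X k l) (crd i x)).
    by apply: is_derive_mxP => k l; rewrite mxE; split=> //; exact: Cinf_derivable (CG k l) _ _ xB.
  have DU : is_derive (crd i x) v nut dnu.
    by apply: is_derive_mxP => a k; rewrite ord1 mxE; split=> //; exact: Cinf_derivable (Cnu k) _ _ xB.
  have DW := is_derive_cst (v : vec) (crd i x) (v : vec).
  have [_ <-] : is_derive (crd i x) v (fun X => bil (Gt X) (nut X) v)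
      (bil (dG g i x v) (nuc (G i x)) v + bil (G i x) dnu v).
    apply: (is_derive_eq (derive_bil3 DA DU DW)).
    rewrite (dGE v ix gE ix xB) /nut -Gx.
    by rewrite bil0r addr0.
  rewrite (@eq_derive_open _ _ _ (Ball (crd i x) d) _ (cst 0)) ?derive_cst//.
    exact: Ball_open.
  move=> X; rewrite inE => /uGt[uX _] /=.
  by rewrite /nut bil_nuc// v0 mul0r.
rewrite /second_fundamental_form -/i E1 !tvE//.
have alg (P Q S a a' c : R) : a + P = 0 -> a' = a -> Q = 2^-1 * (c + a - a) ->
    S = 2^-1 * (a' + a' - c) -> - (P + Q) = S.
  by move=> /eqP; rewrite addrC addr_eq0 => /eqP-> -> -> ->; field.
have -> : Gam2 g i x v v 0 ord0 / Num.sqrt (invmx (G i x) ord0 ord0) =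
    bil (G i x) (Gam2 g i x v v) (nuc (G i x)) by rewrite bil_sym// bil_nuc.
rewrite bil_def bilDl.
apply: (alg _ _ _ _ _ _ E2 (bil_sym _ _ (dG_sym g v ix)) _ (Gam_lower g v v (nuc (G i x)) ix)).
have G2 := Gam_lower g v (nuc (G i x)) v ix.
by rewrite (bil_sym v (nuc (G i x)) (dG_sym g v ix)) in G2.
Qed.

End SecondFundamentalForm.

Section Covariance.
Context {R : realType} {n : nat}.
Variable M : bmanifold R n.
Variable g : metric M.
Local Notation vec := 'rV[R]_n.+1.
Local Notation idx := (cidx (atlas M)).
Local Notation G := (gram g).
Implicit Types (i j : idx) (x y : M) (u v w : vec).

Lemma transition_derive i j x T d y v : cdom i x -> transition i j x T d ->
  cdom i y -> Ball (crd i x) d (crd i y) ->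
  \row_k 'D_v (fun X => T X 0 k) (crd i y) = v *m Jac i j y.
Proof.
move=> ix tT iy yB; have [d0 CT TE full] := tT; have [jy _] := TE y iy yB.
apply/rowP => k; rewrite mxE -(ddir_crd_Jac k v iy jy).
by rewrite (ddir_crdE k v ix tT iy yB).
Qed.

(** The second derivative of the change of charts, the inhomogeneous term in
    the transformation law of Christoffel symbols. *)
Definition hess (T : vec -> vec) (X : vec) w v : vec := \row_k 'D_w ('D_v (fun Y => T Y 0 k)) X.

Lemma hess_sym i j x T d w v : cdom i x -> transition i j x T d ->
  hess T (crd i x) w v = hess T (crd i x) v w.
Proof.
move=> ix tT; have xB := transition_center ix tT; have [d0 CT _ _] := tT.
apply/rowP => k; rewrite [LHS]mxE [RHS]mxE.
exact: (Schwarz _ _ (Ball_open _ _) (CT k 2%N) xB).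
Qed.

(** The derivative of the identity G_i = J G_j J^T. *)
Lemma dG_Jac i j x T d u v w : cdom i x -> transition i j x T d ->
  bil (dG g i x w) u v =
  bil (dG g j x (w *m Jac i j x)) (u *m Jac i j x) (v *m Jac i j x)
  + bil (G j x) (hess T (crd i x) w u) (v *m Jac i j x)
  + bil (G j x) (u *m Jac i j x) (hess T (crd i x) w v).
Proof.
move=> ix tT; have xB := transition_center ix tT; have [d0 CT TE full] := tT.
have [jx Tx] := TE x ix xB.
have [Gi [di gi]] := gram_extP g ix; have [Gj [dj gj]] := gram_extP g jx.
have [di0 CGi GEi sGi uGi] := gi; have [dj0 CGj GEj sGj uGj] := gj.
have xBi := Ball_center (crd i x) di0; have xBj := Ball_center (crd j x) dj0.
have cT : {for crd i x, continuous T}.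
  apply: (@mx_cvg _ _ (nbhs (crd i x)) (nbhs_filter _)) => a b; rewrite ord1.
  exact: Cinf_cont (CT b) _ xB.
have [r r0 Hr] := (cont_normP _ _).1 cT _ dj0.
pose D := Num.min (Num.min d di) r.
have D0 : 0 < D by rewrite !lt_min d0 di0 r0.
have Dd : D <= d by rewrite /D !ge_min lexx.
have Di : D <= di by rewrite /D !ge_min lexx orbT.
have Dr : D <= r by rewrite /D !ge_min lexx !orbT.
have TB X : Ball (crd i x) D X -> Ball (crd j x) dj (T X).
  by move=> /(Ball_sub Dr) XB; rewrite /Ball/= Tx; exact: Hr.
have oB := Ball_open (crd i x) D; have xD := Ball_center (crd i x) D0.
have CTD k : Cinf (Ball (crd i x) D) (fun X => T X 0 k) by apply: Cinf_restrict (CT k); exact: Ball_sub.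
pose Tu z X : vec := \row_k 'D_z (fun Y => T Y 0 k) X.
have CTu z k : Cinf (Ball (crd i x) D) (fun X => Tu z X 0 k).
  apply: (@Cinf_eq _ _ _ ('D_z (fun Y => T Y 0 k))) => //; first by move=> X _; rewrite mxE.
  exact: Cinf_D.
have CGT k l : Cinf (Ball (crd i x) D) (fun X => Gj (T X) k l).
  exact: (Cinf_comp (O' := Ball (crd j x) dj) oB (Ball_open _ _) TB CTD (CGj k l)).
have Cbil (B : vec -> 'M[R]_n.+1) (U W : vec -> vec) :
    (forall k l, Cinf (Ball (crd i x) D) (fun X => B X k l)) ->
    (forall k, Cinf (Ball (crd i x) D) (fun X => U X 0 k)) ->
    (forall k, Cinf (Ball (crd i x) D) (fun X => W X 0 k)) ->
    Cinf (Ball (crd i x) D) (fun X => bil (B X) (U X) (W X)).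
  move=> CB CU CW.
  apply: (@Cinf_eq _ _ _ (fun X => \sum_k \sum_l U X 0 k * B X k l * W X 0 l)) => //.
    by move=> X _; rewrite bilE.
  by apply: Cinf_sum => // k _; apply: Cinf_sum => // l _; apply: Cinf_mul => //; exact: Cinf_mul.
have TuJ z : Tu z (crd i x) = z *m Jac i j x by exact: (transition_derive z ix tT ix xB).
have E : 'D_w (fun X => bil (Gi X) u v) (crd i x) =
         'D_w (fun X => bil (Gj (T X)) (Tu u X) (Tu v X)) (crd i x).
  apply: (ext_derive_unique w ix oB xD _ oB xD _ (chart_dom_open i) ix).
  - apply: Cbil => [k l|k|k]; [|exact: Cinf_cst|exact: Cinf_cst].
    by apply: Cinf_restrict (CGi k l); exact: Ball_sub.
  - exact: Cbil.
  - move=> y _ iy yB _; have [jy Ty] := TE y iy (Ball_sub Dd yB).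
    rewrite -(GEi y iy (Ball_sub Di yB)) -Ty.
    have := TB _ yB; rewrite -Ty => jyB; rewrite -(GEj y jy jyB).
    rewrite /Tu !(transition_derive _ ix tT iy (Ball_sub Dd yB)).
    by rewrite bil_mulmx -gram_Jac.
have DGi : is_derive (crd i x) w Gi (dG g i x w).
  rewrite (dGE w ix gi ix xBi); apply: is_derive_mxP => k l; rewrite mxE.
  by split=> //; exact: Cinf_derivable (CGi k l) _ _ xBi.
have c0 z : is_derive (crd i x) w (fun=> z : vec) 0 by exact: is_derive_cst.
have [_ L] := derive_bil3 DGi (c0 u) (c0 v).
rewrite bil0l bil0r !addr0 in L; rewrite -L E.
have dT : derivable T (crd i x) w.
  by apply/derivable_mxP => a b; rewrite ord1; exact: Cinf_derivable (CT b) _ _ xB.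
have TxB : Ball (crd j x) dj (T (crd i x)) by rewrite -Tx.
have DGj : is_derive (crd i x) w (fun X => Gj (T X)) (dG g j x (w *m Jac i j x)).
  rewrite (dGE _ jx gj jx xBj); apply: is_derive_mxP => k l; rewrite mxE.
  apply: (is_derive_eq (is_derive_compC1 dT (Ball_open _ _) (CGj k l 1%N) TxB)).
  rewrite (derive_sum_coord _ (Ball_open _ _) (CGj k l 1%N) xBj) -Tx.
  by apply: eq_bigr => q _; rewrite -TuJ (derive_mx dT) mxE mxE.
have DTu z : is_derive (crd i x) w (Tu z) (hess T (crd i x) w z).
  apply: is_derive_mxP => a k; rewrite ord1 mxE.
  have := @Cinf_derivable _ _ _ _ (CTu z k) _ w xD => H.
  split=> //; apply: (congr1 (fun h : vec -> R => 'D_w h (crd i x))); apply/funext => X; by rewrite mxE.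
have [_ ->] := derive_bil3 DGj (DTu u) (DTu v).
by rewrite !TuJ -Tx -(GEj x jx xBj).
Qed.

(** Geodesics do not depend on the chart: this is the chain rule for the
    acceleration. It is obtained from dG_Jac by lowering an index, and the
    terms in hess T combine by symmetry of second derivatives. *)
Lemma Gam2_Jac i j x T d v : cdom i x -> transition i j x T d ->
  - Gam2 g j x (v *m Jac i j x) (v *m Jac i j x) =
  - Gam2 g i x v v *m Jac i j x + hess T (crd i x) v v.
Proof.
move=> ix tT; have xB := transition_center ix tT; have [d0 CT TE full] := tT.
have [jx Tx] := TE x ix xB.
have uG := gram_unit g jx; have sG := gram_sym g jx.
set J := Jac i j x; set S := hess T (crd i x).
apply: (bil_nondeg uG) => u'.
pose u := u' *m Jac j i x.
have -> : u' = u *m J by rewrite /u -mulmxA Jac_inv// mulmx1.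
rewrite mulNmx bilDl !bilNl.
have E : bil (G j x) (Gam2 g i x v v *m J) (u *m J) = bil (G i x) (Gam2 g i x v v) u.
  by rewrite bil_mulmx -gram_Jac.
rewrite E.
have SC : S u v = S v u by exact: (hess_sym u v ix tT).
have H1 := Gam_lower g (v *m J) (v *m J) (u *m J) jx.
have H2 := Gam_lower g v v u ix.
have H3 := dG_Jac v u v ix tT.
have H4 := dG_Jac v v u ix tT; rewrite -/S SC in H4.
have H5 := bil_sym (v *m J) (S v u) sG.
have alg (X Y A1 A2 a b c e e' : R) : X = 2^-1 * (a + a - b) -> Y = 2^-1 * (A1 + A1 - A2) ->
    A1 = a + c + e -> A2 = b + e' + e -> e = e' -> - X = - Y + c.
  by move=> -> -> -> -> ->; field.
exact: (alg _ _ _ _ _ _ _ _ _ H1 H2 H3 H4 H5).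
Qed.

End Covariance.

(** * Geodesics, exit time and flow *)

Section DerivWithin.
Context {R : realType} {m : nat}.
Implicit Types (A : set R) (c : R -> 'rV[R]_m) (l : 'rV[R]_m).

Lemma deriv_quot c (t : R) l : is_derive t 1 c l ->
  (fun s : R => (s - t)^-1 *: (c s - c t)) @ t^' --> l.
Proof.
move=> [dc E]; have : (fun h : R => h^-1 *: ((c \o shift t) (h *: 1) - c t)) @ 0^' --> l.
  by rewrite -E; exact: dc.
move=> /cvgrPdist_lt H; apply/cvgrPdist_lt => e /H.
rewrite !near_withinE => /nbhs_normP[d /= d0 dH].
apply/nbhs_normP; exists d => //= s ts st.
have := dH (s - t); rewrite /= sub0r normrN distrC => /(_ ts).
rewrite subr_eq0 => /(_ st).
by rewrite /= [(s - t) *: 1]mulr1 subrK.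
Qed.

(** A one-sided or two-sided derivative within A only sees the values on A
    near t. *)
Lemma deriv_withinP A c c' (t : R) l : A t -> is_derive t 1 c l ->
  (\forall s \near t, A s -> c' s = c s) ->
  (fun s : R => (s - t)^-1 *: (c' s - c' t)) @ within A t^' --> l.
Proof.
move=> At dc cc'.
have ct : c' t = c t by have := nbhs_singleton cc'; exact.
have H : (fun s : R => (s - t)^-1 *: (c s - c t)) @ within A t^' --> l.
  by apply: cvg_within_filter; exact: deriv_quot.
apply: cvg_trans H; apply: near_eq_cvg; rewrite near_withinE.
have H2 : \forall s \near t^', A s -> c' s = c s by exact: nbhs_dnbhs.
by apply: filterS H2 => s H As; rewrite H// ct.
Qed.

Lemma quot_continuous A c (t : R) l : A t ->
  (fun s : R => (s - t)^-1 *: (c s - c t)) @ within A t^' --> l ->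
  forall e : R, 0 < e -> exists2 d : R, 0 < d & forall s, A s -> `|t - s| < d -> `|c t - c s| < e.
Proof.
move=> At H e e0.
have /cvgrPdist_lt/(_ _ ltr01) := H; rewrite near_withinE near_withinE => /nbhs_normP[d /= d0 dH].
have l1 : 0 < `|l| + 1 by rewrite ltr_wpDl.
exists (Num.min d (e / (`|l| + 1))); first by rewrite lt_min d0 divr_gt0.
move=> s As; rewrite lt_min => /andP[ts te].
have [->|st] := eqVneq s t; first by rewrite subrr normr0.
have H1 := dH s ts st As.
have st0 : s - t != 0 by rewrite subr_eq0.
have -> : c t - c s = - ((s - t) *: ((s - t)^-1 *: (c s - c t))).
  by rewrite scalerA divff// scale1r opprB.
rewrite normrN normrZ.
apply: (@le_lt_trans _ _ (`|s - t| * (`|l| + 1))).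
  rewrite ler_wpM2l// -[(s - t)^-1 *: _](subrK l).
  rewrite (le_trans (ler_normD _ _))// addrC lerD2l distrC ltW//.
by rewrite -ltr_pdivlMr// distrC.
Qed.

Lemma quot_is_derive (L : R) c (t : R) l : 0 < t < L ->
  (fun s : R => (s - t)^-1 *: (c s - c t)) @ within `[0, L] t^' --> l ->
  is_derive t 1 c l.
Proof.
move=> /andP[t0 tL] H.
have C : (fun h : R => h^-1 *: ((c \o shift t) (h *: 1) - c t)) @ 0^' --> l.
  apply/cvgrPdist_lt => e e0.
  have /cvgrPdist_lt/(_ _ e0) := H; rewrite near_withinE near_withinE => /nbhs_normP[d /= d0 dH].
  rewrite near_withinE; apply/nbhs_normP.
  exists (Num.min d (Num.min t (L - t))); first by rewrite /= !lt_min d0 t0 subr_gt0.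
  move=> h /=; rewrite sub0r normrN !lt_min => /and3P[h1 h2 h3] hn.
  have := dH (h + t); rewrite /ball_ /= opprD addrCA subrr addr0 normrN => /(_ h1).
  have -> : h + t != t by rewrite -subr_eq0 addrK.
  move=> /(_ isT); rewrite /= in_itv/= addrK [h *: 1]mulr1; apply.
  by move: h2 h3; rewrite !ltr_norml => /andP[? ?] /andP[? ?]; apply/andP; split; lra.
split; first by apply/cvg_ex; exists l; exact: C.
exact: cvg_lim C.
Qed.

End DerivWithin.

(** The supremum of the initial segments on which P holds cannot be smaller
    than L. *)
Lemma interval_induction (R : realType) (P : R -> Prop) (L : R) : 0 <= L -> P 0 ->
  (forall s, 0 < s <= L -> (forall t, 0 <= t < s -> P t) -> P s) ->
  (forall s, 0 <= s < L -> (forall t, 0 <= t <= s -> P t) ->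
     exists2 e : R, 0 < e & forall t, s <= t <= s + e -> t <= L -> P t) ->
  forall t, 0 <= t <= L -> P t.
Proof.
move=> L0 P0 Pl Pr.
pose A := [set s | 0 <= s <= L /\ forall t, 0 <= t <= s -> P t].
have A0 : A 0.
  split; first by rewrite lexx.
  by move=> t /andP[t0 t1]; have -> : t = 0 by apply/eqP; rewrite eq_le t0 t1.
have hA : has_sup A by split; [exists 0|exists L => s [/andP[]]].
pose s := sup A.
have s0 : 0 <= s by apply: sup_upper_bound.
have sL : s <= L by apply: ge_sup; [case: hA|move=> t [/andP[]]].
have Plt t : 0 <= t < s -> P t.
  move=> /andP[t0 ts]; have [a [_ aP] ta] := sup_gt (ex_intro _ 0 A0) ts.
  by apply: aP; rewrite t0 ltW.
have Ps : P s.
  have [<-//|s0'] := eqVneq 0 s.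
  by apply: Pl => //; rewrite sL lt_neqAle s0' s0.
have Pall t : 0 <= t <= s -> P t.
  move=> /andP[t0]; rewrite le_eqVlt => /orP[/eqP->//|ts].
  by apply: Plt; rewrite t0.
have sE : s = L.
  apply/eqP; rewrite eq_le sL leNgt; apply/negP => sL'.
  have [e e0 He] := Pr s (ltac:(by rewrite s0 sL')) Pall.
  pose s' := Num.min L (s + e).
  have As' : A s'.
    split.
      rewrite ge_min lexx andbT le_min; apply/andP; split => //; lra.
    move=> t /andP[t0]; rewrite le_min => /andP[tL te].
    case: (leP t s) => ts; first by apply: Pall; rewrite t0.
    by apply: He => //; rewrite te ltW.
  have := @sup_upper_bound R A hA _ As'; rewrite -/s ge_min => /orP[]; lra.
by move=> t; rewrite -sE; exact: Pall.
Qed.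

Section GeodesicODE.
Context {R : realType} {n : nat}.
Variable M : bmanifold R n.
Variable g : metric M.
Local Notation vec := 'rV[R]_n.+1.
Local Notation svec := 'rV[R]_(n.+1 + n.+1).
Local Notation idx := (cidx (atlas M)).
Implicit Types (i j : idx) (x y : M) (u v w : vec) (z : R -> svec).

Definition state i (q : M * tvec M) : svec := row_mx (crd i q.1) (q.2 i).

(** The geodesic equation as a first order system, for an extended metric. *)
Definition gfield (Gt : vec -> 'M[R]_n.+1) (z : svec) : svec :=
  row_mx (rsubmx z) (\row_k - \sum_l \sum_q christ_ext Gt (lsubmx z) k l q
     * rsubmx z 0 l * rsubmx z 0 q).

Lemma norm_lsubmx (z : svec) : `|lsubmx z| <= `|z|.
Proof. by apply: mx_norm_le => // a b; rewrite mxE; exact: ler_mx_norm_coef. Qed.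

Lemma norm_row_mx (u v : vec) (e : R) : 0 <= e -> `|u| <= e -> `|v| <= e -> `|row_mx u v : svec| <= e.
Proof.
move=> e0 ue ve; apply: mx_norm_le => // a b; rewrite mxE.
by case: (fintype.split b) => k; [apply: le_trans ue|apply: le_trans ve]; exact: ler_mx_norm_coef.
Qed.

Lemma Ball_lsubmx (c z : svec) d : Ball c d z -> Ball (lsubmx c) d (lsubmx z).
Proof.
apply: le_lt_trans; have -> : lsubmx c - lsubmx z = lsubmx (c - z) by rewrite linearB.
exact: norm_lsubmx.
Qed.

Lemma gfield_smooth i p Gt d c k : gram_ext g i p Gt d -> lsubmx c = crd i p ->
  Cinf (Ball c d) (fun z : svec => gfield Gt z 0 k).
Proof.
move=> gE cp; have oB := Ball_open c d.
have CX (q : 'I_n.+1) : Cinf (Ball c d) (fun z : svec => lsubmx z 0 q).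
  apply: (@Cinf_eq _ _ _ (fun z : svec => z 0 (lshift _ q))) => //; last exact: Cinf_coord.
  by move=> z _; rewrite mxE.
have CV (q : 'I_n.+1) : Cinf (Ball c d) (fun z : svec => rsubmx z 0 q).
  apply: (@Cinf_eq _ _ _ (fun z : svec => z 0 (rshift _ q))) => //; last exact: Cinf_coord.
  by move=> z _; rewrite mxE.
have [a|a] := splitP k => ka.
  have -> : k = lshift n.+1 a by apply: val_inj.
  apply: (@Cinf_eq _ _ _ (fun z : svec => rsubmx z 0 a)) => // z _.
  by rewrite /gfield row_mxEl.
have -> : k = rshift n.+1 a by apply: val_inj.
apply: (@Cinf_eq _ _ _ (fun z : svec => - \sum_l \sum_q christ_ext Gt (lsubmx z) a l q
     * rsubmx z 0 l * rsubmx z 0 q)) => //.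
  by move=> z _; rewrite /gfield row_mxEr mxE.
apply: Cinf_opp => //; apply: Cinf_sum => // l _; apply: Cinf_sum => // q _.
apply: Cinf_mul => //; apply: Cinf_mul => //.
apply: (Cinf_comp (O' := Ball (crd i p) d) oB (Ball_open _ _) _ CX (christ_ext_smooth a l q gE)).
by move=> z /Ball_lsubmx; rewrite cp.
Qed.

Lemma gfieldE i p Gt d (q : M * tvec M) : cdom i p -> gram_ext g i p Gt d ->
  cdom i q.1 -> Ball (crd i p) d (crd i q.1) ->
  gfield Gt (state i q) = row_mx (q.2 i) (- Gam2 g i q.1 (q.2 i) (q.2 i)).
Proof.
move=> ip gE iq qB; rewrite /gfield /state row_mxKl row_mxKr; congr row_mx.
apply/rowP => k; rewrite mxE [RHS]mxE Gam2E; congr (- _).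
apply: eq_bigr => l _; apply: eq_bigr => m _.
by rewrite (christ_extE k l m ip gE iq qB).
Qed.

(** For d small enough the image of the chart contains the whole half-ball;
    the solutions of the geodesic equation in that half-ball are then curves
    in M. *)
Definition full_ball i p d := forall X, Ball (crd i p) d X -> 0 <= X 0 ord0 ->
  exists2 y, cdom i y & crd i y = X.

Lemma geodesic_chart_change i y (X V : R -> vec) (t L : R) (zeta : R -> M * tvec M) (j : idx) :
  0 <= t <= L -> cdom i y -> cdom j y -> (zeta t).1 = y ->
  (forall s, 0 <= s <= L -> [/\ cdom i (zeta s).1, crd i (zeta s).1 = X s &
     (zeta s).2 = tv i (zeta s).1 (V s)]) ->
  is_derive t 1 X (V t) -> is_derive t 1 V (- Gam2 g i y (V t) (V t)) ->
  deriv_within `[0, L] (fun s => crd j (zeta s).1) t ((zeta t).2 j) /\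
  deriv_within `[0, L] (fun s => (zeta s).2 j) t
    (\row_k - \sum_(l < n.+1) \sum_(m < n.+1)
       christoffel g j (zeta t).1 k l m * (zeta t).2 j 0 l * (zeta t).2 j 0 m).
Proof.
move=> t0L iy jy yE H DX DV.
have [T [e tT]] := transitionP iy jy; have yB := transition_center iy tT.
have [e0 CT TE full] := tT; have oB := Ball_open (crd i y) e.
have [_ yX zt] := H t t0L; rewrite yE in yX zt.
have cX : {for t, continuous X}.
  by have [dX _] := DX; apply: differentiable_continuous; apply/derivable1_diffP.
have [r r0 Hr] := (cont_normP _ _).1 cX _ e0.
have near_in : \forall s \near t, [set` `[0, L]] s -> Ball (crd i y) e (crd i (zeta s).1) /\ cdom i (zeta s).1.
  apply/nbhs_normP; exists r => //= s ts; rewrite in_itv/= => s0L.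
  by have [is_ -> _] := H s s0L; split=> //; rewrite /Ball/= yX; exact: Hr.
have A : [set` `[0, L]] t by rewrite /= in_itv.
have XB : Ball (crd i y) e (X t) by rewrite -yX.
have dT s k : Ball (crd i y) e (X s) -> is_derive s 1 X (V s) ->
    is_derive s 1 (fun s => T (X s) 0 k) (\sum_q V s 0 q * 'D_(delta_mx 0 q) (fun Y => T Y 0 k) (X s)).
  by move=> sB [dX EX]; have := is_derive_compC1 dX oB (CT k 1%N) sB; rewrite EX.
have JE q k : 'D_(delta_mx 0 q) (fun Y => T Y 0 k) (X t) = Jac i j y q k.
  by rewrite (JacE q k iy tT iy yB) yX.
split.
  apply: (@deriv_withinP R n.+1 [set` `[0, L]] (fun s => T (X s))) => //.
    apply: is_derive_mxP => a k; rewrite ord1.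
    apply: (is_derive_eq (dT t k XB DX)).
    by rewrite zt tv_chart// mxE; apply: eq_bigr => q _; rewrite JE.
  apply: filterS near_in => s Hs As; have [sB is_] := Hs As.
  have [js Es] := TE _ is_ sB; rewrite Es.
  by move: As; rewrite /= in_itv/= => As; have [_ -> _] := H s As.
pose W s : vec := \row_k \sum_q V s 0 q * 'D_(delta_mx 0 q) (fun Y => T Y 0 k) (X s).
have vJ : (zeta t).2 j = V t *m Jac i j y by rewrite zt tv_chart.
have -> : (\row_k - \sum_(l < n.+1) \sum_(m < n.+1)
       christoffel g j (zeta t).1 k l m * (zeta t).2 j 0 l * (zeta t).2 j 0 m) =
   - Gam2 g i y (V t) (V t) *m Jac i j y + hess T (crd i y) (V t) (V t).
  rewrite -(Gam2_Jac g (V t) iy tT) -vJ yE; apply/rowP => k.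
  by rewrite mxE [RHS]mxE Gam2E.
apply: (@deriv_withinP R n.+1 [set` `[0, L]] W) => //; last first.
  apply: filterS near_in => s Hs As; have [sB is_] := Hs As.
  have [js Es] := TE _ is_ sB.
  move: (As); rewrite /= in_itv/= => s0L; have [_ sX ->] := H s s0L.
  rewrite tv_chart//; apply/rowP => k; rewrite !mxE; apply: eq_bigr => q _.
  by rewrite (JacE q k iy tT is_ sB) sX.
apply: is_derive_mxP => a k; rewrite ord1.
have -> : (fun s => W s 0 k) = (fun s => \sum_q V s 0 q * 'D_(delta_mx 0 q) (fun Y => T Y 0 k) (X s)).
  by apply/funext => s; rewrite mxE.
have DD q : is_derive t 1 (fun s => 'D_(delta_mx 0 q) (fun Y => T Y 0 k) (X s))
   (\sum_r V t 0 r * 'D_(delta_mx 0 r) ('D_(delta_mx 0 q) (fun Y => T Y 0 k)) (X t)).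
  have [dX EX] := DX.
  by have := is_derive_compC1 dX oB (Cinf_D (delta_mx 0 q) (CT k) 1%N) XB; rewrite EX.
have H1 := is_derive_fsum (fun q => is_deriveM (is_derive_coef 0 q DV) (DD q)).
apply: (is_derive_eq H1).
rewrite big_split/= addrC [RHS]mxE; congr (_ + _).
  rewrite mxE; apply: eq_bigr => q _.
  by rewrite JE [_ *: _]/(_ * _) mulrC.
rewrite mxE -yX.
have Dv : 'D_(V t) (fun Y => T Y 0 k) =1 (fun Y => 'D_(V t) (fun Y => T Y 0 k) Y) by [].
have CvT := Cinf_D (V t) (CT k).
have E2 : 'D_(V t) ('D_(V t) (fun Y => T Y 0 k)) (crd i y) =
   'D_(V t) (fun Y => \sum_q V t 0 q * 'D_(delta_mx 0 q) (fun Y => T Y 0 k) Y) (crd i y).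
  apply: (@eq_derive_open _ _ _ (Ball (crd i y) e)) => // Y; rewrite inE => YB.
  exact: (derive_sum_coord _ oB (CT k 1%N) YB).
rewrite E2.
have D3 q : is_derive (crd i y) (V t) (fun Y => V t 0 q * 'D_(delta_mx 0 q) (fun Y => T Y 0 k) Y)
   (V t 0 q * \sum_r V t 0 r * 'D_(delta_mx 0 r) ('D_(delta_mx 0 q) (fun Y => T Y 0 k)) (crd i y)).
  have CD := Cinf_D (delta_mx 0 q) (CT k).
  rewrite -(derive_sum_coord (V t) oB (CD 1%N) yB).
  have d0 : derivable ('D_(delta_mx 0 q) (fun Y => T Y 0 k)) (crd i y) (V t).
    exact: Cinf_derivable CD _ _ yB.
  apply: (is_derive_eq (is_deriveM (is_derive_cst (V t 0 q) _ _) (derivableP d0))).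
  by rewrite scaler0 addr0.
by have [_ ->] := is_derive_fsum D3.
Qed.

(** In the chart i the equation holds by construction; in every other chart it
    follows from covariance. *)
Lemma geodesic_of_ode i p Gt d c z (T L : R) : cdom i p -> gram_ext g i p Gt d ->
  full_ball i p d -> lsubmx c = crd i p ->
  0 <= L < T -> (forall t, - T < t < T -> Ball c d (z t)) ->
  (forall t, - T < t < T -> is_derive t 1 z (gfield Gt (z t))) ->
  (forall t, 0 <= t <= L -> 0 <= lsubmx (z t) 0 ord0) ->
  exists2 zeta, geodesic g L zeta &
    forall t, 0 <= t <= L -> cdom i (zeta t).1 /\ state i (zeta t) = z t.
Proof.
move=> ip gE fb cp /andP[L0 LT] zB zD zpos.
have inT t : 0 <= t <= L -> - T < t < T by move=> /andP[? ?]; apply/andP; split; lra.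
have /choice[pt Hpt] : forall t, exists y, 0 <= t <= L -> cdom i y /\ crd i y = lsubmx (z t).
  move=> t; case: (asboolP (0 <= t <= L)) => tL; last by exists p.
  have [||y iy yE] := fb (lsubmx (z t)); last by exists y.
    by rewrite -cp; apply: Ball_lsubmx; apply: zB; exact: inT.
  exact: zpos.
pose X t := lsubmx (z t); pose V t := rsubmx (z t).
pose zeta t : M * tvec M := (pt t, tv i (pt t) (V t)).
have DX t : 0 <= t <= L -> is_derive t 1 X (V t).
  move=> /inT/zD D; apply: is_derive_mxP => a k; rewrite ord1.
  have := is_derive_coef 0 (lshift n.+1 k) D; rewrite /gfield row_mxEl.
  by have -> : (fun t => X t 0 k) = (fun t => z t 0 (lshift n.+1 k)) by apply/funext => s; rewrite mxE.
have cX t : 0 <= t <= L -> {for t, continuous X}.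
  by move=> /DX[dX _]; apply: differentiable_continuous; apply/derivable1_diffP.
have DV t : 0 <= t <= L -> is_derive t 1 V (- Gam2 g i (pt t) (V t) (V t)).
  move=> tL; have [iy yE] := Hpt t tL; have D := zD t (inT t tL).
  apply: is_derive_mxP => a k; rewrite ord1.
  have := is_derive_coef 0 (rshift n.+1 k) D; rewrite /gfield row_mxEr.
  have -> : (fun t => V t 0 k) = (fun t => z t 0 (rshift n.+1 k)) by apply/funext => s; rewrite mxE.
  have yB : Ball (crd i p) d (crd i (pt t)).
    by rewrite yE -cp; apply: Ball_lsubmx; apply: zB; exact: inT.
  move=> H; apply: (is_derive_eq H); rewrite mxE [RHS]mxE Gam2E; congr (- _).
  apply: eq_bigr => l _; apply: eq_bigr => m _.
  by rewrite (christ_extE k l m ip gE iy yB) yE.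
have zE t : 0 <= t <= L -> [/\ cdom i (zeta t).1, crd i (zeta t).1 = X t &
     (zeta t).2 = tv i (zeta t).1 (V t)].
  by move=> tL; have [? ?] := Hpt t tL.
exists zeta; last first.
  move=> t tL; have [iy yE _] := zE t tL; split=> //.
  by rewrite /state yE /zeta /= tvE// hsubmxK.
split.
- apply/subspace_continuousP => t; rewrite /= in_itv/= => tL.
  have [iy yE _] := zE t tL.
  move=> U /nbhs_interior Ui.
  have oU : open (interior U) by exact: open_interior.
  have Uy : interior U (zeta t).1 by exact: nbhs_singleton Ui.
  have [r r0 [_ Hr]] := chart_ball oU Uy iy.
  have [e e0 He] := (cont_normP _ _).1 (cX t tL) _ r0.
  rewrite /= /nbhs/= /within/=; apply/nbhs_normP; exists e => //= s ts.
  rewrite in_itv/= => sL; have [is_ sE _] := zE s sL.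
  apply: interior_subset; apply: Hr => //; rewrite /Ball/= yE sE; exact: He.
- by move=> t tL; have [iy _ ->] := zE t tL; exact: tv_tangent.
- move=> t j tL jt; have [iy yE _] := zE t tL.
  exact: (@geodesic_chart_change i (zeta t).1 X V t L zeta j tL iy jt erefl zE (DX t tL) (DV t tL)).
Qed.

Lemma geodesic_restrict (L L' : R) zeta : 0 <= L' <= L -> geodesic g L zeta -> geodesic g L' zeta.
Proof.
move=> /andP[L'0 LL] [g1 g2 g3].
have sub : [set` `[0, L']] `<=` [set` `[0, L]].
  by move=> t /=; rewrite !in_itv/= => /andP[-> /le_trans->].
have tL t : 0 <= t <= L' -> 0 <= t <= L by move=> /andP[-> /le_trans->].
split; first exact: continuous_subspaceW g1.
- by move=> t /tL; exact: g2.
- move=> t i /tL tL' it; have [d1 d2] := g3 t i tL' it.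
  have W (c : R -> vec) l : deriv_within `[0, L] c t l -> deriv_within `[0, L'] c t l.
    move=> /cvgrPdist_lt H; apply/cvgrPdist_lt => e e0.
    have := H e e0; rewrite !near_withinE => H1.
    by apply: filterS H1 => s H2 st s'; apply: H2 => //; exact: sub.
  by split; exact: W.
Qed.

Lemma lt0_dist_absurd (a b : R) : a < 0 -> 0 <= b -> `|a - b| < - a -> False.
Proof. by move=> a0 b0; rewrite ltr_norml => /andP[? ?]; lra. Qed.

(** A geodesic that starts as the solution z follows it. The points reached
    are in the chart i because the limit point, which is in the half-ball
    covered by the chart, is the only possible limit in a Hausdorff space;
    once there, local uniqueness for the differential equation applies. *)
Lemma geodesic_unique i p Gt d (c : svec) (z : R -> svec) (K T L : R)
  (zeta : R -> M * tvec M) : cdom i p -> gram_ext g i p Gt d ->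
  full_ball i p d -> lsubmx c = crd i p -> 0 <= K ->
  (forall z1 z2 : svec, Ball c (d / 2) z1 -> Ball c (d / 2) z2 ->
     `|gfield Gt z1 - gfield Gt z2| <= K * `|z1 - z2|) ->
  (forall t, - T < t < T -> Ball c (d / 2) (z t)) ->
  (forall t, - T < t < T -> is_derive t 1 z (gfield Gt (z t))) ->
  0 <= L < T -> geodesic g L zeta -> cdom i (zeta 0).1 -> state i (zeta 0) = z 0 ->
  forall t, 0 <= t <= L -> cdom i (zeta t).1 /\ state i (zeta t) = z t.
Proof.
move=> ip gE fb cp K0 FL zB zD /andP[L0 LT] [g1 g2 g3] i0 s0.
have d0 : 0 < d by case: gE.
have d2d : d / 2 <= d by lra.
have inT t : 0 <= t <= L -> - T < t < T by move=> /andP[? ?]; apply/andP; split; lra.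
have cz t : 0 <= t <= L -> {for t, continuous z}.
  by move=> /inT/zD[dz _]; apply: differentiable_continuous; apply/derivable1_diffP.
have inL t : 0 <= t <= L -> [set` `[0, L]] t by rewrite /= in_itv.
have c1 t : 0 <= t <= L -> (zeta s).1 @[s --> within [set` `[0, L]] (nbhs t)] --> (zeta t).1.
  by move=> /inL; move/subspace_continuousP : g1; exact.
have cS t : 0 <= t <= L -> cdom i (zeta t).1 -> forall e : R, 0 < e ->
    exists2 r : R, 0 < r & forall s, 0 <= s <= L -> `|t - s| < r ->
      cdom i (zeta s).1 /\ `|state i (zeta t) - state i (zeta s)| < e.
  move=> tL it e e0; have [D1 D2] := g3 t i tL it.
  have [r1 r10 H1] := quot_continuous (inL _ tL) D1 e0.
  have [r2 r20 H2] := quot_continuous (inL _ tL) D2 e0.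
  have nU : nbhs (zeta t).1 (cdom i) by apply: open_nbhs_nbhs; split=> //; exact: chart_dom_open.
  have := c1 t tL _ nU; rewrite /= /nbhs/= /within/= => /nbhs_normP[r3 /= r30 H3].
  exists (Num.min r1 (Num.min r2 r3)); first by rewrite !lt_min r10 r20.
  move=> s sL; rewrite !lt_min => /and3P[t1 t2 t3]; split; first by apply: H3 => //; exact: inL.
  have -> : state i (zeta t) - state i (zeta s) =
     row_mx (crd i (zeta t).1 - crd i (zeta s).1) ((zeta t).2 i - (zeta s).2 i).
    by rewrite /state opp_row_mx add_row_mx.
  have h1 := H1 s (inL _ sL) t1; have h2 := H2 s (inL _ sL) t2.
  pose m := Num.max `|crd i (zeta t).1 - crd i (zeta s).1| `|(zeta t).2 i - (zeta s).2 i|.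
  apply: (@le_lt_trans _ _ m); last by rewrite gt_max h1.
  by apply: norm_row_mx; rewrite ?le_max ?normr_ge0 ?lexx ?orbT.
pose P t := cdom i (zeta t).1 /\ state i (zeta t) = z t.
apply: (@interval_induction _ P) => //.
- move=> t /andP[t0 tL] Pt.
  have tL' : 0 <= t <= L by rewrite ltW.
  have left (e : R) : 0 < e -> exists s, [/\ 0 <= s <= L, `|t - s| < e & P s].
    move=> e0; pose s := t - Num.min (t / 2) (e / 2).
    have m0 : 0 < Num.min (t / 2) (e / 2) by rewrite lt_min !divr_gt0.
    have m1 : Num.min (t / 2) (e / 2) <= t / 2 by rewrite ge_min lexx.
    have m2 : Num.min (t / 2) (e / 2) <= e / 2 by rewrite ge_min lexx orbT.
    exists s; split; rewrite /s; first by apply/andP; split; lra.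
      by rewrite opprB addrC subrK gtr0_norm//; lra.
    by apply: Pt; apply/andP; split; lra.
  have Xpos : 0 <= lsubmx (z t) 0 ord0.
    rewrite leNgt; apply/negP => Xn.
    have [r r0 Hr] := (cont_normP _ _).1 (cz t tL') (- lsubmx (z t) 0 ord0) (ltac:(by rewrite oppr_gt0)).
    have [s [sL ts [is_ sE]]] := left r r0.
    have := Hr s ts; rewrite -sE => /(le_lt_trans (norm_lsubmx _)).
    have -> : lsubmx (z t - state i (zeta s)) = lsubmx (z t) - crd i (zeta s).1.
      by rewrite linearB/= /state row_mxKl.
    move=> /(le_lt_trans (ler_mx_norm_coef _ 0 ord0)).
    rewrite [(lsubmx (z t) - crd i (zeta s).1) 0 ord0]mxE [(- crd i _) _ _]mxE.
    exact: lt0_dist_absurd Xn (crd_half is_).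
  have [|y iy yE] := fb (lsubmx (z t)) _ Xpos.
    by rewrite -cp; apply: Ball_lsubmx; apply: Ball_sub d2d _ _; apply: zB; exact: inT.
  have yt : (zeta t).1 = y.
    apply/eqP; apply: contrapT => /negP ny.
    have := @space_hausdorff R n M; rewrite open_hausdorff => /(_ _ _ ny).
    move=> [[U W] /= [Ut Wy] [oU oW UW]].
    rewrite !inE in Ut Wy.
    have nU : nbhs (zeta t).1 U by apply: open_nbhs_nbhs.
    have := c1 t tL' _ nU; rewrite /= /nbhs/= /within/= => /nbhs_normP[r1 /= r10 H1].
    have [r2 r20 [_ H2]] := chart_ball oW Wy iy.
    have [r3 r30 H3] := (cont_normP _ _).1 (cz t tL') _ r20.
    have [s [sL]] := left (Num.min r1 r3) (ltac:(by rewrite lt_min r10)).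
    rewrite lt_min => /andP[ts1 ts3] [is_ sE].
    have sU := H1 s ts1 (inL _ sL).
    have sW : W (zeta s).1.
      apply: H2 => //; rewrite /Ball/= yE.
      have := H3 s ts3; rewrite -sE => /(le_lt_trans (norm_lsubmx _)).
      by rewrite linearB/= /state row_mxKl.
    by move/eqP/seteqP : UW => [+ _] => /(_ (zeta s).1); apply.
  have it : cdom i (zeta t).1 by rewrite yt.
  split=> //; apply/eqP; rewrite -subr_eq0 -normr_le0; apply/ler_addgt0Pl => e e0; rewrite addr0.
  have e2 : 0 < e / 2 by rewrite divr_gt0.
  have [r1 r10 H1] := cS t tL' it _ e2.
  have [r3 r30 H3] := (cont_normP _ _).1 (cz t tL') _ e2.
  have [s [sL]] := left (Num.min r1 r3) (ltac:(by rewrite lt_min r10)).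
  rewrite lt_min => /andP[ts1 ts3] [is_ sE].
  have [_ h1] := H1 s sL ts1; have h3 := H3 s ts3.
  rewrite -(subrKA (state i (zeta s))) (le_trans (ler_normD _ _))// [leRHS]splitr lerD ?ltW//.
  by rewrite distrC sE.
- move=> t /andP[t0 tL] Pt.
  have tL' : 0 <= t <= L by rewrite t0 ltW.
  have [it tE] := Pt t (ltac:(by rewrite t0 lexx)).
  have b0 : 0 < d / 2 - `|c - z t|.
    by rewrite subr_gt0; exact: (zB t (inT t tL')).
  have [r r0 Hr] := cS t tL' it _ b0.
  have K1 : 0 < K + 1 by rewrite ltr_wpDl.
  pose e := Num.min (r / 2) (Num.min (L - t) ((K + 1)^-1 / 2)).
  have e0 : 0 < e by rewrite !lt_min subr_gt0 tL !divr_gt0// invr_gt0.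
  have er : e <= r / 2 by rewrite /e ge_min lexx.
  have eL : e <= L - t by rewrite /e !ge_min lexx orbT.
  have eK : e <= (K + 1)^-1 / 2 by rewrite /e !ge_min lexx !orbT.
  have inr s : t <= s <= t + e -> 0 <= s <= L /\ `|t - s| < r.
    move=> /andP[s1 s2]; split; first by clear - s1 s2 eL t0; apply/andP; split; lra.
    by rewrite distrC ger0_norm ?subr_ge0//; clear - s2 er r0; lra.
  have se : t < t + e by rewrite ltrDl.
  have Ke : K * (t + e - t) < 1.
    rewrite addrAC subrr add0r; apply: (@le_lt_trans _ _ ((K + 1) * ((K + 1)^-1 / 2))).
      by apply: ler_pM => //; [exact: ltW|rewrite lerDl].
    by rewrite mulrA mulfV ?gt_eqF// mul1r invf_lt1// ltr1n.
  exists e => // s s1 sL.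
  have dom s' : t <= s' <= t + e -> cdom i (zeta s').1 by move=> /inr[h1 h2]; have [] := Hr s' h1 h2.
  suff E : state i (zeta s) = z s by split=> //; exact: dom.
  apply: (@ode_unique R (n.+1 + n.+1) (Ball c (d / 2)) K t (t + e) (gfield Gt)
    (fun s => state i (zeta s)) z se K0 Ke FL) => //.
  + apply/subspace_continuousP => s'; rewrite /= in_itv/= => s'e.
    have [s'L s'r] := inr s' s'e.
    apply/cvgrPdist_lt => e1 e10; have [r1 r10 H1] := cS s' s'L (dom _ s'e) _ e10.
    rewrite near_withinE; apply/nbhs_normP; exists r1 => //= s2 s2r; rewrite in_itv/= => s2e.
    by have [s2L _] := inr s2 s2e; have [] := H1 s2 s2L s2r.
  + apply/subspace_continuousP => s'; rewrite /= in_itv/= => s'e.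
    by have [/cz cz' _] := inr s' s'e; apply: cvg_within_filter; exact: cz'.
  + move=> s' /inr[h1 h2]; have [_] := Hr s' h1 h2; rewrite tE => H.
    rewrite /Ball/=; have -> : c - state i (zeta s') = (c - z t) + (z t - state i (zeta s')) by rewrite addrA subrK.
    by rewrite (le_lt_trans (ler_normD _ _))// -ltrBrDl.
  + by move=> s' /inr[/inT/zB].
  + move=> s' /andP[h1 h2].
    have s'e : t <= s' <= t + e by rewrite !ltW.
    have [s'L _] := inr s' s'e; have is_ := dom s' s'e.
    have [D1 D2] := g3 s' i s'L is_.
    have s'0 : 0 < s' < L by clear - h1 h2 eL t0; apply/andP; split; lra.
    have E1 := quot_is_derive s'0 D1; have E2 := quot_is_derive s'0 D2.
    have sB : Ball (crd i p) d (crd i (zeta s').1).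
      have := Hr s' s'L (inr s' s'e).2 => -[_]; rewrite tE => H.
      have : Ball c d (state i (zeta s')).
        rewrite /Ball/=; have -> : c - state i (zeta s') = (c - z t) + (z t - state i (zeta s')) by rewrite addrA subrK.
        by rewrite (le_lt_trans (ler_normD _ _))//; move: H; lra.
      by move=> /Ball_lsubmx; rewrite cp /state row_mxKl.
    rewrite (gfieldE ip gE is_ sB).
    apply: is_derive_mxP => a k; rewrite ord1.
    have [b|b] := splitP k => kb.
      have -> : k = lshift n.+1 b by apply: val_inj.
      rewrite row_mxEl.
      have -> : (fun s => state i (zeta s) 0 (lshift n.+1 b)) = (fun s => crd i (zeta s).1 0 b).
        by apply/funext => s2; rewrite /state row_mxEl.
      exact: is_derive_coef E1.
    have -> : k = rshift n.+1 b by apply: val_inj.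
    rewrite row_mxEr.
    have -> : (fun s => state i (zeta s) 0 (rshift n.+1 b)) = (fun s => (zeta s).2 i 0 b).
      by apply/funext => s2; rewrite /state row_mxEr.
    have := is_derive_coef 0 b E2; rewrite mxE.
    by move=> H; apply: (is_derive_eq H); rewrite [RHS]mxE Gam2E.
  + by move=> s' s'e; apply: zD; apply: inT; have := inr s' (ltac:(by rewrite !ltW; case/andP: s'e)); case.
Qed.

(** If the coordinate 0 of the solution becomes negative after tau, no
    geodesic can follow it beyond tau; so tau is the exit time, and the choice
    made in the definition of the flow is forced by uniqueness. *)
Lemma flow_exit i p Gt d (c : svec) (z : R -> svec) (K T tau : R)
  (q : M * tvec M) : cdom i p -> gram_ext g i p Gt d ->
  full_ball i p d -> lsubmx c = crd i p -> 0 <= K ->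
  (forall z1 z2 : svec, Ball c (d / 2) z1 -> Ball c (d / 2) z2 ->
     `|gfield Gt z1 - gfield Gt z2| <= K * `|z1 - z2|) ->
  (forall t, - T < t < T -> Ball c (d / 2) (z t)) ->
  (forall t, - T < t < T -> is_derive t 1 z (gfield Gt (z t))) ->
  tangent q.1 q.2 -> cdom i q.1 -> state i q = z 0 -> 0 <= tau < T ->
  (forall t, 0 <= t <= tau -> 0 <= lsubmx (z t) 0 ord0) ->
  (forall t, tau < t < T -> lsubmx (z t) 0 ord0 < 0) ->
  exit_time g q = tau%:E /\
  forall t, 0 <= t <= tau -> [/\ cdom i (flow g t q).1, state i (flow g t q) = z t &
    tangent (flow g t q).1 (flow g t q).2].
Proof.
move=> ip gE fb cp K0 FL zB zD tq iq qE /andP[tau0 tauT] zpos zneg.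
have d0 : 0 < d by case: gE.
have d2d : d / 2 <= d by lra.
have zB' t : - T < t < T -> Ball c d (z t) by move=> /zB; exact: Ball_sub.
have start zeta L : 0 <= L -> geodesic g L zeta -> cdom i (zeta 0).1 -> state i (zeta 0) = z 0 ->
    zeta 0 = q.
  move=> L0 [_ g2 _] i0 E0.
  have t0 := g2 0 (ltac:(by rewrite lexx L0)).
  move: E0; rewrite -qE /state => /eq_row_mx[e1 e2].
  have p1 : (zeta 0).1 = q.1 by exact: chart_inj i0 iq e1.
  move: t0 e2 p1; case: (zeta 0) => a b /= ta e2 p1; subst a.
  by rewrite (tangent_eq iq ta tq e2) -surjective_pairing.
have ex L : 0 <= L <= tau -> exists zeta, geodesic g L zeta /\ zeta 0 = q.
  move=> /andP[L0 Lt]; have LT : 0 <= L < T by rewrite L0 (le_lt_trans Lt).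
  have [|zeta gz zE] := geodesic_of_ode ip gE fb cp LT zB' zD.
    by move=> t /andP[t0 tL]; apply: zpos; rewrite t0 (le_trans tL).
  exists zeta; split=> //; have [i0 E0] := zE 0 (ltac:(by rewrite lexx L0)).
  exact: start gz i0 E0.
have un L zeta : 0 <= L < T -> geodesic g L zeta -> zeta 0 = q -> forall t, 0 <= t <= L ->
    cdom i (zeta t).1 /\ state i (zeta t) = z t.
  move=> LT gz z0; apply: (geodesic_unique ip gE fb cp K0 FL zB zD LT gz); by rewrite z0.
split.
  apply/eqP; rewrite eq_le; apply/andP; split.
    apply: ge_ereal_sup => _ [L [L0 [zeta [gz z0]]] <-]; rewrite lee_fin leNgt; apply/negP => tL.
    pose L' := Num.min L ((tau + T) / 2).
    have L'L : L' <= L by rewrite /L' ge_min lexx.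
    have L'T : L' < T by rewrite /L'; have := ge_min ((tau + T) / 2) L ((tau + T) / 2); rewrite lexx orbT => ?; lra.
    have tL' : tau < L' by rewrite /L' lt_min tL/=; lra.
    have L'0 : 0 <= L' by lra.
    have gz' : geodesic g L' zeta by apply: geodesic_restrict gz; rewrite L'0.
    have [iL LE] := un L' zeta (ltac:(by rewrite L'0)) gz' z0 L' (ltac:(by rewrite L'0 lexx)).
    have := zneg L' (ltac:(by rewrite tL')); rewrite -LE /state row_mxKl.
    by rewrite ltNge crd_half.
  by apply: ereal_sup_ubound; exists tau => //; split=> //; apply: ex; rewrite tau0 lexx.
move=> t /andP[t0 ttau].
have [zeta [gz z0]] := ex t (ltac:(by rewrite t0)).
have : [set w | exists zeta, [/\ geodesic g t zeta, zeta 0 = q & zeta t = w]] (flow g t q).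
  by apply: xgetPex; exists (zeta t), zeta.
move=> [zeta' [gz' z0' <-]].
have [it tE] := un t zeta' (ltac:(by rewrite t0 (le_lt_trans ttau))) gz' z0' t (ltac:(by rewrite t0 lexx)).
by split=> //; have [_ g2 _] := gz'; apply: g2; rewrite t0 lexx.
Qed.

End GeodesicODE.

(** * Glancing geodesics *)

Section Glancing.
Context {R : realType} {n : nat}.
Variable M : bmanifold R n.
Variable g : metric M.
Local Notation vec := 'rV[R]_n.+1.
Local Notation svec := 'rV[R]_(n.+1 + n.+1).
Local Notation idx := (cidx (atlas M)).
Local Notation G := (gram g).
Implicit Types (i j : idx) (x y p : M) (u v w : vec).

Lemma is_derive_lsubmx (z : R -> svec) (t : R) l : is_derive t 1 z l ->
  is_derive t 1 (fun t => lsubmx (z t)) (lsubmx l).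
Proof.
move=> D; apply: is_derive_mxP => a k; rewrite ord1 mxE.
have -> : (fun t => lsubmx (z t) 0 k) = (fun t => z t 0 (lshift n.+1 k)).
  by apply/funext => s; rewrite mxE.
exact: is_derive_coef D.
Qed.

Lemma is_derive_rsubmx (z : R -> svec) (t : R) l : is_derive t 1 z l ->
  is_derive t 1 (fun t => rsubmx (z t)) (rsubmx l).
Proof.
move=> D; apply: is_derive_mxP => a k; rewrite ord1 mxE.
have -> : (fun t => rsubmx (z t) 0 k) = (fun t => z t 0 (rshift n.+1 k)).
  by apply/funext => s; rewrite mxE.
exact: is_derive_coef D.
Qed.

Lemma gfield_at i p Gt d y (z : svec) : cdom i p -> gram_ext g i p Gt d ->
  cdom i y -> crd i y = lsubmx z -> Ball (crd i p) d (lsubmx z) ->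
  gfield Gt z = row_mx (rsubmx z) (- Gam2 g i y (rsubmx z) (rsubmx z)).
Proof.
move=> ip gE iy yz zB; rewrite -yz in zB.
have := gfieldE (q := (y, tv i y (rsubmx z))) ip gE iy zB.
by rewrite /state /= tvE// yz hsubmxK.
Qed.

(** The derivative of g(X', X') along a solution is dG(X')(X', X') - 2
    g(Gamma(X', X'), X') = 0. *)
Lemma speed_const i p Gt d (c : svec) (z : R -> svec) (tau : R) : cdom i p ->
  gram_ext g i p Gt d -> lsubmx c = crd i p ->
  (forall t, 0 <= t <= tau -> [/\ Ball c d (z t), is_derive t 1 z (gfield Gt (z t)) &
     exists2 y, cdom i y & crd i y = lsubmx (z t)]) ->
  forall t, 0 <= t <= tau -> bil (Gt (lsubmx (z t))) (rsubmx (z t)) (rsubmx (z t)) =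
    bil (Gt (lsubmx (z 0))) (rsubmx (z 0)) (rsubmx (z 0)).
Proof.
move=> ip gE cp H.
have [d0 CG GtE Gsym Gun] := gE.
pose f t := bil (Gt (lsubmx (z t))) (rsubmx (z t)) (rsubmx (z t)).
have D t : 0 <= t <= tau -> is_derive t 1 f 0.
  move=> tt; have [zB zD [y iy yE]] := H t tt.
  have XB : Ball (crd i p) d (lsubmx (z t)) by rewrite -cp; exact: Ball_lsubmx.
  have XB' : Ball (crd i p) d (crd i y) by rewrite yE.
  have gz := gfield_at ip gE iy yE XB.
  have DX := is_derive_lsubmx zD; have DV := is_derive_rsubmx zD.
  rewrite gz row_mxKl in DX; rewrite gz row_mxKr in DV.
  have DG : is_derive t 1 (fun t => Gt (lsubmx (z t))) (dG g i y (rsubmx (z t))).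
    apply: is_derive_mxP => a k.
    have [dX EX] := DX.
    have := is_derive_compC1 dX (Ball_open (crd i p) d) (CG a k 1%N) XB; rewrite EX => DC.
    apply: (is_derive_eq DC).
    rewrite (dGE _ ip gE iy XB') mxE yE.
    by rewrite (derive_sum_coord _ (Ball_open (crd i p) d) (CG a k 1%N) XB).
  apply: (is_derive_eq (derive_bil3 DG DV DV)).
  have GE : Gt (lsubmx (z t)) = G i y by rewrite GtE// yE.
  rewrite GE; move: (rsubmx (z t)) => V.
  have -> : bil (G i y) V (- Gam2 g i y V V) = bil (G i y) (- Gam2 g i y V V) V.
    by apply: bil_sym; exact: gram_sym.
  rewrite bilNl Gam_lower//.
  move: (bil (dG g i y V) V V) => b; lra.
move=> t /andP[]; rewrite le_eqVlt => /predU1P[<-//|t0] tt.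
have [|e _ E] := mvt1 t0 (h := f) (h1 := fun=> 0).
  by move=> s /andP[s0 st]; apply: D; rewrite s0 (le_trans st).
by apply/eqP; rewrite -subr_eq0; apply/eqP; rewrite -/(f t) -/(f 0) E mul0r.
Qed.

Lemma sqrt_onem_bound (a : R) : 0 <= a <= 1 ->
  0 <= 1 - Num.sqrt (1 - a ^+ 2) <= a.
Proof.
move=> /andP[a0 a1].
have a2 : 0 <= a ^+ 2 by rewrite sqr_ge0.
have a3 : a ^+ 2 <= a by rewrite expr2 ler_piMl.
have b0 : 0 <= 1 - a ^+ 2 by lra.
have b1 : 1 - a ^+ 2 <= 1 by lra.
have s0 := sqrtr_ge0 (1 - a ^+ 2).
have s1 : Num.sqrt (1 - a ^+ 2) <= 1 by rewrite -[leRHS]sqrtr1 ler_wsqrtr.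
have s2 : (Num.sqrt (1 - a ^+ 2)) ^+ 2 <= Num.sqrt (1 - a ^+ 2) by rewrite expr2 ler_piMl.
by rewrite sqr_sqrtr// in s2; apply/andP; split; lra.
Qed.

(** The unit vectors close to a unit vector w of the boundary, parametrized by
    their component v along the coordinate 0; u is the unit normal and s its
    own component. *)
Definition tilt (s : R) w u (v : R) : vec := Num.sqrt (1 - (v / s) ^+ 2) *: w + (v / s) *: u.

Lemma tilt_unit i p w (v : R) (s := Num.sqrt (invmx (G i p) ord0 ord0)) : cdom i p ->
  w 0 ord0 = 0 -> bil (G i p) w w = 1 -> 0 <= v <= s ->
  let u := tilt s w (nuc (G i p)) v in
  [/\ u 0 ord0 = v, bil (G i p) u u = 1 & `|w - u| <= v / s * (`|w| + `|nuc (G i p)|)].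
Proof.
move=> ip w0 w1 /andP[v0 vs] u.
have s0 : 0 < s by rewrite sqrtr_gt0; exact: ginv00_gt0.
have a01 : 0 <= v / s <= 1 by apply/andP; split; [apply: divr_ge0 => //; exact: ltW|rewrite ler_pdivrMr// mul1r].
have /andP[a0 a1] := a01.
have n0 : nuc (G i p) 0 ord0 = s by apply: nuc0; exact: ginv00_gt0.
split.
- by rewrite /u /tilt mxE [(_ *: w) _ _]mxE w0 mulr0 add0r mxE n0 divfK// gt_eqF.
- have bw : bil (G i p) (nuc (G i p)) w = 0 by rewrite bil_nuc ?gram_unit// w0 mul0r.
  have bn : bil (G i p) (nuc (G i p)) (nuc (G i p)) = 1.
    by rewrite bil_nuc ?gram_unit// n0 divff// gt_eqF.
  have bw' : bil (G i p) w (nuc (G i p)) = 0.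
    by rewrite -bw; apply: bil_sym; exact: gram_sym.
  rewrite /u /tilt; move: (nuc (G i p)) bw bn bw' {n0 u} => m bw bn bw'.
  rewrite !(bilDl, bilDr, bilZl, bilZr) w1 bw bn bw' !mulr0 add0r addr0 !mulr1 -!expr2.
  by rewrite sqr_sqrtr ?subrK// subr_ge0 expr_le1.
- have -> : w - u = (1 - Num.sqrt (1 - (v / s) ^+ 2)) *: w - (v / s) *: nuc (G i p).
    by rewrite /u /tilt scalerBl scale1r opprD addrA.
  have /andP[b0 b1] := sqrt_onem_bound a01.
  move: (nuc (G i p)) => m; rewrite (le_trans (ler_normB _ _))// [`|_ *: w|]normrZ [`|_ *: m|]normrZ mulrDr (ger0_norm b0) (ger0_norm a0).
  by rewrite lerD2r ler_wpM2r.
Qed.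

(** The geodesic issued from q, a unit vector at p with coordinate 0 equal to
    v and close to w: it exits at time tau ~ v / A and its height is A t (tau
    - t), up to factors within de of 1. *)
Definition glancing i p w (A de v : R) (q : M * tvec M) (tau : R) : Prop :=
  [/\ [/\ dplusSM g q, ~ dzeroSM g q, q = (p, tv i p (q.2 i)), q.2 i 0 ord0 = v &
       `|q.2 i - w| < de],
    0 < tau < de, exit_time g q = tau%:E,
    (1 - de) * (A * tau) <= v <= (1 + de) * (A * tau) &
    {within `[0, tau], continuous (fun t => state i (flow g t q))} /\
    forall t, 0 <= t <= tau -> [/\ cdom i (flow g t q).1, SM g (flow g t q),
      `|state i (flow g t q) - row_mx (crd i p) w| < de &
      (1 - de) * (A * (t * (tau - t))) <= crd i (flow g t q).1 0 ord0
        <= (1 + de) * (A * (t * (tau - t)))]].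

(** The acceleration of the coordinate 0 is - 2 A at (p, w), hence within 2 A
    de of it in a neighbourhood, in which all the solutions with small v stay
    for a common time; the comparison with parabolas concludes. *)
Lemma glancing_exists i p w (A de : R) : cdom i p -> boundary M p -> w 0 ord0 = 0 ->
  bil (G i p) w w = 1 -> Gam2 g i p w w 0 ord0 = 2 * A -> 0 < A -> 0 < de < 1 ->
  exists2 v0 : R, 0 < v0 & forall v : R, 0 < v < v0 ->
    exists q, exists tau, glancing i p w A de v q tau.
Proof.
move=> ip bp w0 w1 GA A0 /andP[de0 de1].
have p0 : crd i p 0 ord0 = 0 by apply/boundaryP.
have [Gt [d1 gE1]] := gram_extP g ip.
have [d2 d20 [full2 _]] := chart_ball (A := setT) openT I ip.
have d10 : 0 < d1 by case: gE1.
pose d := Num.min d1 d2.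
have d0 : 0 < d by rewrite lt_min d10.
have gE : gram_ext g i p Gt d by apply: gram_ext_le gE1 => //; rewrite ge_min lexx.
have [_ CG GtE Gsym Gun] := gE.
have fb : full_ball i p d.
  move=> X XB X0; have [|y [_ iy yE]] := full2 X _ X0; last by exists y.
  by apply: Ball_sub XB; rewrite ge_min lexx orbT.
pose c : svec := row_mx (crd i p) w.
have cp : lsubmx c = crd i p by rewrite row_mxKl.
have cw : rsubmx c = w by rewrite row_mxKr.
have CF k := gfield_smooth k gE cp.
have [K [K0 [KB KL]]] := smooth_field_bounds d0 CF.
have [T T0 HT] := ode_exists d0 K0 KB KL.
have cB : Ball c d c by exact: Ball_center.
have pB : Ball (crd i p) d (crd i p) by exact: Ball_center.
pose Phi (z : svec) := gfield Gt z 0 (rshift n.+1 ord0).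
have Phic : Phi c = - (2 * A).
  have cB' : Ball (crd i p) d (lsubmx c) by rewrite cp.
  by rewrite /Phi (gfield_at ip gE ip (esym cp) cB') row_mxEr mxE cw GA.
have cPhi : {for c, continuous Phi} by exact: (Cinf_cont (CF _) cB).
have Ade : 0 < 2 * A * de by rewrite !mulr_gt0.
have [eta eta0 Heta] := (cont_normP _ _).1 cPhi _ Ade.
(* within rho of c the acceleration of the coordinate 0 is within 2 A de of -
   2 A *)
pose rho := Num.min (Num.min eta de) (d / 4).
have rho0 : 0 < rho by rewrite !lt_min eta0 de0 divr_gt0.
have [re [rd rdd]] : rho <= eta /\ rho <= de /\ rho <= d / 4.
  by rewrite /rho !ge_min !lexx !orbT.
have K1 : 0 < K + 1 by rewrite ltr_wpDl.
pose T1 := Num.min (Num.min (T / 2) de) (rho / 2 / (K + 1)).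
have T10 : 0 < T1 by rewrite !lt_min de0 !divr_gt0.
have [T1T [T1de T1K]] : T1 <= T / 2 /\ T1 <= de /\ T1 <= rho / 2 / (K + 1).
  by rewrite /T1 !ge_min !lexx !orbT.
(* up to the time T1 a solution moves by at most rho / 2 *)
have KT1 : K * T1 <= rho / 2.
  apply: le_trans (_ : (K + 1) * T1 <= _); first by rewrite ler_wpM2r ?ltW// ltrDl.
  by rewrite mulrC -ler_pdivlMr.
pose s := Num.sqrt (invmx (G i p) ord0 ord0).
have s0 : 0 < s by rewrite sqrtr_gt0; exact: ginv00_gt0.
pose N := `|w| + `|nuc (G i p)| + 1.
have N0 : 0 < N by rewrite ltr_wpDl// addr_ge0.
pose v0 := Num.min (Num.min s (A * (1 - de) * T1)) (s * (rho / 2 / N)).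
have v00 : 0 < v0.
  by rewrite !lt_min s0 !mulr_gt0 ?subr_gt0 ?invr_gt0 ?divr_gt0.
exists v0 => // v /andP[v_gt0]; rewrite !lt_min -andbA => /and3P[vs vT vN].
have vs' : 0 <= v <= s by rewrite !ltW.
have := tilt_unit ip w0 w1 vs'; rewrite -/s; set u := tilt _ _ _ _ => -[u0 u1 uw].
have uw' : `|w - u| < rho / 2.
  apply: le_lt_trans uw _; apply: (@le_lt_trans _ _ (v / s * N)).
    by rewrite ler_wpM2l ?divr_ge0 ?ltW// ltrDl.
  by rewrite -ltr_pdivlMr// ltr_pdivrMr// mulrC.
pose z0 : svec := row_mx (crd i p) u.
have cz0 : `|c - z0| <= `|w - u|.
  have -> : c - z0 = row_mx 0 (w - u) by rewrite /c /z0 opp_row_mx add_row_mx subrr.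
  by apply: norm_row_mx => //; rewrite normr0.
have [|z [zz0 zK zB zD]] := HT z0; first by rewrite (le_trans cz0)// ltW// (lt_le_trans uw')//; clear - rdd rho0 d0; lra.
pose q : M * tvec M := (p, tv i p u).
have qi : q.2 i = u by rewrite /= tvE.
have near t : 0 <= t <= T1 -> `|c - z t| < rho.
  move=> /andP[t0 tT]; rewrite -(subrKA z0) (le_lt_trans (ler_normD _ _))//.
  have h1 := zK t 0; rewrite zz0 in h1; rewrite sub0r normrN ger0_norm// in h1.
  have h2 : K * t <= rho / 2 by rewrite (le_trans _ KT1)// ler_wpM2l.
  rewrite [ltRHS]splitr ltr_leD ?(le_lt_trans cz0)//; exact: le_trans h2.
have inT t : 0 <= t <= T1 -> - T < t < T.
  by move=> /andP[t0 t1]; clear - t0 t1 T1T T0; apply/andP; split; lra.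
pose h t := lsubmx (z t) 0 ord0; pose h1 t := rsubmx (z t) 0 ord0; pose h2 t := Phi (z t).
have dh t : 0 <= t <= T1 -> is_derive t 1 h (h1 t).
  move=> /inT/zD/is_derive_lsubmx/(is_derive_coef 0 ord0).
  by rewrite /gfield row_mxKl.
have dh1 t : 0 <= t <= T1 -> is_derive t 1 h1 (h2 t).
  by move=> /inT/zD/is_derive_rsubmx/(is_derive_coef 0 ord0); rewrite [X in is_derive _ _ _ X]mxE.
have h2b t : 0 <= t <= T1 -> - (2 * A * (1 + de)) <= h2 t <= - (2 * A * (1 - de)).
  move=> /near/lt_le_trans/(_ re)/Heta; rewrite Phic ltr_norml => /andP[a1 a2].
  by rewrite /h2; move: a1 a2; move: (Phi (z t)) => y a1 a2; clear - a1 a2; apply/andP; split; lra.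
have h00 : h 0 = 0 by rewrite /h zz0 row_mxKl.
have h10 : h1 0 = v by rewrite /h1 zz0 row_mxKr.
have [||tau [/andP[tau0 tauT] hb hn vb]] := @parabola R h h1 h2 T1 A de T10 A0 _ dh dh1 h2b h00.
- by rewrite de0.
- by rewrite h10 v_gt0.
have aa0 : 0 < A * (1 - de) by rewrite mulr_gt0// subr_gt0.
have zpos t : 0 <= t <= tau -> 0 <= lsubmx (z t) 0 ord0.
  move=> tt; have /andP[+ _] := hb t tt; apply: le_trans.
  by move: tt => /andP[t0 tt]; apply: mulr_ge0; [exact: ltW|apply: mulr_ge0 => //; rewrite subr_ge0].
have KL' (z1 z2 : svec) : Ball c (d / 2) z1 -> Ball c (d / 2) z2 ->
    `|gfield Gt z1 - gfield Gt z2| <= K * `|z1 - z2|.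
  by move=> b1 b2; apply: KL; exact: ltW.
have T1T' : T1 <= T by clear - T1T T0; lra.
have inT1 t : - T1 < t < T1 -> - T < t < T.
  by move=> /andP[t0 t1]; clear - t0 t1 T1T'; apply/andP; split; lra.
have tq : tangent q.1 q.2 by exact: tv_tangent.
have qz : state i q = z 0 by rewrite zz0 /state qi.
have tauT1 : 0 <= tau < T1 by rewrite ltW.
have [ex fl] := flow_exit ip gE fb cp K0 KL' (fun t tt => zB t (inT1 t tt))
  (fun t tt => zD t (inT1 t tt)) tq ip qz tauT1 zpos hn.
have sub t : 0 <= t <= tau -> 0 <= t <= T1 by move=> /andP[-> /le_trans]; apply; exact: ltW.
have sp := @speed_const i p Gt d c z tau ip gE cp.
have {}sp t : 0 <= t <= tau -> bil (Gt (lsubmx (z t))) (rsubmx (z t)) (rsubmx (z t)) = 1.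
  move=> tt; rewrite sp//; last first.
    move=> r rr; have [ir rE _] := fl r rr; split.
    - by apply: (Ball_sub _ (zB r (inT r (sub r rr)))); clear - d0; lra.
    - exact: zD (inT r (sub r rr)).
    - by exists (flow g r q).1 => //; rewrite -rE /state row_mxKl.
  by rewrite zz0 row_mxKl row_mxKr -GtE.
exists q, tau; split.
- split.
  + split=> //; first by split=> //=; rewrite (inner_chart g ip tq tq) qi.
    by rewrite (inner_nu g ip bp tq) qi u0 divr_ge0 ?ltW.
  + move=> [_ [_ _]]; rewrite (inner_nu g ip bp tq) qi u0.
    by rewrite leNgt divr_gt0.
  + by rewrite qi.
  + by rewrite qi.
  + by rewrite qi distrC; apply: lt_le_trans uw' _; clear - rd rho0; lra.
- by rewrite tau0 (lt_le_trans tauT).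
- by [].
- by rewrite -h10; move: vb; rewrite ![A * _ * tau]mulrAC ![_ * (A * tau)]mulrC.
- split.
    apply: (@subspace_eq_continuous _ _ _ z).
      by move=> t; rewrite inE/= in_itv/= => tt; have [_ E _] := fl t tt; exact: esym E.
    apply/subspace_continuousP => t; rewrite /= in_itv/= => tt.
    have [dz _] := zD t (inT t (sub t tt)).
    by apply: cvg_within_filter; apply: differentiable_continuous; apply/derivable1_diffP.
  move=> t tt; have [it tE tt'] := fl t tt; split=> //.
  + split=> //; rewrite (inner_chart g it tt' tt') -(sp t tt) -tE /state row_mxKl row_mxKr.
    rewrite GtE// -cp; have := zB t (inT t (sub t tt)).
    rewrite -tE => zB'; have := Ball_lsubmx zB'; rewrite /state row_mxKl.
    by apply: Ball_sub; clear - d0; lra.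
  + by rewrite tE distrC; apply: lt_le_trans (near t (sub t tt)) rd.
  + have := hb t tt; rewrite /h -tE /state row_mxKl.
    by rewrite ![A * _ * (t * _)]mulrAC ![_ * (A * (t * _))]mulrC.
Qed.

End Glancing.

(** * Smooth functions, derivations and bump functions *)

Section SmoothAlgebra.
Context {R : realType} {Z : Type} {N : nat}.
Variable C : coords R Z N.
Implicit Types (P : set Z) (h u v : Z -> R).

Lemma smooth_restrict P P' h : P' `<=` P -> smooth C P h -> smooth C P' h.
Proof.
move=> PP H i z /PP Pz iz; have [f [U [oO Oz CO E]]] := H i z Pz iz.
by exists f; exists U; split=> // z' /PP; exact: E.
Qed.
Arguments smooth_restrict [P P' h] _ _ i z _ _.

Lemma smooth_eq P h h' : smooth C P h -> (forall z, P z -> h z = h' z) -> smooth C P h'.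
Proof.
move=> H hh i z Pz iz; have [f [U [oO Oz CO E]]] := H i z Pz iz.
by exists f; exists U; split=> // z' Pz' iz' Oz'; rewrite -hh// E.
Qed.
Arguments smooth_eq [P h h'] _ _ i z _ _.

Lemma smooth_cst P (c : R) : smooth C P (fun=> c).
Proof.
move=> i z Pz iz; exists (fun=> c); exists setT; split=> //; first exact: openT.
exact: Cinf_cst.
Qed.
Arguments smooth_cst : clear implicits.

Lemma smooth_add P u v : smooth C P u -> smooth C P v -> smooth C P (fun z => u z + v z).
Proof.
move=> Hu Hv i z Pz iz; have [f [U [oO Oz CO E]]] := Hu i z Pz iz.
have [f' [U' [oO' Oz' CO' E']]] := Hv i z Pz iz.
exists (fun X => f X + f' X); exists (U `&` U'); split=> //; first exact: openI.
  by apply: Cinf_add; [exact: openI|apply: Cinf_restrict CO => X []|apply: Cinf_restrict CO' => X []].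
by move=> z' Pz' iz' [? ?]; rewrite E// E'.
Qed.
Arguments smooth_add [P u v] _ _ i z _ _.

Lemma smooth_mul P u v : smooth C P u -> smooth C P v -> smooth C P (fun z => u z * v z).
Proof.
move=> Hu Hv i z Pz iz; have [f [U [oO Oz CO E]]] := Hu i z Pz iz.
have [f' [U' [oO' Oz' CO' E']]] := Hv i z Pz iz.
exists (fun X => f X * f' X); exists (U `&` U'); split=> //; first exact: openI.
  by apply: Cinf_mul; [exact: openI|apply: Cinf_restrict CO => X []|apply: Cinf_restrict CO' => X []].
by move=> z' Pz' iz' [? ?]; rewrite E// E'.
Qed.
Arguments smooth_mul [P u v] _ _ i z _ _.

Lemma smooth_opp P u : smooth C P u -> smooth C P (fun z => - u z).
Proof.
move=> Hu; refine (smooth_eq (smooth_mul (smooth_cst P (-1)) Hu) _) => z _.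
by rewrite mulN1r.
Qed.
Arguments smooth_opp [P u] _ i z _ _.

Lemma smooth_near P h (i : cidx C) z : smooth C P h -> P z -> cdom i z -> forall e : R, 0 < e ->
  exists2 d : R, 0 < d & forall z', P z' -> cdom i z' -> `|crd i z - crd i z'| < d ->
    `|h z - h z'| < e.
Proof.
move=> H Pz iz e e0; have [f lf] := H i z Pz iz.
have [d d0 [Cf E]] := local_ext_ball lf.
have zB : [set X | `|crd i z - X| < d] (crd i z) by rewrite /= subrr normr0.
have [d' d'0 H'] := (cont_normP _ _).1 (Cinf_cont Cf zB) _ e0.
exists (Num.min d d'); first by rewrite lt_min d0.
move=> z' Pz' iz'; rewrite lt_min => /andP[h1 h2].
by rewrite (E z)// ?subrr ?normr0// (E z')//; exact: H'.
Qed.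

Lemma smooth_adherent P P' h (i : cidx C) z : smooth C P h -> P' `<=` P -> P z -> cdom i z ->
  (forall d : R, 0 < d -> exists z', [/\ P' z', cdom i z' & `|crd i z - crd i z'| < d]) ->
  (forall z', P' z' -> h z' = 0) -> h z = 0.
Proof.
move=> H PP Pz iz ad h0; apply/eqP; rewrite -normr_le0; apply/ler_addgt0Pl => e e0; rewrite addr0.
have [d d0 Hd] := smooth_near H Pz iz e0.
have [z' [Pz' iz' zz']] := ad _ d0.
have := Hd z' (PP _ Pz') iz' zz'; rewrite (h0 z' Pz') subr0; exact: ltW.
Qed.

Variables (NN dN : set Z).
Local Notation No := (NN `\` dN).

(** Such an h is the product of two functions vanishing on the interior, h
    itself and the indicator of the complement, so the Leibniz rule gives 0. A
    vector field, which acts on functions defined on the whole space, thus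
    depends only on their restriction to the interior. *)
Lemma vf_zero W h : vector_field C NN dN W -> (forall z, No z -> h z = 0) ->
  forall z, No z -> W h z = 0.
Proof.
move=> [_ _ WM _] h0 z Nz.
(* h = h * b, where both factors vanish on No *)
pose b (z : Z) : R := if `[< No z >] then 0 else 1.
have b0 z' : No z' -> b z' = 0 by move=> ?; rewrite /b; case: asboolP.
have sb : smooth C No b by refine (smooth_eq (smooth_cst No 0) _) => z' /b0.
have sh : smooth C No h by refine (smooth_eq (smooth_cst No 0) _) => z' /h0.
have E : (fun z => h z * b z) = h.
  apply/funext => z'; rewrite /b; case: asboolP => [/h0->|_]; rewrite ?mulr1//.
  by rewrite mul0r.
by have := WM h b sh sb z Nz; rewrite E h0// b0// mulr0 mul0r addr0.
Qed.

Lemma vf_ext W u v : vector_field C NN dN W -> smooth C No u -> smooth C No v ->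
  (forall z, No z -> u z = v z) -> forall z, No z -> W u z = W v z.
Proof.
move=> VW su sv uv z Nz; have [_ WL _ _] := VW.
have := WL (-1) v u sv su z Nz.
rewrite (vf_zero VW) => [|z' /uv->|//]; last by rewrite mulN1r addNr.
by rewrite mulN1r addrC => /esym/eqP; rewrite subr_eq0 => /eqP.
Qed.

(** A derivation with W rho <> 0 at z shows that a rho does not vanish to
    second order there, while b c would if c z = 0, as b z = 0 too. The
    derivation is only defined on the interior, so the Leibniz identity is
    extended to z by continuity. *)
Lemma bdf_quotient_neq0 W w rho (a b c : Z -> R) (i : cidx C) z : vector_field C NN dN W ->
  smooth C NN rho -> smooth C NN w -> (forall q, No q -> W rho q = w q) ->
  smooth C NN a -> smooth C NN b -> smooth C NN c ->
  (forall q, NN q -> a q * rho q = b q * c q) ->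
  NN z -> cdom i z -> rho z = 0 -> b z = 0 -> a z != 0 -> w z != 0 ->
  (forall d : R, 0 < d -> exists z', [/\ No z', cdom i z' & `|crd i z - crd i z'| < d]) ->
  c z != 0.
Proof.
move=> VW srho sw Ww sa sb sc abc Nz iz rho0 b0 a0 w0 ad.
have NoN : No `<=` NN by move=> q [].
have [_ _ WM WS] := VW.
have [wa swa Wa] := WS _ sa; have [wb swb Wb] := WS _ sb; have [wc swc Wc] := WS _ sc.
have E : wa z * rho z + a z * w z - (wb z * c z + b z * wc z) = 0.
  apply: (smooth_adherent (P := NN) (P' := No) (i := i)
    (h := fun z => wa z * rho z + a z * w z - (wb z * c z + b z * wc z))) => //.
    exact: (smooth_add (smooth_add (smooth_mul swa srho) (smooth_mul sa sw))
      (smooth_opp (smooth_add (smooth_mul swb sc) (smooth_mul sb swc)))).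
  move=> q Nq; rewrite -Ww// -Wa// -Wb// -Wc//.
  have s1 := smooth_restrict NoN sa; have s2 := smooth_restrict NoN srho.
  have s3 := smooth_restrict NoN sb; have s4 := smooth_restrict NoN sc.
  rewrite -(WM a rho s1 s2 q Nq) -(WM b c s3 s4 q Nq).
  rewrite (vf_ext VW (smooth_mul s1 s2) (smooth_mul s3 s4))// ?subrr// => z' [Nz' _].
  exact: abc.
move: E; rewrite rho0 b0 mulr0 mul0r addr0 add0r => /eqP; rewrite subr_eq0 => /eqP E.
apply: contraNneq (mulf_neq0 a0 w0) => c0; by rewrite E c0 mulr0.
Qed.

End SmoothAlgebra.
Arguments smooth_restrict {R Z N C} [P P' h] _ _ i z _ _.
Arguments smooth_eq {R Z N C} [P h h'] _ _ i z _ _.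
Arguments smooth_cst {R Z N C} P c i z _ _.
Arguments smooth_add {R Z N C} [P u v] _ _ i z _ _.
Arguments smooth_mul {R Z N C} [P u v] _ _ i z _ _.
Arguments smooth_opp {R Z N C} [P u] _ i z _ _.

Section Bump.
Context {R : realType} {N : nat}.
Local Notation vec := 'rV[R]_N.

Lemma Ck_local k (O : set vec) f :
  (forall p, O p -> exists O', [/\ open O', O' p & Ck k O' f]) -> Ck k O f.
Proof.
elim: k f => [|k IH] f H.
  by split=> // p Op; have [U' [oO O'p /Ck_cont]] := H p Op; exact.
split; first by move=> p Op; have [U' [oO O'p /Ck_cont]] := H p Op; exact.
move=> v; split.
  by move=> p Op; have [U' [oO O'p /Ck_derivable]] := H p Op; exact.
apply: IH => p Op; have [U' [oO O'p /(Ck_D v) ?]] := H p Op.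
by exists U'.
Qed.

Lemma Cinf_local (O : set vec) f :
  (forall p, O p -> exists O', [/\ open O', O' p & Cinf O' f]) -> Cinf O f.
Proof.
move=> H k; apply: Ck_local => p Op; have [U' [? ? C]] := H p Op.
by exists U'; split=> //; exact: C.
Qed.

Definition bumpf (c : vec) (r : R) (Y : vec) : R :=
  flat 0 (r ^+ 2 - \sum_k (Y 0 k - c 0 k) ^+ 2).

Lemma bumpf_smooth O c r : open O -> Cinf O (bumpf c r).
Proof.
move=> oO; apply: Cinf_flat => //; apply: Cinf_diff => //; first exact: Cinf_cst.
apply: Cinf_sum => // k _; rewrite [X in Cinf _ X](_ : _ = fun p : vec => (p 0 k - c 0 k) * (p 0 k - c 0 k)).
  have H : Cinf O (fun p : vec => p 0 k - c 0 k).
    by apply: Cinf_diff => //; [exact: Cinf_coord|exact: Cinf_cst].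
  exact: Cinf_mul.
by apply/funext => p; rewrite expr2.
Qed.

Lemma bumpf_gt0 c r : 0 < r -> 0 < bumpf c r c.
Proof.
move=> r0; apply: flat_gt0; rewrite big1 ?subr0 ?exprn_gt0// => k _.
by rewrite subrr expr0n.
Qed.

Lemma bumpf_out c r Y : 0 <= r -> r <= `|c - Y| -> bumpf c r Y = 0.
Proof.
move=> r0 rY; apply: flat_le0; rewrite subr_le0 leNgt; apply/negP => H.
suff : `|c - Y| < r by rewrite ltNge rY.
have r0' : 0 < r.
  rewrite lt_neqAle r0 andbT; apply: contraTneq H => <-.
  by rewrite expr0n/= -leNgt; apply: sumr_ge0 => k _; exact: sqr_ge0.
have H2 k : `|(c - Y) 0 k| < r.
  rewrite mxE [(- Y) _ _]mxE distrC -(ltr_pXn2r (n := 2))// ?nnegrE//.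
  rewrite real_normK ?num_real//; apply: le_lt_trans H.
  by rewrite (bigD1 k)//= lerDl; apply: sumr_ge0 => j _; exact: sqr_ge0.
pose m := \big[Num.max/0]_k `|(c - Y) 0 k|.
apply: (@le_lt_trans _ _ m); last by apply/bigmax_ltP.
apply: mx_norm_le => [|a b]; first by rewrite /m; elim/big_rec: _ => // k y _ y0; rewrite le_max y0 orbT.
by rewrite ord1 /m; exact: le_bigmax.
Qed.

(** Extension by 0, used for functions defined on a ball multiplied by a bump
    function. *)
Definition ext0 (c : vec) (d : R) (F : vec -> R) (Y : vec) : R :=
  if `[< Ball c d Y >] then F Y else 0.

Lemma ext0_smooth c r d F : 0 <= r < d -> Cinf (Ball c d) F ->
  Cinf setT (ext0 c d (fun Y => bumpf c r Y * F Y)).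
Proof.
move=> /andP[r0 rd] CF; apply: Cinf_local => Y _.
have [YB|YB] := pselect (Ball c d Y).
  exists (Ball c d); split=> //; first exact: Ball_open.
  apply: (@Cinf_eq _ _ _ (fun Y => bumpf c r Y * F Y)); first exact: Ball_open.
    by move=> X; rewrite inE => XB; rewrite /ext0; case: asboolP.
  by apply: Cinf_mul => //; [exact: Ball_open|apply: bumpf_smooth; exact: Ball_open].
have dY : d <= `|c - Y| by rewrite leNgt; apply/negP.
exists (Ball Y (`|c - Y| - r)); split; [exact: Ball_open|apply: Ball_center; lra|].
apply: (@Cinf_eq _ _ _ (fun=> 0)); [exact: Ball_open| |exact: Cinf_cst].
move=> X; rewrite inE => XB; rewrite /ext0; case: asboolP => // _.
rewrite bumpf_out// ?mul0r//.
have := ler_normD (c - X) (X - Y); rewrite addrA subrK [`|X - Y|]distrC.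
by move: XB; rewrite /Ball/=; lra.
Qed.

Lemma ext0_out c r d F Y : 0 <= r -> r <= `|c - Y| ->
  ext0 c d (fun Y => bumpf c r Y * F Y) Y = 0.
Proof. by move=> r0 rY; rewrite /ext0 bumpf_out// mul0r if_same. Qed.

Lemma ext0_in c d F Y : Ball c d Y -> ext0 c d F Y = F Y.
Proof. by move=> YB; rewrite /ext0; case: asboolP. Qed.

End Bump.

(** * Boundary defining functions of M *)

Section Gluing.
Context {R : realType} {n : nat}.
Variable M : bmanifold R n.
Local Notation vec := 'rV[R]_n.+1.
Local Notation svec := 'rV[R]_(n.+1 + n.+1).
Local Notation idx := (cidx (atlas M)).
Implicit Types (i j : idx) (x y p : M) (u v w : vec).

(** It is the image of a compact half-ball under the inverse of the chart, and
    M is Hausdorff. *)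
Lemma chart_ball_closed i p (d r : R) : cdom i p -> full_ball i p d -> 0 <= r < d ->
  closed [set y | cdom i y /\ `|crd i p - crd i y| <= r].
Proof.
move=> ip fb /andP[r0 rd].
pose B := [set Y : vec | `|crd i p - Y| <= r] `&` [set Y : vec | 0 <= Y 0 ord0].
have cB : compact B.
  apply: compact_closedI; first exact: closed_ball_compact.
  have -> : [set Y : vec | 0 <= Y 0 ord0] = ~` [set Y : vec | [set t : R | t < 0] (Y 0 ord0)].
    by apply/seteqP; split=> Y /=; rewrite leNgt => /negP.
  by apply: open_closedC; apply: open_coord; exact: open_lt.
pose psi (Y : vec) : M := xget p [set y | cdom i y /\ crd i y = Y].
have psiP Y : B Y -> cdom i (psi Y) /\ crd i (psi Y) = Y.
  move=> [YB Y0]; have [|y iy yE] := fb Y _ Y0; first exact: le_lt_trans rd.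
  by apply: (@xgetPex _ p [set y | cdom i y /\ crd i y = Y]); exists y.
have -> : [set y | cdom i y /\ `|crd i p - crd i y| <= r] = psi @` B.
  apply/seteqP; split=> [y [iy yr]|_ [Y BY <-]] /=.
    have By : B (crd i y) by split=> //=; exact: crd_half.
    exists (crd i y) => //; have [ip' pE] := psiP _ By.
    exact: chart_inj ip' iy pE.
  by have [iY ->] := psiP _ BY; split=> //; have [] := BY.
apply: compact_closed; first exact: space_hausdorff.
apply: continuous_compact => //.
apply/subspace_continuousP => Y BY U /nbhs_interior Ui.
have [iY YE] := psiP Y BY.
have [e e0 [_ He]] := chart_ball (open_interior U) (nbhs_singleton Ui) iY.
suff H : \forall Y' \near within B (nbhs Y), U (psi Y') by exact: H.
rewrite near_withinE.
have nB : nbhs (Y : vec) (Ball (Y : vec) e).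
  by apply: open_nbhs_nbhs; split; [exact: Ball_open|exact: Ball_center].
apply: filterS nB => Y' YY' BY'.
have [iY' YE'] := psiP Y' BY'.
by apply: interior_subset; apply: He => //; rewrite /Ball/= YE YE'.
Qed.

(** The closed ball of the chart i is closed in M. *)
Lemma chart_avoid i p (d r : R) j y : cdom i p -> full_ball i p d -> 0 <= r < d ->
  ~ cdom i y -> cdom j y ->
  exists2 e : R, 0 < e & forall y', cdom j y' -> Ball (crd j y) e (crd j y') ->
    cdom i y' -> r < `|crd i p - crd i y'|.
Proof.
move=> ip fb rd iy jy.
have oA := closed_openC (chart_ball_closed ip fb rd).
have [|e e0 [_ He]] := chart_ball oA _ jy; first by move=> [].
by exists e => // y' jy' /(He _ jy') H iy'; rewrite ltNge; apply/negP => ?; exact: H.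
Qed.

(** The only points to examine are those outside the chart i, and by
    chart_avoid the function vanishes near them. *)
Lemma glue_base (P : set M) i p (d r : R) (F : vec -> R) : cdom i p -> full_ball i p d ->
  0 <= r < d -> Cinf setT F -> (forall Y, r <= `|crd i p - Y| -> F Y = 0) ->
  smooth (atlas M) P (fun y => if `[< cdom i y >] then F (crd i y) else 0).
Proof.
move=> ip fb rd CF F0 j y Py jy; have [iy|iy] := pselect (cdom i y).
  have [T [e [e0 CT TE _]]] := transitionP jy iy.
  exists (fun Y => F (T Y)); exists (Ball (crd j y) e); split.
  - exact: Ball_open.
  - exact: Ball_center.
  - by apply: (Cinf_comp (O' := setT) (Ball_open _ _) openT _ CT CF).
  - move=> y' _ jy' yB; have [iy' E] := TE y' jy' yB.
    by case: asboolP => // _; rewrite E.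
have [e e0 He] := chart_avoid ip fb rd iy jy.
exists (fun=> 0); exists (Ball (crd j y) e); split.
- exact: Ball_open.
- exact: Ball_center.
- exact: Cinf_cst.
- by move=> y' _ jy' yB; case: asboolP => // iy'; apply: F0; apply: ltW; exact: He.
Qed.

(** The analogue of glue_base on the tangent bundle. Fibres are not compact,
    but away from the chart i the base point is already far from p. *)
Lemma glue_tangent (P : set (M * tvec M)) i p (c : svec) (d r : R) (F : svec -> R) :
  cdom i p -> full_ball i p d -> lsubmx c = crd i p -> (forall z, P z -> tangent z.1 z.2) ->
  0 <= r < d -> Cinf setT F -> (forall Y, r <= `|c - Y| -> F Y = 0) ->
  smooth (tatlas M) P (fun z => if `[< cdom i z.1 >] then F (state i z) else 0).
Proof.
move=> ip fb cp PT rd CF F0 j z Pz jz; rewrite /= in jz.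
change (cidx (atlas M)) in j.
have [iy|iy] := pselect (cdom i z.1).
  have [T [e tT]] := transitionP jz iy; have [e0 CT TE _] := tT.
  pose Phi (Y : svec) : svec := row_mx (T (lsubmx Y))
    (\row_k \sum_l rsubmx Y 0 l * 'D_(delta_mx 0 l) (fun X => T X 0 k) (lsubmx Y)).
  have oB := Ball_open (state j z) e.
  have CL k : Cinf (Ball (state j z) e) (fun Y => lsubmx Y 0 k).
    by apply: (Cinf_eq oB _ (Cinf_coord (lshift _ k) oB)) => Y _; rewrite mxE.
  have CR k : Cinf (Ball (state j z) e) (fun Y => rsubmx Y 0 k).
    by apply: (Cinf_eq oB _ (Cinf_coord (rshift _ k) oB)) => Y _; rewrite mxE.
  have LB Y : Ball (state j z) e Y -> Ball (crd j z.1) e (lsubmx Y).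
    by move=> /Ball_lsubmx; rewrite /state row_mxKl.
  have Ccomp f : Cinf (Ball (crd j z.1) e) f -> Cinf (Ball (state j z) e) (fun Y => f (lsubmx Y)).
    by move=> Cf; exact: (Cinf_comp oB (Ball_open _ _) LB CL Cf).
  exists (fun Y => F (Phi Y)); exists (Ball (state j z) e); split.
  - exact: oB.
  - exact: Ball_center.
  - apply: (Cinf_comp (O' := setT) oB openT _ _ CF) => // k.
    have [a|a] := splitP k => ka.
      have -> : k = lshift n.+1 a by apply: val_inj.
      by apply: (Cinf_eq oB _ (Ccomp _ (CT a))) => Y _; rewrite row_mxEl.
    have -> : k = rshift n.+1 a by apply: val_inj.
    apply: (@Cinf_eq _ _ _ (fun Y => \sum_l rsubmx Y 0 l * 'D_(delta_mx 0 l) (fun X => T X 0 a) (lsubmx Y))) => //.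
      by move=> Y _; rewrite row_mxEr mxE.
    apply: Cinf_sum => // l _; apply: Cinf_mul => //.
    exact: (Ccomp _ (Cinf_D _ (CT a))).
  - move=> z' Pz' jz' zB; rewrite /= in jz' zB.
    have yB : Ball (crd j z.1) e (crd j z'.1) by have := LB _ zB; rewrite row_mxKl.
    have [iz' E] := TE z'.1 jz' yB.
    case: asboolP => // _; congr F; rewrite /Phi /state /= row_mxKl row_mxKr E; congr row_mx.
    have [_ H] := (tangentE _ _).1 (PT z' Pz'); rewrite (H j i jz' iz').
    by apply/rowP => k; rewrite !mxE; apply: eq_bigr => l _; rewrite (JacE l k jz tT jz' yB).
have [e e0 He] := chart_avoid ip fb rd iy jz.
exists (fun=> 0); exists (Ball (state j z) e); split.
- exact: Ball_open.
- exact: Ball_center.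
- exact: Cinf_cst.
- move=> z' _ jz' zB; case: asboolP => // iz'; apply: F0; apply: ltW.
  have yB : Ball (crd j z.1) e (crd j z'.1) by have := Ball_lsubmx zB; rewrite /state /= !row_mxKl.
  have H := He _ jz' yB iz'; apply: lt_le_trans H _.
  have -> : crd i p - crd i z'.1 = lsubmx (c - state i z') by rewrite linearB/= /state row_mxKl cp.
  exact: norm_lsubmx.
Qed.

(** Division by the coordinate 0 provides a smooth factor H. It does not
    vanish at p because the differential of x does not: as this is expressed
    by global derivations of functions on M, the identity x = X_0 H has to be
    multiplied by bump functions to become one between smooth functions on M.
    Its sign is that of x. *)
Lemma base_bdf_factor (x : M -> R) i p : boundary_defining (atlas M) setT (boundary M) x ->
  boundary M p -> cdom i p -> exists d : R, exists H : vec -> R,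
  [/\ 0 < d, Cinf (Ball (crd i p) d) H, 0 < H (crd i p) &
    forall y, cdom i y -> Ball (crd i p) d (crd i y) -> x y = crd i y 0 ord0 * H (crd i y)].
Proof.
move=> [sx xpos xb xnd] bp ip; set c := crd i p.
have c0 : c 0 ord0 = 0 by apply/boundaryP.
have [f lf] := sx i p I ip; have [d1 d10 [Cf xf]] := local_ext_ball lf.
have [d2 d20 [full2 _]] := chart_ball (A := setT) openT I ip.
pose d := Num.min d1 d2; have d0 : 0 < d by rewrite lt_min d10.
have dd1 : d <= d1 by rewrite ge_min lexx.
have fb : full_ball i p d.
  move=> X XB X0; have [|y [_ iy yE]] := full2 X _ X0; last by exists y.
  by apply: Ball_sub XB; rewrite ge_min lexx orbT.
have {}Cf : Cinf (Ball c d) f by apply: Cinf_restrict Cf; exact: Ball_sub.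
have {}xf y : cdom i y -> Ball c d (crd i y) -> x y = f (crd i y).
  by move=> iy yB; apply: xf => //; exact: (Ball_sub dd1 yB).
have f0 Y : Ball c d Y -> Y 0 ord0 = 0 -> f Y = 0.
  move=> YB Y0; have [|y iy yE] := fb Y YB; first by rewrite Y0.
  by rewrite -yE -xf ?yE// xb//; apply/(boundaryP iy); rewrite yE.
have [H CH fH] := Hadamard c0 Cf f0.
have xH y : cdom i y -> Ball c d (crd i y) -> x y = crd i y 0 ord0 * H (crd i y).
  by move=> iy yB; rewrite xf// fH.
have cB : Ball c d c by exact: Ball_center.
have ad (e : R) : 0 < e -> exists z', [/\ (setT `\` boundary M) z', cdom i z' & `|c - crd i z'| < e].
  move=> e0; pose t := Num.min (e / 2) (d / 2).
  have t0 : 0 < t by rewrite lt_min !divr_gt0.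
  have te : t <= e / 2 by rewrite ge_min lexx.
  have td : t <= d / 2 by rewrite ge_min lexx orbT.
  pose Y : vec := c + t *: delta_mx 0 ord0.
  have cY : `|c - Y| <= t.
    rewrite /Y opprD addrA subrr sub0r normrN normrZ gtr0_norm// -[leRHS]mulr1.
    apply: ler_wpM2l; [exact: ltW|apply: mx_norm_le => // a b; rewrite mxE].
    by case: (_ && _); rewrite ?normr1 ?normr0.
  have Y0 : Y 0 ord0 = t by rewrite /Y mxE c0 add0r mxE mxE/= mulr1.
  have [||y iy yE] := fb Y.
  - by rewrite /Ball/= (le_lt_trans cY)//; lra.
  - by rewrite Y0 ltW.
  exists y; split=> //; last by rewrite yE (le_lt_trans cY)//; lra.
  by split=> // /(boundaryP iy); rewrite yE Y0 => E; rewrite E ltxx in t0.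
pose r := d / 2; have rd : 0 <= r < d by rewrite /r; apply/andP; split; lra.
have r0 : 0 < r by rewrite divr_gt0.
have r00 : 0 <= r by exact: ltW.
have CB : Cinf setT (bumpf c r) by apply: bumpf_smooth; exact: openT.
have H0 : H c != 0.
  have [W [w [VW sw Ww w0]]] := xnd p bp.
  pose lift (F : vec -> R) y := if `[< cdom i y >] then F (crd i y) else 0.
  have liftE F y : cdom i y -> lift F y = F (crd i y) by rewrite /lift; case: asboolP.
  have lift0 F y : ~ cdom i y -> lift F y = 0 by rewrite /lift; case: asboolP.
  have sl := @glue_base setT i p d r _ ip fb rd.
  have sa : smooth (atlas M) setT (lift (fun Y => bumpf c r Y * bumpf c r Y)).
    by apply: sl => [|Y cY]; [exact: (Cinf_mul openT CB CB)|rewrite bumpf_out// mul0r].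
  have sb : smooth (atlas M) setT (lift (fun Y => bumpf c r Y * Y 0 ord0)).
    apply: sl => [|Y cY]; last by rewrite bumpf_out// mul0r.
    exact: (Cinf_mul openT CB (Cinf_coord ord0 openT)).
  have sc : smooth (atlas M) setT (lift (ext0 c d (fun Y => bumpf c r Y * H Y))).
    by apply: sl => [|Y cY]; [exact: ext0_smooth|rewrite ext0_out].
  have la : lift (fun Y => bumpf c r Y * bumpf c r Y) p != 0.
    by rewrite liftE// mulf_neq0// gt_eqF// bumpf_gt0.
  have lb : lift (fun Y => bumpf c r Y * Y 0 ord0) p = 0.
    by rewrite liftE// -/c c0 mulr0.
  have abc q : setT q -> lift (fun Y => bumpf c r Y * bumpf c r Y) q * x q =
      lift (fun Y => bumpf c r Y * Y 0 ord0) q * lift (ext0 c d (fun Y => bumpf c r Y * H Y)) q.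
    move=> _; have [iq|iq] := pselect (cdom i q); last by rewrite !lift0// !mul0r.
    rewrite !liftE//; have [qB|qB] := pselect (Ball c d (crd i q)).
      by rewrite ext0_in// xH//; ring.
    rewrite bumpf_out ?mul0r//; rewrite leNgt; apply/negP => h; apply: qB.
    by apply: lt_trans h _; case/andP: rd.
  have := bdf_quotient_neq0 VW sx sw Ww sa sb sc abc I ip (xb p bp) lb la w0 ad.
  by rewrite liftE// -/c ext0_in//; apply: contraNneq => ->; rewrite mulr0.
exists d, H; split=> //.
rewrite lt_neqAle eq_sym H0 leNgt /=; apply/negP => Hn.
have [e e0 He] := (cont_normP _ _).1 (Cinf_cont CH cB) (- H c) (ltac:(by rewrite oppr_gt0)).
have [y [[_ ny] iy]] := ad (Num.min e d) (ltac:(by rewrite lt_min e0)).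
rewrite lt_min => /andP[ye yd].
have := xpos y (conj I ny); rewrite xH//.
have := He _ ye; rewrite ltr_norml => /andP[h1 h2].
have Hy : H (crd i y) < 0 by move: h1 h2 Hn; clear; lra.
rewrite ltNge => /negP; apply; apply: mulr_ge0_le0; [exact: crd_half|exact: ltW].
Qed.

End Gluing.

(** * Boundary defining functions of the inward unit bundle *)

Section MuFactor.
Context {R : realType} {n : nat}.
Variable M : bmanifold R n.
Variable g : metric M.
Local Notation vec := 'rV[R]_n.+1.
Local Notation svec := 'rV[R]_(n.+1 + n.+1).
Local Notation idx := (cidx (atlas M)).
Local Notation G := (gram g).
Implicit Types (i j : idx) (x y p : M) (u v w : vec).

(** Projection of the coordinates onto the boundary hyperplane. *)
Definition flatten0 (X : vec) : vec := X - X 0 ord0 *: delta_mx 0 ord0.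

Lemma flatten0E (X : vec) k : flatten0 X 0 k = if k == ord0 then 0 else X 0 k.
Proof.
rewrite /flatten0 !mxE eqxx /=; case: eqP => [->|_].
  by rewrite mulr1 subrr.
by rewrite mulr0 subr0.
Qed.

Lemma flatten0_id (X : vec) : X 0 ord0 = 0 -> flatten0 X = X.
Proof. by move=> X0; rewrite /flatten0 X0 scale0r subr0. Qed.

Lemma flatten0_dist (c X : vec) : c 0 ord0 = 0 -> `|c - flatten0 X| <= `|c - X|.
Proof.
move=> c0; apply: mx_norm_le => // a k; rewrite ord1.
have -> : (c - flatten0 X) 0 k = c 0 k - flatten0 X 0 k by rewrite !mxE.
rewrite flatten0E; case: eqP => [->|_]; first by rewrite c0 subrr normr0.
by have := ler_mx_norm_coef (c - X) 0 k; rewrite mxE [(- X) _ _]mxE.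
Qed.

Definition speed2 (Gt : vec -> 'M[R]_n.+1) (Y : svec) : R :=
  bil (Gt (flatten0 (lsubmx Y))) (rsubmx Y) (rsubmx Y).

(** A retraction of the coordinate space onto the unit vectors based on the
    boundary. It turns a function on the submanifold d_+SM into a function on
    an open set, to which the division by a coordinate applies. *)
Definition unitize (Gt : vec -> 'M[R]_n.+1) (Y : svec) : svec :=
  row_mx (flatten0 (lsubmx Y)) ((Num.sqrt (speed2 Gt Y))^-1 *: rsubmx Y).

Lemma unitize_smooth i p Gt d (c : svec) : cdom i p -> gram_ext g i p Gt d ->
  lsubmx c = crd i p -> crd i p 0 ord0 = 0 -> speed2 Gt c = 1 -> forall e : R, 0 < e ->
  exists2 r : R, 0 < r & [/\ forall Y, Ball c r Y -> 0 < speed2 Gt Y /\ Ball c e (unitize Gt Y) &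
    forall k, Cinf (Ball c r) (fun Y => unitize Gt Y 0 k)].
Proof.
move=> ip [d0 CG GtE _ _] cp p0 sc e e0.
have oB := Ball_open c d.
have cB : Ball c d c by exact: Ball_center.
have CL k O : open O -> Cinf O (fun Y : svec => lsubmx Y 0 k).
  by move=> oO; apply: (Cinf_eq oO _ (Cinf_coord (lshift _ k) oO)) => Y _; rewrite mxE.
have CR k O : open O -> Cinf O (fun Y : svec => rsubmx Y 0 k).
  by move=> oO; apply: (Cinf_eq oO _ (Cinf_coord (rshift _ k) oO)) => Y _; rewrite mxE.
have CFl k O : open O -> Cinf O (fun Y : svec => flatten0 (lsubmx Y) 0 k).
  move=> oO; have [->|k0] := eqVneq k ord0.
    by apply: (Cinf_eq oO _ (Cinf_cst O 0)) => Y _; rewrite flatten0E eqxx.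
  by apply: (Cinf_eq oO _ (CL k O oO)) => Y _; rewrite flatten0E (negbTE k0).
have FB Y : Ball c d Y -> Ball (crd i p) d (flatten0 (lsubmx Y)).
  move=> /Ball_lsubmx; rewrite cp /Ball/=; apply: le_lt_trans; exact: flatten0_dist.
have CS : Cinf (Ball c d) (speed2 Gt).
  apply: (@Cinf_eq _ _ _ (fun Y => \sum_k \sum_l rsubmx Y 0 k * Gt (flatten0 (lsubmx Y)) k l * rsubmx Y 0 l)) => //.
    by move=> Y _; rewrite /speed2 bilE.
  apply: Cinf_sum => // k _; apply: Cinf_sum => // l _.
  apply: Cinf_mul => //; last exact: CR.
  apply: Cinf_mul => //; first exact: CR.
  exact: (Cinf_comp oB (Ball_open _ _) FB (fun k => CFl k _ oB) (CG k l)).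
have [d1 d10 H1] := (cont_normP _ _).1 (Cinf_cont CS cB) 1 ltr01.
pose d2 := Num.min d d1.
have d20 : 0 < d2 by rewrite lt_min d0.
have S0 Y : Ball c d2 Y -> 0 < speed2 Gt Y.
  move=> YB; have : `|c - Y| < d1 by apply: lt_le_trans YB _; rewrite ge_min lexx orbT.
  by move=> /H1; rewrite sc ltr_norml => /andP[_ ?]; lra.
have oB2 := Ball_open c d2.
have CU k : Cinf (Ball c d2) (fun Y => unitize Gt Y 0 k).
  have [a|a] := splitP k => ka.
    have -> : k = lshift n.+1 a by apply: val_inj.
    by apply: (Cinf_eq oB2 _ (CFl a _ oB2)) => Y _; rewrite row_mxEl.
  have -> : k = rshift n.+1 a by apply: val_inj.
  apply: (@Cinf_eq _ _ _ (fun Y => (Num.sqrt (speed2 Gt Y))^-1 * rsubmx Y 0 a)) => //.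
    by move=> Y _; rewrite /unitize row_mxEr [RHS]mxE.
  apply: Cinf_mul => //; last exact: CR.
  apply: Cinf_inv => //; first by move=> Y YB; rewrite gt_eqF// sqrtr_gt0 S0.
  apply: Cinf_sqrt => //; apply: Cinf_restrict CS; apply: Ball_sub; by rewrite ge_min lexx.
have Uc : unitize Gt c = c.
  rewrite /unitize sc sqrtr1 invr1 scale1r flatten0_id ?hsubmxK//.
  by rewrite cp.
have c2B : Ball c d2 c by exact: Ball_center.
have e2 : 0 < e / 2 by rewrite divr_gt0.
have [|r r0 Hr] := @common_radius R _ (fun k r => forall Y, `|c - Y| < r ->
    `|c 0 k - unitize Gt Y 0 k| < e / 2) (fun k r r' rr H Y Yr => H Y (lt_le_trans Yr rr)).
  move=> k; have [r r0 Hr] := (cont_normP _ _).1 (Cinf_cont (CU k) c2B) _ e2.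
  by exists r => // Y /Hr; rewrite Uc.
exists (Num.min r d2); first by rewrite lt_min r0.
have rB : Ball c (Num.min r d2) `<=` Ball c d2 by apply: Ball_sub; rewrite ge_min lexx orbT.
split; last by move=> k; apply: Cinf_restrict (CU k).
move=> Y YB; split; first by apply: S0; exact: rB.
have : `|c - Y| < r by apply: lt_le_trans YB _; rewrite ge_min lexx.
move=> /Hr H; apply: (@le_lt_trans _ _ (e / 2)); last by lra.
apply: mx_norm_le => [|a k]; first exact: ltW.
have -> : (c - unitize Gt Y) a k = c 0 k - unitize Gt Y 0 k by rewrite ord1 [LHS]mxE; congr (_ + _); rewrite [LHS]mxE.
exact: ltW.
Qed.

(** The analogue of base_bdf_factor, for the coordinate 0 of the vector: the
    function mu is extended to an open set by the retraction unitize and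
    divided by that coordinate, which vanishes exactly on the glancing
    vectors. *)
Lemma inflow_bdf_factor (mu : M * tvec M -> R) i p w (A : R) :
  boundary_defining (tatlas M) (dplusSM g) (dzeroSM g) mu ->
  boundary M p -> cdom i p -> w 0 ord0 = 0 -> bil (G i p) w w = 1 ->
  Gam2 g i p w w 0 ord0 = 2 * A -> 0 < A ->
  let c : svec := row_mx (crd i p) w in
  exists d : R, exists H : svec -> R, [/\ 0 < d, Cinf (Ball c d) H, 0 < H c &
    forall z, dplusSM g z -> cdom i z.1 -> Ball c d (state i z) ->
      mu z = z.2 i 0 ord0 * H (state i z)].
Proof.
move=> [smu mupos mub mund] bp ip w0 w1 GA A0 c.
have p0 : crd i p 0 ord0 = 0 by apply/boundaryP.
have cp : lsubmx c = crd i p by rewrite row_mxKl.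
have cw : rsubmx c = w by rewrite row_mxKr.
pose z0 : M * tvec M := (p, tv i p w).
have tz0 : tangent z0.1 z0.2 by exact: tv_tangent.
have z0i : z0.2 i = w by rewrite /= tvE.
have z0c : state i z0 = c by rewrite /state z0i.
have SMz0 : SM g z0 by split=> //; rewrite (inner_chart g ip tz0 tz0) z0i.
have z0p : dplusSM g z0 by split=> //; rewrite (inner_nu g ip bp tz0) z0i w0 mul0r.
have z0m : dminusSM g z0 by split=> //; rewrite (inner_nu g ip bp tz0) z0i w0 mul0r.
have z0z : dzeroSM g z0 by [].
have [f lf] := smu i z0 z0p ip; have [d1 d10 [Cf muf]] := local_ext_ball lf.
change (crd (i : cidx (tatlas M)) z0) with (state i z0) in Cf, muf; rewrite z0c in Cf muf.
have {}muf z : dplusSM g z -> cdom i z.1 -> Ball c d1 (state i z) -> mu z = f (state i z).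
  by move=> zp iz zB; exact: (muf z zp iz zB).
have [Gt [d2 gE2]] := gram_extP g ip; have d20 : 0 < d2 by case: gE2.
have [d3 d30 [full3 _]] := chart_ball (A := setT) openT I ip.
pose d4 := Num.min d2 d3; have d40 : 0 < d4 by rewrite lt_min d20.
have gE : gram_ext g i p Gt d4 by apply: gram_ext_le gE2 => //; rewrite ge_min lexx.
have [_ CG GtE _ _] := gE.
have fb : full_ball i p d4.
  move=> X XB X0; have [|y [_ iy yE]] := full3 X _ X0; last by exists y.
  by apply: Ball_sub XB; rewrite ge_min lexx orbT.
have pB : Ball (crd i p) d4 (crd i p) by exact: Ball_center.
have sc1 : speed2 Gt c = 1 by rewrite /speed2 cp cw flatten0_id// -GtE.
have e0 : 0 < Num.min d1 d4 by rewrite lt_min d10.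
have [r r0 [Hr CU]] := unitize_smooth ip gE cp p0 sc1 e0.
pose d := Num.min r d4; have d0 : 0 < d by rewrite lt_min r0.
have dr : d <= r by rewrite ge_min lexx.
have dd4 : d <= d4 by rewrite ge_min lexx orbT.
have oB := Ball_open c d.
have UB Y : Ball c d Y -> Ball c d1 (unitize Gt Y).
  by move=> /(Ball_sub dr)/Hr[_]; apply: Ball_sub; rewrite ge_min lexx.
have CF : Cinf (Ball c d) (fun Y => f (unitize Gt Y)).
  apply: (Cinf_comp oB (Ball_open c d1) UB _ Cf) => k.
  by apply: Cinf_restrict (CU k); exact: Ball_sub.
have c0 : c 0 (rshift n.+1 ord0) = 0 by rewrite row_mxEr.
have F0 Y : Ball c d Y -> Y 0 (rshift n.+1 ord0) = 0 -> f (unitize Gt Y) = 0.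
  move=> YB Y0.
  have [S0 U4] := Hr Y (Ball_sub dr YB).
  have XB : Ball (crd i p) d4 (flatten0 (lsubmx Y)).
    have := Ball_lsubmx (Ball_sub dd4 YB); rewrite cp; apply: le_lt_trans.
    exact: flatten0_dist.
  have [|y iy yE] := fb _ XB; first by rewrite flatten0E eqxx.
  have by_ : boundary M y by apply/(boundaryP iy); rewrite yE flatten0E eqxx.
  pose V := (Num.sqrt (speed2 Gt Y))^-1 *: rsubmx Y.
  pose z : M * tvec M := (y, tv i y V).
  have tz : tangent z.1 z.2 by exact: tv_tangent.
  have zi : z.2 i = V by rewrite /= tvE.
  have V0 : V 0 ord0 = 0 by rewrite mxE mxE Y0 mulr0.
  have SMz : SM g z.
    split=> //; rewrite (inner_chart g iy tz tz) zi GtE ?yE//.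
    rewrite bilZl bilZr -/(speed2 Gt Y) -[X in _ * (_ * X)]sqr_sqrtr ?ltW//.
    by rewrite expr2 mulKf ?mulVf// gt_eqF// sqrtr_gt0.
  have zp : dplusSM g z by split=> //; rewrite (inner_nu g iy by_ tz) zi V0 mul0r.
  have zm : dminusSM g z by split=> //; rewrite (inner_nu g iy by_ tz) zi V0 mul0r.
  have sE : state i z = unitize Gt Y by rewrite /state zi yE.
  have muz : mu z = 0 by apply: mub; split.
  have := muf z zp iy; rewrite sE muz => E; rewrite -E//; exact: UB.
have [H CH fH] := Hadamard c0 CF F0.
have muH z : dplusSM g z -> cdom i z.1 -> Ball c d (state i z) ->
    mu z = z.2 i 0 ord0 * H (state i z).
  move=> zp iz zB; have [[tz SMz] bz _] := zp.
  have z1 : crd i z.1 0 ord0 = 0 by apply/boundaryP.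
  have zB1 : Ball (crd i p) d4 (crd i z.1).
    by have := Ball_lsubmx (Ball_sub dd4 zB); rewrite cp /state row_mxKl.
  have SE : speed2 Gt (state i z) = 1.
    by rewrite /speed2 /state row_mxKl row_mxKr flatten0_id// -GtE// -(inner_chart g iz tz tz).
  have UE : unitize Gt (state i z) = state i z.
    by rewrite /unitize SE sqrtr1 invr1 scale1r flatten0_id /state ?row_mxKl ?row_mxKr.
  have := fH _ zB; rewrite /= UE [state i z 0 (rshift _ _)]row_mxEr => <-.
  by apply: muf => //; have := UB _ zB; rewrite UE.
have cB : Ball c d c by exact: Ball_center.
have ad (e : R) : 0 < e -> exists z', [/\ (dplusSM g `\` dzeroSM g) z', cdom i z'.1,
    `|c - state i z'| < e & 0 < z'.2 i 0 ord0].
  move=> e1; pose de := Num.min (e / 2) (2^-1).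
  have de0 : 0 < de < 1.
    rewrite lt_min divr_gt0//= invr_gt0 ltr0n/= gt_min; apply/orP; right; lra.
  have [v0 v00 Hv] := glancing_exists ip bp w0 w1 GA A0 de0.
  have [|q [tau [[zp nz qE qv qw] _ _ _ _]]] := Hv (v0 / 2); first by apply/andP; split; lra.
  exists q; split=> //; first by rewrite qE.
    have -> : c - state i q = row_mx 0 (w - q.2 i).
      by rewrite /c /state {1}qE opp_row_mx add_row_mx subrr.
    apply: (@le_lt_trans _ _ de); last by rewrite gt_min; apply/orP; left; lra.
    by apply: norm_row_mx; rewrite ?normr0 ?[`|w - _|]distrC ltW//; case/andP: de0.
  by rewrite qv divr_gt0.
pose rr := d / 2; have rd : 0 <= rr < d by rewrite /rr; apply/andP; split; lra.
have rr0 : 0 < rr by rewrite divr_gt0.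
have rr00 : 0 <= rr by exact: ltW.
have CB : Cinf setT (bumpf c rr) by apply: bumpf_smooth; exact: openT.
have H0 : H c != 0.
  have [W [om [VW sw Ww om0]]] := mund z0 z0z.
  pose lift (F : svec -> R) (z : M * tvec M) := if `[< cdom i z.1 >] then F (state i z) else 0.
  have liftE F z : cdom i z.1 -> lift F z = F (state i z) by rewrite /lift; case: asboolP.
  have lift0 F z : ~ cdom i z.1 -> lift F z = 0 by rewrite /lift; case: asboolP.
  have fbd : full_ball i p d by move=> X XB; apply: fb; exact: (Ball_sub dd4 XB).
  have PT z : dplusSM g z -> tangent z.1 z.2 by move=> [[]].
  have sl := @glue_tangent _ _ _ (dplusSM g) i p c d rr _ ip fbd cp PT rd.
  have sa : smooth (tatlas M) (dplusSM g) (lift (fun Y => bumpf c rr Y * bumpf c rr Y)).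
    by apply: sl => [|Y cY]; [exact: (Cinf_mul openT CB CB)|rewrite bumpf_out// mul0r].
  have sb : smooth (tatlas M) (dplusSM g) (lift (fun Y => bumpf c rr Y * Y 0 (rshift n.+1 ord0))).
    apply: sl => [|Y cY]; last by rewrite bumpf_out// mul0r.
    exact: (Cinf_mul openT CB (Cinf_coord (rshift n.+1 ord0) openT)).
  have sc : smooth (tatlas M) (dplusSM g) (lift (ext0 c d (fun Y => bumpf c rr Y * H Y))).
    by apply: sl => [|Y cY]; [exact: ext0_smooth|rewrite ext0_out].
  have la : lift (fun Y => bumpf c rr Y * bumpf c rr Y) z0 != 0.
    by rewrite liftE// z0c mulf_neq0// gt_eqF// bumpf_gt0.
  have lb : lift (fun Y => bumpf c rr Y * Y 0 (rshift n.+1 ord0)) z0 = 0.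
    by rewrite liftE// z0c c0 mulr0.
  have abc q : dplusSM g q -> lift (fun Y => bumpf c rr Y * bumpf c rr Y) q * mu q =
      lift (fun Y => bumpf c rr Y * Y 0 (rshift n.+1 ord0)) q * lift (ext0 c d (fun Y => bumpf c rr Y * H Y)) q.
    move=> qp; have [iq|iq] := pselect (cdom i q.1); last by rewrite !lift0// !mul0r.
    rewrite !liftE//; have [qB|qB] := pselect (Ball c d (state i q)).
      by rewrite ext0_in// muH// [state i q 0 (rshift _ _)]row_mxEr; ring.
    rewrite bumpf_out ?mul0r//; rewrite leNgt; apply/negP => h; apply: qB.
    by apply: lt_trans h _; case/andP: rd.
  have ad' (e : R) : 0 < e -> exists z', [/\ (dplusSM g `\` dzeroSM g) z',
      cdom (i : cidx (tatlas M)) z' & `|crd (i : cidx (tatlas M)) z0 - crd (i : cidx (tatlas M)) z'| < e].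
    move=> e1; have [z' [z1 z2 z3 _]] := ad e e1; exists z'; split=> //.
    by change (`|state i z0 - state i z'| < e); rewrite z0c.
  have := bdf_quotient_neq0 VW smu sw Ww sa sb sc abc z0p (ip : cdom (i : cidx (tatlas M)) z0)
    (mub z0 z0z) lb la om0 ad'.
  by rewrite liftE// z0c ext0_in//; apply: contraNneq => ->; rewrite mulr0.
exists d, H; split=> //.
rewrite lt_neqAle eq_sym H0 leNgt /=; apply/negP => Hn.
have [e e1 He] := (cont_normP _ _).1 (Cinf_cont CH cB) (- H c) (ltac:(by rewrite oppr_gt0)).
have [z [zN iz]] := ad (Num.min e d) (ltac:(by rewrite lt_min e1)).
rewrite lt_min => /andP[ye yd] zv.
have := mupos z zN; rewrite muH//; last by case: zN.
have := He _ ye; rewrite ltr_norml => /andP[h1 h2].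
have Hy : H (state i z) < 0 by move: h1 h2 Hn; clear; lra.
rewrite ltNge => /negP; apply; apply: mulr_ge0_le0; exact: ltW.
Qed.

End MuFactor.

(** * Asymptotics along glancing geodesics *)

Section Package.
Context {R : realType} {n : nat}.
Variable M : bmanifold R n.
Variable g : metric M.
Local Notation vec := 'rV[R]_n.+1.
Local Notation svec := 'rV[R]_(n.+1 + n.+1).
Local Notation idx := (cidx (atlas M)).
Local Notation G := (gram g).
Implicit Types (i j : idx) (p : M).

Lemma ln_near1 (y d : R) : 0 < d <= 2^-1 -> (1 - d) <= y <= (1 + d) -> `|ln y| <= 2 * d.
Proof.
move=> /andP[d0 d1] /andP[y1 y2]; have y0 : 0 < y by lra.
have ub (u : R) : 0 < u -> ln u <= u - 1.
  by move=> u0; have := @le_ln1Dx R (u - 1); rewrite [1 + _]addrC subrK; apply; lra.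
have h1 : ln y <= d by apply: (le_trans (ub _ y0)); lra.
have h2 : - ln y <= 2 * d.
  rewrite -lnV ?posrE//; have yi : 0 < y^-1 by rewrite invr_gt0.
  apply: (le_trans (ub _ yi)).
  have H3 : (1 + 2 * d) * (1 - d) <= (1 + 2 * d) * y by rewrite ler_wpM2l//; lra.
  have H4 : 0 <= d * (1 - 2 * d) by rewrite mulr_ge0//; lra.
  have : y^-1 <= 1 + 2 * d by rewrite -[y^-1]mul1r ler_pdivrMr//; lra.
  by move=> ?; lra.
by rewrite ler_norml; apply/andP; split; lra.
Qed.

Lemma ratio_ln (a y d : R) : 0 < d <= 2^-1 -> 0 < a -> (1 - d) * a <= y <= (1 + d) * a ->
  0 < y /\ `|ln y - ln a| <= 2 * d.
Proof.
move=> d01 a0 /andP[y1 y2]; have /andP[d0 d1] := d01.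
have y0 : 0 < y by apply: lt_le_trans y1; rewrite mulr_gt0//; lra.
split=> //; rewrite -ln_div ?posrE//; apply: ln_near1 => //.
by rewrite ler_pdivlMr// ler_pdivrMr// y1.
Qed.

(** The asymptotics of x, mu and tau along glancing geodesics, in the
    logarithmic form in which powers and logarithms of x are estimated; the
    error is uniform up to the ends of the geodesic. *)
Lemma glancing_package (x : M -> R) (mu : M * tvec M -> R) p w (i := chart_at p)
    (c : svec := row_mx (crd i p) (w i)) :
  strictly_convex_boundary g -> boundary_defining (atlas M) setT (boundary M) x ->
  boundary_defining (tatlas M) (dplusSM g) (dzeroSM g) mu -> dzeroSM g (p, w) ->
  exists A B m0 : R, [/\ 0 < A, 0 < B, 0 < m0 & forall eta : R, 0 < eta -> exists2 v0 : R, 0 < v0 &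
    forall v : R, 0 < v < v0 -> exists q, exists tau : R,
    [/\ (dplusSM g `\` dzeroSM g) q, exit_time g q = tau%:E /\ 0 < tau /\ v <= 2 * (A * tau),
      m0 / 2 * v <= mu q <= 2 * m0 * v &
      forall t, 0 < t < tau -> let z := flow g t q in
        [/\ cdom i z.1, SM g z, `|c - state i z| < eta, ~ boundary M z.1 /\ 0 < x z.1 < eta /\
          `|ln (x z.1) - (ln B + 2 * ln v) - ln (parab (t / tau))| <= eta &
          {for t, continuous (fun t => state i (flow g t q))}]]].
Proof.
move=> cvx bx bmu dz; have [[[tz SMz] bp nu1] [_ _ nu2]] := dz; rewrite /= in tz SMz bp nu1 nu2.
have ip : cdom i p by exact: chart_at_dom.
have p0 : crd i p 0 ord0 = 0 by exact/(boundaryP ip).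
have s0 : 0 < Num.sqrt (invmx (G i p) ord0 ord0) by rewrite sqrtr_gt0; exact: ginv00_gt0.
have w0 : w i 0 ord0 = 0.
  have E : inner g p w (nu g p) = 0 by apply/eqP; rewrite eq_le nu1 nu2.
  move: E; rewrite (inner_nu g ip bp tz) => /eqP; rewrite mulf_eq0 invr_eq0.
  by rewrite (gt_eqF s0) orbF => /eqP.
have w1 : bil (G i p) (w i) (w i) = 1 by rewrite -(inner_chart g ip tz tz).
have wn0 : w i != 0.
  by apply/eqP => E; move: w1; rewrite E bil0l => /eqP; rewrite eq_sym oner_eq0.
pose A := Gam2 g i p (w i) (w i) 0 ord0 / 2.
have GA : Gam2 g i p (w i) (w i) 0 ord0 = 2 * A by rewrite /A mulrC divfK.
have A0 : 0 < A.
  have tb : tangent_boundary p w by split.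
  have := cvx p w bp tb wn0; rewrite (tangent_tv ip tz) (II_Gam g bp w0) -/i GA.
  by rewrite pmulr_lgt0 ?invr_gt0// pmulr_rgt0.
have [d1 [H [d10 CH H0 xH]]] := base_bdf_factor bx bp ip.
have [d2 [Hm [d20 CHm Hm0 muH]]] := inflow_bdf_factor bmu bp ip w0 w1 GA A0.
rewrite -/c in CHm Hm0 muH.
exists A, (H (crd i p) / A), (Hm c); split=> //; first by rewrite divr_gt0.
move=> eta eta0; have [sx xpos xb _] := bx.
pose e := Num.min (eta / 8) 2^-1.
have e0 : 0 < e by rewrite lt_min divr_gt0//= invr_gt0.
have e1 : e <= 2^-1 by rewrite ge_min lexx orbT.
have e8 : 8 * e <= eta.
  have : e <= eta / 8 by rewrite ge_min lexx.
  by lra.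
clearbody e; have e01 : 0 < e <= 2^-1 by rewrite e0.
have h0e : 0 < H (crd i p) * e by rewrite mulr_gt0.
have pB1 : Ball (crd i p) d1 (crd i p) by exact: Ball_center.
have [r1 r10 HH] := (cont_normP _ _).1 (Cinf_cont CH pB1) _ h0e.
have cB2 : Ball c d2 c by exact: Ball_center.
have m02 : 0 < Hm c / 2 by rewrite divr_gt0.
have [r2 r20 HHm] := (cont_normP _ _).1 (Cinf_cont CHm cB2) _ m02.
have [r3 r30 Hx] := smooth_near sx I ip eta0.
pose de := Num.min (Num.min (Num.min d1 r1) (Num.min d2 r2)) (Num.min (Num.min r3 eta) e).
have de0 : 0 < de by rewrite !lt_min d10 r10 d20 r20 r30 eta0 e0.
have [k1 [k2 [k3 [k4 [k5 [k6 k7]]]]]] : de <= d1 /\ de <= r1 /\ de <= d2 /\ de <= r2 /\ de <= r3 /\ de <= eta /\ de <= e.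
  by rewrite /de !ge_min !lexx !orbT.
have de1 : 0 < de < 1 by rewrite de0 (le_lt_trans (le_trans k7 e1))// invf_lt1// ltr1n.
have [v0 v00 Hv] := glancing_exists ip bp w0 w1 GA A0 de1.
exists v0 => // v v01; have /andP[v_gt0 _] := v01.
have [q [tau [[qp qz qE qv qw] /andP[tau0 taude] ex vb [cs Ht]]]] := Hv v v01.
have sq : `|c - state i q| < de.
  have -> : c - state i q = row_mx 0 (w i - q.2 i).
    by rewrite /c /state {1}qE opp_row_mx add_row_mx subrr.
  apply: (@le_lt_trans _ _ `|q.2 i - w i|) => //.
  by apply: norm_row_mx; rewrite ?normr0// distrC.
have iq : cdom i q.1 by rewrite qE.
have At0 : 0 < A * tau by rewrite mulr_gt0.
have vb' : (1 - e) * (A * tau) <= v <= (1 + e) * (A * tau).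
  have /andP[vb1 vb2] := vb; apply/andP; split.
    by apply: le_trans vb1; rewrite ler_wpM2r ?(ltW At0)//; clear - k7; lra.
  by apply: (le_trans vb2); rewrite ler_wpM2r ?(ltW At0)//; clear - k7; lra.
exists q, tau; split=> //.
- split=> //; split=> //; have /andP[_ vb2] := vb'; apply: (le_trans vb2).
  by rewrite ler_wpM2r ?(ltW At0)//; clear - e1; lra.
- rewrite muH//; last by apply: lt_le_trans sq k3.
  rewrite qv; have := HHm _ (lt_le_trans sq k4); rewrite ltr_norml => /andP[m1 m2].
  rewrite ![_ * v]mulrC !ler_pM2l//; move: (Hm _) (Hm c) m1 m2 Hm0 => y y' m1 m2 m3.
  by clear - m1 m2 m3; apply/andP; split; lra.
- move=> t /andP[t0 tt] z.
  have tt' : 0 <= t <= tau by rewrite !ltW.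
  have [iz SMz' sz hz] := Ht t tt'; rewrite -/z in iz SMz' sz hz.
  have cz : `|c - state i z| < de by rewrite distrC.
  have cz1 : `|crd i p - crd i z.1| < de.
    apply: le_lt_trans cz; have -> : crd i p - crd i z.1 = lsubmx (c - state i z).
      by rewrite linearB/= /c /state !row_mxKl.
    exact: norm_lsubmx.
  have ts0 : 0 < t * (tau - t) by rewrite mulr_gt0// subr_gt0.
  have Ats0 : 0 < A * (t * (tau - t)) by rewrite mulr_gt0.
  have hz' : (1 - e) * (A * (t * (tau - t))) <= crd i z.1 0 ord0 <= (1 + e) * (A * (t * (tau - t))).
    have /andP[z1 z2] := hz; apply/andP; split.
      by apply: le_trans z1; rewrite ler_wpM2r ?(ltW Ats0)//; clear - k7; lra.
    by apply: (le_trans z2); rewrite ler_wpM2r ?(ltW Ats0)//; clear - k7; lra.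
  have [X0 lX] := ratio_ln e01 Ats0 hz'.
  have nb : ~ boundary M z.1 by move=> /(boundaryP iz) E; rewrite E ltxx in X0.
  have [_ lv] := ratio_ln e01 At0 vb'.
  have HB : (1 - e) * H (crd i p) <= H (crd i z.1) <= (1 + e) * H (crd i p).
    have := HH _ (lt_le_trans cz1 k2); rewrite ltr_norml => /andP[m1 m2].
    by move: (H (crd i z.1)) (H (crd i p)) m1 m2 => y y' m1 m2; clear - m1 m2; apply/andP; split; lra.
  have [H1 lH] := ratio_ln e01 H0 HB.
  have xE := xH z.1 iz (lt_le_trans cz1 k1).
  have pt : parab (t / tau) = t * (tau - t) / tau ^+ 2.
    by rewrite /parab; field; rewrite gt_eqF.
  split=> //; first exact: lt_le_trans cz k6.
    split=> //; split.
      have x0 : 0 < x z.1 by apply: xpos; split.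
      rewrite x0 /=; have := Hx z.1 I iz (lt_le_trans cz1 k5).
      by rewrite xb// sub0r normrN gtr0_norm.
    have E1 : ln (parab (t / tau)) = ln (t * (tau - t)) - 2 * ln tau.
      by rewrite pt ln_div ?posrE ?exprn_gt0// lnXn// mulr_natl.
    have E2 : ln (H (crd i p) / A) = ln (H (crd i p)) - ln A by rewrite ln_div ?posrE.
    have E3 : ln (x z.1) = ln (crd i z.1 0 ord0) + ln (H (crd i z.1)) by rewrite xE lnM ?posrE.
    have E4 : ln (A * (t * (tau - t))) = ln A + ln (t * (tau - t)) by rewrite lnM ?posrE.
    have E5 : ln (A * tau) = ln A + ln tau by rewrite lnM ?posrE.
    rewrite E1 E2 E3; rewrite E4 in lX; rewrite E5 in lv.
    move: lX lv lH; move: (ln (crd i z.1 0 ord0)) (ln (H (crd i z.1))) (ln (H (crd i p))) (ln A) (ln v) (ln tau) (ln (t * (tau - t))).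
    move=> a1 a2 a3 a4 a5 a6 a7; rewrite !ler_norml => /andP[b1 b2] /andP[b3 b4] /andP[b5 b6].
    by clear - b1 b2 b3 b4 b5 b6 e8; apply/andP; split; lra.
  have tin : [set` `]0, tau[%R] t by rewrite /= in_itv/= t0.
  have := continuous_subspaceW (@subset_itv_oo_cc _ _ 0 tau) cs.
  rewrite continuous_open_subspace; last exact: interval_open.
  by move=> C; apply: C; rewrite inE.
Qed.

End Package.

(** * Exponential sums and rescaled terms of an expansion *)

Import Normc.

Section ExpSums.
Context {R : realType}.
Implicit Types (x y L h e : R) (u v : R[i]).

Lemma normc_add u v : normc (u + v) <= normc u + normc v.
Proof. exact: (@le_normcD R u v). Qed.

Lemma normc_opp u : normc (- u) = normc u.
Proof. exact: (@normcN R u). Qed.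

Lemma normc_sub u v : normc (u - v) <= normc u + normc v.
Proof. by rewrite -(normc_opp v); exact: normc_add. Qed.

Lemma normc_ge0 u : 0 <= normc u.
Proof. by case: u => a b; exact: sqrtr_ge0. Qed.

Lemma normc_real x : normc (Complex x 0) = `|x|.
Proof. by rewrite /normc /= expr0n/= addr0 sqrtr_sqr. Qed.

Lemma Re_le_normc u : `|complex.Re u| <= normc u.
Proof. by case: u => a b /=; rewrite -sqrtr_sqr ler_wsqrtr// lerDl sqr_ge0. Qed.

Lemma Im_le_normc u : `|complex.Im u| <= normc u.
Proof. by case: u => a b /=; rewrite -sqrtr_sqr ler_wsqrtr// lerDr sqr_ge0. Qed.

Lemma normc_le u (c d : R) : `|complex.Re u| <= c -> `|complex.Im u| <= d -> normc u <= c + d.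
Proof.
case: u => a b /= ac bd; have c0 := le_trans (normr_ge0 _) ac; have d0 := le_trans (normr_ge0 _) bd.
rewrite -[leRHS]ger0_norm ?addr_ge0// -sqrtr_sqr ler_wsqrtr//.
rewrite -(real_normK (num_real a)) -(real_normK (num_real b)) sqrrD.
have : `|a| ^+ 2 <= c ^+ 2 by rewrite ler_pXn2r ?nnegrE.
have : `|b| ^+ 2 <= d ^+ 2 by rewrite ler_pXn2r ?nnegrE.
have : 0 <= c * d *+ 2 by rewrite mulrn_wge0// mulr_ge0.
by lra.
Qed.

Definition cis x : R[i] := Complex (cos x) (sin x).

Lemma cisD x y : cis (x + y) = cis x * cis y.
Proof.
by rewrite /cis cosD sinD; apply/eqP; rewrite eq_complex /=; apply/andP; split; apply/eqP; ring.
Qed.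

Lemma normc_cis x : normc (cis x) = 1.
Proof. by rewrite /normc/= cos2Dsin2 sqrtr1. Qed.

Lemma cis_neq0 x : cis x != 0.
Proof. by apply/eqP => E; have := normc_cis x; rewrite E normc0 => /eqP; rewrite eq_sym oner_eq0. Qed.

Lemma cis_pi x : cis (x + pi) = - cis x.
Proof. by rewrite /cis cosDpi sinDpi; apply/eqP; rewrite eq_complex /= !eqxx. Qed.

(** By induction on the number of terms: S (L + h) - e^{i b h} S (L) also
    tends to 0 and has lost the frequency b. Its other coefficients,
    multiplied by e^{i b' h} - e^{i b h}, are therefore 0, and some h makes
    this factor nonzero. *)
Lemma exp_sum_zero (s : seq (R * R[i])) : uniq (map fst s) ->
  (forall e, 0 < e -> exists L0, forall L, L < L0 ->
     normc (\sum_(c <- s) c.2 * cis (c.1 * L)) < e) ->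
  forall c, c \in s -> c.2 = 0.
Proof.
have [m] := ubnP (size s); elim: m s => // m IH [//|[b1 C1] s] sm /= /andP[b1s us] H.
have Z (h : R) (c : R * R[i]) : c \in s -> c.2 * (cis (c.1 * h) - cis (b1 * h)) = 0.
  move=> cs; pose s' := [seq (d.1, d.2 * (cis (d.1 * h) - cis (b1 * h))) | d <- s].
  have : (c.1, c.2 * (cis (c.1 * h) - cis (b1 * h))) \in s' by apply/mapP; exists c.
  apply: (IH s').
  - by rewrite size_map.
  - by rewrite -map_comp (eq_map (g := fst)).
  move=> e e0; have e2 : 0 < e / 2 by rewrite divr_gt0.
  have [L0 HL] := H _ e2; exists (Num.min L0 (L0 - h)) => L; rewrite lt_min => /andP[L1 L2].
  have h1 := HL L L1; have h2 := HL (L + h) (ltac:(by rewrite -ltrBrDr)).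
  have -> : \sum_(c <- s') c.2 * cis (c.1 * L) =
      \sum_(c <- (b1, C1) :: s) c.2 * cis (c.1 * (L + h))
      - cis (b1 * h) * \sum_(c <- (b1, C1) :: s) c.2 * cis (c.1 * L).
    rewrite big_map !big_cons /= !mulrDr !cisD opprD addrACA.
    have -> : C1 * (cis (b1 * L) * cis (b1 * h)) - cis (b1 * h) * (C1 * cis (b1 * L)) = 0 by ring.
    rewrite add0r mulr_sumr -sumrB; apply: eq_bigr => d _.
    by rewrite [d.1 * (L + h)]mulrDr cisD; ring.
  apply: le_lt_trans (normc_sub _ _) _.
  by rewrite normcM normc_cis mul1r [ltRHS]splitr; exact: ltrD.
have Zs (c : R * R[i]) : c \in s -> c.2 = 0.
  move=> cs; have cb : c.1 != b1.
    by apply: contraNneq b1s => <-; apply: map_f.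
  have cb0 : c.1 - b1 != 0 by rewrite subr_eq0.
  (* for this h the two exponentials are opposite *)
  have := Z (pi / (c.1 - b1)) c cs.
  have -> : c.1 * (pi / (c.1 - b1)) = b1 * (pi / (c.1 - b1)) + pi by field.
  rewrite cis_pi => /eqP; rewrite mulf_eq0 => /orP[/eqP//|].
  by rewrite -opprD oppr_eq0 -mulr2n mulrn_eq0 (negbTE (cis_neq0 _)).
move=> c; rewrite inE => /orP[/eqP->/=|]; last exact: Zs.
apply: eq0_normc; apply/eqP; rewrite -[_ == 0]andbT eq_le normc_ge0 !andbT.
apply/ler_addgt0Pl => e e0; rewrite addr0.
have [L0 HL] := H _ e0; have := HL (L0 - 1) (ltac:(by rewrite ltrBlDr ltrDl)).
rewrite big_cons big_seq big1 ?addr0 => [|d /Zs->]; last by rewrite mul0r.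
by rewrite normcM normc_cis mulr1 => /ltW.
Qed.

End ExpSums.

Section PowLog.
Context {R : realType}.
Implicit Types (a b r th l L u e : R) (k K m : nat).

Lemma powlog_exp (x : R) (zk : R[i] * nat) : 0 < x -> powlog x zk =
  Complex (expR (complex.Re zk.1 * ln x) * (ln x) ^+ zk.2) 0 * cis (complex.Im zk.1 * ln x).
Proof.
move=> x0; rewrite /powlog /cis /powR gt_eqF//.
by apply/eqP; rewrite eq_complex /= !mul0r subr0 addr0 !eqxx.
Qed.

Lemma expRX_bound m th : 0 < th -> exists2 C : R, 0 < C &
  forall x : R, 0 <= x -> (2 + x) ^+ m <= C * expR (th * x).
Proof.
move=> th0; pose q := Num.min 2^-1 (th / m.+1%:R).
have q0 : 0 < q by rewrite lt_min invr_gt0 divr_gt0// ltr0n.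
have q1 : q <= 2^-1 by rewrite ge_min lexx.
have q2 : q * m%:R <= th.
  apply: (@le_trans _ _ (th / m.+1%:R * m.+1%:R)); last by rewrite divfK.
  by apply: ler_pM; rewrite ?(ltW q0)// ?ge_min ?lexx ?orbT// ler_nat.
exists (q ^- m); first by rewrite invr_gt0 exprn_gt0.
move=> x x0; have H : q * (2 + x) <= expR (q * x).
  apply: le_trans (expR_ge1Dx _); rewrite mulrDr lerD2r.
  by rewrite -ler_pdivlMr// mul1r.
rewrite mulrC ler_pdivlMr ?exprn_gt0// -exprMn mulrC.
apply: (@le_trans _ _ (expR (q * x) ^+ m)).
  by rewrite lerXn2r// nnegrE ?expR_ge0// mulr_ge0 ?addr_ge0// ltW.
by rewrite -expRM_natl ler_expR mulrA [m%:R * q]mulrC ler_wpM2r.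
Qed.

Lemma pow1w_bound K (w : R) : `|(1 + w) ^+ K - 1| <= `|w| * (K%:R * (1 + `|w|) ^+ K).
Proof.
elim: K => [|K IH]; first by rewrite expr0 subrr normr0 mul0r mulr0.
have w1 : 1 <= 1 + `|w| by rewrite lerDl.
have -> : (1 + w) ^+ K.+1 - 1 = (1 + w) * ((1 + w) ^+ K - 1) + w by rewrite exprS; ring.
apply: (le_trans (ler_normD _ _)); rewrite normrM.
have h1 : `|1 + w| <= 1 + `|w| by rewrite (le_trans (ler_normD _ _))// normr1.
have h2 : 1 <= (1 + `|w|) ^+ K.+1 by rewrite exprn_ege1.
have h3 : `|1 + w| * `|(1 + w) ^+ K - 1| <= (1 + `|w|) * (`|w| * (K%:R * (1 + `|w|) ^+ K)).
  by apply: ler_pM.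
apply: (le_trans (lerD h3 (lexx `|w|))).
have : `|w| <= `|w| * ((1 + `|w|) * (1 + `|w|) ^+ K) by rewrite ler_peMr// -exprS.
rewrite -[K.+1%:R]natr1 exprS; move: `|w| => y ?.
have -> : y * ((K%:R + 1) * ((1 + y) * (1 + y) ^+ K)) =
  (1 + y) * (y * (K%:R * (1 + y) ^+ K)) + y * ((1 + y) * (1 + y) ^+ K) by ring.
by rewrite lerD2l.
Qed.

(** The term x^{a + i b} (ln x)^k divided by e^{r L} L^K, where ln x = la.
    Along glancing geodesics la = L + l + u with l = ln (s (1 - s)) and u
    small. *)
Definition scaled (a b : R) k (r : R) K L (la : R) : R[i] :=
  Complex (expR (- (r * L)) * L ^- K * (expR (a * la) * la ^+ k)) 0 * cis (b * la).

Lemma normc_scaled a b k r K L la :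
  normc (scaled a b k r K L la) = expR (- (r * L)) * `|L| ^- K * (expR (a * la) * `|la| ^+ k).
Proof.
rewrite /scaled normcM normc_cis mulr1 normc_real !normrM normfV !normrX.
by rewrite [`|expR (- _)|]ger0_norm ?expR_ge0// [`|expR _|]ger0_norm ?expR_ge0.
Qed.

Lemma abs_sum_bound L l u : L <= -1 -> l <= 0 -> `|u| <= 1 -> `|L + l + u| <= `|L| * (2 + `|l|).
Proof.
move=> L1 l0 u1; rewrite (ler0_norm l0) [in leRHS]ler0_norm; last by lra.
have H : `|L + l + u| <= - L - l + 1.
  rewrite (le_trans (ler_normD _ _))// lerD// (le_trans (ler_normD _ _))//.
  by rewrite !ler0_norm//; lra.
apply: (le_trans H).
have : 0 <= (- L - 1) * (- l) by rewrite mulr_ge0//; lra.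
by lra.
Qed.

(** The factor e^{(a - r) (L + l)} is exponentially small in L, while the
    logarithms grow polynomially. *)
Lemma scaled_higher (a b r th : R) k K : r < a -> 0 < th ->
  forall e, 0 < e -> exists2 L0, L0 <= -1 & forall L l u, L < L0 -> l <= 0 -> `|u| <= 1 ->
    normc (scaled a b k r K L (L + l + u)) <= e * expR ((r - th) * l).
Proof.
move=> ra th0 e e0; have [C C0 HC] := expRX_bound k th0.
have c0 : 0 < (a - r) / 2 by rewrite divr_gt0// subr_gt0.
have [C' C'0 HC'] := expRX_bound k c0.
pose D := expR `|a| * C * C'; have D0 : 0 < D by rewrite !mulr_gt0// expR_gt0.
pose L1 := ln (e / D) / ((a - r) / 2).
exists (Num.min (-1) L1); first by rewrite ge_min lexx.
move=> L l u; rewrite lt_min => /andP[L_1 LL1] l0 u1.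
have La : 1 <= `|L| by rewrite ltr0_norm; lra.
have L0 : 0 < `|L| by lra.
rewrite normc_scaled.
have h1 : `|L| ^- K <= 1 by rewrite invf_le1 ?exprn_gt0// exprn_ege1.
have h2 : `|L + l + u| ^+ k <= (`|L| ^+ k) * (2 + `|l|) ^+ k.
  by rewrite -exprMn lerXn2r ?nnegrE ?mulr_ge0 ?addr_ge0// abs_sum_bound// ltW.
have h3 : (2 + `|l|) ^+ k <= C * expR (- (th * l)).
  by apply: (le_trans (HC _ (normr_ge0 l))); rewrite ler0_norm// mulrN.
have h4 : `|L| ^+ k <= C' * expR (- ((a - r) / 2 * L)).
  have := HC' _ (normr_ge0 L); rewrite [in X in expR X]ltr0_norm ?mulrN; last by lra.
  by apply: le_trans; rewrite lerXn2r ?nnegrE// lerDr.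
have h5 : expR (a * (L + l + u)) <= expR (a * L + r * l) * expR `|a|.
  rewrite -expRD ler_expR mulrDr mulrDr -!addrA lerD2l.
  have : a * u <= `|a|.
    by rewrite (le_trans (ler_norm _))// normrM ler_piMr.
  have : 0 <= (a - r) * (- l) by rewrite mulr_ge0//; lra.
  by lra.
have h6 : expR ((a - r) / 2 * L) <= e / D.
  rewrite -[leRHS]lnK ?posrE ?divr_gt0// ler_expR mulrC -ler_pdivlMr//; exact: ltW.
have h24 : `|L + l + u| ^+ k <= C' * expR (- ((a - r) / 2 * L)) * (C * expR (- (th * l))).
  by apply: (le_trans h2); apply: ler_pM => //; rewrite exprn_ge0// addr_ge0.
have hA : expR (- (r * L)) * `|L| ^- K <= expR (- (r * L)) by rewrite ler_piMr ?expR_ge0.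
have hB : expR (a * (L + l + u)) * `|L + l + u| ^+ k <=
   expR (a * L + r * l) * expR `|a| * (C' * expR (- ((a - r) / 2 * L)) * (C * expR (- (th * l)))).
  by apply: ler_pM => //; rewrite ?expR_ge0 ?exprn_ge0.
have p0 : 0 <= expR (- (r * L)) / `|L| ^+ K.
  by apply: mulr_ge0; [exact: expR_ge0|rewrite invr_ge0 exprn_ge0].
have p1 : 0 <= expR (a * (L + l + u)) * `|L + l + u| ^+ k.
  by apply: mulr_ge0; [exact: expR_ge0|exact: exprn_ge0].
apply: (le_trans (ler_pM p0 p1 hA hB)).
have -> : expR (- (r * L)) * (expR (a * L + r * l) * expR `|a| * (C' * expR (- ((a - r) / 2 * L)) * (C * expR (- (th * l)))))
  = D * (expR (- (r * L)) * expR (a * L + r * l) * expR (- ((a - r) / 2 * L)) * expR (- (th * l))).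
  by rewrite /D; ring.
rewrite -!expRD.
have -> : - (r * L) + (a * L + r * l) + - ((a - r) / 2 * L) + - (th * l) =
   (a - r) / 2 * L + (r - th) * l by field.
rewrite expRD mulrA ler_wpM2r ?expR_ge0//.
by rewrite mulrC -ler_pdivlMr.
Qed.

(** A power of ln x smaller than K loses at least a factor L, uniformly if an
    arbitrarily small power of s (1 - s) is given up. *)
Lemma scaled_lowlog (b r th : R) k K : (k < K)%N -> 0 < th ->
  forall e, 0 < e -> exists2 L0, L0 <= -1 & forall L l u, L < L0 -> l <= 0 -> `|u| <= 1 ->
    normc (scaled r b k r K L (L + l + u)) <= e * expR ((r - th) * l).
Proof.
move=> kK th0 e e0; have [C C0 HC] := expRX_bound k th0.
pose D := expR `|r| * C; have D0 : 0 < D by rewrite !mulr_gt0// expR_gt0.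
exists (Num.min (-1) (- (D / e))); first by rewrite ge_min lexx.
move=> L l u; rewrite lt_min => /andP[L_1 LL1] l0 u1.
have La : 1 <= `|L| by rewrite ltr0_norm; lra.
have L0 : 0 < `|L| by lra.
rewrite normc_scaled.
have h2 : `|L + l + u| ^+ k <= (`|L| ^+ k) * (2 + `|l|) ^+ k.
  by rewrite -exprMn lerXn2r ?nnegrE ?mulr_ge0 ?addr_ge0// abs_sum_bound// ltW.
have h3 : (2 + `|l|) ^+ k <= C * expR (- (th * l)).
  by apply: (le_trans (HC _ (normr_ge0 l))); rewrite ler0_norm// mulrN.
have h5 : expR (r * (L + l + u)) <= expR (r * L + r * l) * expR `|r|.
  rewrite -expRD ler_expR mulrDr mulrDr lerD2l.
  by rewrite (le_trans (ler_norm _))// normrM ler_piMr.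
have h6 : `|L| ^- K * `|L| ^+ k <= `|L|^-1.
  rewrite mulrC ler_pdivrMr ?exprn_gt0// -(subnK kK) addnS exprSr mulrA [_^-1 * _]mulrC.
  by rewrite -mulrA mulVf ?mulr1 ?gt_eqF// exprD ler_peMl ?exprn_ge0// exprn_ege1.
have h7 : `|L|^-1 <= e / D.
  rewrite -[leRHS]invf_div lef_pV2 ?posrE ?divr_gt0//.
  by rewrite ltr0_norm; lra.
have hB : expR (r * (L + l + u)) * `|L + l + u| ^+ k <=
   expR (r * L + r * l) * expR `|r| * (`|L| ^+ k * (C * expR (- (th * l)))).
  apply: ler_pM => //; rewrite ?expR_ge0 ?exprn_ge0//.
  by apply: (le_trans h2); rewrite ler_wpM2l ?exprn_ge0.
have p0 : 0 <= expR (- (r * L)) / `|L| ^+ K.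
  by apply: mulr_ge0; [exact: expR_ge0|rewrite invr_ge0 exprn_ge0].
apply: (le_trans (ler_wpM2l p0 hB)).
have -> : expR (- (r * L)) / `|L| ^+ K * (expR (r * L + r * l) * expR `|r| * (`|L| ^+ k * (C * expR (- (th * l)))))
  = D * (`|L| ^- K * `|L| ^+ k) * (expR (- (r * L)) * expR (r * L + r * l) * expR (- (th * l))).
  by rewrite /D; ring.
rewrite -!expRD.
have -> : - (r * L) + (r * L + r * l) + - (th * l) = (r - th) * l by ring.
rewrite ler_wpM2r ?expR_ge0//.
by rewrite mulrC -ler_pdivlMr// (le_trans h6).
Qed.

(** At level (r, K) the logarithm ln x is replaced by L, at the price of a
    power of s (1 - s). *)
Lemma scaled_main (b r th : R) K : 0 < th ->
  forall e, 0 < e -> exists L0 eta : R, [/\ L0 <= -1, 0 < eta <= 1 &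
   forall L l u, L < L0 -> l <= 0 -> `|u| <= eta ->
    normc (scaled r b K r K L (L + l + u) - Complex (expR (r * l)) 0 * cis (b * (L + l)))
      <= e * expR ((r - th) * l)].
Proof.
move=> th0 e e0; have [C C0 HC] := expRX_bound K.+1 th0.
have e2 : 0 < e / 2 by rewrite divr_gt0.
pose D := expR `|r| * K%:R * C + 1.
have D0 : 0 < D by rewrite /D ltr_wpDl// !mulr_ge0 ?expR_ge0// ltW.
have cexp : {for (0 : R), continuous (fun u : R => expR (r * u) * cos (b * u))}.
  apply: continuousM.
    apply: (@continuous_comp _ _ _ (fun u : R => r * u) expR); last exact: continuous_expR.
    by apply: continuousM; [exact: cvg_cst|exact: cvg_id].
  apply: (@continuous_comp _ _ _ (fun u : R => b * u) (@cos R)); last exact: continuous_cos.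
  by apply: continuousM; [exact: cvg_cst|exact: cvg_id].
have sexp : {for (0 : R), continuous (fun u : R => expR (r * u) * sin (b * u))}.
  apply: continuousM.
    apply: (@continuous_comp _ _ _ (fun u : R => r * u) expR); last exact: continuous_expR.
    by apply: continuousM; [exact: cvg_cst|exact: cvg_id].
  apply: (@continuous_comp _ _ _ (fun u : R => b * u) (@sin R)); last exact: continuous_sin.
  by apply: continuousM; [exact: cvg_cst|exact: cvg_id].
have e4 : 0 < e / 4 by rewrite divr_gt0.
have [d1 d10 H1] := (cont_normP _ _).1 cexp _ e4.
have [d2 d20 H2] := (cont_normP _ _).1 sexp _ e4.
pose eta := Num.min 1 (Num.min d1 d2 / 2).
have m0 : 0 < Num.min d1 d2 by rewrite lt_min d10.
exists (Num.min (-1) (- (2 * D / e))), eta; split.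
- by rewrite ge_min lexx.
- by rewrite lt_min ltr01 divr_gt0//= ge_min lexx.
move=> L l u; rewrite lt_min => /andP[L_1 LL1] l0 ue.
have u1 : `|u| <= 1 by rewrite (le_trans ue)// ge_min lexx.
have um : `|u| < Num.min d1 d2.
  by rewrite (le_lt_trans ue)// /eta gt_min; apply/orP; right; lra.
have La : 1 <= `|L| by rewrite ltr0_norm; lra.
have L0 : 0 < `|L| by lra.
have Ln0 : L != 0 by rewrite lt_eqF//; lra.
pose w := (l + u) / L.
have laE : L + l + u = L * (1 + w) by rewrite /w; field.
have wb : 1 + `|w| <= 2 + `|l|.
  have : `|w| <= 1 + `|l|.
    rewrite /w normrM normfV ler_pdivrMr//.
    apply: (@le_trans _ _ (1 + `|l|)); last by rewrite ler_peMr// addr_ge0.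
    by rewrite (le_trans (ler_normD _ _))// addrC lerD2r.
  lra.
have wb2 : `|w| <= (2 + `|l|) / `|L|.
  rewrite /w normrM normfV ler_pM2r ?invr_gt0// (le_trans (ler_normD _ _))//.
  by rewrite addrC lerD2r; lra.
have E : scaled r b K r K L (L + l + u) =
   Complex (expR (r * l)) 0 * cis (b * (L + l)) * (Complex (expR (r * u) * (1 + w) ^+ K) 0 * cis (b * u)).
  rewrite /scaled [b * (L + l + u)]mulrDr cisD.
  have -> : expR (- (r * L)) / L ^+ K * (expR (r * (L + l + u)) * (L + l + u) ^+ K) =
     expR (r * l) * (expR (r * u) * (1 + w) ^+ K).
    rewrite {2}laE exprMn [r * (L + l + u)]mulrDr [r * (L + l)]mulrDr !expRD expRN.
    field; by rewrite ?expf_neq0 ?Ln0 ?gt_eqF ?expR_gt0.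
  have -> : Complex (expR (r * l) * (expR (r * u) * (1 + w) ^+ K)) 0 =
     Complex (expR (r * l)) 0 * Complex (expR (r * u) * (1 + w) ^+ K) 0 :> R[i].
    by apply/eqP; rewrite eq_complex /= !mul0r mulr0 subr0 addr0 !eqxx.
  by ring.
pose T := Complex (expR (r * u)) 0 * cis (b * u).
have E2 : Complex (expR (r * u) * (1 + w) ^+ K) 0 * cis (b * u) = T + T * Complex ((1 + w) ^+ K - 1) 0.
  by apply/eqP; rewrite eq_complex /=; apply/andP; split; apply/eqP; ring.
rewrite E -[X in _ - X]mulr1 -mulrBr normcM normcM normc_cis mulr1 normc_real ger0_norm ?expR_ge0//.
have T1 : normc (T - 1) <= e / 2.
  rewrite [e / 2](_ : _ = e / 4 + e / 4); last by field.
  have := H1 u; have := H2 u; rewrite sub0r normrN !mulr0 expR0 cos0 sin0 mulr0 mulr1.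
  move: um; rewrite lt_min => /andP[um1 um2] /(_ um2) h2 /(_ um1) h1.
  apply: normc_le; rewrite /T /= ?mul0r ?subr0 ?addr0.
    by rewrite distrC ltW.
  by move: h2; rewrite sub0r normrN => /ltW.
have T2 : normc T <= expR `|r|.
  rewrite /T normcM normc_cis mulr1 normc_real ger0_norm ?expR_ge0// ler_expR.
  by rewrite (le_trans (ler_norm _))// normrM ler_piMr.
have T3 : `|(1 + w) ^+ K - 1| <= K%:R * (2 + `|l|) ^+ K.+1 / `|L|.
  apply: (le_trans (pow1w_bound _ _)).
  apply: (@le_trans _ _ ((2 + `|l|) / `|L| * (K%:R * (2 + `|l|) ^+ K))).
    apply: ler_pM => //.
    by rewrite ler_wpM2l// lerXn2r// nnegrE addr_ge0.
  by rewrite exprS le_eqVlt; apply/orP; left; apply/eqP; ring.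
have h3 : (2 + `|l|) ^+ K.+1 <= C * expR (- (th * l)).
  by apply: (le_trans (HC _ (normr_ge0 l))); rewrite ler0_norm// mulrN.
have e1 : 1 <= expR (- (th * l)).
  by rewrite -[leLHS]expR0 ler_expR oppr_ge0 mulr_ge0_le0// ltW.
have -> : e * expR ((r - th) * l) = expR (r * l) * (e * expR (- (th * l))).
  by rewrite mulrBl expRD; ring.
rewrite ler_wpM2l ?expR_ge0//.
rewrite E2 addrAC; apply: (le_trans (normc_add _ _)).
rewrite [in leRHS](splitr e) mulrDl; apply: lerD.
  by apply: (le_trans T1); rewrite ler_peMr// ltW.
rewrite normcM normc_real.
have h7 : `|L|^-1 <= e / 2 / D.
  rewrite -[leRHS]invf_div lef_pV2 ?posrE ?divr_gt0//.
  rewrite ltr0_norm; last by lra.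
  have -> : D / (e / 2) = 2 * D / e by field; rewrite gt_eqF.
  by lra.
apply: (@le_trans _ _ (expR `|r| * (K%:R * (C * expR (- (th * l))) / `|L|))).
  apply: ler_pM => //; first exact: normc_ge0.
  apply: (le_trans T3); rewrite ler_wpM2r ?invr_ge0// ler_wpM2l//.
apply: (@le_trans _ _ (D * expR (- (th * l)) / `|L|)).
  have -> : expR `|r| * (K%:R * (C * expR (- (th * l))) / `|L|) = (expR `|r| * K%:R * C) * expR (- (th * l)) / `|L| by ring.
  by rewrite ler_wpM2r ?invr_ge0// ler_wpM2r ?expR_ge0// /D lerDl.
rewrite mulrAC ler_wpM2r ?expR_ge0//.
by rewrite mulrC -ler_pdivlMr.
Qed.

End PowLog.

(** * Rescaled integrals along a geodesic *)

Section Asymptotics.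
Context {R : realType}.
Local Notation mu := (@lebesgue_measure R).
Local Notation oo tau := [set` `]0%R, tau[%R].
Implicit Types (tau r th L e : R).

Lemma measurable_oo tau : measurable (oo tau : set (measurableTypeR R)).
Proof. exact: measurable_itv. Qed.

(** F is integrable because it is within e W of G. *)
Lemma int_close tau (F G W : R -> R) e : 0 < tau ->
  (forall t, 0 < t < tau -> {for t, continuous F}) ->
  mu.-integrable (oo tau) (EFin \o G) -> mu.-integrable (oo tau) (EFin \o W) ->
  (forall t, 0 < t < tau -> `|F t - G t| <= e * W t) ->
  `|(\int[mu]_(t in [set t : R | (0 <= t <= tau)%R]) F t)%R - (\int[mu]_(t in oo tau) G t)%R|
    <= e * (\int[mu]_(t in oo tau) W t)%R.
Proof.
move=> tau0 cF itG itW H.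
have mF := @oo_measurable_fun R tau F cF.
have itZ : mu.-integrable (oo tau) (EFin \o (fun t => e * W t)) by exact: (integrableZl (measurable_oo tau) e itW).
have mG : measurable_fun (oo tau) G by apply/measurable_EFinP; exact: (measurable_int mu itG).
have itD : mu.-integrable (oo tau) (EFin \o (fun t => F t - G t)).
  apply: (le_integrable (measurable_oo tau) _ _ itZ).
    by apply/measurable_EFinP; apply: measurable_funB.
  move=> t; rewrite /= in_itv/= lee_fin => tt.
  by rewrite (le_trans (H t tt))// ler_norm.
have itF : mu.-integrable (oo tau) (EFin \o F).
  have := @integrableD _ _ R mu (oo tau) (measurable_oo tau) _ _ itD itG.
  apply: eq_integrable; first exact: measurable_oo.
  by move=> t _; rewrite /= -EFinD subrK.
have -> : (\int[mu]_(t in [set t : R | (0 <= t <= tau)%R]) F t)%R = (\int[mu]_(t in oo tau) F t)%R.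
  have -> : [set t : R | (0 <= t <= tau)%R] = [set` `[0, tau]%R].
    by apply/seteqP; split=> t; rewrite /= in_itv.
  rewrite /Rintegral; congr fine; apply: integral_itv_bndoo.
  by apply/measurable_EFinP; exact: mF.
rewrite -(RintegralB (measurable_oo tau) itF itG).
apply: (le_trans (le_normr_Rintegral (measurable_oo tau) itD)).
rewrite -(RintegralZl e (measurable_oo tau) itW).
by apply: (le_Rintegral (measurable_oo tau)) => //; exact: (integrable_norm itD).
Qed.

Lemma sum_ebeta_int r (I : Type) (s : seq I) (b A B : I -> R) : -1 < r ->
  let G t := \sum_(i <- s) (A i * ebeta r (b i) 0 t + B i * ebeta r (b i) (- (pi / 2)) t) in
  [/\ forall t, 0 < t < 1 -> {for t, continuous G}, mu.-integrable (oo 1) (EFin \o G) &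
    (\int[mu]_(t in oo 1) G t)%R =
    \sum_(i <- s) (A i * beta r (b i) 0 + B i * beta r (b i) (- (pi / 2)))].
Proof.
move=> r1 G; have it a th := @ebeta_integrable R r a th r1.
have cG t : 0 < t < 1 -> {for t, continuous G}.
  move=> t01; apply: continuous_fsum => i; apply: continuousD;
    by apply: continuousM; [exact: cvg_cst|exact: ebeta_cont].
suff [] : mu.-integrable (oo 1) (EFin \o G) /\ (\int[mu]_(t in oo 1) G t)%R =
    \sum_(i <- s) (A i * beta r (b i) 0 + B i * beta r (b i) (- (pi / 2))) by [].
rewrite {cG}/G; elim: s => [|i s [IH1 IH2]].
  have -> : (fun t : R => \sum_(i <- [::]) (A i * ebeta r (b i) 0 t + B i * ebeta r (b i) (- (pi / 2)) t)) = (fun=> 0).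
    by apply/funext => t; rewrite big_nil.
  by split; [exact: integrable0|rewrite big_nil /Rintegral integral0].
have [i1 E1] := Rint_comb (A i) (B i) (measurable_oo 1) (it (b i) 0) (it (b i) (- (pi / 2))).
have -> : (fun t : R => \sum_(i <- i :: s) (A i * ebeta r (b i) 0 t + B i * ebeta r (b i) (- (pi / 2)) t)) =
   (fun t => (A i * ebeta r (b i) 0 t + B i * ebeta r (b i) (- (pi / 2)) t) +
     \sum_(i <- s) (A i * ebeta r (b i) 0 t + B i * ebeta r (b i) (- (pi / 2)) t)).
  by apply/funext => t; rewrite big_cons.
split; first exact: (@integrableD _ _ R mu (oo 1) (measurable_oo 1) _ _ i1 IH1).
by rewrite (RintegralD (measurable_oo 1) i1 IH1) E1 IH2 big_cons.
Qed.

(** The complex number J(r + i b). *)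
Definition cbeta r (b : R) : R[i] := Complex (beta r b 0) (beta r b (- (pi / 2))).

Lemma cbeta_neq0 r (b : R) : -1 < r -> cbeta r b != 0.
Proof.
move=> r1; apply/eqP => -[E1 E2]; exact: (@beta_neq0 R r b r1).
Qed.

(** So the integral of this term over the unit interval is c e^{i b L} J(r + i
    b), in real form. *)
Lemma main_term r (b L : R) (c : R[i]) (t : R) (l := ln (parab t)) :
  c * (Complex (expR (r * l)) 0 * cis (b * (L + l))) =
  Complex (complex.Re (c * cis (b * L)) * ebeta r b 0 t - complex.Im (c * cis (b * L)) * ebeta r b (- (pi / 2)) t)
   (complex.Im (c * cis (b * L)) * ebeta r b 0 t + complex.Re (c * cis (b * L)) * ebeta r b (- (pi / 2)) t).
Proof.
have -> : ebeta r b (- (pi / 2)) t = expR (r * l) * sin (b * l).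
  rewrite /ebeta; have -> : cos (b * l + - (pi / 2)) = sin (b * l).
    by rewrite cosB cos_pihalf sin_pihalf mulr0 add0r mulr1.
  by [].
rewrite /ebeta addr0 -/l mulrDr cisD.
case: c => c1 c2; apply/eqP; rewrite eq_complex /=; apply/andP; split; apply/eqP; ring.
Qed.

Lemma Re_sum (I : Type) (s : seq I) (F : I -> R[i]) :
  complex.Re (\sum_(i <- s) F i) = \sum_(i <- s) complex.Re (F i).
Proof. by elim: s => [|i s IH]; rewrite ?big_nil// !big_cons -IH; case: (F i); case: (\sum_(_ <- _) _). Qed.

Lemma Im_sum (I : Type) (s : seq I) (F : I -> R[i]) :
  complex.Im (\sum_(i <- s) F i) = \sum_(i <- s) complex.Im (F i).
Proof. by elim: s => [|i s IH]; rewrite ?big_nil// !big_cons -IH; case: (F i); case: (\sum_(_ <- _) _). Qed.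

(** The rescaling t = tau s turns the main terms into beta integrals. *)
Lemma cint_asym tau (N r th L e : R) (F : R -> R[i]) (s : seq (R * R[i])) :
  0 < tau -> N != 0 -> -1 < r - th -> 0 < th ->
  (forall t, 0 < t < tau -> {for t, continuous (fun t => complex.Re (F t))}) ->
  (forall t, 0 < t < tau -> {for t, continuous (fun t => complex.Im (F t))}) ->
  (forall t (l := ln (parab (t / tau))), 0 < t < tau ->
    normc (Complex N^-1 0 * F t - \sum_(c <- s) c.2 * (Complex (expR (r * l)) 0 * cis (c.1 * (L + l))))
     <= e * expR ((r - th) * l)) ->
  normc (Complex (N * tau)^-1 0 *
    Complex (\int[mu]_(t in [set t : R | (0 <= t <= tau)%R]) complex.Re (F t))%R
            (\int[mu]_(t in [set t : R | (0 <= t <= tau)%R]) complex.Im (F t))%R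
    - \sum_(c <- s) c.2 * cbeta r c.1 * cis (c.1 * L)) <= 2 * (e * beta (r - th) 0 0).
Proof.
move=> tau0 N0 rth th0 cR cI H; have r1 : -1 < r by lra.
pose A (c : R * R[i]) := complex.Re (c.2 * cis (c.1 * L)); pose B (c : R * R[i]) := complex.Im (c.2 * cis (c.1 * L)).
pose Gr t := \sum_(c <- s) (A c * ebeta r c.1 0 t + - B c * ebeta r c.1 (- (pi / 2)) t).
pose Gi t := \sum_(c <- s) (B c * ebeta r c.1 0 t + A c * ebeta r c.1 (- (pi / 2)) t).
have [cGr iGr EGr] := @sum_ebeta_int r _ s fst A (fun c => - B c) r1.
have [cGi iGi EGi] := @sum_ebeta_int r _ s fst B A r1.
have [jGr SGr] := Rintegral_scale tau0 cGr iGr; have [jGi SGi] := Rintegral_scale tau0 cGi iGi.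
have iW := @ebeta_integrable R (r - th) 0 0 rth.
have cW t := @ebeta_cont R (r - th) 0 0 t.
have [jW SW] := Rintegral_scale tau0 cW iW.
have EW t : ebeta (r - th) 0 0 t = expR ((r - th) * ln (parab t)).
  by rewrite /ebeta mul0r addr0 cos0 mulr1.
have ES t : \sum_(c <- s) c.2 * (Complex (expR (r * ln (parab t))) 0 * cis (c.1 * (L + ln (parab t)))) = Complex (Gr t) (Gi t).
  apply/eqP; rewrite eq_complex Re_sum Im_sum; apply/andP; split; apply/eqP; apply: eq_bigr => c _;
  by rewrite main_term /= ?mulNr.
have NA : 0 < `|N| by rewrite normr_gt0.
have part (f g : R -> R) : (forall t, 0 < t < tau -> {for t, continuous f}) ->
    mu.-integrable (oo tau) (EFin \o (fun t => g (t / tau))) ->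
    (forall t, 0 < t < tau -> `|N^-1 * f t - g (t / tau)| <= e * expR ((r - th) * ln (parab (t / tau)))) ->
    `|(N * tau)^-1 * (\int[mu]_(t in [set t : R | (0 <= t <= tau)%R]) f t)%R -
       tau^-1 * (\int[mu]_(t in oo tau) g (t / tau))%R| <= e * beta (r - th) 0 0.
  move=> cf ig fg.
  have jg : mu.-integrable (oo tau) (EFin \o (fun t => N * g (t / tau))) by exact: (integrableZl (measurable_oo tau) N ig).
  have := int_close (e := `|N| * e) tau0 cf jg jW.
  rewrite (RintegralZl N (measurable_oo tau) ig) SW -/(beta (r - th) 0 0).
  have P t : 0 < t < tau -> `|f t - N * g (t / tau)| <= `|N| * e * ebeta (r - th) 0 0 (t / tau).
    move=> tt; have := fg t tt; rewrite EW -(ler_pM2l NA) -normrM mulrA; apply: le_trans.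
    by rewrite mulrBr mulVKf.
  move=> /(_ P); move: (\int[mu]_(t in _) f t)%R (\int[mu]_(t in _) g (t / tau))%R (beta _ _ _) => I1 I2 b Q.
  have -> : (N * tau)^-1 * I1 - tau^-1 * I2 = (N * tau)^-1 * (I1 - N * I2).
    by field; rewrite N0 gt_eqF.
  rewrite normrM normfV normrM [`|tau|]gtr0_norm// mulrC ler_pdivrMr ?mulr_gt0//.
  by apply: (le_trans Q); rewrite le_eqVlt; apply/orP; left; apply/eqP; ring.
have bd t (tt : 0 < t < tau) : normc (Complex N^-1 0 * F t - Complex (Gr (t / tau)) (Gi (t / tau))) <= e * expR ((r - th) * ln (parab (t / tau))).
  by rewrite -ES; exact: H.
have PR := part _ Gr cR jGr; have PI := part _ Gi cI jGi.
rewrite SGr mulKf ?gt_eqF// EGr in PR; rewrite SGi mulKf ?gt_eqF// EGi in PI.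
rewrite mulr_natl mulr2n; apply: normc_le.
  have -> : complex.Re (Complex (N * tau)^-1 0 *
    Complex (\int[mu]_(t in [set t : R | (0 <= t <= tau)%R]) complex.Re (F t))%R
            (\int[mu]_(t in [set t : R | (0 <= t <= tau)%R]) complex.Im (F t))%R
    - \sum_(c <- s) c.2 * cbeta r c.1 * cis (c.1 * L)) =
    (N * tau)^-1 * (\int[mu]_(t in [set t : R | (0 <= t <= tau)%R]) complex.Re (F t))%R
     - \sum_(c <- s) (A c * beta r c.1 0 + - B c * beta r c.1 (- (pi / 2))).
    rewrite raddfB/= Re_sum mul0r subr0; congr (_ - _); apply: eq_bigr => c _.
    by rewrite /A /B /cbeta; case: c => c1 [c2 c3] /=; ring.
  apply: PR => t tt; apply: le_trans (bd t tt).
  have -> : N^-1 * complex.Re (F t) - Gr (t / tau) = complex.Re (Complex N^-1 0 * F t - Complex (Gr (t / tau)) (Gi (t / tau))).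
    by case: (F t) => f1 f2 /=; rewrite mul0r subr0.
  exact: Re_le_normc.
have -> : complex.Im (Complex (N * tau)^-1 0 *
    Complex (\int[mu]_(t in [set t : R | (0 <= t <= tau)%R]) complex.Re (F t))%R
            (\int[mu]_(t in [set t : R | (0 <= t <= tau)%R]) complex.Im (F t))%R
    - \sum_(c <- s) c.2 * cbeta r c.1 * cis (c.1 * L)) =
    (N * tau)^-1 * (\int[mu]_(t in [set t : R | (0 <= t <= tau)%R]) complex.Im (F t))%R
     - \sum_(c <- s) (B c * beta r c.1 0 + A c * beta r c.1 (- (pi / 2))).
  rewrite raddfB/= Im_sum mul0r addr0; congr (_ - _); apply: eq_bigr => c _.
  by rewrite /A /B /cbeta; case: c => c1 [c2 c3] /=; ring.
apply: PI => t tt; apply: le_trans (bd t tt).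
have -> : N^-1 * complex.Im (F t) - Gi (t / tau) = complex.Im (Complex N^-1 0 * F t - Complex (Gr (t / tau)) (Gi (t / tau))).
  by case: (F t) => f1 f2 /=; rewrite mul0r addr0.
exact: Im_le_normc.
Qed.

End Asymptotics.

(** * The leading coefficient vanishes *)

Lemma common_list (R : realType) (T : eqType) (s : seq T) (P : T -> R -> Prop) :
  (forall z d d', d' <= d -> P z d -> P z d') ->
  (forall z, z \in s -> exists2 d, 0 < d & P z d) ->
  exists2 d, 0 < d & forall z, z \in s -> P z d.
Proof.
move=> mono; elim: s => [|z s IH] H; first by exists 1.
have [d d0 Hd] := H z (mem_head _ _).
have [d' d'0 Hd'] := IH (fun z' zs => H z' (ltac:(by rewrite inE zs orbT))).
exists (Num.min d d'); first by rewrite lt_min d0.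
move=> z'; rewrite inE => /orP[/eqP->|zs].
  by apply: mono Hd; rewrite ge_min lexx.
by apply: mono (Hd' z' zs); rewrite ge_min lexx orbT.
Qed.

Lemma cont_along (R : realType) (Z : Type) (N : nat) (C : coords R Z N) (P : set Z) (h : Z -> R)
    (i : cidx C) (gam : R -> Z) (tau t : R) : smooth C P h ->
  (forall t', 0 < t' < tau -> P (gam t') /\ cdom i (gam t')) ->
  {for t, continuous (fun t => crd i (gam t))} -> 0 < t < tau ->
  {for t, continuous (fun t => h (gam t))}.
Proof.
move=> sh Pg cg tt; have /andP[t0 t1] := tt; apply/cont_normP => e e0; have [Pt it] := Pg t tt.
have [d d0 Hd] := smooth_near sh Pt it e0.
have [d' d'0 Hd'] := (cont_normP _ _).1 cg _ d0.
have m0 : 0 < Num.min t (tau - t) by rewrite lt_min t0 subr_gt0.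
exists (Num.min d' (Num.min t (tau - t))); first by rewrite lt_min d'0.
move=> t'; rewrite !lt_min => /and3P[h1 h2 h3].
have tt' : 0 < t' < tau.
  by move: h2 h3; rewrite !ltr_norml => /andP[? ?] /andP[? ?]; apply/andP; split; lra.
have [Pt' it'] := Pg t' tt'.
by apply: Hd => //; exact: Hd'.
Qed.

Section Vanish.
Context {R : realType} {n : nat}.
Variable M : bmanifold R n.
Variable g : metric M.
Local Notation vec := 'rV[R]_n.+1.
Local Notation svec := 'rV[R]_(n.+1 + n.+1).
Local Notation idx := (cidx (atlas M)).
Implicit Types (i j : idx) (p : M).

Lemma smoothC_near (Z : Type) (N : nat) (C : coords R Z N) (P : set Z) (h : Z -> R[i])
    (i : cidx C) z : smoothC C P h -> P z -> cdom i z -> forall e : R, 0 < e ->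
  exists2 d : R, 0 < d & forall z', P z' -> cdom i z' -> `|crd i z - crd i z'| < d ->
    normc (h z' - h z) <= e.
Proof.
move=> [sR sI] Pz iz e e0; have e2 : 0 < e / 2 by rewrite divr_gt0.
have [d d0 Hd] := smooth_near sR Pz iz e2; have [d' d'0 Hd'] := smooth_near sI Pz iz e2.
exists (Num.min d d'); first by rewrite lt_min d0.
move=> z' Pz' iz'; rewrite lt_min => /andP[h1 h2].
rewrite (splitr e); apply: normc_le.
  have -> : complex.Re (h z' - h z) = complex.Re (h z') - complex.Re (h z) by rewrite raddfB.
  by rewrite distrC ltW// Hd.
have -> : complex.Im (h z' - h z) = complex.Im (h z') - complex.Im (h z) by rewrite raddfB.
by rewrite distrC ltW// Hd'.
Qed.

Lemma scaledE (x r L : R) (zk : R[i] * nat) K : 0 < x ->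
  Complex (expR (r * L) * L ^+ K)^-1 0 * powlog x zk =
  scaled (complex.Re zk.1) (complex.Im zk.1) zk.2 r K L (ln x).
Proof.
move=> x0; rewrite powlog_exp// /scaled mulrA; congr (_ * _).
apply/eqP; rewrite eq_complex /= !mul0r !mulr0 subr0 addr0 eqxx andbT; apply/eqP.
by rewrite invfM expRN.
Qed.

(** The three cases of a term of the expansion: larger exponent, smaller power
    of the logarithm, or leading term. *)
Lemma scaled_term (r th e1 : R) K (zk : R[i] * nat) : 0 < th -> 0 < e1 ->
  r < complex.Re zk.1 \/ (complex.Re zk.1 = r /\ (zk.2 <= K)%N) ->
  exists2 d : R, 0 < d & forall L l u : R, L < - d^-1 -> l <= 0 -> `|u| <= d -> L <= -1 /\
    normc (scaled (complex.Re zk.1) (complex.Im zk.1) zk.2 r K L (L + l + u) -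
      (if (complex.Re zk.1 == r) && (zk.2 == K) then
         Complex (expR (r * l)) 0 * cis (complex.Im zk.1 * (L + l)) else 0))
    <= e1 * expR ((r - th) * l).
Proof.
move=> th0 e10 H.
have [L0 [eta [L01 /andP[eta0 eta1] Hs]]] : exists L0 eta : R, [/\ L0 <= -1, 0 < eta <= 1 &
   forall L l u : R, L < L0 -> l <= 0 -> `|u| <= eta ->
    normc (scaled (complex.Re zk.1) (complex.Im zk.1) zk.2 r K L (L + l + u) -
      (if (complex.Re zk.1 == r) && (zk.2 == K) then
         Complex (expR (r * l)) 0 * cis (complex.Im zk.1 * (L + l)) else 0))
    <= e1 * expR ((r - th) * l)].
  case: H => [ra|[ra]].
    have [L0 L01 HL] := scaled_higher (complex.Im zk.1) zk.2 K ra th0 e10.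
    exists L0, 1; split=> //; first by rewrite ltr01 lexx.
    by move=> L l u *; rewrite (gt_eqF ra) andFb subr0; exact: HL.
  rewrite leq_eqVlt => /orP[/eqP kK|kK].
    have [L0 [eta [? ? HL]]] := scaled_main (complex.Im zk.1) r K th0 e10.
    exists L0, eta; split=> //.
    by move=> L l u *; rewrite ra kK !eqxx; exact: HL.
  have [L0 L01 HL] := scaled_lowlog (complex.Im zk.1) r kK th0 e10.
  exists L0, 1; split=> //; first by rewrite ltr01 lexx.
  by move=> L l u *; rewrite ra eqxx (ltn_eqF kK) andbF subr0; exact: HL.
have L00 : 0 < - L0 by lra.
exists (Num.min eta (- L0)^-1); first by rewrite lt_min eta0 invr_gt0.
move=> L l u HL l0 ud.
have LL0 : L < L0.
  have : - L0 <= (Num.min eta (- L0)^-1)^-1.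
    rewrite -[leLHS]invrK lef_pV2 ?posrE ?invr_gt0 ?lt_min ?eta0//= ?invr_gt0//.
    by rewrite ge_min lexx orbT.
  by move: HL; lra.
split; first by lra.
by apply: Hs => //; rewrite (le_trans ud)// ge_min lexx.
Qed.

Lemma ln_parab_le0 (t : R) : ln (parab t) <= 0.
Proof. by apply: ln_le0; have := @parab_le R t; lra. Qed.

(** At a single boundary point p: the transform along the glancing geodesics
    at (p, w) forces an exponential sum in L, whose coefficients are multiples
    of the leading coefficients at p, to tend to 0. *)
Lemma leading_coef_eq0 (x : M -> R) (mu : M * tvec M -> R) (phi : M * tvec M -> R[i]) (f rem : M -> R[i])
    p w (zs : seq (R[i] * nat)) (at_ : R[i] * nat -> M -> R[i]) (a0 : R[i] * nat -> R[i])
    (r s' d0 Cr Cx : R) (K : nat) (i := chart_at p) :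
  strictly_convex_boundary g -> boundary_defining (atlas M) setT (boundary M) x ->
  boundary_defining (tatlas M) (dplusSM g) (dzeroSM g) mu ->
  smoothC (tatlas M) (SM g) phi -> smoothC (atlas M) (setT `\` boundary M) f ->
  dzeroSM g (p, w) -> phi (p, w) != 0 -> uniq zs ->
  (forall zk, zk \in zs -> forall e : R, 0 < e -> exists2 d : R, 0 < d & forall y, cdom i y ->
     `|crd i p - crd i y| < d -> x y < d -> normc (at_ zk y - a0 zk) <= e) ->
  0 < d0 -> 0 <= Cr -> 0 <= Cx ->
  (forall y, ~ boundary M y -> x y < d0 ->
     f y = \sum_(zk <- zs) at_ zk y * powlog (x y) zk + rem y /\ normc (rem y) <= Cr * x y `^ s') ->
  (forall q, (dplusSM g `\` dzeroSM g) q -> normc (xray g phi f q) <= Cx * mu q `^ (1 + 2 * s')) ->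
  -1 < r -> r < s' ->
  (forall zk, zk \in zs -> r < complex.Re zk.1 \/ (complex.Re zk.1 = r /\ (zk.2 <= K)%N)) ->
  forall zk, zk \in zs -> complex.Re zk.1 = r -> zk.2 = K -> a0 zk = 0.
Proof.
move=> cvx bx bmu sphi sf dz phi0 uzs Hat d00 Cr0 Cx0 Hf HI r1 rs Hzs zk zks zkr zkK.
have ip : cdom i p by exact: chart_at_dom.
(* the room r + 1 > 0 left by integrability is shared between th and r - th >
   -1 *)
pose th := (r + 1) / 2; have th0 : 0 < th by rewrite divr_gt0//; lra.
have rth : -1 < r - th by rewrite /th; lra.
have [A [B [m0 [A0 B0 m00 Pack]]]] := glancing_package cvx bx bmu dz.
rewrite -/i in Pack; set c := row_mx (crd i p) (w i) in Pack.
pose ph := phi (p, w).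
pose S := [seq z <- zs | (complex.Re z.1 == r) && (z.2 == K)].
pose cs := [seq (complex.Im z.1, ph * a0 z * cbeta r (complex.Im z.1)) | z <- S].
suff H : forall c, c \in cs -> c.2 = 0.
  have zkS : zk \in S by rewrite mem_filter zkr zkK !eqxx zks.
  have /H/= : (complex.Im zk.1, ph * a0 zk * cbeta r (complex.Im zk.1)) \in cs by apply/mapP; exists zk.
  move=> /eqP; rewrite !mulf_eq0 (negbTE phi0) (negbTE (cbeta_neq0 _ r1)) /= orbF.
  by move/eqP.
apply: exp_sum_zero.
  rewrite -map_comp map_inj_in_uniq ?filter_uniq//.
  move=> [[z1 z2] k] [[z1' z2'] k']; rewrite !mem_filter /=.
  by move=> /andP[/andP[/eqP-> /eqP->] _] /andP[/andP[/eqP-> /eqP->] _] /= ->.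
move=> e e0.
pose B' := beta (r - th) 0 0.
have B'0 : 0 <= B'.
  apply: Rintegral_ge0 => t _; rewrite /ebeta mul0r addr0 cos0 mulr1; exact: expR_ge0.
(* each term contributes at most its summand in Q times e1, the remainder at
   most the last one *)
pose Q := \sum_(z <- zs) (normc (ph * a0 z) + 2) + (normc ph + 1) * Cr.
have Q0 : 0 <= Q.
  rewrite addr_ge0//; last by rewrite mulr_ge0// addr_ge0// normc_ge0.
  by rewrite big_seq; apply: sumr_ge0 => z _; rewrite addr_ge0// normc_ge0.
pose e1 := Num.min 1 (e / (4 * ((Q + 1) * (B' + 1)))).
have QB0 : 0 < (Q + 1) * (B' + 1) by rewrite mulr_gt0// ltr_wpDl.
have e10 : 0 < e1 by rewrite lt_min ltr01 divr_gt0// mulr_gt0.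
have e11 : e1 <= 1 by rewrite ge_min lexx.
have e1e : e1 * ((Q + 1) * (B' + 1)) <= e / 4.
  have : e1 <= e / (4 * ((Q + 1) * (B' + 1))) by rewrite ge_min lexx orbT.
  have QB4 : 0 < 4 * ((Q + 1) * (B' + 1)) by rewrite mulr_gt0.
  by rewrite ler_pdivlMr// ler_pdivlMr// mulrCA [4 * _]mulrC.
have SMp : SM g (p, w) by case: dz => -[].
have [d1 d10 Hphi] : exists2 d : R, 0 < d & forall z, SM g z -> cdom i z.1 -> `|c - state i z| < d ->
    normc (phi z - ph) <= 1.
  exact: (smoothC_near (i := (i : cidx (tatlas M))) sphi SMp ip ltr01).
have Hka z : z \in zs -> exists2 d : R, 0 < d & forall q, SM g q -> cdom i q.1 ->
    `|c - state i q| < d -> x q.1 < d -> normc (phi q * at_ z q.1 - ph * a0 z) <= e1.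
  move=> zzs; pose e2 := e1 / (normc ph + 1 + normc (a0 z) + 1).
  have D0 : 0 < normc ph + 1 + normc (a0 z) + 1 by rewrite ltr_wpDl// !addr_ge0// normc_ge0.
  have e20 : 0 < e2 by rewrite divr_gt0.
  have [d2 d20 H2] := Hat z zzs e2 e20.
  have [d3 d30 H3] : exists2 d : R, 0 < d & forall z, SM g z -> cdom i z.1 -> `|c - state i z| < d ->
      normc (phi z - ph) <= e2.
    exact: (smoothC_near (i := (i : cidx (tatlas M))) sphi SMp ip e20).
  exists (Num.min d1 (Num.min d2 d3)); first by rewrite !lt_min d10 d20.
  move=> q SMq iq; rewrite !lt_min => /and3P[q1 q2 q3] /and3P[_ x2 _].
  have cq : `|crd i p - crd i q.1| < d2.
    apply: le_lt_trans q2; have -> : crd i p - crd i q.1 = lsubmx (c - state i q).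
      by rewrite linearB/= /c /state !row_mxKl.
    exact: norm_lsubmx.
  have h1 := Hphi q SMq iq q1; have h2 := H2 _ iq cq x2; have h3 := H3 q SMq iq q3.
  have h4 : normc (phi q) <= normc ph + 1.
    have := normc_add (phi q - ph) ph; rewrite subrK; move: (normc (phi q)) (normc ph) (normc (phi q - ph)) h1.
    by clear; move=> y y' y'' *; lra.
  have -> : phi q * at_ z q.1 - ph * a0 z = phi q * (at_ z q.1 - a0 z) + (phi q - ph) * a0 z by ring.
  apply: (le_trans (normc_add _ _)); rewrite !normcM.
  have a1 : normc (phi q) * normc (at_ z q.1 - a0 z) <= (normc ph + 1) * e2.
    by apply: ler_pM => //; exact: normc_ge0.
  have a2 : normc (phi q - ph) * normc (a0 z) <= e2 * normc (a0 z).
    by apply: ler_wpM2r => //; exact: normc_ge0.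
  have -> : e1 = (normc ph + 1 + normc (a0 z) + 1) * e2 by rewrite mulrC divfK ?gt_eqF.
  apply: (le_trans (lerD a1 a2)); rewrite !mulrDl !mul1r [e2 * _]mulrC.
  by move: (normc ph * e2) (normc (a0 z) * e2) => y y'; move: e20; clear; lra.
have [dka dka0 Hka'] := @common_list R _ zs (fun z d => forall q, SM g q -> cdom i q.1 ->
    `|c - state i q| < d -> x q.1 < d -> normc (phi q * at_ z q.1 - ph * a0 z) <= e1)
  (fun z d d' dd H q a1 a2 a3 a4 => H q a1 a2 (lt_le_trans a3 dd) (lt_le_trans a4 dd)) Hka.
pose Tg (z : R[i] * nat) (L l : R) : R[i] := if (complex.Re z.1 == r) && (z.2 == K) then
         Complex (expR (r * l)) 0 * cis (complex.Im z.1 * (L + l)) else 0.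
pose TP (z : R[i] * nat) d := 0 < d -> forall L l u : R, L < - d^-1 -> l <= 0 -> `|u| <= d -> L <= -1 /\
    normc (scaled (complex.Re z.1) (complex.Im z.1) z.2 r K L (L + l + u) - Tg z L l)
    <= e1 * expR ((r - th) * l).
have [dt dt0 Ht] : exists2 d, 0 < d & forall z, z \in zs -> TP z d.
  apply: common_list => [z d d' dd H d'0 L l u LL l0 ud|z zzs].
    apply: H => //; first exact: lt_le_trans dd.
      by apply: (lt_le_trans LL); rewrite lerN2 lef_pV2// posrE// (lt_le_trans d'0).
    exact: le_trans dd.
  have [d d0' Hd] := scaled_term th0 e10 (Hzs z zzs).
  by exists d => // _; exact: Hd.
have [dr dr0 Hr] := @scaled_term r th e1 K (Complex s' 0, 0%N) th0 e10 (or_introl rs).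
pose q := 1 + 2 * s'.
pose Mq := expR (`|q| * (`|ln (m0 / 2)| + `|ln (2 * m0)|)).
(* the transform divided by N tau is at most D e^{(s' - r) L}, which is small
   for L < L2 *)
pose D := Cx * Mq * (2 * A) * expR (- (s' * ln B)) + 1.
have D0 : 0 < D.
  by rewrite ltr_wpDl// !mulr_ge0 ?expR_ge0// ltW.
pose eta := Num.min (Num.min (Num.min d0 d1) dka) (Num.min dt dr).
have eta0 : 0 < eta by rewrite !lt_min d00 d10 dka0 dt0 dr0.
have [k1 [k2 [k3 [k4 k5]]]] : eta <= d0 /\ eta <= d1 /\ eta <= dka /\ eta <= dt /\ eta <= dr.
  by rewrite /eta !ge_min !lexx !orbT.
have [v0 v00 Hv] := Pack eta eta0; clearbody eta.
pose L1 := ln B + 2 * ln v0.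
pose L2 := ln (e / 2 / D) / (s' - r).
exists (Num.min (Num.min L1 L2) (Num.min (- dt^-1) (Num.min (- dr^-1) (-1)))) => L.
rewrite !lt_min -!andbA => /and5P[LL1 LL2 LL3 LL4 LL5].
pose v := expR ((L - ln B) / 2).
have v_gt0 : 0 < v by exact: expR_gt0.
have lnv : ln v = (L - ln B) / 2 by rewrite expRK.
have vv0 : 0 < v < v0.
  rewrite v_gt0 /= -[ltRHS]lnK ?posrE// ltr_expR; move: LL1; rewrite /L1; clear; lra.
have LE : ln B + 2 * ln v = L by rewrite lnv; clear; lra.
have [qq [tau [qN [ex [tau0 vtau]] muq Hq]]] := Hv v vv0.
rewrite LE in Hq.
pose N := expR (r * L) * L ^+ K.
have Lneg : L < 0 by clear - LL5; lra.
have N0 : N != 0.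
  by apply: mulf_neq0; [rewrite gt_eqF// expR_gt0|rewrite expf_neq0// lt_eqF].
pose F t := phi (flow g t qq) * f (flow g t qq).1.
pose cs' := [seq (complex.Im z.1, ph * a0 z) | z <- S].
have Hq' t' : 0 < t' < tau -> SM g (flow g t' qq) /\ cdom i (flow g t' qq).1.
  by move=> /Hq[].
have cphi (h : M * tvec M -> R) t : smooth (tatlas M) (SM g) h -> 0 < t < tau ->
    {for t, continuous (fun t => h (flow g t qq))}.
  move=> sh tt; have [_ _ _ _ cst] := Hq t tt.
  exact: (@cont_along R _ _ (tatlas M) (SM g) h (i : cidx (tatlas M)) (fun t => flow g t qq) tau t sh Hq' cst tt).
have cf (h : M -> R) t : smooth (atlas M) (setT `\` boundary M) h -> 0 < t < tau ->
    {for t, continuous (fun t => h (flow g t qq).1)}.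
  move=> sh tt; have [_ _ _ _ cst] := Hq t tt.
  have Hq2 t' : 0 < t' < tau -> (setT `\` boundary M) (flow g t' qq).1 /\ cdom i (flow g t' qq).1.
    by move=> /Hq[? _ _ [nb _] _].
  apply: (@cont_along R _ _ (atlas M) _ h i (fun t => (flow g t qq).1) tau t sh Hq2 _ tt).
  apply/cont_normP => e2 e20; have [d d0' Hd] := (cont_normP _ _).1 cst _ e20.
  exists d => // t' /Hd; apply: le_lt_trans.
  have -> : crd i (flow g t qq).1 - crd i (flow g t' qq).1 = lsubmx (state i (flow g t qq) - state i (flow g t' qq)).
    by rewrite linearB/= /state !row_mxKl.
  exact: norm_lsubmx.
have [sphR sphI] := sphi; have [sfR sfI] := sf.
have cR t : 0 < t < tau -> {for t, continuous (fun t => complex.Re (F t))}.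
  move=> tt; have -> : (fun t => complex.Re (F t)) = (fun t => complex.Re (phi (flow g t qq)) * complex.Re (f (flow g t qq).1)
      - complex.Im (phi (flow g t qq)) * complex.Im (f (flow g t qq).1)).
    by apply/funext => t'; rewrite /F; case: (phi _) => ? ?; case: (f _) => ? ?.
  apply: continuousB; apply: continuousM.
  - exact: (cphi (fun z => complex.Re (phi z)) t sphR tt).
  - exact: (cf (fun z => complex.Re (f z)) t sfR tt).
  - exact: (cphi (fun z => complex.Im (phi z)) t sphI tt).
  - exact: (cf (fun z => complex.Im (f z)) t sfI tt).
have cI t : 0 < t < tau -> {for t, continuous (fun t => complex.Im (F t))}.
  move=> tt; have -> : (fun t => complex.Im (F t)) = (fun t => complex.Re (phi (flow g t qq)) * complex.Im (f (flow g t qq).1)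
      + complex.Im (phi (flow g t qq)) * complex.Re (f (flow g t qq).1)).
    by apply/funext => t'; rewrite /F; case: (phi _) => ? ?; case: (f _) => ? ?.
  apply: continuousD; apply: continuousM.
  - exact: (cphi (fun z => complex.Re (phi z)) t sphR tt).
  - exact: (cf (fun z => complex.Im (f z)) t sfI tt).
  - exact: (cphi (fun z => complex.Im (phi z)) t sphI tt).
  - exact: (cf (fun z => complex.Re (f z)) t sfR tt).
have close t (l := ln (parab (t / tau))) : 0 < t < tau ->
    normc (Complex N^-1 0 * F t - \sum_(c <- cs') c.2 * (Complex (expR (r * l)) 0 * cis (c.1 * (L + l))))
     <= Q * e1 * expR ((r - th) * l).
  move=> tt; have [iz SMz cz [nb [/andP[x0 xeta] lx]] _] := Hq t tt.
  set z := flow g t qq in iz SMz cz nb x0 xeta lx.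
  have l0 : l <= 0.
    exact: ln_parab_le0.
  pose u := ln (x z.1) - L - l.
  have ud : `|u| <= eta by exact: lx.
  have lnx : ln (x z.1) = L + l + u by rewrite /u; ring.
  have [fE remb] := Hf z.1 nb (lt_le_trans xeta k1).
  pose W := expR ((r - th) * l); have W0 : 0 <= W by exact: expR_ge0.
  have -> : \sum_(c <- cs') c.2 * (Complex (expR (r * l)) 0 * cis (c.1 * (L + l))) =
      \sum_(z' <- zs) ph * a0 z' * Tg z' L l.
    rewrite big_map big_filter big_mkcond; apply: eq_bigr => z' _.
    by rewrite /Tg /=; case: ifP => _; rewrite ?mulr0.
  have -> : Complex N^-1 0 * F t = \sum_(z' <- zs) phi z * at_ z' z.1 *
       scaled (complex.Re z'.1) (complex.Im z'.1) z'.2 r K L (L + l + u) + phi z * (Complex N^-1 0 * rem z.1).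
    rewrite /F -/z fE !mulrDr mulr_sumr mulr_sumr; congr (_ + _); last by ring.
    by apply: eq_bigr => z' _; rewrite -lnx -scaledE// -/N; ring.
  rewrite addrAC -sumrB; apply: (le_trans (normc_add _ _)).
  rewrite /Q mulrDl mulrDl; apply: lerD.
    rewrite mulr_suml mulr_suml.
    have tri (s : seq (R[i] * nat)) (h : R[i] * nat -> R[i]) (b : R[i] * nat -> R) :
        (forall z', z' \in s -> normc (h z') <= b z') -> normc (\sum_(z' <- s) h z') <= \sum_(z' <- s) b z'.
      elim: s => [|z' s IH] Hs; first by rewrite !big_nil normc0.
      rewrite !big_cons; apply: (le_trans (normc_add _ _)); apply: lerD; first by apply: Hs; exact: mem_head.
      by apply: IH => z'' zs''; apply: Hs; rewrite inE zs'' orbT.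
    apply: tri => z' zzs.
    have b1 := Hka' z' zzs z SMz iz (lt_le_trans cz k3) (lt_le_trans xeta k3).
    have [_ b2] := Ht z' zzs dt0 L l u LL3 l0 (le_trans ud k4).
    set ka := phi z * at_ z' z.1 in b1 *; set ka0 := ph * a0 z' in b1 *.
    set sc := scaled _ _ _ _ _ _ _ in b2 *.
    have b3 : normc (Tg z' L l) <= W.
      rewrite /Tg; case: ifP => _; last by rewrite normc0.
      rewrite normcM normc_cis mulr1 normc_real ger0_norm ?expR_ge0// ler_expR.
      have := mulr_ge0 (ltW th0) (_ : 0 <= - l).
      by rewrite oppr_ge0 => /(_ l0) h; clear - h; lra.
    have b4 : normc ka <= normc ka0 + 1.
      have := normc_add (ka - ka0) ka0; rewrite subrK; move: (normc ka) (normc ka0) (normc (ka - ka0)) b1.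
      by clear - e11; move=> y y' y'' *; lra.
    have -> : ka * sc - ka0 * Tg z' L l = ka * (sc - Tg z' L l) + (ka - ka0) * Tg z' L l by ring.
    apply: (le_trans (normc_add _ _)); rewrite (normcM ka) (normcM (ka - ka0)).
    have a1 : normc ka * normc (sc - Tg z' L l) <= (normc ka0 + 1) * (e1 * W).
      by apply: ler_pM => //; exact: normc_ge0.
    have a2 : normc (ka - ka0) * normc (Tg z' L l) <= e1 * W.
      by apply: ler_pM => //; exact: normc_ge0.
    apply: (le_trans (lerD a1 a2)); rewrite -/W.
    by rewrite le_eqVlt; apply/orP; left; apply/eqP; ring.
  rewrite !normcM normc_real.
  have [_ b2] := Hr L l u LL4 l0 (le_trans ud k5).
  have E : normc (scaled s' 0 0 r K L (L + l + u)) = `|N^-1| * x z.1 `^ s'.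
    rewrite normc_scaled expr0 mulr1 -lnx /powR (gt_eqF x0).
    by rewrite /N normfV normrM normrX ger0_norm ?expR_ge0// invfM expRN.
  have rs0 : (s' == r) = false by rewrite gt_eqF.
  have b3 : normc (scaled s' 0 0 r K L (L + l + u)) <= e1 * W.
    by move: b2; rewrite [X in X == r](_ : _ = s')// rs0 andFb subr0.
  rewrite E in b3.
  have h4 : normc (phi z) <= normc ph + 1.
    have := normc_add (phi z - ph) ph; rewrite subrK.
    have := Hphi z SMz iz (lt_le_trans cz k2).
    by clear - e11; move: (normc (phi z)) (normc ph) (normc (phi z - ph)) => y y' y'' *; lra.
  have h5 : `|N^-1| * normc (rem z.1) <= Cr * (e1 * W).
    apply: (@le_trans _ _ (Cr * (`|N^-1| * x z.1 `^ s'))).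
      by rewrite mulrCA ler_wpM2l.
    by rewrite ler_wpM2l.
  have h6 : normc (phi z) * (`|N^-1| * normc (rem z.1)) <= (normc ph + 1) * (Cr * (e1 * W)).
    by apply: ler_pM => //; rewrite ?mulr_ge0// normc_ge0.
  by apply: (le_trans h6); rewrite le_eqVlt; apply/orP; left; apply/eqP; rewrite /W; ring.
have main := cint_asym tau0 N0 rth th0 cR cI close; rewrite -/B' in main.
have exr : xray g phi f qq = Complex
    (\int[@lebesgue_measure R]_(t in [set t : R | (0 <= t <= tau)%R]) complex.Re (F t))%R
    (\int[@lebesgue_measure R]_(t in [set t : R | (0 <= t <= tau)%R]) complex.Im (F t))%R.
  by rewrite /xray ex.
rewrite -exr in main.
have -> : \sum_(c <- cs) c.2 * cis (c.1 * L) = \sum_(c <- cs') c.2 * cbeta r c.1 * cis (c.1 * L).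
  by rewrite !big_map.
set Sg := \sum_(c <- cs') _ in main *.
have xb : normc (Complex (N * tau)^-1 0 * xray g phi f qq) < e / 2.
  rewrite normcM normc_real normfV normrM [`|tau|]gtr0_norm//.
  have NL : expR (r * L) <= `|N|.
    rewrite /N normrM normrX ger0_norm ?expR_ge0// ler_peMr ?expR_ge0// exprn_ege1//.
    by rewrite ltr0_norm//; clear - LL5; lra.
  have tauv : v / (2 * A) <= tau.
    by rewrite ler_pdivrMr ?mulr_gt0//; apply: (le_trans vtau); rewrite mulrA mulrC.
  have inv : (`|N| * tau)^-1 <= expR (- (r * L)) * (2 * A / v).
    rewrite -[leRHS]invrK lef_pV2 ?posrE ?mulr_gt0 ?normr_gt0 ?invr_gt0 ?mulr_gt0 ?expR_gt0 ?invr_gt0//.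
    rewrite invfM -expRN opprK invf_div; apply: ler_pM => //.
    by rewrite divr_ge0// ltW// mulr_gt0.
  have mub : mu qq `^ q <= Mq * v `^ q.
    have /andP[u1 u2] := muq.
    have mu0 : 0 < mu qq by apply: lt_le_trans u1; rewrite !mulr_gt0// invr_gt0.
    rewrite /powR !gt_eqF// /Mq -expRD ler_expR.
    have w1 : ln (m0 / 2) + ln v <= ln (mu qq).
      by rewrite -lnM ?posrE ?divr_gt0// ler_ln ?posrE ?mulr_gt0 ?divr_gt0.
    have w2 : ln (mu qq) <= ln (2 * m0) + ln v.
      by rewrite -lnM ?posrE ?mulr_gt0// ler_ln ?posrE ?mulr_gt0.
    rewrite -lerBlDr -mulrBr (le_trans (ler_norm _))// normrM ler_wpM2l//.
    have n1 := ler_norm (ln (2 * m0)); have n2 := ler_norm (- ln (m0 / 2)); rewrite normrN in n2.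
    have n3 := normr_ge0 (ln (2 * m0)); have n4 := normr_ge0 (ln (m0 / 2)).
    rewrite ler_norml; move: (ln (m0 / 2)) (ln v) (ln (mu qq)) (ln (2 * m0)) w1 w2 n1 n2 n3 n4 => y1 y2 y3 y4 a1 a2 a3 a4 a5 a6.
    by clear - a1 a2 a3 a4 a5 a6; apply/andP; split; lra.
  have X1 := HI qq qN; rewrite -/q in X1.
  have X2 : Cx * mu qq `^ q <= Cx * (Mq * v `^ q) by rewrite ler_wpM2l.
  have i0 : 0 <= (`|N| * tau)^-1 by rewrite invr_ge0 mulr_ge0// ltW.
  apply: (le_lt_trans (ler_pM i0 (normc_ge0 _) inv (le_trans X1 X2))).
  have -> : expR (- (r * L)) * (2 * A / v) * (Cx * (Mq * v `^ q)) =
      (Cx * Mq * (2 * A) * expR (- (s' * ln B))) * expR ((s' - r) * L).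
    have -> : v `^ q = v * expR (s' * (L - ln B)).
      rewrite /powR gt_eqF// /q mulrDl mul1r expRD lnK ?posrE// lnv; congr (_ * expR _).
      by field.
    have -> : expR (s' * (L - ln B)) = expR (- (s' * ln B)) * expR (s' * L).
      by rewrite -expRD; congr expR; ring.
    have -> : expR ((s' - r) * L) = expR (- (r * L)) * expR (s' * L).
      by rewrite -expRD; congr expR; ring.
    by field; rewrite gt_eqF.
  apply: (@lt_trans _ _ (D * expR ((s' - r) * L))).
    by rewrite ltr_pM2r ?expR_gt0// ltrDl.
  rewrite mulrC -ltr_pdivlMr// -[ltRHS]lnK ?posrE ?divr_gt0// ltr_expR mulrC.
  by rewrite -ltr_pdivlMr// subr_gt0.
have e4 : 2 * (Q * e1 * B') <= e / 2.
  have : Q * e1 * B' <= e1 * ((Q + 1) * (B' + 1)).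
    have h := mulr_ge0 (ltW e10) (addr_ge0 (addr_ge0 Q0 B'0) ler01).
    by rewrite -subr_ge0 (_ : _ - _ = e1 * (Q + B' + 1)); [|ring].
  by move: e1e; clear; lra.
have -> : Sg = Complex (N * tau)^-1 0 * xray g phi f qq - (Complex (N * tau)^-1 0 * xray g phi f qq - Sg) by rewrite subKr.
apply: (le_lt_trans (normc_sub _ _)); rewrite [ltRHS]splitr; apply: ltr_leD => //.
exact: le_trans main e4.
Qed.

End Vanish.

(** * Locality of derivations, collars *)

Section Locality.
Context {R : realType} {Z : Type} {N : nat}.
Variable C : coords R Z N.
Variables (NN dN : set Z).
Local Notation No := (NN `\` dN).
Implicit Types (u v w rho : Z -> R).

(** If w vanishes on {rho < delta} and rho p = c < delta, then w = (rho - c)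
    (w / (rho - c)) with a smooth quotient that vanishes at p, so a derivation
    kills w at p. *)
Lemma vf_local V rho u v (delta : R) : vector_field C NN dN V -> smooth C No rho ->
  smooth C No u -> smooth C No v -> (forall p, No p -> rho p < delta -> u p = v p) ->
  forall p, No p -> rho p < delta -> V u p = V v p.
Proof.
move=> VV sr su sv uv p Np pd; have [_ VL VM _] := VV.
pose w z := - 1 * v z + u z.
have sw : smooth C No w := smooth_add (smooth_mul (smooth_cst (C := C) No (-1)) sv) su.
have w0 z : No z -> rho z < delta -> w z = 0.
  by move=> Nz zd; rewrite /w uv// mulN1r addNr.
pose b z := rho z + - rho p.
have sb : smooth C No b := smooth_add sr (smooth_cst (C := C) No (- rho p)).
pose q z := w z * (b z)^-1.
have sq : smooth C No q.
  move=> i z Nz iz; have [zd|zd] := ltP (rho z) delta.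
    have zd0 : 0 < delta - rho z by rewrite subr_gt0.
    have [d d0 Hd] := smooth_near sr Nz iz zd0.
    exists (fun=> 0); exists (Ball (crd i z) d); split.
    - exact: Ball_open.
    - exact: Ball_center.
    - exact: Cinf_cst.
    move=> z' Nz' iz' zz'; rewrite /q w0 ?mul0r//.
    by have := Hd z' Nz' iz' zz'; rewrite ltr_norml => /andP[h _]; clear - h; lra.
  have [h lh] := sr i z Nz iz; have [k lk] := sw i z Nz iz.
  have [d d0 [Ch Eh]] := local_ext_ball lh; have [d' d'0 [Ck' Ek]] := local_ext_ball lk.
  have zp0 : 0 < rho z - rho p by rewrite subr_gt0; exact: lt_le_trans pd zd.
  have zz : Ball (crd i z) d (crd i z) := Ball_center _ d0.
  have hz : h (crd i z) = rho z by rewrite (Eh z).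
  have [d2 d20 Hd2] := (cont_normP _ _).1 (Cinf_cont Ch zz) _ zp0.
  pose m := Num.min d (Num.min d' d2).
  have md : Ball (crd i z) m `<=` Ball (crd i z) d by apply: Ball_sub; rewrite /m ge_min lexx.
  have md' : Ball (crd i z) m `<=` Ball (crd i z) d'.
    by apply: Ball_sub; rewrite /m !ge_min lexx orbT.
  have md2 : Ball (crd i z) m `<=` Ball (crd i z) d2.
    by apply: Ball_sub; rewrite /m !ge_min lexx !orbT.
  have hp X : Ball (crd i z) m X -> h X + - rho p != 0.
    move=> /md2/Hd2; rewrite hz ltr_norml => /andP[_ h2].
    by rewrite gt_eqF//; clear - h2; lra.
  exists (fun X => k X * (h X + - rho p)^-1); exists (Ball (crd i z) m); split.
  - exact: Ball_open.
  - by apply: Ball_center; rewrite /m !lt_min d0 d'0.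
  - have oB : open (Ball (crd i z) m) := @Ball_open _ _ _ _.
    apply: Cinf_mul => //; first exact: Cinf_restrict Ck'.
    apply: Cinf_inv => //; apply: Cinf_add => //; last exact: Cinf_cst.
    exact: Cinf_restrict Ch.
  by move=> z' Nz' iz' zz'; rewrite /q /b -(Ek z')// -?(Eh z')//; [exact: md|exact: md'].
have wq z : No z -> w z = b z * q z.
  move=> Nz; have [b0|b0] := eqVneq (b z) 0; last by rewrite /q mulrCA divff// mulr1.
  rewrite b0 mul0r w0//; move/eqP: b0; rewrite /b subr_eq0 => /eqP->//.
have : V w p = 0.
  have bp : b p = 0 := subrr _.
  have qp : q p = 0 by rewrite /q w0// mul0r.
  by rewrite (vf_ext VV sw (smooth_mul sb sq) wq Np) VM// bp qp mulr0 mul0r addr0.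
rewrite /w VL// mulN1r addrC => /eqP; rewrite subr_eq0 => /eqP//.
Qed.

(** Off {rho < delta} the weights rho^s and rho^s0 are comparable, and on {rho
    < delta} the two functions have the same derivatives. *)
Lemma conormalR_local rho (s s0 delta B : R) u v : smooth C No rho ->
  0 < delta -> (forall p, No p -> 0 < rho p <= B) ->
  conormalR C NN dN rho s0 u -> conormalR C NN dN rho s v ->
  (forall p, No p -> rho p < delta -> u p = v p) -> conormalR C NN dN rho s u.
Proof.
move=> sr d0 rB [su Hu] [sv Hv] uv; split=> // Vs HVs.
have [K1 HK1] := Hu Vs HVs; have [K2 HK2] := Hv Vs HVs.
have [_ [_ agree]] : let F w := foldr (fun V w => V w) w Vs in
    smooth C No (F u) /\ smooth C No (F v) /\
    (forall p, No p -> rho p < delta -> F u p = F v p).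
  elim: Vs HVs {Hu Hv HK1 HK2} => [//|V Vs IH] HVs F.
  have [a1 [a2 a3]] := IH (fun k ks => HVs k.+1 ks).
  have [VV _] := HVs 0%N isT; have [V1 _ _ _] := VV.
  split; first exact: (V1 _ a1).
  split; first exact: (V1 _ a2).
  exact: (vf_local VV sr a1 a2 a3).
pose c := expR (`|s0 - s| * (`|ln delta| + `|ln B|)).
exists (`|K2| + `|K1| * c) => p Np; have /andP[r0 rB'] := rB p Np.
have K20 : 0 <= `|K2| * rho p `^ s by rewrite mulr_ge0// powR_ge0.
have K10 : 0 <= `|K1| * c * rho p `^ s by rewrite !mulr_ge0// ?powR_ge0// expR_ge0.
rewrite mulrDl; have [pd|pd] := ltP (rho p) delta.
  rewrite agree//; apply: (le_trans (HK2 p Np)).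
  apply: (@le_trans _ _ (`|K2| * rho p `^ s)); first by rewrite ler_wpM2r ?powR_ge0// ler_norm.
  by rewrite lerDl.
apply: (le_trans (HK1 p Np)); apply: (@le_trans _ _ (`|K1| * c * rho p `^ s)); last by rewrite lerDr.
apply: (@le_trans _ _ (`|K1| * rho p `^ s0)); first by rewrite ler_wpM2r ?powR_ge0// ler_norm.
rewrite -mulrA ler_wpM2l// /powR gt_eqF// /c -expRD ler_expR.
have -> : s0 * ln (rho p) = (s0 - s) * ln (rho p) + s * ln (rho p) by ring.
rewrite lerD2r (le_trans (ler_norm _))// normrM ler_wpM2l//.
have l1 : ln delta <= ln (rho p) by rewrite ler_ln ?posrE.
have l2 : ln (rho p) <= ln B by rewrite ler_ln ?posrE//; exact: lt_le_trans rB'.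
have n1 := ler_norm (ln B); have n2 := ler_norm (- ln delta); rewrite normrN in n2.
have n3 := normr_ge0 (ln delta); have n4 := normr_ge0 (ln B).
by rewrite ler_norml; clear - l1 l2 n1 n2 n3 n4; apply/andP; split; lra.
Qed.

End Locality.

Section Collar.
Context {R : realType} {Z : Type} {m : nat}.
Variable C : coords R Z m.
Variables (NN dN : set Z).

Lemma smooth_fst (u : Z -> R) eps : smooth C dN u ->
  smooth (times_line C) [set z | dN z.1 /\ 0 <= z.2 < eps] (fun z => u z.1).
Proof.
move=> su i z [dz _] iz; have [h lh] := su i z.1 dz iz.
have [d d0 [Ch Eh]] := local_ext_ball lh.
have oB : open (Ball (@crd _ _ _ (times_line C) i z) d) := @Ball_open _ _ _ _.
have L Y : Ball (@crd _ _ _ (times_line C) i z) d Y -> Ball (@crd _ _ _ C i z.1) d (lsubmx Y).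
  apply: le_lt_trans; rewrite /=; set X := row_mx _ _.
  have -> : @crd _ _ _ C i z.1 - lsubmx Y = lsubmx (X - Y) by rewrite linearB/= row_mxKl.
  by apply: mx_norm_le => // a b; rewrite mxE; exact: ler_mx_norm_coef.
exists (fun Y => h (lsubmx Y)); exists (Ball (@crd _ _ _ (times_line C) i z) d); split=> //.
- exact: Ball_center.
- apply: (@Cinf_comp _ _ _ _ (Ball (@crd _ _ _ C i z.1) d)) => //; first exact: Ball_open.
  by move=> k; apply: (Cinf_eq oB _ (Cinf_coord (lshift _ k) oB)) => Y _; rewrite mxE.
move=> z' [dz' _] iz' /L; rewrite /= row_mxKl => zz'; exact: Eh.
Qed.

(** A collar is a diffeomorphism to the product, on which functions on the
    boundary are smooth. *)
Lemma collar_pull rho eps y (u : Z -> R) : collar C NN dN rho eps y -> smooth C dN u ->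
  smooth C [set p | NN p /\ rho p < eps] (fun p => u (y p)).
Proof. by move=> [_ _ _ [[_ H] _]] su; exact: (H _ (@smooth_fst _ eps su)). Qed.

Lemma collar_boundary rho eps y p : collar C NN dN rho eps y -> NN p -> rho p < eps -> dN (y p).
Proof. by move=> [_ _ _ [[H _] _]] Np pe; have [] := H p (conj Np pe). Qed.

End Collar.

(** * All low coefficients vanish *)

Lemma seq_min (T : eqType) (le : rel T) : total le -> transitive le ->
  forall (s : seq T) z, z \in s -> exists2 m, m \in s & forall z', z' \in s -> le m z'.
Proof.
move=> tot tr; elim=> [//|a s IH] z _; have [->|sN] := eqVneq s [::].
  by exists a; rewrite ?mem_head// => z'; rewrite inE => /eqP->; have := tot a a; rewrite orbb.
have [m ms Hm] : exists2 m, m \in s & forall z', z' \in s -> le m z'.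
  by case: s sN IH => // b s _ IH; apply: (IH b); exact: mem_head.
have [am|ma] := orP (tot a m).
  by exists a; rewrite ?mem_head// => z'; rewrite inE => /orP[/eqP->|/Hm]; [have := tot a a; rewrite orbb|exact: tr].
by exists m; [rewrite inE ms orbT|move=> z'; rewrite inE => /orP[/eqP->//|/Hm]].
Qed.

(** The order of magnitude of x^z (ln x)^k as x tends to 0, the largest terms
    first. *)
Definition term_le {R : realType} : rel (R[i] * nat) := fun z z' =>
  (complex.Re z.1 < complex.Re z'.1) || ((complex.Re z.1 == complex.Re z'.1) && (z'.2 <= z.2)%N).

Lemma term_le_total {R : realType} : total (@term_le R).
Proof.
move=> [z k] [z' k'] /=; rewrite /term_le /=.
by case: (ltgtP (complex.Re z) (complex.Re z')) => //= _; exact: leq_total.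
Qed.

Lemma term_le_trans {R : realType} : transitive (@term_le R).
Proof.
move=> [z k] [z' k'] [z'' k'']; rewrite /term_le /=.
move=> /orP[h|/andP[/eqP h h']] /orP[h2|/andP[/eqP h2 h2']].
- by rewrite (lt_trans h h2).
- by rewrite -h2 h.
- by rewrite h h2.
by rewrite h h2 eqxx (leq_trans h2' h') orbT.
Qed.

Section Main.
Context {R : realType} {n : nat}.
Variable M : bmanifold R n.
Variable g : metric M.
Implicit Types (x : M -> R) (f : M -> R[i]).

Lemma conormal_normc (Z : Type) (N : nat) (C : coords R Z N) (NN dN : set Z) rho s (u : Z -> R[i]) :
  conormal C NN dN rho s u ->
  exists2 K : R, 0 <= K & forall p, (NN `\` dN) p -> normc (u p) <= K * rho p `^ s.
Proof.
move=> [[_ /(_ [::])[//|K1 H1]] [_ /(_ [::])[//|K2 H2]]].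
exists (`|K1| + `|K2|); first by rewrite addr_ge0.
move=> p Np; rewrite mulrDl; apply: normc_le.
  by apply: (le_trans (H1 p Np)); rewrite ler_wpM2r ?powR_ge0// ler_norm.
by apply: (le_trans (H2 p Np)); rewrite ler_wpM2r ?powR_ge0// ler_norm.
Qed.

(** Otherwise, among the finitely many terms whose coefficients do not vanish
    identically on the boundary, take the first one in the order term_le. At
    any boundary point its coefficient is a leading one, and the hypothesis
    on phi provides a glancing direction there; so it vanishes, a
    contradiction. *)
Lemma low_coefs_eq0 x (eps : R) (y : M -> M) (mu : M * tvec M -> R) (phi : M * tvec M -> R[i])
    (E : set (R[i] * nat)) f (a : R[i] * nat -> M -> R[i]) (s' delta : R) (r : M -> R[i]) :
  strictly_convex_boundary g -> collar (atlas M) setT (boundary M) x eps y ->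
  boundary_defining (tatlas M) (dplusSM g) (dzeroSM g) mu ->
  smoothC (tatlas M) (SM g) phi ->
  (forall p, boundary M p -> exists w, dzeroSM g (p, w) /\ phi (p, w) <> 0) ->
  index_set E -> ((-1)%:E < inf_index E)%E ->
  smoothC (atlas M) (setT `\` boundary M) f ->
  (forall zk, E zk -> smoothC (atlas M) (boundary M) (a zk)) ->
  0 < delta <= eps -> conormal (atlas M) setT (boundary M) x s' r ->
  (forall p, (setT `\` boundary M) p -> x p < delta ->
     f p = \sum_(zk \in [set zk | E zk /\ complex.Re zk.1 <= s'])
              (a zk (y p) * powlog (x p) zk) + r p) ->
  conormal (tatlas M) (dplusSM g) (dzeroSM g) mu (1 + 2 * s') (xray g phi f) ->
  forall zk p, E zk -> complex.Re zk.1 < s' -> boundary M p -> a zk p = 0.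
Proof.
move=> cvx col bmu sphi phin [Efin _] Einf sf sa /andP[d0 deps] cr fE cI zk0 p0 Ezk0 zs0 bp0.
have [bx eps0 yb _] := col.
set A := [set zk | E zk /\ complex.Re zk.1 <= s'] in fE.
have Af : finite_set A := Efin s'.
(* the terms that are identically zero on the boundary are dropped *)
pose nz zk := `[< exists2 p, boundary M p & a zk p <> 0 >].
have /finite_seqP[lA AE] := Af.
pose l := undup lA; have Al : A = [set` l] by rewrite AE; apply/seteqP; split=> zk; rewrite /= mem_undup.
pose zs := [seq zk <- l | nz zk].
have zsA zk : zk \in zs -> A zk by rewrite mem_filter => /andP[_]; rewrite Al.
apply: contrapT => a0.
have z0s : zk0 \in zs.
  rewrite mem_filter; apply/andP; split; first by apply/asboolP; exists p0.
  by have : A zk0 by [split=> //; exact: ltW]; rewrite Al.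
have [[z K] ms Hm] := @seq_min _ _ term_le_total term_le_trans zs zk0 z0s.
have : nz (z, K) by move: ms; rewrite mem_filter => /andP[].
move=> /asboolP[p bp]; apply.
have [w [dz /eqP phi0]] := phin p bp.
have [Cr Cr0 HCr] := conormal_normc cr.
have [Cx Cx0 HCx] := conormal_normc cI.
have zr : complex.Re z < s'.
  have := Hm zk0 z0s; rewrite /term_le /= => /orP[h|/andP[/eqP-> _]//]; exact: lt_trans zs0.
have r1 : -1 < complex.Re z.
  rewrite -lte_fin; apply: (lt_le_trans Einf); apply: ereal_inf_lbound.
  by exists (z, K) => //; have [] := zsA _ ms.
have uzs : uniq zs by rewrite filter_uniq// undup_uniq.
have xp : x p = 0 by have [_ _ xd _] := bx; exact: xd.
apply: (@leading_coef_eq0 _ _ M g x mu phi f r p w zs (fun zk q => a zk (y q)) (fun zk => a zk p)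
  (complex.Re z) s' delta Cr Cx K cvx bx bmu sphi sf dz phi0 uzs _ d0 Cr0 Cx0 _ HCx r1 zr _ (z, K) ms erefl erefl).
- move=> zk /zsA[Ezk _] e e0; have [saR saI] := sa zk Ezk.
  have sy : smoothC (atlas M) [set q | setT q /\ x q < eps] (fun q => a zk (y q)).
    by split; [exact: (collar_pull col saR)|exact: (collar_pull col saI)].
  have Pp : [set q | setT q /\ x q < eps] p by split=> //; rewrite xp.
  have [d d00 Hd] := smoothC_near sy Pp (chart_at_dom p) e0.
  exists (Num.min d eps); first by rewrite lt_min d00.
  move=> q iq; rewrite !lt_min => /andP[q1 _] /andP[_ q2].
  by have := Hd q (conj I q2) iq q1; rewrite (yb p bp).
- move=> q bq xq; have Nq : (setT `\` boundary M) q by [].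
  split; last exact: HCr.
  rewrite fE//; congr (_ + _); rewrite Al -fsbig_seq ?undup_uniq// big_filter [RHS]big_mkcond.
  apply: eq_bigr => zk _; case: ifPn => // /asboolPn h.
  rewrite (_ : a zk (y q) = 0) ?mul0r//; apply: contrapT => h'; apply: h; exists (y q) => //.
  exact: (collar_boundary col _ (lt_le_trans xq deps)).
move=> zk /Hm; rewrite /term_le /= => /orP[|/andP[/eqP]]; first by left.
by right.
Qed.

Lemma bdf_bounded x : compact [set: M] -> smooth (atlas M) setT x -> exists B : R, forall p, x p <= B.
Proof.
move=> cM sx; have cx : continuous x.
  move=> p; apply/cvgrPdist_lt => e e0.
  have [d d0 Hd] := smooth_near sx I (chart_at_dom p) e0.
  have := @chart_continuous _ _ M (chart_at p) p (chart_at_dom p).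
  move/cvgrPdist_lt => /(_ d d0) cc.
  have op := open_nbhs_nbhs (conj (chart_dom_open (chart_at p)) (chart_at_dom p)).
  near=> q; apply: Hd => //; first by near: q.
  by near: q.
have [B [_ HB]] := compact_bounded (continuous_compact (continuous_subspaceT cx) cM).
exists (B + 1) => p; apply: (le_trans (ler_norm _)).
by apply: (HB (B + 1)); [rewrite ltrDl|exists p].
Unshelve. all: by end_near.
Qed.

End Main.

Theorem theorem2p5 (R : realType) (n : nat) (M : bmanifold R n) (g : metric M)
  (dim_ge2 : (2 <= n.+1)%N)
  (M_compact : compact [set: M])
  (M_non_trapping : non_trapping g)
  (M_convex : strictly_convex_boundary g)
  (* boundary defining function and collar coordinates (x, y) on M *)
  (x : M -> R) (eps : R) (y : M -> M)
  (xy_collar : collar (atlas M) [set: M] (boundary M) x eps y)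
  (* boundary defining function of the manifold with boundary d_+SM *)
  (mu : M * tvec M -> R)
  (mu_bdf : boundary_defining (tatlas M) (dplusSM g) (dzeroSM g) mu)
  (phi : M * tvec M -> R[i])
  (phi_smooth : smoothC (tatlas M) (SM g) phi)
  (phi_neq0 : forall p, boundary M p ->
     exists w, dzeroSM g (p, w) /\ phi (p, w) <> 0)
  (E : set (R[i] * nat))
  (E_index : index_set E)
  (E_inf : ((-1)%:E < inf_index E)%E)
  (f : M -> R[i])
  (f_phg : phg (atlas M) [set: M] (boundary M) x eps y E f) :
  (forall s' : R, (inf_index E < s'%:E)%E ->
     conormal (tatlas M) (dplusSM g) (dzeroSM g) mu (1 + 2 * s')
       (xray g phi f) ->
     phg (atlas M) [set: M] (boundary M) x eps y (index_ge E s') f) /\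
  (rapidly_vanishing (tatlas M) (dplusSM g) (dzeroSM g) mu (xray g phi f) ->
     rapidly_vanishing (atlas M) [set: M] (boundary M) x f).
Proof.
have [bx eps0 yb _] := xy_collar.
have [sx x0 xd _] := bx.
have [[s0 [cfR cfI]] [a [sa Ha]]] := f_phg.
have sf : smoothC (atlas M) (setT `\` boundary M) f by split; [case: cfR|case: cfI].
have van (s' : R) : conormal (tatlas M) (dplusSM g) (dzeroSM g) mu (1 + 2 * s') (xray g phi f) ->
    forall zk p, E zk -> complex.Re zk.1 < s' -> boundary M p -> a zk p = 0.
  move=> cI; have [delta [r [d01 cr fE]]] := Ha s'.
  exact: (low_coefs_eq0 M_convex xy_collar mu_bdf phi_smooth phi_neq0 E_index E_inf sf sa d01 cr fE cI).
split=> [s' _ cI|rv].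
  split; first by exists s0.
  exists a; split=> [zk [Ezk _]|s]; first exact: sa.
  have [delta [r [d01 cr fE]]] := Ha s; exists delta, r; split=> // p Np xp.
  rewrite fE//; congr (_ + _); apply/esym/fsbig_widen; first by move=> zk [[]].
  move=> zk [[Ezk zs] nge] /=.
  have zs' : complex.Re zk.1 < s' by rewrite ltNge; apply/negP => h; apply: nge.
  have yp : boundary M (y p).
    by apply: (collar_boundary xy_collar) => //; case/andP: d01 => _; exact: lt_le_trans.
  by rewrite (van s' cI zk (y p) Ezk zs' yp) mul0r.
have [B HB] := bdf_bounded M_compact sx.
move=> s; have [delta [r [/andP[d0 de] [crR crI] fE]]] := Ha s.
have fr p : (setT `\` boundary M) p -> x p < delta -> f p = r p.
  move=> Np xp; rewrite fE// fsbig1 ?add0r// => zk [Ezk zs].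
  have yp : boundary M (y p) by apply: (collar_boundary xy_collar) => //; exact: lt_le_trans de.
  have zs1 : complex.Re zk.1 < s + 1 by rewrite ltr_pwDr.
  by rewrite (van (s + 1) (rv _) zk (y p) Ezk zs1 yp) mul0r.
have sx' : smooth (atlas M) (setT `\` boundary M) x by apply: smooth_restrict sx.
have xB p : (setT `\` boundary M) p -> 0 < x p <= B by move=> Np; rewrite x0// HB.
split.
  by apply: (conormalR_local sx' d0 xB cfR crR) => p Np xp; rewrite fr.
by apply: (conormalR_local sx' d0 xB cfI crI) => p Np xp; rewrite fr.
Qed.
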